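(* Assume the rank condition stated in the context, $R>0$ and $AR=RA'$. Then for every $t\ge0$, $$\mathcal{J}(\eta^h_t\mid\eta^h_\infty)\le \alpha_h^2\,e^{-2\beta_h t}\,\mathcal{J}(\eta^h_0\mid\eta^h_\infty)\quad\text{and}\quad \mathrm{Ent}(\eta^h_t\mid\eta^h_\infty)\le e^{-t/\iota_h}\,\mathrm{Ent}(\eta^h_0\mid\eta^h_\infty).$$
   Context: Setting: $r\ge1$; $A,R,S$ are real $r\times r$ matrices, $R,S$ symmetric positive semi-definite; $'$ denotes transposition. Rank condition: the matrices $[R^{1/2},AR^{1/2},\ldots,A^{r-1}R^{1/2}]$ and $[S^{1/2},A'S^{1/2},\ldots,(A')^{r-1}S^{1/2}]$ both have rank $r$. Under this condition let $P_\infty$ be the unique positive definite solution of $AP+PA'+R-PSP=0$ and $Q_\infty$ the unique positive definite solution of $A'Q+QA-QRQ+S=0$. The matrix $A-RQ_\infty$ is Hurwitz; $\alpha_h,\beta_h>0$ are parameters such that $\|e^{(A-RQ_\infty)t}\|\le\alpha_h e^{-\beta_h t}$ for all $t\ge0$ (spectral norm), and $\iota_h:=\int_0^\infty\|e^{(A-RQ_\infty)t}\|^2dt$. Let $B$ be an $r\times r_1$ matrix with $BB'=R$ and $W_t$ an $r_1$-dimensional Brownian motion independent of the initial condition. The $h$-process solves $dX^h_t=(A-RQ_\infty)X^h_t\,dt+B\,dW_t$, and $\eta^h_t$ denotes the law of $X^h_t$. Its initial law is $\eta_0^h(dx)=h_0(x)\eta_0(dx)/\eta_0(h_0)$, where $\eta_0$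 is a probability measure on $\mathbb{R}^r$ and $h_0(x)=\exp(-\frac12x'Q_\infty x)$. The measure $\eta^h_\infty=\mathcal{N}(0,P^h_\infty)$ is the centered Gaussian measure with covariance $P^h_\infty=(P_\infty^{-1}+Q_\infty)^{-1}$. For probability measures $\nu_1,\nu_2$: $\mathrm{Ent}(\nu_1\mid\nu_2)=\int\log(d\nu_1/d\nu_2)\,d\nu_1$ if $\nu_1\ll\nu_2$ and $+\infty$ otherwise; $\mathcal{J}(\nu_1\mid\nu_2)=\int\|\nabla\log(d\nu_1/d\nu_2)\|^2d\nu_1$ if $\nu_1\ll\nu_2$ and $\log(d\nu_1/d\nu_2)$ is a locally integrable function whose weak gradient belongs to $L_2(\nu_1)$, and $+\infty$ otherwise. *)

(* Defs.v *)
From HB Require Import structures.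
From mathcomp Require Import all_boot all_order all_algebra.
From mathcomp Require Import all_classical all_reals all_analysis.

Set Implicit Arguments.
Unset Strict Implicit.
Unset Printing Implicit Defensive.

Import Order.TTheory GRing.Theory Num.Theory.
Import numFieldNormedType.Exports.
Local Open Scope classical_set_scope.
Local Open Scope ring_scope.

Section Matrices.
Context {K : realType}.

Definition psd (n : nat) (M : 'M[K]_n) : Prop :=
  M^T = M /\ forall x : 'cV[K]_n, 0 <= (x^T *m M *m x) 0 0.

Definition posdef (n : nat) (M : 'M[K]_n) : Prop :=
  M^T = M /\ forall x : 'cV[K]_n, x != 0 -> 0 < (x^T *m M *m x) 0 0.

(* The unique positive semi-definite square root of a positive semi-definite
   matrix; the default value 0 is only taken on other matrices. *)
Definition sqrtmx (n : nat) (M : 'M[K]_n) : 'M[K]_n :=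
  xget 0 [set N | psd N /\ N *m N = M].

Definition krylov (n : nat) (A N : 'M[K]_n) :=
  \mxrow_(j < n) (A ^+ j *m N).

Definition enorm (n : nat) (x : 'cV[K]_n) : K :=
  Num.sqrt (\sum_(i < n) x i 0 ^+ 2).

(* The norm `|M| of MathComp-Analysis is the largest absolute value of an entry
   of M, not the spectral norm. *)
Definition specnorm (n : nat) (M : 'M[K]_n) : K :=
  sup [set enorm (M *m x) | x in [set x : 'cV[K]_n | enorm x <= 1]].

Definition expmx (n : nat) (M : 'M[K]_n) : 'M[K]_n :=
  limn (series (fun k : nat => (k`!%:R)^-1 *: M ^+ k)).

End Matrices.

(* The Borel sigma-algebra. *)
Section borel.
Context {K : realType} {m n : nat}.
Local Notation opens := (@open 'M[K]_(m, n)).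

Let borel0 : <<s opens >> set0.
Proof. exact: sigma_algebra0. Qed.

Let borelC A : <<s opens >> A -> <<s opens >> (~` A).
Proof. exact: sigma_algebraC. Qed.

Let borel_bigcup (F : (set 'M[K]_(m, n))^nat) :
  (forall i, <<s opens >> (F i)) -> <<s opens >> (\bigcup_i F i).
Proof. exact: sigma_algebra_bigcup. Qed.

HB.instance Definition _ := @isMeasurable.Build (sigma_display opens)
  'M[K]_(m, n) <<s opens >> borel0 borelC borel_bigcup.

End borel.


Section borel_lemmas.
Context {K : realType}.

Lemma measurable_coord (m n : nat) (i : 'I_m) (j : 'I_n) :
  measurable_fun setT (fun M : 'M[K]_(m, n) => M i j).
Proof.
apply: (measurability _ (measurable_realfun.RGenOpens.measurableE K)).
move=> _ [_ [a [b ->]] <-]; rewrite setTI; apply: sub_sigma_algebra.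
by apply: open_comp => // M _; exact: coord_continuous.
Qed.

Lemma measurable_fun_mx d (T : measurableType d) (m n : nat)
    (f : T -> 'M[K]_(m, n)) :
  (forall i j, measurable_fun setT (fun x => f x i j)) ->
  measurable_fun setT f.
Proof.
move=> mf; apply: (measurability (@open 'M[K]_(m, n))) => //.
move=> _ [U oU <-]; rewrite setTI.
pose D := [set p : 'M[rat]_(m, n) * nat |
  (forall x : 'M[K]_(m, n), (forall i j, `|ratr (p.1 i j) - x i j| < p.2.+1%:R^-1) -> U x)].
have -> : f @^-1` U = \bigcup_(p in D)
   \bigcap_(ij in [set: 'I_m * 'I_n])
     (fun x => f x ij.1 ij.2) @^-1` (ball (ratr (p.1 ij.1 ij.2) : K) (p.2.+1%:R^-1)).
  apply/seteqP; split=> [x Ux|x [p Dp px]]; last first.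
    by apply: Dp => i j; exact: (px (i, j)).
  have [e e0 eU] : exists2 e : K, 0 < e & ball (f x) e `<=` U.
    by move: oU; rewrite openE => /(_ _ Ux) /nbhs_ballP.
  have [k ke] : exists k : nat, k.+1%:R^-1 < e / 2.
    have := @near_infty_natSinv_lt K (PosNum (divr_gt0 e0 (ltr0n _ 2))).
    by move=> [k _ /(_ k (leqnn _))]; exists k.
  have k0 : (0 : K) < k.+1%:R^-1 by rewrite invr_gt0.
  have /choice[q hq] (y : K) : exists q : rat, `|ratr q - y| < k.+1%:R^-1.
    have [|c] := @rat_in_itvoo K (y - k.+1%:R^-1) (y + k.+1%:R^-1).
      by rewrite ltrD2l gtrN.
    rewrite in_itv/= => /andP[c1 c2]; exists c.
    by rewrite ltr_distl c1 c2.
  exists (\matrix_(i, j) q (f x i j), k) => /=; last first.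
    by move=> [i j] _; rewrite /ball/= mxE; exact: hq.
  move=> y yq; apply: eU; split => // i j.
  rewrite /ball/= (le_lt_trans (ler_distD (ratr (q (f x i j))) _ _))//.
  rewrite (splitr e) ltrD// (lt_trans _ ke)//.
    by rewrite distrC; exact: hq.
  by have := yq i j; rewrite mxE.
rewrite bigcup_mkcond; apply: countable_bigcupT_measurable => [|p].
  exact: countableP.
case: ifPn => // _.
apply: fin_bigcap_measurable => [|[i j] _ /=]; first exact: finite_finset.
rewrite -[X in measurable X]setTI; apply: mf => //.
by rewrite ball_itv; exact: measurable_itv.
Qed.

End borel_lemmas.

Section lebesgue_measure_step.
Context {K : realType} {n : nat}.
Variable mu : {sigma_finite_measure set 'cV[K]_n -> \bar K}.

Definition consv (p : K * 'cV[K]_n) : 'cV[K]_n.+1 :=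
  \col_i oapp (fun j => p.2 j 0) p.1 (unlift ord0 i).

Let unconsv (x : 'cV[K]_n.+1) : K * 'cV[K]_n :=
  (x ord0 0, \col_j x (lift ord0 j) 0).

Let consvK : cancel consv unconsv.
Proof.
move=> [a x]; rewrite /unconsv mxE unlift_none/=; congr pair.
by apply/colP => j; rewrite !mxE liftK.
Qed.

Lemma measurable_consv : measurable_fun setT consv.
Proof.
apply: measurable_fun_mx => i j; rewrite /consv.
under eq_fun do rewrite mxE.
case: unliftP => [k _|_] /=; last exact: measurable_fst.
exact: (measurableT_comp (measurable_coord k 0) measurable_snd).
Qed.

Let measurable_unconsv : measurable_fun setT unconsv.
Proof.
apply/measurable_fun_pairP; split; first exact: measurable_coord.
apply: measurable_fun_mx => i j; rewrite /unconsv/=.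
under eq_fun do rewrite mxE.
exact: measurable_coord.
Qed.

Definition lebesgue_cons : set 'cV[K]_n.+1 -> \bar K :=
  pushforward (@lebesgue_measure K \x mu)%E consv.

HB.instance Definition _ := Measure.copy lebesgue_cons
  (measure_function_pushforward__canonical__measure_function_Measure
     (@lebesgue_measure K \x mu)%E measurable_consv).

Let lebesgue_cons_sigma_finite : sigma_finite setT lebesgue_cons.
Proof.
have /sigma_finiteP[F [TF ndF Foo]] := sigma_finiteT (@lebesgue_measure K).
have /sigma_finiteP[G [TG ndG Goo]] := sigma_finiteT mu.
exists (fun k => unconsv @^-1` (F k `*` G k)).
  apply/seteqP; split=> // x _.
  have : setT (unconsv x).1 by []; rewrite TF => -[k _ Fk].
  have : setT (unconsv x).2 by []; rewrite TG => -[l _ Gl].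
  exists (maxn k l) => //; split.
    by move: Fk; exact/subsetPset/ndF/leq_maxl.
  by move: Gl; exact/subsetPset/ndG/leq_maxr.
move=> k; have [mF Fk] := Foo k; have [mG Gk] := Goo k; split.
  rewrite -[X in measurable X]setTI; apply: measurable_unconsv => //.
  exact: measurableX.
rewrite /lebesgue_cons /pushforward -comp_preimage.
rewrite (_ : unconsv \o consv = id) ?preimage_id; last first.
  by apply/funext => p; exact: consvK.
by rewrite product_measure1E// lte_mul_pinfty// ge0_fin_numE.
Qed.

HB.instance Definition _ := Measure_isSigmaFinite.Build _ _ _ lebesgue_cons
  lebesgue_cons_sigma_finite.

End lebesgue_measure_step.

Fixpoint lebesgueV (K : realType) (n : nat) :
    {sigma_finite_measure set 'cV[K]_n -> \bar K} :=
  match n with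
  | 0 => \d_ (0 : 'cV[K]_0)
  | n'.+1 => lebesgue_cons (lebesgueV K n')
  end.

Lemma lebesgueV_box (K : realType) (n : nat) (E : 'I_n -> set K) :
  (forall i, measurable (E i)) ->
  lebesgueV K n [set x | forall i, E i (x i 0)] =
  (\prod_(i < n) @lebesgue_measure K (E i))%E.
Proof.
elim: n E => [|n ih] E mE.
  by rewrite big_ord0 /= diracE mem_set//; case.
have mbox : measurable [set x : 'cV[K]_n | forall i, E (lift ord0 i) (x i 0)].
  rewrite (_ : mkset _ = \bigcap_(i in [set: 'I_n])
      ((fun x : 'cV[K]_n => x i 0) @^-1` E (lift ord0 i))); last first.
    by apply/seteqP; split=> x xE; [move=> i _|move=> i]; exact: xE.
  apply: fin_bigcap_measurable => [|i _]; first exact: finite_finset.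
  by rewrite -[X in measurable X]setTI; apply: measurable_coord.
rewrite big_ord_recl -ih// -product_measure1E//=; last exact: mE.
rewrite /lebesgue_cons /pushforward; congr (_ _); apply/seteqP; split.
  move=> -[a x] /= xE; split=> [|i].
    by have := xE ord0; rewrite mxE unlift_none.
  by have := xE (lift ord0 i); rewrite mxE liftK.
move=> -[a x] /= [Ea xE] i; rewrite mxE.
by case: unliftP => [j|] ->.
Qed.

Section Entropy.
Context {K : realType}.
Local Open Scope ereal_scope.

Definition density d (T : measurableType d) (nu1 nu2 : probability T K) :
    T -> \bar K :=
  Radon_Nikodym (charge_of_finite_measure nu1) nu2.

(* lne is the logarithm with value -oo at 0. *)
Definition Ent d (T : measurableType d) (nu1 nu2 : probability T K) : \bar K :=
  if `[< nu1 `<< nu2 >] then \int[nu1]_x lne (density nu1 nu2 x) else +oo.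

Context {n : nat}.
Implicit Types (phi : 'cV[K]_n -> K) (u : 'cV[K]_n -> \bar K)
  (g : 'cV[K]_n -> 'cV[K]_n).

Definition basis_vec (i : 'I_n) : 'cV[K]_n := delta_mx i 0%R.

Fixpoint C_k (k : nat) phi : Prop :=
  match k with
  | 0 => continuous phi
  | k'.+1 => (forall x, differentiable phi x) /\
             forall i, C_k k' (fun x => 'D_(basis_vec i) phi x)
  end.

Definition test_function phi : Prop :=
  (forall k, C_k k phi) /\
  exists C : set 'cV[K]_n, compact C /\ forall x, ~ C x -> phi x = 0%R.

Definition locally_integrableV u : Prop :=
  forall C, compact C -> (lebesgueV K n).-integrable C u.

Definition is_weak_gradient u g : Prop :=
  (forall i, locally_integrableV (fun x => (g x i 0%R)%:E)) /\
  forall phi, test_function phi -> forall i,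
    \int[lebesgueV K n]_x (u x * ('D_(basis_vec i) phi x)%:E) =
    - \int[lebesgueV K n]_x (g x i 0%R * phi x)%:E.

(* When it exists it is unique up to a Lebesgue negligible set: Fisher below is
   meant for nu1 dominated by the Lebesgue measure. *)
Definition weak_gradient u : 'cV[K]_n -> 'cV[K]_n :=
  xget (fun=> 0%R) [set g | is_weak_gradient u g].

Definition Fisher (nu1 nu2 : probability 'cV[K]_n K) : \bar K :=
  let u x := lne (density nu1 nu2 x) in
  let energy g := \int[nu1]_x (enorm (g x) ^+ 2)%:E in
  if `[< [/\ nu1 `<< nu2, locally_integrableV u,
           exists g, is_weak_gradient u g &
           energy (weak_gradient u) < +oo] >]
  then energy (weak_gradient u) else +oo.

End Entropy.

Section Processes.
Context {K : realType}.

Definition gauss_pdf (n : nat) (V : 'M[K]_n) (x : 'cV[K]_n) : K :=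
  expR (- (x^T *m invmx V *m x) 0 0 / 2) / Num.sqrt ((2 * pi) ^+ n * \det V).

(* Only meaningful for a positive definite covariance matrix V. *)
Definition centered_gaussian (n : nat) (V : 'M[K]_n)
    (mu : set 'cV[K]_n -> \bar K) : Prop :=
  forall E, measurable E ->
    mu E = (\int[lebesgueV K n]_(x in E) (gauss_pdf V x)%:E)%E.

Definition reweight (n : nat) (eta : probability 'cV[K]_n K)
    (h : 'cV[K]_n -> K) (E : set 'cV[K]_n) : \bar K :=
  ((\int[eta]_(x in E) (h x)%:E) / (\int[eta]_x (h x)%:E))%E.

Context {d : measure_display} {Omega : measurableType d}.
Variable Pr : probability Omega K.

Definition independent_sigma (F G : set (set Omega)) : Prop :=
  forall A B, F A -> G B -> Pr (A `&` B) = (Pr A * Pr B)%E.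

Definition sigma_of (n : nat) (X : Omega -> 'cV[K]_n) : set (set Omega) :=
  preimage_set_system setT X measurable.

Definition sigma_proc (n : nat) (X : K -> Omega -> 'cV[K]_n) (I : set K) :
    set (set Omega) :=
  <<s \bigcup_(t in I) sigma_of (X t) >>.

Record brownian_motion (n : nat) (W : K -> {RV Pr >-> 'cV[K]_n}) : Prop := {
  bm_start : {ae Pr, forall w, W 0 w = 0};
  bm_gauss : forall s t, 0 <= s -> s < t ->
    centered_gaussian ((t - s)%:M) (pushforward Pr (fun w => W t w - W s w));
  bm_indep : forall s t, 0 <= s -> s < t ->
    independent_sigma (sigma_of (fun w => W t w - W s w))
      (sigma_proc W `[0, s]);
  bm_cont : {ae Pr, forall w, {within `[0, +oo[, continuous (fun t => W t w)}}
}.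

(* Strong solutions of dX_t = F X_t dt + B dW_t: the noise is additive, so that
   the stochastic integral of the constant B is B W_t and the equation is read
   path by path. *)
Definition linear_sde (n m : nat) (F : 'M[K]_n) (B : 'M[K]_(n, m))
    (W : K -> {RV Pr >-> 'cV[K]_m}) (X : K -> {RV Pr >-> 'cV[K]_n}) : Prop :=
  {ae Pr, forall w,
    {within `[0, +oo[, continuous (fun t => X t w)} /\
    forall t, 0 <= t ->
      X t w = X 0 w
        + \col_i \int[lebesgue_measure]_(s in `[0, t]) (F *m X s w) i 0
        + B *m W t w}.

End Processes.

(* Main.v *)
(* Put F = A - R Q_oo and Sg = P^h_oo. The Riccati equations give the Lyapunov
   equation F Sg + Sg F' + R = 0, and A R = R A' gives F R = R F'; together they
   force F Sg = Sg F' = - R / 2: the h-process is reversible. Its law at time t is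
   that of M x + z, with M = exp (t F), x of law eta^h_0 and z an independent
   centered Gaussian vector of covariance St = Sg - M Sg M'; this is read off from
   the characteristic functions of the Euler schemes. By reversibility the law of
   M x + z has, with respect to N(0, Sg), a density k y x symmetric in x and y.

   Fisher information: the density f1 = \int k y x d nu(x) of the law at time t
   satisfies grad f1 = \int k y x M' (grad log f) (x) d nu(x), where f is the initial
   density, so that |grad log f1|^2 is controlled by Cauchy-Schwarz and by
   |M| <= alpha exp (- beta t). For weak gradients this uses that a function with a
   locally integrable weak gradient is absolutely continuous on almost all lines,
   where the chain rule for the exponential holds.

   Entropy: let E s be the entropy of f averaged over the part of variance 1 - s of
   a Gaussian vector of law N(0, Sg). The relative entropy of a law with respect to
   the product of its marginals is nonnegative, hence E is midpoint convex, and
   E s <= s Ent f for dyadic s. If M Sg M' <= th Sg, then the entropy at time t is at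
   most E s for every s > th, hence at most th Ent f. With lam the smallest
   eigenvalue of - F one may take th = exp (- 2 lam t), and the corresponding
   eigenvector gives |exp (s F)| >= exp (- lam s), thus iota >= 1 / (2 lam). *)

Require Import Defs.
From HB Require Import structures.
From mathcomp Require Import all_boot all_order all_algebra.
From mathcomp Require Import all_classical all_reals all_analysis.
From mathcomp Require Import measurable_realfun ring lra.

Set Implicit Arguments.
Unset Strict Implicit.
Unset Printing Implicit Defensive.

Import Order.TTheory GRing.Theory Num.Theory.
Import numFieldNormedType.Exports.
Local Open Scope classical_set_scope.
Local Open Scope ring_scope.

(** * Lebesgue measure on column vectors *)

Section measurability.
Context {K : realType}.

(** Reversibility is used twice. It makes [k] symmetric, so that the average of [k y x] over the
    initial law is also the mean of the initial density at [M *m y + z]: differentiating in y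
    becomes following that density along lines of direction [M *m a]. It also gives F Sg = - R / 2,
    so that the slowest rate is read off a generalized eigenvector of R and Sg. The logarithm u of
    the density is only locally integrable and its gradient only known almost everywhere; identities
    along lines therefore hold off null sets. The noise has a Lebesgue density, so averaging hides
    these sets, and the smoothed density has continuous derivatives in every direction. The entropy
    argument is run for densities between two positive constants, where all integrals are finite.
    Truncation at exp (- (j + 1)) and exp (j + 1) does not raise x ln x, and Fatou's lemma removes
    it. The interpolation parameter s stays strictly above th because s Sg - M Sg M' may degenerate
    at th; likewise St vanishes at t = 0, a time treated apart. *)

Lemma continuous_measurable_mx (m n : nat) (f : 'M[K]_(m, n) -> K) :
  continuous f -> measurable_fun setT f.
Proof.
move=> cf; apply: (measurability _ (measurable_realfun.RGenOpens.measurableE K)).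
move=> _ [_ [a [b ->]] <-]; rewrite setTI; apply: sub_sigma_algebra.
by apply: open_comp => // M _; exact: cf.
Qed.

Context d (T : measurableType d).

Lemma measurable_mx_coord (m n : nat) (f : T -> 'M[K]_(m, n)) i j :
  measurable_fun setT f -> measurable_fun setT (fun x => f x i j).
Proof. by move=> mf; exact: (measurableT_comp (measurable_coord i j) mf). Qed.

Lemma measurable_mulmx (m n p : nat) (f : T -> 'M[K]_(m, n)) (g : T -> 'M[K]_(n, p)) :
  measurable_fun setT f -> measurable_fun setT g ->
  measurable_fun setT (fun x => f x *m g x).
Proof.
move=> mf mg; apply: measurable_fun_mx => i j.
under eq_fun do rewrite mxE.
by apply: measurable_sum => k; apply: measurable_funM; exact: measurable_mx_coord.
Qed.

Lemma measurable_addmx (m n : nat) (f g : T -> 'M[K]_(m, n)) :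
  measurable_fun setT f -> measurable_fun setT g ->
  measurable_fun setT (fun x => f x + g x).
Proof.
move=> mf mg; apply: measurable_fun_mx => i j.
under eq_fun do rewrite mxE.
by apply: measurable_funD; exact: measurable_mx_coord.
Qed.

Lemma measurable_oppmx (m n : nat) (f : T -> 'M[K]_(m, n)) :
  measurable_fun setT f -> measurable_fun setT (fun x => - f x).
Proof.
move=> mf; apply: measurable_fun_mx => i j.
under eq_fun do rewrite mxE.
by apply: measurableT_comp => //; exact: measurable_mx_coord.
Qed.

Lemma measurable_scalemx (m n : nat) (c : T -> K) (f : T -> 'M[K]_(m, n)) :
  measurable_fun setT c -> measurable_fun setT f ->
  measurable_fun setT (fun x => c x *: f x).
Proof.
move=> mc mf; apply: measurable_fun_mx => i j.
under eq_fun do rewrite mxE.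
by apply: measurable_funM => //; exact: measurable_mx_coord.
Qed.

Lemma measurable_trmx (m n : nat) (f : T -> 'M[K]_(m, n)) :
  measurable_fun setT f -> measurable_fun setT (fun x => (f x)^T).
Proof.
move=> mf; apply: measurable_fun_mx => i j.
by under eq_fun do rewrite mxE; exact: measurable_mx_coord.
Qed.

End measurability.

(** * Affine changes of variables on the line *)

Section affine.
Context {K : realType}.
Local Notation mu := (@lebesgue_measure K).
Local Open Scope ereal_scope.

Lemma preimage_affine_itv (c a : K) (i : interval K) : (0 < c)%R ->
  (fun x : K => c * x + a)%R @^-1` [set` i] =
  [set` Interval (match i.1 with BSide b x => BSide b ((x - a) / c)%R | BInfty b => BInfty _ b end)
                 (match i.2 with BSide b x => BSide b ((x - a) / c)%R | BInfty b => BInfty _ b end)].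
Proof.
move=> c0; case: i => i j; apply/seteqP; split => x /=;
 rewrite !itv_boundlr => /andP[ix xj]; apply/andP; split; move: ix xj.
- case: i => [[]y|[]]//=; case: j => [[]z|[]]//=; rewrite !bnd_simp ?ler_pdivrMr// ?ltr_pdivrMr//; lra.
- case: i => [[]y|[]]//=; case: j => [[]z|[]]//=; rewrite !bnd_simp ?ler_pdivlMr// ?ltr_pdivlMr//; lra.
- case: i => [[]y|[]]//=; case: j => [[]z|[]]//=; rewrite !bnd_simp ?ler_pdivrMr// ?ltr_pdivrMr//; lra.
- case: i => [[]y|[]]//=; case: j => [[]z|[]]//=; rewrite !bnd_simp ?ler_pdivlMr// ?ltr_pdivlMr//; lra.
Qed.

Lemma measurable_affine (c a : K) : measurable_fun setT (fun x : K => c * x + a)%R.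
Proof. by apply: measurable_funD => //; apply: measurable_funM. Qed.

(** The pushforward of Lebesgue measure by the affine map, multiplied by c, agrees with Lebesgue
    measure on half-open intervals, and uniqueness of Lebesgue measure extends this to all
    measurable sets. *)
Lemma lebesgue_measure_affine (c a : K) (A : set K) : (0 < c)%R -> measurable A ->
  mu ((fun x : K => c * x + a)%R @^-1` A) = c^-1%:E * mu A.
Proof.
move=> c0 mA.
pose aff := (fun x : K => c * x + a)%R.
have maff : measurable_fun setT (aff : _ -> measurableTypeR K) by exact: measurable_affine.
have cn : (0 <= c)%R by exact: ltW.
suff -> : mu A = mscale (NngNum cn) (pushforward mu (aff : _ -> measurableTypeR K)) A.
  rewrite /= /mscale /= muleA -EFinM mulVf ?mul1e// gt_eqF//.
move=> m; apply: lebesgue_measure_unique => //= _ [[x y]] _ <-.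
rewrite /= /mscale /= /pushforward preimage_affine_itv//= !lebesgue_measure_itv/=.
rewrite !lte_fin ltr_pM2r ?invr_gt0// ltrD2r; case: ifP => _; last by rewrite mule0.
by rewrite -EFinB -EFinM; congr EFin; field; rewrite gt_eqF.
Qed.

Lemma ge0_integral_affine (c a : K) (f : K -> \bar K) : (0 < c)%R ->
  measurable_fun setT f -> (forall x, 0 <= f x) ->
  \int[mu]_x f (c * x + a)%R = c^-1%:E * \int[mu]_x f x.
Proof.
move=> c0 mf f0.
pose aff := (fun x : K => c * x + a)%R.
have maff : measurable_fun setT (aff : _ -> measurableTypeR K) by exact: measurable_affine.
have cn : (0 <= c^-1)%R by rewrite invr_ge0 ltW.
transitivity (\int[mscale (NngNum cn) mu]_x f x); last first.
  by rewrite ge0_integral_mscale.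
transitivity (\int[pushforward mu (aff : _ -> measurableTypeR K)]_x f x).
  by rewrite ge0_integral_pushforward//.
by apply: eq_measure_integral => A mA _; exact: lebesgue_measure_affine.
Qed.

End affine.

Section lebesgueV_integral.
Context {K : realType}.
Local Open Scope ereal_scope.
Local Notation V n := 'cV[K]_n.

Lemma integral_lebesgueVS n (f : V n.+1 -> \bar K) : measurable_fun setT f ->
  (forall x, 0 <= f x) ->
  \int[lebesgueV K n.+1]_x f x =
  \int[@lebesgue_measure K]_s \int[lebesgueV K n]_y f (consv (s, y)).
Proof.
move=> mf f0.
transitivity (\int[(@lebesgue_measure K \x lebesgueV K n)%E]_z f (consv z)).
  rewrite /= /lebesgue_cons ge0_integral_pushforward//; exact: measurable_consv.
rewrite fubini_tonelli1//.
by apply: measurableT_comp => //; exact: measurable_consv.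
Qed.

Lemma measurable_affinemx n (c : K) (a : V n) :
  measurable_fun setT (fun x : V n => c *: x + a)%R.
Proof. by apply: measurable_addmx => //; exact: measurable_scalemx. Qed.

(** Induction on the dimension through [consv]: the one-dimensional rule contributes one factor c^-1
    per coordinate. *)
Lemma ge0_integral_affineV n (c : K) (a : V n) (f : V n -> \bar K) : (0 < c)%R ->
  measurable_fun setT f -> (forall x, 0 <= f x) ->
  \int[lebesgueV K n]_x f (c *: x + a)%R = (c ^- n)%:E * \int[lebesgueV K n]_x f x.
Proof.
move=> c0; elim: n => [|n ih] in a f *.
  move=> mf f0; rewrite expr0 invr1 mul1e /=; apply: eq_integral => x _.
  by congr f; apply/colP; case.
move=> mf f0; rewrite integral_lebesgueVS//; last first.
  by apply: measurableT_comp => //; exact: measurable_affinemx.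
have -> : (fun s => \int[lebesgueV K n]_y f (c *: consv (s, y) + a)%R) =
   (fun s => (c ^- n)%:E * \int[lebesgueV K n]_y f (consv ((c * s + a ord0 ord0)%R, y))).
  apply/funext => s.
  rewrite -(ih (\col_i a (lift ord0 i) ord0)) => [| |y]; last exact: f0.
    apply: eq_integral => y _; congr f; apply/colP => i; rewrite !mxE /=.
    by case: unliftP => [j|] -> /=; rewrite ?mxE.
  apply: measurableT_comp => //.
  exact: (measurableT_comp (@measurable_consv K n) (measurable_pair1 _)).
have mg : measurable_fun setT (fun s : K => \int[lebesgueV K n]_y f (consv (s, y))).
  apply: (measurable_fun_fubini_tonelli_F (m2 := lebesgueV K n) (f \o @consv K n)) => //.
    by apply: measurableT_comp => //; exact: measurable_consv.
  by move=> x; exact: f0.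
rewrite ge0_integralZl//; last 3 first.
- apply: (measurableT_comp mg); exact: measurable_affine.
- by move=> x _; apply: integral_ge0.
- by rewrite lee_fin invr_ge0 exprn_ge0// ltW.
rewrite (ge0_integral_affine _ c0 mg)//; last by move=> x; exact: integral_ge0.
by rewrite muleA -EFinM -invfM -exprSr -integral_lebesgueVS.
Qed.

Lemma ge0_integral_translateV n (a : V n) (f : V n -> \bar K) :
  measurable_fun setT f -> (forall x, 0 <= f x) ->
  \int[lebesgueV K n]_x f (x + a)%R = \int[lebesgueV K n]_x f x.
Proof.
move=> mf f0; have := @ge0_integral_affineV n 1 a f ltr01 mf f0.
rewrite expr1n invr1 mul1e => <-; apply: eq_integral => x _.
by rewrite scale1r.
Qed.

Lemma measurable_translateV n (a : V n) :
  measurable_fun setT (fun x : V n => x + a)%R.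
Proof. by apply: measurable_addmx. Qed.

Lemma integral_translateV n (a : V n) (f : V n -> \bar K) :
  measurable_fun setT f ->
  \int[lebesgueV K n]_x f (x + a)%R = \int[lebesgueV K n]_x f x.
Proof.
move=> mf; rewrite [LHS]integralE [RHS]integralE.
rewrite (_ : (fun x => f (x + a)%R) = f \o (fun x => x + a)%R)//.
rewrite funepos_comp funeneg_comp; congr (_ - _).
- by apply: (ge0_integral_translateV a (f := f^\+)) => //; exact: measurable_funepos.
- by apply: (ge0_integral_translateV a (f := f^\-)) => //; exact: measurable_funeneg.
Qed.

Lemma integrable_translateV n (a : V n) (f : V n -> \bar K) :
  (lebesgueV K n).-integrable setT f ->
  (lebesgueV K n).-integrable setT (fun x => f (x + a)%R).
Proof.
move=> /integrableP[mf fi]; apply/integrableP; split.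
  by apply: measurableT_comp => //; exact: measurable_translateV.
rewrite (_ : (fun x => _) = (fun x => (abse \o f) (x + a)%R))// ge0_integral_translateV//; last by move=> x; exact: abse_ge0.
exact: measurableT_comp.
Qed.

End lebesgueV_integral.

(** * Measures given by a density *)

Section density.
Local Open Scope ereal_scope.
Context {K : realType} d (T : measurableType d).

Section density_measure.
Variables (mu : {measure set T -> \bar K}) (p : T -> \bar K).
Hypotheses (p0 : forall x, 0 <= p x) (mp : measurable_fun setT p).
Hypothesis p1 : \int[mu]_x p x = 1.

Let dens (A : set T) : \bar K := \int[mu]_(x in A) p x.

Let dens0 : dens set0 = 0.
Proof. by rewrite /dens integral_set0. Qed.

Let dens_ge0 A : 0 <= dens A.
Proof. by apply: integral_ge0. Qed.

Let dens_sigma_additive : semi_sigma_additive dens.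
Proof.
move=> A mA tA mUA; rewrite /dens ge0_integral_bigcup//; last first.
  exact: measurable_funTS.
by apply: is_cvg_ereal_nneg_natsum_cond => n _ _; exact: integral_ge0.
Qed.

HB.instance Definition _ := isMeasure.Build _ _ _
  dens dens0 dens_ge0 dens_sigma_additive.

Lemma ex_density_measure : exists m : {measure set T -> \bar K},
  forall A, measurable A -> m A = \int[mu]_(x in A) p x.
Proof. by exists dens. Qed.

Let dens_setT : dens [set: _] = 1%E.
Proof. exact: p1. Qed.

HB.instance Definition _ := @Measure_isProbability.Build _ _ K dens dens_setT.

Lemma ex_density_probability : exists P : probability T K,
  forall A, measurable A -> P A = \int[mu]_(x in A) p x.
Proof. by exists dens. Qed.

End density_measure.

(** The explicit density p is almost everywhere the Radon-Nikodym derivative, for which the change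
    of variables is known. No integrability of g is asked: positive and negative parts are treated
    apart, and p >= 0 commutes with taking them. *)
Lemma density_integral (mu : {sigma_finite_measure set T -> \bar K})
  (P : probability T K) (p : T -> K) : (forall x, 0 <= p x)%R ->
  measurable_fun setT p ->
  (forall A, measurable A -> P A = \int[mu]_(x in A) (p x)%:E) ->
  forall g, measurable_fun setT g ->
  \int[P]_x g x = \int[mu]_x (g x * (p x)%:E).
Proof.
move=> p0 mp PE.
have Pmu : P `<< mu.
  apply/null_content_dominatesP => A mA A0; rewrite PE//.
  by apply: null_set_integral => //; exact/measurable_funTS/measurable_EFinP.
have mpE : measurable_fun setT (EFin \o p) by exact/measurable_EFinP.
have aep : ae_eq mu setT (Radon_Nikodym_SigmaFinite.f P mu) (EFin \o p).
  apply: integral_ae_eq => //.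
    exact: Radon_Nikodym_SigmaFinite.f_integrable.
  by move=> A _ mA; rewrite -Radon_Nikodym_SigmaFinite.f_integral//; exact: PE.
have ge0case g : measurable_fun setT g -> (forall x, 0 <= g x) ->
    \int[P]_x g x = \int[mu]_x (g x * (p x)%:E).
  move=> mg g0; rewrite -(Radon_Nikodym_SigmaFinite.change_of_variables Pmu)//.
  apply: ge0_ae_eq_integral => //.
  - apply: emeasurable_funM => //.
    exact: measurable_int (Radon_Nikodym_SigmaFinite.f_integrable _).
  - exact: emeasurable_funM.
  - by move=> x _; rewrite mule_ge0// Radon_Nikodym_SigmaFinite.f_ge0.
  - by move=> x _; rewrite mule_ge0// lee_fin.
  - exact: ae_eqe_mul2l.
move=> g mg; rewrite [LHS]integralE [RHS]integralE.
rewrite (ge0case _ (measurable_funepos mg))// (ge0case _ (measurable_funeneg mg))//.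
congr (_ - _); apply: eq_integral => x _.
- rewrite !unlock /=; have [gx|gx] := leP 0 (g x).
    by rewrite !max_l// mule_ge0// lee_fin.
  by rewrite !max_r ?mul0e// ?mule_le0_ge0 ?lee_fin// ltW.
- rewrite !unlock /=; have [gx|gx] := leP 0 (g x).
    by rewrite !max_r ?mul0e// leeNl oppe0// mule_ge0// lee_fin.
  by rewrite !max_l ?muleN ?mulNe// leeNr oppe0 ?mule_le0_ge0 ?lee_fin// ltW.
Qed.

End density.

Section prob_integral.
Context {K : realType} d (T : measurableType d) (P : probability T K).

Lemma bounded_integrable (f : T -> K) (C : K) : measurable_fun setT f ->
  (forall x, `|f x| <= C) -> P.-integrable setT (EFin \o f).
Proof.
move=> mf fC; apply: measurable_bounded_integrable => //.
  by rewrite (le_lt_trans (probability_le1 P measurableT))// ltry.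
exists C; split; first exact: num_real.
by move=> M CM x _ /=; rewrite (le_trans (fC x))// ltW.
Qed.

Lemma bounded_cvg (f_ : nat -> T -> K) (f : T -> K) (C : K) :
  (forall n, measurable_fun setT (f_ n)) -> (forall n x, `|f_ n x| <= C) ->
  (forall x, f_ n x @[n --> \oo] --> f x) ->
  (\int[P]_x (f_ n x)%:E)%E @[n --> \oo] --> (\int[P]_x (f x)%:E)%E.
Proof.
move=> mf fC fcvg.
have mlim : measurable_fun setT f.
  by apply: (measurable_fun_cvg mf) => x _; exact: fcvg.
have [] := @dominated_convergence _ _ _ P setT measurableT
  (fun n => EFin \o f_ n) (EFin \o f) (cst C%:E).
- by move=> n; exact/measurable_EFinP.
- exact/measurable_EFinP.
- apply: aeW => x _ /=; apply: cvg_EFin; first exact: nearW.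
  exact: fcvg.
- apply: (@bounded_integrable (cst C) `|C|) => //.
- by apply: aeW => x n _; rewrite /= lee_fin.
by move=> _ _.
Qed.

Lemma probability_integral_cst (c : K) : (\int[P]_x c%:E)%E = c%:E.
Proof. by rewrite integral_cst//= probability_setT mule1. Qed.

End prob_integral.

(** * The characteristic function of a Gaussian variable from its tilting identity *)

Section cf_ode.
Context {K : realType} d (T : measurableType d) (P : probability T K).
Variables (Y : T -> K) (s2 : K).
Hypothesis mY : measurable_fun setT Y.
(** The Cameron-Martin formula for a centered Gaussian variable of variance s2: weighting by exp (h
    Y) amounts to a translation by h s2. It is all that is known of the law of Y; even the
    exponential moments come from it, with psi = 1. *)
Hypothesis tilt : forall (h : K) (psi : K -> K), measurable_fun setT psi ->
  (forall x, `|psi x| <= 1) ->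
  (\int[P]_x (psi (Y x) * expR (h * Y x))%:E =
   (expR (h ^+ 2 * s2 / 2))%:E * \int[P]_x (psi (Y x + h * s2))%:E)%E.

Let mY' (h : K) : measurable_fun setT (fun x => h * Y x).
Proof. exact: measurable_funM. Qed.

Let mexpY (h : K) : measurable_fun setT (fun x => expR (h * Y x)).
Proof. by apply: measurableT_comp => //; exact: measurable_expR. Qed.

Let int_expY (h : K) : P.-integrable setT (fun x => (expR (h * Y x))%:E).
Proof.
apply/integrableP; split; first exact/measurable_EFinP.
under eq_integral do rewrite gee0_abs ?lee_fin ?expR_ge0//.
rewrite [X in (X < _)%E](_ : _ = \int[P]_x (cst 1 (Y x) * expR (h * Y x))%:E)%E; last first.
  by apply: eq_integral => x _; rewrite /= mul1r.
rewrite tilt//; last by move=> x; rewrite normr1.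
by rewrite probability_integral_cst mule1 ltry.
Qed.

(** Dominates [|Y x| * expR (h * Y x)] for all |h| < 1: one factor exp |Y| absorbs |Y|, another
    absorbs exp (h Y), whence the 2. *)
Let G x := expR (2 * Y x) + expR (- 2 * Y x).

Let int_G : P.-integrable setT (EFin \o G).
Proof.
rewrite (_ : EFin \o G = (fun x => (expR (2 * Y x))%:E + (expR (- 2 * Y x))%:E)%E)//.
exact: (integrableD measurableT (int_expY _) (int_expY _)).
Qed.

Let YexpY_le (h : K) x : `|h| < 1 -> `|Y x| * expR (h * Y x) <= G x.
Proof.
move=> h1.
apply: (@le_trans _ _ (expR `|Y x| * expR `|Y x|)).
  apply: ler_pM; rewrite ?expR_ge0//.
    by apply: le_trans (expR_ge1Dx _); rewrite lerDr.
  rewrite ler_expR (le_trans (ler_norm _))// normrM ler_piMl// ltW//.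
rewrite -expRD /G; have [Y0|Y0] := leP 0 (Y x).
  rewrite (ger0_norm Y0) (_ : Y x + Y x = 2 * Y x); last by ring.
  by rewrite lerDl expR_ge0.
rewrite (ltr0_norm Y0) (_ : - Y x - Y x = -2 * Y x); last by ring.
by rewrite lerDr expR_ge0.
Qed.

Let int_Y : P.-integrable setT (EFin \o Y).
Proof.
apply: le_integrable int_G => //; first exact/measurable_EFinP.
move=> x _; rewrite /= lee_fin.
rewrite (le_trans _ (ler_norm _))//.
have := @YexpY_le 0 x; rewrite mul0r expR0 mulr1 normr0; apply; exact: ltr01.
Qed.

Let C s := (\int[P]_x cos (s * Y x))%R.
Let D s := (\int[P]_x sin (s * Y x))%R.

Let mcos : measurable_fun setT (@cos K).
Proof. by apply: continuous_measurable_fun; exact: continuous_cos. Qed.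
Let msin : measurable_fun setT (@sin K).
Proof. by apply: continuous_measurable_fun; exact: continuous_sin. Qed.

Let int_bd (f : K -> K) s : measurable_fun setT f -> (forall x, `|f x| <= 1) ->
  P.-integrable setT (EFin \o (fun x => f (s * Y x))).
Proof.
by move=> mf f1; apply: (@bounded_integrable _ _ _ _ _ 1) => //; exact: measurableT_comp.
Qed.

Let cos1 (x : K) : `|cos x| <= 1. Proof. exact: cos_max. Qed.
Let sin1 (x : K) : `|sin x| <= 1. Proof. exact: sin_max. Qed.

Let der_gen (f f' : K -> K -> K) (a : K) :
  (forall x, `|x| < 1 -> P.-integrable setT (EFin \o (fun y => f (x + a) (Y y)))) ->
  (forall x y : K, is_derive (x:K) (1:K) (f ^~ y) (f' x y)) ->
  (forall x y, `|x - a| < 1 -> `|f' x (Y y)| <= G y) ->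
  is_derive (a:K) (1:K) (fun x => (\int[P]_y f x (Y y))%R) (\int[P]_y f' a (Y y))%R.
Proof.
move=> fi fd fG.
have Ia : `](a - 1), (a + 1)[%classic a.
  by rewrite /= in_itv/= ltrDl ltrBlDr ltrDl ltr01.
have fd' x y : derivable (f ^~ y) x 1 by case: (fd x y).
have fdE x y : partial1of2 (fun x y => f x (Y y)) x y = f' x (Y y).
  by rewrite partial1of2E; case: (fd x (Y y)).
have dF x y : (`](a - 1), (a + 1)[%classic x -> setT y ->
   derivable ((fun x y => f x (Y y)) ^~ y) x 1) by move=> _ _; exact: fd'.
have fi' x : `](a - 1), (a + 1)[%classic x -> P.-integrable setT (EFin \o (fun y => f x (Y y))).
  rewrite /= in_itv/= => /andP[x1 x2].
  have := fi (x - a); rewrite subrK; apply.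
  rewrite ltr_norml; apply/andP; split; lra.
have fG' x y : `](a - 1), (a + 1)[%classic x -> setT y ->
    `|partial1of2 (fun x y => f x (Y y)) x y| <= G y.
  rewrite /= in_itv/= => /andP[x1 x2] _; rewrite fdE fG//.
  rewrite ltr_norml; apply/andP; split; lra.
have G0 y : 0 <= G y by rewrite addr_ge0// expR_ge0.
split.
  exact: (derivable_under_integral measurableT Ia fi' dF G0 int_G fG').
rewrite -derive1E (differentiation_under_integral measurableT Ia fi' dF G0 int_G fG').
by apply: eq_Rintegral => y _; rewrite fdE.
Qed.

Let der_C s : is_derive (s:K) (1:K) C (- \int[P]_x (Y x * sin (s * Y x)))%R.
Proof.
have := @der_gen (fun s y => cos (s * y)) (fun s y => - (y * sin (s * y))) s.
rewrite (_ : (\int[P]_y (- (Y y * sin (s * Y y)))) = (- \int[P]_x (Y x * sin (s * Y x))))%R.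
  apply.
  - by move=> x _; exact: (@int_bd cos).
  - move=> x y; apply: is_derive_eq.
    by rewrite /GRing.scale/=; ring.
  - move=> x y xs; rewrite normrN normrM.
    apply: (@le_trans _ _ (`|Y y| * expR (0 * Y y))).
      by rewrite mul0r expR0 ler_wpM2l.
    by rewrite YexpY_le// normr0.
under eq_Rintegral do rewrite -mulN1r.
rewrite RintegralZl ?mulN1r//.
apply: (@le_integrable _ _ _ _ _ measurableT _ (EFin \o Y)) => //.
  apply/measurable_EFinP; apply: measurable_funM => //.
  by apply: (measurableT_comp msin).
by move=> x _; rewrite /= lee_fin normrM ler_piMr.
Qed.

Let der_D s : is_derive (s:K) (1:K) D (\int[P]_x (Y x * cos (s * Y x)))%R.
Proof.
apply: (@der_gen (fun s y => sin (s * y)) (fun s y => (y * cos (s * y))) s).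
- by move=> x _; exact: (@int_bd sin).
- move=> x y; apply: is_derive_eq.
  by rewrite /GRing.scale/=; ring.
- move=> x y xs; rewrite normrM.
  apply: (@le_trans _ _ (`|Y y| * expR (0 * Y y))).
    by rewrite mul0r expR0 ler_wpM2l.
  by rewrite YexpY_le// normr0.
Qed.

Let tiltR (h : K) (psi : K -> K) : measurable_fun setT psi -> (forall x, `|psi x| <= 1) ->
  (\int[P]_x (psi (Y x) * expR (h * Y x)) =
   (expR (h ^+ 2 * s2 / 2)) * \int[P]_x (psi (Y x + h * s2)))%R.
Proof.
move=> mpsi psi1; rewrite /Rintegral tilt// fineM//.
apply: integrable_fin_num => //; apply: (@bounded_integrable _ _ _ _ _ 1) => //.
by apply: measurableT_comp => //; apply: measurable_funD.
Qed.

(** Gaussian integration by parts, obtained by differentiating both sides of [tilt] at h = 0: the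
    weight produces the factor Y, and exp (h^2 s2 / 2) has zero derivative there. *)
Let stein (f f' : K -> K) : measurable_fun setT f -> (forall x, `|f x| <= 1) ->
  (forall h, (\int[P]_x f (Y x + h * s2) = f' h)%R) -> derivable f' 0 1 ->
  (\int[P]_x (Y x * f (Y x)) = 'D_1 f' 0)%R.
Proof.
move=> mf f1 f'E df'.
have H1 := @der_gen (fun h y => f y * expR (h * y)) (fun h y => y * f y * expR (h * y)) 0.
have {}H1 : is_derive (0:K) (1:K) (fun h => (\int[P]_y (f (Y y) * expR (h * Y y)))%R) (\int[P]_y (Y y * f (Y y) * expR (0 * Y y)))%R.
  apply: H1.
  - move=> h h1; rewrite addr0.
    apply: (@le_integrable _ _ _ _ _ measurableT _ (fun x => (expR (h * Y x))%:E)) => //.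
      apply/measurable_EFinP; apply: measurable_funM => //; exact: measurableT_comp.
    by move=> x _; rewrite /= lee_fin normrM ler_piMl.
  - move=> x y; apply: is_derive_eq.
    by rewrite /GRing.scale/=; ring.
  - move=> x y; rewrite subr0 => x1; rewrite normrM (ger0_norm (expR_ge0 _)).
    apply: le_trans (YexpY_le _ x1); rewrite ler_wpM2r ?expR_ge0//.
    by rewrite normrM ler_piMr.
have H2 : is_derive (0:K) (1:K) (fun h => (\int[P]_y (f (Y y) * expR (h * Y y)))%R) ('D_1 f' 0).
  have -> : (fun h => (\int[P]_y (f (Y y) * expR (h * Y y)))%R) = (fun h => expR (h ^+ 2 * s2 / 2) * f' h).
    by apply/funext => h; rewrite tiltR// f'E.
  have d' := derivableP df'.
  apply: is_derive_eq.
  rewrite /GRing.scale/= expr0n/= !mul0r expR0; ring.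
case: H1 => _; case: H2 => _ -> ->.
by apply: eq_Rintegral => y _; rewrite mul0r expR0 mulr1.
Qed.

Let stein_sin s : (\int[P]_x (Y x * sin (s * Y x)) = s * s2 * C s)%R.
Proof.
pose f' h := sin (s * (h * s2)) * C s + cos (s * (h * s2)) * D s.
rewrite (@stein (fun y => sin (s * y)) f').
- have : is_derive (0:K) (1:K) f' (s * s2 * C s).
    apply: is_derive_eq; rewrite /GRing.scale/= !mul0r !mulr0 sin0 cos0; ring.
  by case.
- apply: measurableT_comp => //; exact: measurable_funM.
- by [].
- move=> h; rewrite /f'.
  rewrite /C /D -RintegralZl//; last exact: int_bd.
  rewrite -RintegralZl//; last exact: int_bd.
  rewrite -RintegralD//=.
  - by apply: eq_Rintegral => x _; rewrite mulrDr sinD; ring.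
  - exact: (integrableZl measurableT (sin (s * (h * s2))) (int_bd s mcos cos1)).
  - exact: (integrableZl measurableT (cos (s * (h * s2))) (int_bd s msin sin1)).
- rewrite /f'; apply: ex_derive.
Qed.

Let stein_cos s : (\int[P]_x (Y x * cos (s * Y x)) = - s * s2 * D s)%R.
Proof.
pose f' h := cos (s * (h * s2)) * C s - sin (s * (h * s2)) * D s.
rewrite (@stein (fun y => cos (s * y)) f').
- have : is_derive (0:K) (1:K) f' (- s * s2 * D s).
    apply: is_derive_eq; rewrite /GRing.scale/= !mul0r !mulr0 sin0 cos0; ring.
  by case.
- apply: measurableT_comp => //; exact: measurable_funM.
- by [].
- move=> h; rewrite /f'.
  rewrite /C /D -RintegralZl//; last exact: int_bd.
  rewrite -RintegralZl//; last exact: int_bd.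
  rewrite -RintegralB//=.
  - by apply: eq_Rintegral => x _; rewrite mulrDr cosD; ring.
  - exact: (integrableZl measurableT (cos (s * (h * s2))) (int_bd s mcos cos1)).
  - exact: (integrableZl measurableT (sin (s * (h * s2))) (int_bd s msin sin1)).
- rewrite /f'; apply: ex_derive.
Qed.

(** By the Stein identities C and D solve the same equation F' = - s s2 F, so that F exp (s^2 s2 /
    2) is constant. Only the value at 0 tells them apart: 1 for the cosine, 0 for the sine. *)
Lemma gauss_cf_ode s : C s = expR (- (s ^+ 2 * s2) / 2) /\ D s = 0.
Proof.
have dE (F : K -> K) : (forall s : K, is_derive (s:K) (1:K) F (- s * s2 * F s)) ->
    F s = F 0 * expR (- (s ^+ 2 * s2) / 2).
  move=> dF; pose E s := F s * expR (s ^+ 2 * s2 / 2).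
  have : E s = E 0.
    apply: is_derive_0_is_cst => {}s; have := dF s => ?.
    rewrite /E (_ : (fun s : K => _) = (fun s : K => F s * expR (s * s * s2 / 2))); last by apply/funext => x; rewrite expr2.
    by apply: is_derive_eq; rewrite /GRing.scale/=; field.
  rewrite /E expr0n/= !mul0r expR0 mulr1 => <-.
  by rewrite -mulrA -expRD mulNr subrr expR0 mulr1.
have dC (u : K) : is_derive (u:K) (1:K) C (- u * s2 * C u).
  by have := der_C u; rewrite stein_sin !mulNr.
have dD (u : K) : is_derive (u:K) (1:K) D (- u * s2 * D u).
  by have := der_D u; rewrite stein_cos.
split.
  rewrite (dE C dC) /C; under eq_Rintegral do rewrite mul0r cos0.
  by rewrite /Rintegral probability_integral_cst mul1r.
rewrite (dE D dD) /D; under eq_Rintegral do rewrite mul0r sin0.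
by rewrite /Rintegral probability_integral_cst mul0r.
Qed.

End cf_ode.

(** * Quadratic forms *)

Section vectors.
Context {K : realType}.
Local Notation V n := 'cV[K]_n.

Definition dotp n (u x : V n) : K := (u^T *m x) 0 0.

Lemma dotpE n (u x : V n) : dotp u x = \sum_i u i 0 * x i 0.
Proof. by rewrite /dotp mxE; apply: eq_bigr => i _; rewrite mxE. Qed.

Lemma dotpC n (u x : V n) : dotp u x = dotp x u.
Proof. by rewrite !dotpE; apply: eq_bigr => i _; rewrite mulrC. Qed.

Lemma dotpDr n (u x y : V n) : dotp u (x + y) = dotp u x + dotp u y.
Proof. by rewrite /dotp mulmxDr mxE. Qed.

Lemma dotpDl n (u x y : V n) : dotp (x + y) u = dotp x u + dotp y u.
Proof. by rewrite dotpC dotpDr !(dotpC u). Qed.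

Lemma dotpZr n c (u x : V n) : dotp u (c *: x) = c * dotp u x.
Proof. by rewrite /dotp -scalemxAr mxE. Qed.

Lemma dotpZl n c (u x : V n) : dotp (c *: u) x = c * dotp u x.
Proof. by rewrite dotpC dotpZr dotpC. Qed.

Lemma dotpNr n (u x : V n) : dotp u (- x) = - dotp u x.
Proof. by rewrite -scaleN1r dotpZr mulN1r. Qed.

Lemma dotpNl n (u x : V n) : dotp (- u) x = - dotp u x.
Proof. by rewrite dotpC dotpNr dotpC. Qed.

Lemma dotpBr n (u x y : V n) : dotp u (x - y) = dotp u x - dotp u y.
Proof. by rewrite dotpDr dotpNr. Qed.

Lemma dotpBl n (u x y : V n) : dotp (x - y) u = dotp x u - dotp y u.
Proof. by rewrite dotpDl dotpNl. Qed.

Lemma dotp0r n (u : V n) : dotp u 0 = 0.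
Proof. by rewrite /dotp mulmx0 mxE. Qed.

Lemma dotp0l n (u : V n) : dotp 0 u = 0.
Proof. by rewrite dotpC dotp0r. Qed.

Lemma dotp_mulmx m n (u : V m) (A : 'M[K]_(m, n)) (x : V n) :
  dotp u (A *m x) = dotp (A^T *m u) x.
Proof. by rewrite /dotp mulmxA trmx_mul trmxK. Qed.

Lemma quadE n (M : 'M[K]_n) (x : V n) : (x^T *m M *m x) 0 0 = dotp x (M *m x).
Proof. by rewrite /dotp mulmxA. Qed.

Lemma dotp_ge0 n (x : V n) : 0 <= dotp x x.
Proof. by rewrite dotpE; apply: sumr_ge0 => i _; rewrite -expr2 sqr_ge0. Qed.

Lemma dotp_eq0 n (x : V n) : (dotp x x == 0) = (x == 0).
Proof.
apply/eqP/eqP => [|->]; last by rewrite dotp0r.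
rewrite dotpE => /eqP; rewrite psumr_eq0 => [/allP h|i _]; last by rewrite -expr2 sqr_ge0.
apply/colP => i; rewrite mxE; apply/eqP; have := h i (mem_index_enum i).
by rewrite /= -expr2 sqrf_eq0.
Qed.

Lemma dotp_gt0 n (x : V n) : x != 0 -> 0 < dotp x x.
Proof. by move=> x0; rewrite lt_neqAle eq_sym dotp_eq0 x0 dotp_ge0. Qed.

Lemma dotp_ext n (x y : V n) : (forall u, dotp u x = dotp u y) -> x = y.
Proof.
move=> h; apply/eqP; rewrite -subr_eq0 -dotp_eq0 dotpBr h subrr//.
Qed.

Lemma dotp_cauchy n (x y : V n) : dotp x y ^+ 2 <= dotp x x * dotp y y.
Proof.
have [->|x0] := eqVneq x 0; first by rewrite !dotp0l expr0n mul0r.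
have := dotp_ge0 (dotp x x *: y - dotp x y *: x).
rewrite dotpBr !dotpBl !dotpZr !dotpZl (dotpC y x).
have := dotp_gt0 x0; set a := dotp x x; set b := dotp x y; set c := dotp y y.
move=> a0 h; have : 0 <= a * (a * c - b ^+ 2).
  by move: h; congr (0 <= _); ring.
by rewrite pmulr_rge0// subr_ge0.
Qed.

Lemma mx_norm_coord m n (M : 'M[K]_(m, n)) i j : `|M i j| <= `|M|.
Proof.
rewrite [leRHS]/Num.Def.normr /= mx_normrE; apply/bigmax_geP; right => /=.
by exists (i, j).
Qed.

Lemma mx_norm_le m n (M : 'M[K]_(m, n)) e : 0 <= e ->
  (forall i j, `|M i j| <= e) -> `|M| <= e.
Proof.
by move=> e0 h; rewrite [leLHS]/Num.Def.normr /= mx_normrE (bigmax_le _ e0)//= => -[i j] _.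
Qed.

Lemma cvg_mx (T : Type) (F : set_system T) {FF : Filter F} m n
    (f : T -> 'M[K]_(m, n)) (M : 'M[K]_(m, n)) :
  (forall i j, f x i j @[x --> F] --> M i j) -> f x @[x --> F] --> M.
Proof.
move=> h; apply/cvgrPdist_le => e e0.
have : \forall x \near F, forall ij : 'I_m * 'I_n, `|M ij.1 ij.2 - f x ij.1 ij.2| <= e.
  by apply: filter_forall => -[i j] /=; have /cvgrPdist_le := h i j; apply.
apply: filterS => x hx; apply: mx_norm_le; first exact: ltW.
by move=> i j; have := hx (i, j); rewrite !mxE.
Qed.

Lemma cvg_mx_coord (T : Type) (F : set_system T) {FF : Filter F} m n
    (f : T -> 'M[K]_(m, n)) (M : 'M[K]_(m, n)) i j :
  f x @[x --> F] --> M -> f x i j @[x --> F] --> M i j.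
Proof.
move=> h; apply: (@cvg_comp _ _ _ f (fun N : 'M[K]_(m, n) => N i j) F (nbhs M) (nbhs (M i j)) h).
exact: coord_continuous.
Qed.

Lemma cvg_mulmx (T : Type) (F : set_system T) {FF : Filter F} m n p
    (f : T -> 'M[K]_(m, n)) (g : T -> 'M[K]_(n, p)) (M : 'M[K]_(m, n)) (N : 'M[K]_(n, p)) :
  f x @[x --> F] --> M -> g x @[x --> F] --> N ->
  (f x *m g x) @[x --> F] --> M *m N.
Proof.
move=> hf hg; apply: cvg_mx => i j; rewrite mxE.
under eq_fun do rewrite mxE.
apply: cvg_big => [|k _]; first exact: add_continuous.
by apply: cvgM; exact: cvg_mx_coord.
Qed.

Lemma cvg_trmx (T : Type) (F : set_system T) {FF : Filter F} m n
    (f : T -> 'M[K]_(m, n)) (M : 'M[K]_(m, n)) :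
  f x @[x --> F] --> M -> (f x)^T @[x --> F] --> M^T.
Proof.
move=> hf; apply: cvg_mx => i j; rewrite mxE.
by under eq_fun do rewrite mxE; exact: cvg_mx_coord.
Qed.

Lemma cvg_dotp (T : Type) (F : set_system T) {FF : Filter F} n
    (f g : T -> V n) (x y : V n) :
  f t @[t --> F] --> x -> g t @[t --> F] --> y ->
  dotp (f t) (g t) @[t --> F] --> dotp x y.
Proof.
move=> hf hg; apply: cvg_mx_coord; apply: cvg_mulmx => //.
exact: cvg_trmx.
Qed.

Lemma continuous_quad n (M : 'M[K]_n) : continuous (fun x : V n => dotp x (M *m x)).
Proof.
move=> x; apply: (@cvg_dotp _ (nbhs x) (nbhs_filter x) n id (fun t => M *m t) x (M *m x)).
  exact: cvg_id.
apply: (@cvg_mulmx _ (nbhs x) (nbhs_filter x) n n 1 (cst M) id M x); [exact: cvg_cst|exact: cvg_id].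
Qed.

Lemma compact_colV n (A : set (V n)) (C : K) : closed A ->
  (forall x, A x -> `|x| <= C) -> compact A.
Proof.
move=> cA bA.
pose B := [set v : 'rV[K]_n | forall i, v ord0 i \in `[- C, C]].
have cB : compact B.
  by apply: (@rV_compact _ _ (fun=> `[- C, C]%classic)) => _; exact: segment_compact.
have ctr : {within B, continuous (@trmx K 1 n)}.
  apply: continuous_subspaceT => v.
  exact: (@cvg_trmx _ (nbhs v) (nbhs_filter v) 1 n id v cvg_id).
apply: subclosed_compact cA (continuous_compact ctr cB) _ => x Ax.
exists x^T; last by rewrite trmxK.
move=> i; rewrite mxE in_itv/= -ler_norml; apply: le_trans (bA _ Ax).
exact: mx_norm_coord.
Qed.

Definition pd n (M : 'M[K]_n) : Prop :=
  forall x : V n, x != 0 -> 0 < dotp x (M *m x).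

Lemma posdefP n (M : 'M[K]_n) : posdef M <-> M^T = M /\ pd M.
Proof.
by split=> -[sM hM]; split=> // x x0; have := hM x x0; rewrite quadE.
Qed.

Lemma quad_ge0 n (M : 'M[K]_n) x : posdef M -> 0 <= dotp x (M *m x).
Proof.
move=> /posdefP[_ hM]; have [->|x0] := eqVneq x 0; first by rewrite dotp0l.
exact/ltW/hM.
Qed.

Lemma dotp_sym n (M : 'M[K]_n) x y : M^T = M -> dotp x (M *m y) = dotp y (M *m x).
Proof. by move=> sM; rewrite dotp_mulmx sM dotpC. Qed.

(** Nonnegativity of the form at v plus a suitable multiple of y forces [dotp y (H *m v)] to vanish,
    for every y. *)
Lemma quad_null n (H : 'M[K]_n) (v : V n) : H^T = H ->
  (forall x, 0 <= dotp x (H *m x)) -> dotp v (H *m v) = 0 -> H *m v = 0.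
Proof.
move=> sH pH vH; apply: dotp_ext => y; rewrite dotp0r.
pose b := dotp y (H *m v); pose c := dotp y (H *m y).
have c0 : 0 <= c by exact: pH.
have c1 : c + 1 != 0 by rewrite gt_eqF// ltr_wpDl.
(* The minimum along y is at - b / c; replacing c by c + 1 avoids c = 0 and still yields a negative
   value unless b = 0. *)
have := pH (v + (- b / (c + 1)) *: y).
rewrite mulmxDr -scalemxAr dotpDr !dotpDl !dotpZr !dotpZl vH (dotp_sym v y sH).
rewrite -/b -/c => h.
have h2 : 0 <= - (b ^+ 2 * ((c + 2) / (c + 1) ^+ 2)).
  by move: h; congr (0 <= _); field.
have : 0 < (c + 2) / (c + 1) ^+ 2.
  by rewrite divr_gt0// ?ltr_wpDl// exprn_gt0// ltr_wpDl.
move=> p; move: h2; rewrite oppr_ge0 pmulr_lle0// => h2.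
apply/eqP; rewrite -sqrf_eq0 eq_le h2 sqr_ge0//.
Qed.

(** The Rayleigh quotient of M by N attains its maximum mu on the unit sphere, compact for the
    entrywise norm. The form mu N - M is then nonnegative and vanishes at the maximizer, so
    [quad_null] gives the eigenvector equation. Every spectral argument below is an instance of this
    one. *)
Lemma generalized_eigen n (M N : 'M[K]_n.+1) : M^T = M -> posdef N ->
  exists (v : V n.+1) (mu : K), [/\ v != 0, M *m v = mu *: (N *m v) &
    forall x, dotp x (M *m x) <= mu * dotp x (N *m x)].
Proof.
move=> sM /[dup] hN /posdefP[sN pN].
pose A := [set x : V n.+1 | `|x| = 1].
have cA : compact A.
  apply: (@compact_colV _ _ 1); last by move=> x ->.
  rewrite (_ : A = (fun x : V n.+1 => `|x|) @^-1` [set 1])//.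
  apply: closed_comp; last exact: closed_eq.
  by move=> x _; exact: norm_continuous.
have A0 : (A !=set0)%classic.
  exists (const_mx 1); rewrite /A/=; apply/eqP; rewrite eq_le; apply/andP; split.
    by apply: mx_norm_le => // i j; rewrite mxE normr1.
  by rewrite (le_trans _ (mx_norm_coord _ ord0 ord0))// mxE normr1.
pose f x := dotp x (M *m x) / dotp x (N *m x).
have neq0 x : A x -> x != 0.
  by move=> Ax; rewrite -normr_eq0 Ax oner_eq0.
have cf : {within A, continuous f}.
  apply: continuous_in_subspaceT => x /set_mem Ax.
  have cq P : (fun x : V n.+1 => dotp x (P *m x)) y @[y --> nbhs x] --> dotp x (P *m x).
    exact: continuous_quad.
  rewrite /continuous_at; apply: (cvgM (cq M)).
  by apply: (cvgV _ (cq N)); rewrite gt_eqF// pN// neq0.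
have [v /set_mem Av vmax] := compact_EVT_max A0 cA cf.
pose mu := f v.
have hmu x : dotp x (M *m x) <= mu * dotp x (N *m x).
  have [->|x0] := eqVneq x 0; first by rewrite !dotp0l mulr0.
  have nx0 : 0 < `|x| by rewrite normr_gt0.
  have Ax : A (`|x|^-1 *: x).
    by rewrite /A/= normrZ ger0_norm ?invr_ge0// mulVf// gt_eqF.
  have := vmax _ (mem_set Ax); rewrite /f -!scalemxAr !dotpZr !dotpZl -/(f v) -/mu.
  rewrite ler_pdivrMr; last first.
    by rewrite !mulr_gt0// ?invr_gt0// pN.
  set a := dotp x _; set b := dotp x (N *m x).
  rewrite (mulrA _ _ a) (mulrA _ _ b) mulrCA ler_pM2l//.
  by rewrite mulr_gt0// invr_gt0.
exists v, mu; split; [exact: neq0| |exact: hmu].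
have : (mu *: N - M) *m v = 0.
  apply: quad_null.
  - by rewrite linearB/= linearZ/= sN sM.
  - move=> x; rewrite mulmxBl -scalemxAl dotpBr dotpZr subr_ge0; exact: hmu.
  - rewrite mulmxBl -scalemxAl dotpBr dotpZr /mu /f divfK ?subrr// gt_eqF// pN//.
    exact: neq0.
by rewrite mulmxBl -scalemxAl => /eqP; rewrite subr_eq0 => /eqP ->.
Qed.

Lemma posdef1 n : posdef (1%:M : 'M[K]_n).
Proof. by apply/posdefP; split; rewrite ?trmx1// => x x0; rewrite mul1mx dotp_gt0. Qed.

(** If mu is the largest eigenvalue of the identity relative to J, then |x|^2 <= mu x'Jx, and e = 1
    / mu works. *)
Lemma posdef_lower n (J : 'M[K]_n) : posdef J ->
  exists2 e : K, 0 < e & forall x, e * dotp x x <= dotp x (J *m x).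
Proof.
case: n J => [|n] J hJ.
  by exists 1 => // x; rewrite (_ : x = 0) ?dotp0l ?mulr0//; apply/colP; case.
have [v [mu [v0 vE hmu]]] := generalized_eigen (trmx1 K n.+1) hJ.
have : mu * dotp v (J *m v) = dotp v v by rewrite -dotpZr -vE mul1mx.
have /posdefP[_ pJ] := hJ; move=> muE.
have mu0 : 0 < mu.
  by rewrite -(pmulr_lgt0 _ (pJ _ v0)) muE dotp_gt0.
exists mu^-1; first by rewrite invr_gt0.
by move=> x; have := hmu x; rewrite mul1mx ler_pdivrMl.
Qed.

Lemma posdef_unit n (M : 'M[K]_n) : posdef M -> M \in unitmx.
Proof.
move=> /posdefP[sM pM]; rewrite -row_free_unit -kermx_eq0.
apply/rowV0P => u /sub_kermxP uM.
apply/eqP; apply: contraT => u0.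
have := pM u^T; rewrite trmx_eq0 => /(_ u0).
by rewrite dotp_mulmx sM -[X in X *m _]sM -trmx_mul uM trmx0 dotp0l ltxx.
Qed.

Lemma posdef_inv n (M : 'M[K]_n) : posdef M -> posdef (invmx M).
Proof.
move=> /[dup] hM /posdefP[sM pM]; have uM := posdef_unit hM.
apply/posdefP; split; first by rewrite trmx_inv sM.
move=> x x0; have -> : x = M *m (invmx M *m x) by rewrite mulKVmx.
rewrite mulKmx// dotpC; apply: pM.
by apply: contra x0 => /eqP h; rewrite -(mulKVmx uM x) h mulmx0.
Qed.

Lemma posdefD n (M N : 'M[K]_n) : posdef M -> posdef N -> posdef (M + N).
Proof.
move=> /posdefP[sM pM] /posdefP[sN pN]; apply/posdefP; split.
  by rewrite linearD/= sM sN.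
by move=> x x0; rewrite mulmxDl dotpDr addr_gt0// ?pM ?pN.
Qed.

Lemma posdefZ n c (M : 'M[K]_n) : 0 < c -> posdef M -> posdef (c *: M).
Proof.
move=> c0 /posdefP[sM pM]; apply/posdefP; split; first by rewrite linearZ/= sM.
by move=> x x0; rewrite -scalemxAl dotpZr mulr_gt0// pM.
Qed.

Lemma measurable_dotp d (T : measurableType d) n (f g : T -> V n) :
  measurable_fun setT f -> measurable_fun setT g ->
  measurable_fun setT (fun x => dotp (f x) (g x)).
Proof.
move=> mf mg; rewrite /dotp.
apply: measurable_mx_coord; apply: measurable_mulmx => //; exact: measurable_trmx.
Qed.

Lemma measurable_quad d (T : measurableType d) n (M : 'M[K]_n) (f : T -> V n) :
  measurable_fun setT f -> measurable_fun setT (fun x => dotp (f x) (M *m f x)).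
Proof. by move=> mf; apply: measurable_dotp => //; exact: measurable_mulmx. Qed.

End vectors.

(** * Smooth bumps *)

Section flat.
Context {K : realType}.
Variable c : K.
Hypothesis c0 : 0 < c.

(** The polynomial in 1 / t closes the family under differentiation, so that smoothness of every
    order follows from one derivative formula. The rate c is kept free because the bumps built from
    it tend to the indicator of a box as c tends to 0. *)
Definition flat (p : {poly K}) (t : K) : K :=
  if 0 < t then p.[t^-1] * expR (- (c / t)) else 0.

Lemma pow_exp_bound (m : nat) : exists C : K, forall y, 0 < y ->
  y ^+ m * expR (- (c * y)) <= C.
Proof.
exists (m`!%:R / c ^+ m) => y y0.
rewrite expRN ler_pdivrMr ?expR_gt0// mulrAC ler_pdivlMr ?exprn_gt0//.
rewrite -exprMn mulrC -ler_pdivrMl ?ltr0n ?fact_gt0// mulrC (mulrC y).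
case: m => [|m]; last first.
  apply: (@le_trans _ _ (1 + (c * y) ^+ m.+1 / m.+1`!%:R)); first by rewrite [leLHS]mulrC ler_wpDl.
  by apply: expR_ge1Dxn; rewrite mulr_ge0// ltW.
rewrite expr0 fact0 mulr1 invr1.
by rewrite -[leLHS]addr0 (le_trans _ (expR_ge1Dx _))// lerD2l mulr_ge0// ltW.
Qed.

Lemma poly_exp_bound (p : {poly K}) (m : nat) : exists2 C : K, 0 <= C &
  forall y, 0 < y -> `|p.[y]| * y ^+ m * expR (- (c * y)) <= C.
Proof.
elim/poly_ind: p m => [|p a ih] m.
  by exists 0 => // y y0; rewrite horner0 normr0 !mul0r.
have [C1 C10 h1] := ih m.+1; have [C2 h2] := pow_exp_bound m.
exists (C1 + `|a| * `|C2|); first by rewrite addr_ge0// mulr_ge0.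
move=> y y0; rewrite hornerD hornerMX hornerC.
apply: (@le_trans _ _ ((`|p.[y]| * y + `|a|) * y ^+ m * expR (- (c * y)))).
  rewrite ler_wpM2r ?expR_ge0// ler_wpM2r ?exprn_ge0 ?(ltW y0)//.
  by rewrite (le_trans (ler_normD _ _))// normrM (gtr0_norm y0).
rewrite !mulrDl lerD//.
  by rewrite (le_trans _ (h1 _ y0))// exprS mulrA.
rewrite -mulrA ler_wpM2l// (le_trans (h2 _ y0))//.
exact: ler_norm.
Qed.

(** The second power of t makes the difference quotient at 0 tend to 0; this settles the only
    delicate point of [is_derive_flat]. *)
Lemma flat_bound (p : {poly K}) : exists2 C : K, 0 <= C &
  forall t, `|flat p t| <= C * t ^+ 2.
Proof.
have [C C0 h] := poly_exp_bound p 2; exists C => // t; rewrite /flat.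
case: ifPn => [t0|_]; last by rewrite normr0 mulr_ge0// sqr_ge0.
have := h t^-1; rewrite invr_gt0 => /(_ t0).
by rewrite normrM (ger0_norm (expR_ge0 _)) exprVn mulrAC ler_pdivrMr// exprn_gt0.
Qed.

(** For t > 0 the derivative of p(1/t) exp (- c/t) is t^-2 (c p(1/t) - p'(1/t)) exp (- c/t); this is
    the polynomial in 1 / t that appears. *)
Definition dflat (p : {poly K}) : {poly K} := 'X^2 * (c *: p - p^`()).

Lemma is_derive_quadratic (f : K -> K) (x C : K) :
  (forall h, `|f (h + x) - f x| <= C * h ^+ 2) -> is_derive (x : K) (1 : K) f 0.
Proof.
move=> hf.
have cv : h^-1 *: ((f \o shift x) (h *: 1) - f x) @[h --> 0^'] --> (0 : K).
  apply/cvgrPdist_le => e e0.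
  near=> h; rewrite sub0r normrN normrZ /= /GRing.scale/= mulr1.
  have hn0 : h != 0 by near: h; exact: nbhs_dnbhs_neq.
  rewrite normfV ler_pdivrMl ?normr_gt0//.
  rewrite (le_trans (hf h))// -real_normK ?num_real// expr2 mulrA mulrC ler_wpM2l//.
  apply: (@le_trans _ _ ((`|C| + 1) * `|h|)).
    by rewrite ler_wpM2r// (le_trans (ler_norm _))// lerDl.
  rewrite mulrC -ler_pdivlMr//.
  near: h; apply: dnbhs0_le; rewrite divr_gt0//.
split; first by apply/cvg_ex; exists 0.
by apply/cvg_lim.
Unshelve. all: by end_near. Qed.

Lemma is_derive_flat (p : {poly K}) (t : K) :
  is_derive (t : K) (1 : K) (flat p) (flat (dflat p) t).
Proof.
have [t0|t0|<-] := ltgtP 0 t.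
- pose g (t : K) := p.[t^-1] * expR (- (c / t)).
  have tn0 : t != 0 by rewrite gt_eqF.
  have dp (y : K) : is_derive (y : K) (1 : K) (horner p) (p^`()).[y].
    have -> : (p^`()).[y] = 'D_1 (horner p) y by rewrite derivE derive1E.
    by apply: derivableP; exact: derivable_horner.
  have di : is_derive (t : K) (1 : K) (fun t : K => t^-1) (- t ^- 2).
    have did : derivable (id : K -> K) t 1 by exact: derivable_id.
    split; first exact: (derivableV (f := id) tn0 did).
    by rewrite (deriveV (f := id) tn0 did) derive_id /GRing.scale/= mulr1.
  have dpc : is_derive (t : K) (1 : K) (fun t : K => p.[t^-1]) ((p^`()).[t^-1] * (- t ^- 2)).
    have := @is_derive1_comp _ (horner p) (fun t : K => t^-1) t _ _ (dp t^-1) di.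
    by [].
  have dg : is_derive (t : K) (1 : K) g (flat (dflat p) t).
    rewrite /g; apply: is_derive_eq.
    rewrite /flat t0 /dflat !hornerE /GRing.scale/=.
    field => //.
  apply: (@near_eq_is_derive _ _ _ g (flat p)) => //.
  near=> y; rewrite /flat /g ifT//.
  near: y; exact: lt_nbhsr.
- rewrite {2}/flat ltNge (ltW t0)/=.
  apply: (@near_eq_is_derive _ _ _ (cst 0) (flat p)) => //.
  near=> y; rewrite /flat /= ifF//; apply/negbTE; rewrite -leNgt.
  apply/ltW; near: y; exact: lt_nbhsl.
- rewrite {2}/flat ltxx; have [C C0 h] := flat_bound p.
  apply: (is_derive_quadratic (C := C)) => y.
  by rewrite addr0 {2}/flat ltxx subr0.
Unshelve. all: by end_near. Qed.

Lemma flat1_ge0 t : 0 <= flat 1 t.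
Proof. by rewrite /flat; case: ifP => // _; rewrite hornerE mul1r expR_ge0. Qed.

Lemma flat1_le1 t : flat 1 t <= 1.
Proof.
rewrite /flat; case: ifP => // t0; rewrite hornerE mul1r -expR0 ler_expR.
by rewrite oppr_le0 divr_ge0// ltW.
Qed.

End flat.

Section smooth.
Context {K : realType} {n : nat}.
Local Notation V := 'cV[K]_n.
Implicit Types f g : V -> K.

Lemma C_kSP k f : C_k k.+1 f <-> (forall x, differentiable f x) /\
  forall i, C_k k (fun x => 'D_(basis_vec i) f x).
Proof. by []. Qed.

Lemma C_kW k f : C_k k.+1 f -> C_k k f.
Proof.
elim: k f => [|k ih] f.
  by move=> [df _] x; exact: differentiable_continuous.
by move=> /C_kSP[df h]; apply/C_kSP; split => // i; apply: ih; exact: h.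
Qed.

Lemma C_kD k f g : C_k k f -> C_k k g -> C_k k (fun x => f x + g x).
Proof.
elim: k f g => [|k ih] f g.
  by move=> cf cg x; exact: (cvgD (cf x) (cg x)).
move=> /C_kSP[df hf] /C_kSP[dg hg]; apply/C_kSP; split.
  by move=> x; apply: differentiableD.
move=> i; rewrite (_ : (fun x => _) = (fun x => 'D_(basis_vec i) f x + 'D_(basis_vec i) g x)).
  exact: ih.
by apply/funext => x; rewrite deriveD//; apply: diff_derivable.
Qed.

Lemma C_kM k f g : C_k k f -> C_k k g -> C_k k (fun x => f x * g x).
Proof.
elim: k f g => [|k ih] f g.
  by move=> cf cg x; exact: (cvgM (cf x) (cg x)).
move=> /[dup] Cf /C_kSP[df hf] /[dup] Cg /C_kSP[dg hg]; apply/C_kSP; split.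
  by move=> x; apply: differentiableM.
move=> i; rewrite (_ : (fun x => _) = (fun x => f x * 'D_(basis_vec i) g x + g x * 'D_(basis_vec i) f x)).
  by apply: C_kD; apply: ih => //; exact: C_kW.
by apply/funext => x; rewrite deriveM//; apply: diff_derivable.
Qed.

Lemma C_k_cst k (a : K) : C_k k (fun _ : V => a).
Proof.
elim: k a => [|k ih] a; first exact: cst_continuous.
apply/C_kSP; split; first by move=> x; exact: differentiable_cst.
move=> i; rewrite (_ : 'D_(basis_vec i) _ = (fun _ => 0)); first exact: ih.
by apply/funext => x; rewrite derive_cst.
Qed.

(** The sequence h lists the successive derivatives of h 0, so each differentiation only shifts the
    index m; hence the conclusion for all m at once. *)
Lemma C_k_coord k (h : nat -> K -> K) (s a : K) (i : 'I_n) :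
  (forall m t, is_derive (t : K) (1 : K) (h m) (h m.+1 t)) ->
  forall m, C_k k (fun x : V => h m (s * x i 0 + a)).
Proof.
move=> dh.
pose l (x : V) : K := s * x i 0 + a.
have dl x : differentiable l x.
  apply: differentiableD => //; apply: differentiableM => //.
  exact: differentiable_coord.
have dhm m t : differentiable (h m : K -> K) t.
  by apply/derivable1_diffP; case: (dh m t).
have dhl m x : differentiable (fun x : V => h m (s * x i 0 + a)) x.
  exact: (@differentiable_comp _ _ _ _ l (h m) x (dl x) (dhm m _)).
elim: k => [|k ih] m.
  by move=> x; apply: differentiable_continuous.
apply/C_kSP; split; first exact: dhl.
move=> j.
rewrite (_ : (fun x => _) = (fun x : V => (s * (basis_vec j : V) i 0) * h m.+1 (s * x i 0 + a))).
  by apply: C_kM => //; exact: C_k_cst.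
apply/funext => x; rewrite deriveE//.
rewrite (_ : (fun x : V => h m (s * x i 0 + a)) = h m \o l)//.
rewrite diff_comp//= diff1E//.
have -> : 'd l x (basis_vec j) = s * (basis_vec j : V) i 0.
  rewrite -deriveE//; apply: lim_near_cst => //; near=> t.
  have t0 : t != 0 by near: t; exact: nbhs_dnbhs_neq.
  have -> : (l \o shift x) (t *: basis_vec j) - l x = t * (s * (basis_vec j : V) i 0).
    by rewrite /basis_vec /l /= !mxE; ring.
  by rewrite /GRing.scale /= mulKf.
rewrite /= derive1E; case: (dh m (l x)) => _ ->.
by rewrite /GRing.scale/=.
Unshelve. all: by end_near. Qed.

Lemma C_k_prod (I : Type) k (r : seq I) (F : I -> V -> K) :
  (forall i, C_k k (F i)) -> C_k k (fun x => \prod_(i <- r) F i x).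
Proof.
move=> hF; elim: r => [|j r ih].
  by under eq_fun do rewrite big_nil; exact: C_k_cst.
by under eq_fun do rewrite big_cons; exact: C_kM.
Qed.

End smooth.

Section box_bump.
Context {K : realType} {n : nat}.
Local Notation V := 'cV[K]_n.
Variables (a b : 'I_n -> K).

Definition box : set V := [set x | forall i, a i < x i 0 < b i].

Definition box_bump (c : K) (x : V) : K :=
  \prod_(i < n) (flat c 1 (x i 0 - a i) * flat c 1 (b i - x i 0)).

Lemma box_bump_ge0 c x : 0 < c -> 0 <= box_bump c x.
Proof.
by move=> c0; apply: prodr_ge0 => i _; apply: mulr_ge0; exact: flat1_ge0.
Qed.

Lemma box_bump_le1 c x : 0 < c -> box_bump c x <= 1.
Proof.
move=> c0; apply: prodr_ile1 => i _; apply/andP; split.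
  by apply: mulr_ge0; exact: flat1_ge0.
by apply: mulr_ile1; rewrite ?flat1_ge0 ?flat1_le1.
Qed.

Lemma box_bump_out c x : ~ box x -> box_bump c x = 0.
Proof.
move=> /existsNP[i /negP hi]; rewrite /box_bump (bigD1 i)//=.
suff -> : flat c 1 (x i 0 - a i) * flat c 1 (b i - x i 0) = 0 by rewrite mul0r.
move: hi; rewrite negb_and => /orP[hi|hi]; rewrite /flat !subr_gt0 (negbTE hi).
  by rewrite mul0r.
by rewrite mulr0.
Qed.

Lemma box_bump_cvg x : box_bump (k.+1%:R^-1) x @[k --> \oo] --> (\1_box x : K).
Proof.
rewrite indicE; have [bx|nbx] := pselect (box x); last first.
  rewrite memNset//; under eq_fun do rewrite box_bump_out//; exact: cvg_cst.
rewrite mem_set//= (_ : true%:R = \prod_(i < n) (1 * 1 : K)); last first.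
  by rewrite big1// => i _; rewrite mulr1.
have cv (s : K) : 0 < s -> flat (k.+1%:R^-1) 1 s @[k --> \oo] --> (1 : K).
  move=> s0; rewrite /flat s0; under eq_fun do rewrite hornerE mul1r -mulNr.
  have h : (- k.+1%:R^-1 / s) @[k --> \oo] --> (- 0 * s^-1 : K).
    apply: cvgM; last exact: cvg_cst.
    by apply: cvgN; exact: cvg_harmonic.
  rewrite oppr0 mul0r in h.
  by have := cvg_comp _ _ h (@continuous_expR K 0); rewrite expR0.
apply: cvg_big => [|i _]; first exact: mul_continuous.
have /andP[h1 h2] := bx i.
by apply: cvgM; apply: cv; rewrite subr_gt0.
Qed.

Lemma test_function_box_bump c : 0 < c -> test_function (box_bump c).
Proof.
move=> c0; split.
  move=> k; apply: C_k_prod => i; apply: C_kM.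
    rewrite (_ : (fun x : V => _) = (fun x : V => flat c (iter 0 (dflat c) 1) (1 * x i 0 + - a i))).
      apply: (C_k_coord k (h := fun m => flat c (iter m (dflat c) 1))) => m t.
      by rewrite iterS; exact: is_derive_flat.
    by apply/funext => x; rewrite mul1r.
  rewrite (_ : (fun x : V => _) = (fun x : V => flat c (iter 0 (dflat c) 1) (-1 * x i 0 + b i))).
    apply: (C_k_coord k (h := fun m => flat c (iter m (dflat c) 1))) => m t.
    by rewrite iterS; exact: is_derive_flat.
  by apply/funext => x; rewrite mulN1r addrC.
pose C := \sum_i (`|a i| + `|b i|).
exists [set x : V | forall i, a i <= x i 0 <= b i]; split.
  apply: (@compact_colV _ _ _ C).
    rewrite (_ : mkset _ = \bigcap_(i in [set: 'I_n])
        ((fun x : V => x i 0) @^-1` `[a i, b i]%classic)); last first.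
      apply/seteqP; split => x /= h i => [_|]; first by rewrite /= in_itv/= h.
      by have := h i I; rewrite /= in_itv.
    apply: closed_bigI => i _; apply: closed_comp; last exact: itv_closed.
    by move=> x _; exact: coord_continuous.
  move=> x hx; apply: mx_norm_le.
    by apply: sumr_ge0 => i _; rewrite addr_ge0.
  move=> i j; rewrite (ord1 j); have /andP[h1 h2] := hx i.
  rewrite /C (bigD1 i)//= ler_wpDr//.
    by apply: sumr_ge0 => k _; rewrite addr_ge0.
  rewrite ler_norml; apply/andP; split.
    rewrite (le_trans _ h1)// lerNl (le_trans (ler_norm _))// normrN lerDl//.
  by rewrite (le_trans h2)// (le_trans (ler_norm _))// lerDr.
move=> x nx; apply: box_bump_out => bx; apply: nx => i.
by have /andP[h1 h2] := bx i; rewrite !ltW.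
Qed.

End box_bump.

(** * Gaussian measures *)

Section gaussian_measures.
Context {K : realType}.
Local Notation V n := 'cV[K]_n.
Local Notation leb := (lebesgueV K).

Lemma dotp_consv n (s : K) (y : V n) :
  dotp (consv (s, y)) (consv (s, y)) = s ^+ 2 + dotp y y.
Proof.
rewrite !dotpE big_ord_recl !mxE unlift_none /= expr2; congr (_ + _).
by apply: eq_bigr => i _; rewrite !mxE liftK.
Qed.

Lemma measurable_expquad d (T : measurableType d) n (e : K) (J : 'M[K]_n) (f : T -> V n) :
  measurable_fun setT f -> measurable_fun setT (fun x => expR (e * dotp (f x) (J *m f x))).
Proof.
move=> mf; apply: measurableT_comp; first exact: measurable_expR.
by apply: measurable_funM => //; exact: measurable_quad.
Qed.

Lemma measurable_expsq d (T : measurableType d) n (e : K) (f : T -> V n) :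
  measurable_fun setT f -> measurable_fun setT (fun x => expR (e * dotp (f x) (f x))).
Proof.
move=> mf; apply: measurableT_comp; first exact: measurable_expR.
by apply: measurable_funM => //; exact: measurable_dotp.
Qed.

Lemma integral_gauss1D (e : K) : 0 < e ->
  (\int[@lebesgue_measure K]_s (expR (- e * s ^+ 2))%:E < +oo)%E.
Proof.
move=> e0; have se : 0 < Num.sqrt e by rewrite sqrtr_gt0.
have := @ge0_integral_affine K (Num.sqrt e) 0 (EFin \o @gauss_fun K) se _ _.
have -> : (fun x => (EFin \o @gauss_fun K) (Num.sqrt e * x + 0)) = (fun s => (expR (- e * s ^+ 2))%:E).
  apply/funext => s /=; rewrite /gauss_fun addr0 exprMn sqr_sqrtr ?mulNr//.
  exact: ltW.
move=> ->.
- have /integrableP[_] := @integrableT_gauss K.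
  under eq_integral do rewrite gee0_abs ?lee_fin ?gauss_fun_ge0//.
  move=> h; rewrite lte_mul_pinfty// ?lee_fin ?invr_ge0 ?ltW//.
- by apply/measurable_EFinP; exact: measurable_gauss_fun.
- by move=> x; rewrite lee_fin gauss_fun_ge0.
Qed.

Lemma integral_exp_sq n (e : K) : 0 < e ->
  (\int[leb n]_x (expR (- e * dotp x x))%:E < +oo)%E.
Proof.
move=> e0; elim: n => [|n ih].
  rewrite /= integral_dirac//; last first.
    by apply/measurable_EFinP; exact: measurable_expsq.
  by rewrite diracT mul1e ltry.
have mE m : measurable_fun setT (fun x : V m => (expR (- e * dotp x x))%:E).
  by apply/measurable_EFinP; exact: measurable_expsq.
rewrite integral_lebesgueVS//.
have -> : (fun s => \int[leb n]_y (expR (- e * dotp (consv (s, y)) (consv (s, y))))%:E)%E =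
  (fun s => (expR (- e * s ^+ 2))%:E * \int[leb n]_y (expR (- e * dotp y y))%:E)%E.
  apply/funext => s; rewrite -ge0_integralZl//.
  by apply: eq_integral => y _; rewrite dotp_consv mulrDr expRD.
rewrite ge0_integralZr//; last 2 first.
- apply/measurable_EFinP; apply: measurableT_comp; first exact: measurable_expR.
  by apply: measurable_funM => //; exact: exprn_measurable.
- by apply: integral_ge0 => x _; rewrite lee_fin expR_ge0.
have h1 := integral_gauss1D e0.
rewrite ltey_eq fin_numM// ge0_fin_numE//; apply: integral_ge0 => x _; rewrite lee_fin expR_ge0//.
Qed.

Lemma positive_integral_gt0 d (T : measurableType d) (m : {measure set T -> \bar K})
    (p : T -> K) : (0 < m setT)%E -> measurable_fun setT p -> (forall x, 0 < p x) ->
  (0 < \int[m]_x (p x)%:E)%E.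
Proof.
move=> mT mp p0; rewrite lt0e; apply/andP; split; last first.
  by apply: integral_ge0 => x _; rewrite lee_fin ltW.
apply/eqP => h.
have /(ae_eq_integral_abs _ measurableT) : (\int[m]_x `|(p x)%:E| = 0)%E.
  by under eq_integral do rewrite gee0_abs ?lee_fin ?(ltW (p0 _))//.
move=> /(_ ltac:(exact/measurable_EFinP)) [A [mA A0 sA]].
have : (m setT <= m A)%E.
  apply: le_measure; rewrite ?inE// => x _; apply: sA => /= /(_ I) /eqP.
  by rewrite eqe gt_eqF.
by rewrite A0 leNgt mT.
Qed.

Lemma lebesgueV_setT_gt0 n : (0 < leb n setT)%E.
Proof.
pose B := [set x : V n | forall i, (`[0, 1]%classic : set K) (x i 0)].
have h : leb n B = 1%E.
  rewrite (@lebesgueV_box K n (fun=> `[0, 1]%classic)) => [|i]; last exact: measurable_itv.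
  by rewrite big1// => i _; rewrite lebesgue_measure_itv/= lte_fin ltr01 oppr0 adde0.
apply: (@lt_le_trans _ _ 1%E) => //; rewrite -h; apply: le_measure => //; rewrite inE//.
rewrite (_ : B = \bigcap_(i in [set: 'I_n])
      ((fun x : 'cV[K]_n => x i 0) @^-1` `[0, 1]%classic)); last first.
  by apply/seteqP; split=> x xE; [move=> i _|move=> i]; exact: xE.
apply: fin_bigcap_measurable => [|i _]; first exact: finite_finset.
by rewrite -[X in measurable X]setTI; apply: measurable_coord.
Qed.

(** The normalizing constant is existential: its value never matters below, and no determinant has
    to be computed. *)
Definition gaussian n (S : 'M[K]_n) (N : probability (V n) K) : Prop :=
  exists2 c : K, 0 < c & forall E, measurable E ->
    N E = (\int[leb n]_(x in E) (c * expR (- 2^-1 * dotp x (invmx S *m x)))%:E)%E.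

Lemma measurable_gauss_density n (c : K) (J : 'M[K]_n) :
  measurable_fun setT (fun x : V n => c * expR (- 2^-1 * dotp x (J *m x))).
Proof. by apply: measurable_funM => //; exact: measurable_expquad. Qed.

Lemma ex_gaussian n (S : 'M[K]_n) : posdef S -> exists N, gaussian S N.
Proof.
move=> hS; have [e e0 hJ] := posdef_lower (posdef_inv hS).
set J := invmx S in hJ *.
pose q (x : V n) := expR (- 2^-1 * dotp x (J *m x)).
have mq : measurable_fun setT q by exact: measurable_expquad.
have qfin : (\int[leb n]_x (q x)%:E < +oo)%E.
  apply: le_lt_trans (integral_exp_sq n (divr_gt0 e0 (ltr0n _ 2))).
  apply: ge0_le_integral => //.
  - by move=> x _; rewrite lee_fin expR_ge0.
  - exact/measurable_EFinP.
  - by apply/measurable_EFinP; exact: measurable_expsq.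
  - move=> x _; rewrite lee_fin ler_expR; have := hJ x; lra.
have q0 : (0 < \int[leb n]_x (q x)%:E)%E.
  by apply: (positive_integral_gt0 (@lebesgueV_setT_gt0 n)) => // x; exact: expR_gt0.
have [Z Z0 ZE] : exists2 Z : K, 0 < Z & (\int[leb n]_x (q x)%:E)%E = Z%:E.
  move: q0 qfin; case: (\int[_]_x _)%E => [z|//|//] z0 _.
  by exists z => //; rewrite -lte_fin.
have c0 : 0 < Z^-1 by rewrite invr_gt0.
have mp := measurable_gauss_density Z^-1 J.
have [N NE] := @ex_density_probability K _ (V n) (leb n) (fun x => (Z^-1 * q x)%:E)
  ltac:(by move=> x; rewrite lee_fin mulr_ge0 ?expR_ge0// ltW)
  ltac:(exact/measurable_EFinP)
  ltac:(by under eq_integral do rewrite EFinM; rewrite ge0_integralZl//;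
   [rewrite ZE -EFinM mulVf ?gt_eqF|exact/measurable_EFinP|
    move=> x _; rewrite lee_fin expR_ge0|rewrite lee_fin ltW]).
by exists N, Z^-1.
Qed.

Lemma gaussian_integral n (S : 'M[K]_n) N : gaussian S N ->
  exists2 c : K, 0 < c & forall g, measurable_fun setT g ->
    (\int[N]_x g x = \int[leb n]_x (g x * (c * expR (- 2^-1 * dotp x (invmx S *m x)))%:E))%E.
Proof.
move=> [c c0 NE]; exists c => // g mg.
apply: density_integral => //; last exact: measurable_gauss_density.
by move=> x; rewrite mulr_ge0 ?expR_ge0// ltW.
Qed.

(** The constant is the inverse of a square root, hence nonnegative; it cannot be 0, since the total
    mass would then be 0 instead of 1. This replaces a proof that the determinant is positive. *)
Lemma centered_gaussianE n (S : 'M[K]_n) (N : probability (V n) K) :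
  centered_gaussian S N -> gaussian S N.
Proof.
move=> hN; set Z := Num.sqrt ((2 * pi) ^+ n * \det S).
have NE E : measurable E -> N E = (\int[leb n]_(x in E) (Z^-1 * expR (- 2^-1 * dotp x (invmx S *m x)))%:E)%E.
  move=> mE; rewrite hN//; apply: eq_integral => x _; congr EFin.
  by rewrite /gauss_pdf quadE mulrC; congr (_ * expR _); ring.
have Z0 : 0 <= Z^-1 by rewrite invr_ge0 sqrtr_ge0.
exists Z^-1 => //; rewrite lt_neqAle Z0 andbT; apply/eqP => h.
have := NE setT measurableT; rewrite probability_setT -h.
under eq_integral do rewrite mul0r.
by rewrite integral0 => /eqP; rewrite onee_eq0.
Qed.

(** Translating the Lebesgue integral by S w completes the square: the linear exponent is absorbed
    and leaves the constant w'Sw / 2. *)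
Lemma gaussian_tilt n (S : 'M[K]_n) N (w : V n) (g : V n -> K) : posdef S -> gaussian S N ->
  measurable_fun setT g -> (forall x, `|g x| <= 1) ->
  (\int[N]_x (g x * expR (dotp w x))%:E =
   (expR (dotp w (S *m w) / 2))%:E * \int[N]_x (g (x + S *m w))%:E)%E.
Proof.
move=> hS hN mg g1; have uS := posdef_unit hS; have /posdefP[sS _] := hS.
have [c c0 NE] := gaussian_integral hN.
have mgt : measurable_fun setT (fun x : V n => g (x + S *m w)).
  by apply: measurableT_comp => //; exact: measurable_translateV.
rewrite -integralZl//; last exact: (bounded_integrable N mgt (fun x => g1 _)).
have mw : measurable_fun setT (fun x : V n => expR (dotp w x)).
  by apply: measurableT_comp; [exact: measurable_expR|exact: measurable_dotp].
rewrite NE; last by apply/measurable_EFinP; exact: measurable_funM.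
rewrite NE; last by apply/measurable_EFinP; exact: measurable_funM.
rewrite -(integral_translateV (S *m w)); last first.
  apply/measurable_EFinP; apply: measurable_funM; first exact: measurable_funM.
  exact: measurable_gauss_density.
apply: eq_integral => x _; rewrite -!EFinM; congr EFin.
rewrite mulrACA (mulrC _ (g _)) [RHS]mulrACA; congr (_ * _).
rewrite -!expRD; congr expR.
rewrite mulmxDr mulmxA (mulVmx uS) mul1mx !dotpDr !dotpDl.
rewrite (dotpC (S *m w) w) (dotpC x w).
have -> : dotp (S *m w) (invmx S *m x) = dotp w x.
  by rewrite dotp_mulmx trmx_inv sS mulmxA (mulVmx uS) mul1mx.
by field.
Qed.

Lemma gaussian_cf n (S : 'M[K]_n) N (u : V n) : posdef S -> gaussian S N ->
  (\int[N]_x cos (dotp u x) = expR (- (dotp u (S *m u)) / 2))%R /\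
  (\int[N]_x sin (dotp u x) = 0)%R.
Proof.
move=> hS hN.
have mY : measurable_fun setT (fun x : V n => dotp u x) by exact: measurable_dotp.
have := @gauss_cf_ode K _ (V n) N (dotp u) (dotp u (S *m u)) mY _ 1.
rewrite expr1n mul1r => h.
case: h => [a psi mpsi psi1|].
  have := @gaussian_tilt n S N (a *: u) (psi \o dotp u) hS hN _ _.
  under eq_integral do rewrite dotpZl.
  move=> ->.
  - rewrite -scalemxAr dotpZl dotpZr mulrA -expr2.
    by under eq_integral do rewrite /= dotpDr dotpZr.
  - exact: measurableT_comp.
  - by move=> x; exact: psi1.
under eq_Rintegral do rewrite mul1r.
by move=> hC; under eq_Rintegral do rewrite mul1r.
Qed.

End gaussian_measures.

(** * Uniqueness of characteristic functions *)

Section boxes.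
Context {K : realType} {n : nat}.
Local Notation V := 'cV[K]_n.

Lemma open_measurableV (U : set V) : open U -> measurable U.
Proof. by move=> oU; exact: sub_sigma_algebra. Qed.

Lemma measurable_box (a b : 'I_n -> K) : measurable (box a b).
Proof.
rewrite (_ : box a b = \bigcap_(i in [set: 'I_n])
      ((fun x : V => x i 0) @^-1` `]a i, b i[%classic)); last first.
  apply/seteqP; split=> x xE i => [_|]; first by rewrite /= in_itv/= xE.
  by have := xE i I; rewrite /= in_itv/=.
apply: fin_bigcap_measurable => [|i _]; first exact: finite_finset.
by rewrite -[X in measurable X]setTI; apply: measurable_coord.
Qed.

Definition boxes : set (set V) := [set A | exists a b, A = box a b].

Lemma boxes_setI : setI_closed boxes.
Proof.
move=> _ _ [a1 [b1 ->]] [a2 [b2 ->]].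
exists (fun i => Num.max (a1 i) (a2 i)), (fun i => Num.min (b1 i) (b2 i)).
apply/seteqP; split => x.
  move=> [h1 h2] i; rewrite gt_max lt_min.
  by have /andP[-> ->] := h1 i; have /andP[-> ->] := h2 i.
by move=> h; split => i; have := h i; rewrite gt_max lt_min => /andP[/andP[h1 h2] /andP[h3 h4]]; apply/andP.
Qed.

Lemma boxes_cover : \bigcup_(k : nat) box (fun=> - k%:R) (fun=> k%:R) = [set: V].
Proof.
apply/seteqP; split => // x _.
have [k hk] : exists k : nat, `|x| < k%:R.
  by exists (Num.truncn `|x|).+1; rewrite truncnS_gt.
exists k => // i; rewrite -ltr_norml; apply: le_lt_trans hk.
exact: mx_norm_coord.
Qed.

Lemma measurable_boxes : @measurable _ V = <<s boxes >>.
Proof.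
apply/seteqP; split; last first.
  apply: smallest_sub; first exact: sigma_algebra_measurable.
  by move=> _ [a [b ->]]; exact: measurable_box.
pose T := g_sigma_algebraType boxes.
have midf : measurable_fun [set: T] (id : T -> V).
  apply: measurable_fun_mx => i j; rewrite (ord1 j).
  apply: (measurability _ (measurable_realfun.RGenOpens.measurableE K)).
  move=> _ [_ [a [b ->]] <-]; rewrite setTI.
  rewrite (_ : _ @^-1` _ = \bigcup_(k : nat)
     box (fun l => if l == i then a else - k%:R) (fun l => if l == i then b else k%:R)).
    by apply: bigcup_measurable => k _; apply: sub_sigma_algebra; eexists; eexists.
  apply/seteqP; split => x /=; rewrite in_itv/=.
    move=> xab.
    have [k hk] : exists k : nat, `|x| < k%:R.
      by exists (Num.truncn `|x|).+1; rewrite truncnS_gt.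
    exists k => // l; case: eqP => [->//|_].
    by rewrite -ltr_norml; apply: le_lt_trans hk; exact: mx_norm_coord.
  by move=> [k _ /(_ i)]; rewrite eqxx.
by move=> A mA; have := midf measurableT A mA; rewrite setTI.
Qed.

Lemma measure_unique_boxes (m1 m2 : {measure set V -> \bar K}) :
  (forall a b, m1 (box a b) = m2 (box a b)) ->
  (forall a b, (m1 (box a b) < +oo)%E) ->
  forall A, measurable A -> m1 A = m2 A.
Proof.
move=> h hf; apply: (measure_unique boxes (fun k : nat => box (fun=> - k%:R) (fun=> k%:R))).
- exact: measurable_boxes.
- exact: boxes_setI.
- by move=> k; eexists; eexists.
- exact: boxes_cover.
- by move=> _ [a [b ->]].
- by move=> k.
Qed.

End boxes.

(** * Gaussian regularization and inversion of characteristic functions *)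

Section cf_uniqueness.
Context {K : realType}.
Local Notation V n := 'cV[K]_n.
Local Notation leb := (lebesgueV K).

Lemma bounded_integrable2 d1 d2 (T1 : measurableType d1) (T2 : measurableType d2)
  (P : probability T1 K) (Q : probability T2 K) (f : T1 * T2 -> K) (C : K) :
  measurable_fun setT f -> (forall x, `|f x| <= C) ->
  (P \x Q)%E.-integrable setT (EFin \o f).
Proof.
move=> mf fC; apply/integrable12ltyP; first exact/measurable_EFinP.
apply: (@le_lt_trans _ _ (\int[P]_x \int[Q]_y C%:E)%E); last first.
  under eq_integral do rewrite probability_integral_cst.
  by rewrite probability_integral_cst ltry.
have mfE : measurable_fun setT (fun z => `|(EFin \o f) z|%E).
  by apply: measurableT_comp => //; exact/measurable_EFinP.
apply: ge0_le_integral => //.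
- by move=> x _; apply: integral_ge0.
- apply: (measurable_fun_fubini_tonelli_F (m2 := Q) (abse \o (EFin \o f))) => // z.
  exact: abse_ge0.
- move=> x _; apply: ge0_le_integral => //.
  + by apply: (measurableT_comp mfE); exact: measurable_pair1.
  + by move=> y _; rewrite lee_fin (le_trans _ (fC (x, y))).
Qed.

Lemma Rintegral_EFin d (T : measurableType d) (P : {measure set T -> \bar K}) (f : T -> K) :
  P.-integrable setT (EFin \o f) -> (\int[P]_x (f x)%:E)%E = (\int[P]_x f x)%:E.
Proof. by move=> h; rewrite /Rintegral fineK//; exact: integrable_fin_num. Qed.

Lemma Rintegral_bounded d (T : measurableType d) (P : probability T K) (f : T -> K) C :
  measurable_fun setT f -> (forall x, `|f x| <= C) -> `|\int[P]_x f x|%R <= C.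
Proof.
move=> mf fC; have fi := bounded_integrable P mf fC.
apply: (le_trans (le_normr_Rintegral measurableT fi)).
rewrite -[leRHS](_ : \int[P]_x C = C)%R; last first.
  by rewrite /Rintegral probability_integral_cst.
apply: le_Rintegral => //; first exact: integrable_norm.
by apply: (@bounded_integrable _ _ _ _ (cst C) `|C|).
Qed.

(** Adding C makes f nonnegative, so that Tonelli's theorem gives the measurability; the constant is
    subtracted afterwards. *)
Lemma measurable_Rintegral_fst d1 d2 (T1 : measurableType d1) (T2 : measurableType d2)
  (Q : probability T2 K) (f : T1 * T2 -> K) C :
  measurable_fun setT f -> (forall x, `|f x| <= C) ->
  measurable_fun setT (fun x => \int[Q]_y f (x, y))%R.
Proof.
move=> mf fC.
have mfx x : measurable_fun setT (fun y => f (x, y)).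
  by apply: (measurableT_comp mf); exact: measurable_pair1.
have mC : measurable_fun setT (fun z => (f z + C)%:E).
  by apply/measurable_EFinP; exact: measurable_funD.
have h : measurable_fun setT (fun x => \int[Q]_y (f (x, y) + C)%:E)%E.
  apply: (measurable_fun_fubini_tonelli_F (m2 := Q) (fun z => (f z + C)%:E)) => //.
  by move=> z; rewrite lee_fin -lerBlDr sub0r; have := fC z; rewrite ler_norml => /andP[].
have -> : (fun x => \int[Q]_y f (x, y))%R = (fun x => fine (\int[Q]_y (f (x, y) + C)%:E)%E - C).
  apply/funext => x.
  under [in RHS]eq_integral do rewrite EFinD.
  rewrite integralD//=; last 2 first.
  - exact: (bounded_integrable Q (mfx x) (fun y => fC (x, y))).
  - exact: (@bounded_integrable _ _ _ _ (cst C) `|C|).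
  rewrite probability_integral_cst fineD//; first by rewrite /= addrK.
  apply: integrable_fin_num => //.
  exact: (bounded_integrable Q (mfx x) (fun y => fC (x, y))).
apply: measurable_funB => //; apply/measurable_EFinP.
apply: (eq_measurable_fun _ _ h) => x _ /=.
rewrite fineK//.
have := @bounded_integrable _ _ _ Q (fun y => f (x, y) + C) (C + `|C|).
move=> hh; apply: (integrable_fin_num measurableT); apply: hh.
  exact: measurable_funD.
by move=> y; rewrite (le_trans (ler_normD _ _))// lerD2r.
Qed.

Lemma bounded_cvg2 d1 d2 (T1 : measurableType d1) (T2 : measurableType d2)
  (P : probability T1 K) (Q : probability T2 K) (f_ : nat -> T1 * T2 -> K) (f : T1 * T2 -> K) C :
  (forall n, measurable_fun setT (f_ n)) -> (forall n z, `|f_ n z| <= C) ->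
  (forall z, f_ n z @[n --> \oo] --> f z) ->
  (\int[P]_x \int[Q]_y (f_ n (x, y))%:E)%E @[n --> \oo] -->
  (\int[P]_x \int[Q]_y (f (x, y))%:E)%E.
Proof.
move=> mf fC cf.
have mlim : measurable_fun setT f.
  by apply: (measurable_fun_cvg mf) => x _; exact: cf.
have fC' z : `|f z| <= C.
  have h : `|f_ n z| @[n --> \oo] --> `|f z| by apply: cvg_norm; exact: cf.
  rewrite -(cvg_lim _ h)//; apply: limr_le; first by apply/cvg_ex; exists `|f z|.
  by apply: nearW => k; exact: fC.
have E (g : T1 * T2 -> K) : measurable_fun setT g -> (forall z, `|g z| <= C) ->
    (\int[P]_x \int[Q]_y (g (x, y))%:E = \int[P]_x (\int[Q]_y g (x, y))%:E)%E.
  move=> mg gC; apply: eq_integral => x _; rewrite -Rintegral_EFin//.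
  apply: (bounded_integrable _ (C := C)) => [|y]; last exact: gC.
  by apply: (measurableT_comp mg); exact: measurable_pair1.
rewrite E//; under eq_fun do rewrite E//.
have := @bounded_cvg _ _ _ P (fun n x => \int[Q]_y f_ n (x, y))%R (fun x => \int[Q]_y f (x, y))%R C.
apply.
- by move=> n; exact: (measurable_Rintegral_fst Q (mf n) (fC n)).
- move=> n x; apply: Rintegral_bounded => [|y]; last exact: fC.
  by apply: (measurableT_comp (mf n)); exact: measurable_pair1.
- move=> x; apply: fine_cvg; rewrite -Rintegral_EFin; last first.
    apply: (bounded_integrable _ (C := C)) => [|y]; last exact: fC'.
    by apply: (measurableT_comp mlim); exact: measurable_pair1.
  have := @bounded_cvg _ _ _ Q (fun n y => f_ n (x, y)) (fun y => f (x, y)) C; apply => //.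
  by move=> n; apply: (measurableT_comp (mf n)); exact: measurable_pair1.
Qed.

Let mcos : measurable_fun setT (@cos K).
Proof. by apply: continuous_measurable_fun; exact: continuous_cos. Qed.
Let msin : measurable_fun setT (@sin K).
Proof. by apply: continuous_measurable_fun; exact: continuous_sin. Qed.

Section kernel.
Variables (n : nat) (N : probability (V n) K).
Hypothesis hN : gaussian 1%:M N.

Let Ncos z : (\int[N]_u (cos (dotp u z))%:E)%E = (expR (- (dotp z z) / 2))%:E.
Proof.
have [h _] := gaussian_cf z (@posdef1 K n) hN.
rewrite mul1mx in h; rewrite -h -Rintegral_EFin.
  by apply: eq_integral => u _; rewrite dotpC.
apply: (bounded_integrable _ (C := 1)); last by move=> u; exact: cos_max.
by apply: (measurableT_comp mcos); exact: measurable_dotp.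
Qed.

Definition cf_eq (mu nu : probability (V n) K) := forall u,
  (\int[mu]_x cos (dotp u x) = \int[nu]_x cos (dotp u x))%R /\
  (\int[mu]_x sin (dotp u x) = \int[nu]_x sin (dotp u x))%R.

Variables (mu nu : probability (V n) K).
Hypothesis munu : cf_eq mu nu.

Let gk (e : K) (a x : V n) := expR (- (dotp (e *: (x - a)) (e *: (x - a))) / 2).

(** A Gaussian function is its own Fourier transform: [gk e a x] is the mean of cos (u . e (x - a))
    over the standard Gaussian u. Fubini's theorem then expresses its integral against m through the
    characteristic function of m alone. *)
Let kernelE (m : probability (V n) K) e a :
  (\int[m]_x (gk e a x)%:E =
   \int[N]_u ((cos (dotp (e *: u) a) * \int[m]_x cos (dotp (e *: u) x) +
               sin (dotp (e *: u) a) * \int[m]_x sin (dotp (e *: u) x))%R)%:E)%E.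
Proof.
have mf : measurable_fun setT (fun z : V n * V n => cos (dotp z.2 (e *: (z.1 - a)))).
  apply: (measurableT_comp mcos); apply: measurable_dotp => //.
  by apply: measurable_scalemx => //; apply: measurable_addmx.
have ib := bounded_integrable2 m N mf (fun z => cos_max _).
transitivity (\int[m]_x \int[N]_u (cos (dotp u (e *: (x - a))))%:E)%E.
  by apply: eq_integral => x _; rewrite Ncos.
rewrite (Fubini ib); apply: eq_integral => u _ /=.
rewrite -!RintegralZl//; last 2 first.
- apply: (bounded_integrable _ (C := 1)) => [|x]; last exact: sin_max.
  by apply: (measurableT_comp msin); exact: measurable_dotp.
- apply: (bounded_integrable _ (C := 1)) => [|x]; last exact: cos_max.
  by apply: (measurableT_comp mcos); exact: measurable_dotp.
have iz (c : K) (f : V n -> K) : m.-integrable setT (EFin \o f) ->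
    m.-integrable setT (EFin \o (fun x => c * f x)).
  by move=> h; exact: (integrableZl measurableT c h).
have ic (c : K) : m.-integrable setT (EFin \o (fun x : V n => c * cos (dotp (e *: u) x))).
  apply: iz; apply: (bounded_integrable _ (C := 1)) => [|x]; last exact: cos_max.
  by apply: (measurableT_comp mcos); exact: measurable_dotp.
have is_ (c : K) : m.-integrable setT (EFin \o (fun x : V n => c * sin (dotp (e *: u) x))).
  apply: iz; apply: (bounded_integrable _ (C := 1)) => [|x]; last exact: sin_max.
  by apply: (measurableT_comp msin); exact: measurable_dotp.
rewrite -RintegralD// -Rintegral_EFin.
  apply: eq_integral => x _; congr EFin.
  rewrite scalerBr dotpBr cosB !dotpZr !dotpZl; ring.
exact: (integrableD measurableT (ic _) (is_ _)).
Qed.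

Let kernel_eq e a : (\int[mu]_x (gk e a x)%:E = \int[nu]_x (gk e a x)%:E)%E.
Proof.
rewrite !kernelE; apply: eq_integral => u _.
by have [-> ->] := munu (e *: u).
Qed.

Let mgk e (d : measure_display) (T : measurableType d) (f g : T -> V n) :
  measurable_fun setT f -> measurable_fun setT g ->
  measurable_fun setT (fun z => gk e (f z) (g z)).
Proof.
move=> mf mg; apply: (measurableT_comp (@measurable_expR K)).
apply: measurable_funM => //; apply: measurableT_comp => //.
by apply: measurable_dotp; apply: measurable_scalemx => //; apply: measurable_addmx => //;
  exact: measurable_oppmx.
Qed.

(** Adding an independent noise e z gives the law a Lebesgue density, an average of Gaussian
    kernels. The constant c is the same for all m, so two laws whose kernel averages agree have
    equal regularizations. *)
Let smooth_eq (e : K) : 0 < e -> exists2 c : K, 0 <= c &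
  forall (m : probability (V n) K) (phi : V n -> K),
  measurable_fun setT phi -> (forall x, 0 <= phi x) ->
  (\int[m]_x \int[N]_z (phi (x + e *: z))%:E =
   \int[leb n]_a ((phi a * c)%:E * \int[m]_x (gk e^-1 a x)%:E))%E.
Proof.
move=> e0; have [c0 c00 NE] := gaussian_integral hN.
have c1 : 0 <= e ^- n * c0 by rewrite mulr_ge0 ?invr_ge0 ?exprn_ge0 ?ltW.
exists (e ^- n * c0) => // m phi mphi phi0.
pose f x a := (phi a * (c0 * gk e^-1 a x))%:E.
have mf2 : measurable_fun setT (fun z : V n * V n => (phi z.2 * (e ^- n * c0))%:E * (gk e^-1 z.2 z.1)%:E)%E.
  apply: emeasurable_funM; last by apply/measurable_EFinP; exact: mgk.
  apply/measurable_EFinP; apply: measurable_funM => //.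
  exact: (measurableT_comp mphi measurable_snd).
have f20 (z : V n * V n) : (0 <= (phi z.2 * (e ^- n * c0))%:E * (gk e^-1 z.2 z.1)%:E)%E.
  by rewrite mule_ge0// lee_fin ?expR_ge0// mulr_ge0.
transitivity (\int[m]_x \int[leb n]_a ((phi a * (e ^- n * c0))%:E * (gk e^-1 a x)%:E))%E.
  apply: eq_integral => x _; rewrite NE; last first.
    apply/measurable_EFinP; apply: (measurableT_comp mphi).
    by apply: measurable_addmx => //; exact: measurable_scalemx.
  transitivity (\int[leb n]_z f x (e *: z + x)%R)%E.
    apply: eq_integral => z _; rewrite /f addrC; congr EFin; congr (_ * (_ * expR _)).
    rewrite (_ : x - (e *: z + x) = - (e *: z)); last by rewrite opprD addrCA subrr addr0.
    rewrite invmx1 mul1mx scalerN scalerA mulVf ?gt_eqF//.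
    by rewrite scale1r dotpNl dotpNr opprK; ring.
  have mfx : measurable_fun setT (f x).
    apply/measurable_EFinP; apply: measurable_funM => //; apply: measurable_funM => //.
    exact: mgk.
  rewrite ge0_integral_affineV//; last first.
    by move=> y; rewrite lee_fin mulr_ge0// mulr_ge0 ?expR_ge0// ltW.
  rewrite -ge0_integralZl//; last 2 first.
  - by move=> y _; rewrite lee_fin mulr_ge0// mulr_ge0 ?expR_ge0// ltW.
  - by rewrite lee_fin invr_ge0 exprn_ge0// ltW.
  apply: eq_integral => y _; rewrite /f -!EFinM; congr EFin; ring.
rewrite (fubini_tonelli (fun z : V n * V n => ((phi z.2 * (e ^- n * c0))%:E * (gk e^-1 z.2 z.1)%:E)%E))//.
apply: eq_integral => a _; rewrite -ge0_integralZl//.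
- by apply/measurable_EFinP; exact: mgk.
- by move=> x _; rewrite lee_fin expR_ge0.
- by rewrite lee_fin mulr_ge0.
Qed.

(** The noise is removed by letting its scale 1 / (k + 1) tend to 0, the bump being bounded and
    continuous. *)
Let bump_eq (a b : 'I_n -> K) (c : K) : 0 < c ->
  (\int[mu]_x (box_bump a b c x)%:E = \int[nu]_x (box_bump a b c x)%:E)%E.
Proof.
move=> c0.
have cb : continuous (box_bump a b c) by have [h _] := test_function_box_bump a b c0; exact: (h 0).
have mb : measurable_fun setT (box_bump a b c) by exact: continuous_measurable_mx.
have b1 x : `|box_bump a b c x| <= 1 by rewrite ger0_norm ?box_bump_ge0 ?box_bump_le1.
have key (m : probability (V n) K) :
    (\int[m]_x \int[N]_z (box_bump a b c (x + k.+1%:R^-1 *: z))%:E)%E @[k --> \oo] -->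
    (\int[m]_x \int[N]_z (box_bump a b c x)%:E)%E.
  have := @bounded_cvg2 _ _ _ _ m N (fun k (z : V n * V n) => box_bump a b c (z.1 + k.+1%:R^-1 *: z.2))
     (fun z : V n * V n => box_bump a b c z.1) 1; apply => //.
  - move=> k; apply: (measurableT_comp mb); apply: measurable_addmx => //.
    exact: measurable_scalemx.
  - move=> z; apply: (cvg_comp (fun k => z.1 + k.+1%:R^-1 *: z.2) (box_bump a b c)); last exact: cb.
    have : z.1 + k.+1%:R^-1 *: z.2 @[k --> \oo] --> z.1 + 0 *: z.2.
      apply: cvgD; first exact: cvg_cst.
      by apply: cvgZ; [exact: cvg_harmonic|exact: cvg_cst].
    by rewrite scale0r addr0.
have E (m : probability (V n) K) : (\int[m]_x (box_bump a b c x)%:E = \int[m]_x \int[N]_z (box_bump a b c x)%:E)%E.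
  by apply: eq_integral => x _; rewrite probability_integral_cst.
rewrite !E -(cvg_lim (@ereal_hausdorff K) (key mu)) -(cvg_lim (@ereal_hausdorff K) (key nu)).
have -> : (fun k : nat => \int[mu]_x \int[N]_z (box_bump a b c (x + k.+1%:R^-1 *: z))%:E)%E =
  (fun k : nat => \int[nu]_x \int[N]_z (box_bump a b c (x + k.+1%:R^-1 *: z))%:E)%E.
  apply/funext => k.
  have k0 : 0 < k.+1%:R^-1 :> K by rewrite invr_gt0.
  have [c1 _ h] := smooth_eq k0.
  rewrite !h//; try (by move=> x; exact: box_bump_ge0).
  by apply: eq_integral => y _; rewrite kernel_eq.
by [].
Qed.

(** As their rate tends to 0 the bumps tend to indicators of open boxes, and boxes determine a
    finite measure. *)
Lemma cf_unique_aux A : measurable A -> mu A = nu A.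
Proof.
move=> mA; apply: measure_unique_boxes => // a b; last first.
  by rewrite (le_lt_trans (probability_le1 mu (measurable_box a b)))// ltry.
have key (m : probability (V n) K) :
    (\int[m]_x (box_bump a b k.+1%:R^-1 x)%:E)%E @[k --> \oo] --> m (box a b).
  rewrite (_ : m (box a b) = \int[m]_x (\1_(box a b) x)%:E)%E; last first.
    by rewrite integral_indic ?setIT//; exact: measurable_box.
  have k0 (k : nat) : 0 < k.+1%:R^-1 :> K by rewrite invr_gt0.
  have := @bounded_cvg _ _ _ m (fun k => box_bump a b k.+1%:R^-1) (\1_(box a b)) 1; apply.
  - move=> k; apply: continuous_measurable_mx.
    by have [h _] := test_function_box_bump a b (k0 k); exact: (h 0).
  - by move=> k x; rewrite ger0_norm ?box_bump_ge0 ?box_bump_le1.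
  - by move=> x; exact: box_bump_cvg.
suff : mu (box a b) = nu (box a b) by [].
rewrite -(cvg_lim (@ereal_hausdorff K) (key mu)) -(cvg_lim (@ereal_hausdorff K) (key nu)).
have -> : (fun k : nat => \int[mu]_x (box_bump a b k.+1%:R^-1 x)%:E)%E =
  (fun k : nat => \int[nu]_x (box_bump a b k.+1%:R^-1 x)%:E)%E.
  by apply/funext => k; apply: bump_eq; rewrite invr_gt0.
by [].
Qed.

End kernel.

Lemma cf_unique n (mu nu : probability (V n) K) : cf_eq mu nu ->
  forall A, measurable A -> mu A = nu A.
Proof.
by move=> h A; have [N hN] := ex_gaussian (@posdef1 K n); exact: (cf_unique_aux hN h).
Qed.

End cf_uniqueness.

(** * Laws and independence *)

Section laws.
Context {K : realType}.

Definition is_law d d' (T : measurableType d) (T' : measurableType d')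
  (L : probability T' K) (P : probability T K) (phi : T -> T') : Prop :=
  forall A, measurable A -> L A = P (phi @^-1` A).

Context d d' (T : measurableType d) (T' : measurableType d').

Lemma ex_law (P : probability T K) (phi : T -> T') : measurable_fun setT phi ->
  exists L : probability T' K, is_law L P phi.
Proof.
move=> mphi; pose X : {mfun T >-> T'} := mfun_Sub (mem_set mphi).
by exists (distribution P X).
Qed.

Lemma ge0_law_integral (L : probability T' K) (P : probability T K) (phi : T -> T')
    (g : T' -> \bar K) : measurable_fun setT phi -> is_law L P phi ->
  measurable_fun setT g -> (forall x, 0 <= g x)%E ->
  (\int[L]_x g x = \int[P]_x g (phi x))%E.
Proof.
move=> mphi hL mg g0; pose X : {mfun T >-> T'} := mfun_Sub (mem_set mphi).
rewrite (eq_measure_integral (distribution P X)); last by move=> A mA _; exact: hL.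
by rewrite (ge0_integral_distribution X).
Qed.

Lemma law_Rintegral (L : probability T' K) (P : probability T K) (phi : T -> T')
    (g : T' -> K) C : measurable_fun setT phi -> is_law L P phi ->
  measurable_fun setT g -> (forall x, `|g x| <= C) ->
  (\int[L]_x g x = \int[P]_x g (phi x))%R.
Proof.
move=> mphi hL mg gC; pose X : {mfun T >-> T'} := mfun_Sub (mem_set mphi).
rewrite /Rintegral; congr fine.
rewrite (eq_measure_integral (distribution P X)); last by move=> A mA _; exact: hL.
rewrite (@integral_distribution _ _ _ _ _ _ X (EFin \o g))//.
  exact/measurable_EFinP.
apply: (bounded_integrable P (f := g \o phi) (C := C)) => [|x]; last exact: gC.
exact: measurableT_comp.
Qed.

End laws.

(** * Independence and products of integrals *)

Section independence.
Context {K : realType}.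

Lemma Rintegral_prod d1 d2 (T1 : measurableType d1) (T2 : measurableType d2)
  (P : probability T1 K) (Q : probability T2 K) (f : T1 * T2 -> K) (C : K) :
  measurable_fun setT f -> (forall x, `|f x| <= C) ->
  (\int[(P \x Q)%E]_z f z = \int[P]_x \int[Q]_y f (x, y))%R.
Proof.
move=> mf fC; have fi := bounded_integrable2 P Q mf fC.
rewrite [LHS]/Rintegral -(integral12_prod_meas1 fi) /Rintegral; congr fine.
apply: eq_integral => x _; rewrite /fubini_F -Rintegral_EFin//.
apply: (bounded_integrable Q (C := C)) => [|y]; last exact: fC.
by apply: (measurableT_comp mf); exact: measurable_pair1.
Qed.

Definition indep d d1 d2 (T : measurableType d) (T1 : measurableType d1)
   (T2 : measurableType d2) (P : probability T K) (X : T -> T1) (Z : T -> T2) :=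
  forall A B, measurable A -> measurable B ->
    P (X @^-1` A `&` Z @^-1` B) = (P (X @^-1` A) * P (Z @^-1` B))%E.

Context d d1 d2 (T : measurableType d) (T1 : measurableType d1)
   (T2 : measurableType d2) (P : probability T K) (X : T -> T1) (Z : T -> T2).
Hypotheses (mX : measurable_fun setT X) (mZ : measurable_fun setT Z).
Hypothesis hXZ : indep P X Z.

(** The joint law agrees with the product of the marginal laws on rectangles, hence everywhere;
    Fubini's theorem then factors the integral. *)
Lemma indep_Rintegral (f : T1 -> K) (h : T2 -> K) C D :
  measurable_fun setT f -> (forall x, `|f x| <= C) ->
  measurable_fun setT h -> (forall x, `|h x| <= D) ->
  (\int[P]_w (f (X w) * h (Z w)) = \int[P]_w f (X w) * \int[P]_w h (Z w))%R.
Proof.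
move=> mf fC mh hD.
have [LX hLX] := ex_law P mX; have [LZ hLZ] := ex_law P mZ.
have mXZ : measurable_fun setT (fun w => (X w, Z w)) by exact: measurable_fun_pair.
have [J hJ] := ex_law P mXZ.
have mF : measurable_fun setT (fun z : T1 * T2 => f z.1 * h z.2).
  by apply: measurable_funM; exact: measurableT_comp.
have FB (z : T1 * T2) : `|f z.1 * h z.2| <= C * D.
  by rewrite normrM ler_pM.
rewrite -(law_Rintegral mXZ hJ mF FB) -(law_Rintegral mX hLX mf fC) -(law_Rintegral mZ hLZ mh hD).
transitivity (\int[(LX \x LZ)%E]_z (f z.1 * h z.2))%R.
  rewrite /Rintegral; congr fine; apply: eq_measure_integral => A mA _.
  apply/esym; apply: product_measure_unique => // A1 A2 mA1 mA2.
  apply: (etrans (hJ _ (measurableX mA1 mA2))); apply: (etrans (hXZ mA1 mA2)).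
  exact: (congr2 mule (esym (hLX _ mA1)) (esym (hLZ _ mA2))).
rewrite (Rintegral_prod LX LZ mF FB) /=.
transitivity (\int[LX]_x (f x * \int[LZ]_y h y))%R.
  by apply: eq_Rintegral => x _; rewrite RintegralZl//; exact: (bounded_integrable LZ mh hD).
rewrite RintegralZr//; exact: (bounded_integrable LX mf fC).
Qed.

End independence.

(** * Characteristic functions of sums and linear images, as pairs of cosine and sine integrals *)

Section cf_sums.
Context {K : realType}.
Local Notation V n := 'cV[K]_n.

Lemma measurable_cos : measurable_fun setT (@cos K).
Proof. by apply: continuous_measurable_fun; exact: continuous_cos. Qed.

Lemma measurable_sin : measurable_fun setT (@sin K).
Proof. by apply: continuous_measurable_fun; exact: continuous_sin. Qed.

Definition Ecos d (T : measurableType d) (P : probability T K) n (X : T -> V n) u : K :=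
  (\int[P]_w cos (dotp u (X w)))%R.
Definition Esin d (T : measurableType d) (P : probability T K) n (X : T -> V n) u : K :=
  (\int[P]_w sin (dotp u (X w)))%R.

Lemma law_Ecos d (T : measurableType d) (P : probability T K) n (X : T -> V n) u
   (L : probability (V n) K) : measurable_fun setT X -> is_law L P X ->
  Ecos L id u = Ecos P X u /\ Esin L id u = Esin P X u.
Proof.
move=> mX hL; split.
- apply: (law_Rintegral mX hL (g := fun x => cos (dotp u x)) (C := 1)).
    by apply: (measurableT_comp measurable_cos); exact: measurable_dotp.
  by move=> x; exact: cos_max.
- apply: (law_Rintegral mX hL (g := fun x => sin (dotp u x)) (C := 1)).
    by apply: (measurableT_comp measurable_sin); exact: measurable_dotp.
  by move=> x; exact: sin_max.
Qed.

Context d (T : measurableType d) (P : probability T K).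

Lemma Ecos_lin m n (X : T -> V m) (M : 'M[K]_(n, m)) u :
  Ecos P (fun w => M *m X w) u = Ecos P X (M^T *m u) /\
  Esin P (fun w => M *m X w) u = Esin P X (M^T *m u).
Proof. by split; apply: eq_Rintegral => w _; rewrite dotp_mulmx. Qed.

Lemma indep_Ecos n (X Z : T -> V n) u :
  measurable_fun setT X -> measurable_fun setT Z -> indep P X Z ->
  Ecos P (fun w => X w + Z w) u = Ecos P X u * Ecos P Z u - Esin P X u * Esin P Z u /\
  Esin P (fun w => X w + Z w) u = Esin P X u * Ecos P Z u + Ecos P X u * Esin P Z u.
Proof.
move=> mX mZ hXZ.
have mc : measurable_fun setT (fun x : V n => cos (dotp u x)).
  by apply: (measurableT_comp measurable_cos); exact: measurable_dotp.
have ms : measurable_fun setT (fun x : V n => sin (dotp u x)).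
  by apply: (measurableT_comp measurable_sin); exact: measurable_dotp.
have c1 (x : V n) : `|cos (dotp u x)| <= 1 by exact: cos_max.
have s1 (x : V n) : `|sin (dotp u x)| <= 1 by exact: sin_max.
have ip (f g : V n -> K) : measurable_fun setT f -> (forall x, `|f x| <= 1) ->
   measurable_fun setT g -> (forall x, `|g x| <= 1) ->
   P.-integrable setT (EFin \o (fun w => f (X w) * g (Z w))).
  move=> mf f1 mg g1; apply: (bounded_integrable P (C := 1)) => [|x].
    by apply: measurable_funM; exact: measurableT_comp.
  by rewrite normrM mulr_ile1.
split; rewrite /Ecos /Esin.
- rewrite -(indep_Rintegral mX mZ hXZ mc c1 mc c1) -(indep_Rintegral mX mZ hXZ ms s1 ms s1).
  rewrite -RintegralB//; [|exact: (ip _ _ mc c1 mc c1)|exact: (ip _ _ ms s1 ms s1)].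
  by apply: eq_Rintegral => w _; rewrite dotpDr cosD.
- rewrite -(indep_Rintegral mX mZ hXZ ms s1 mc c1) -(indep_Rintegral mX mZ hXZ mc c1 ms s1).
  rewrite -RintegralD//; [|exact: (ip _ _ ms s1 mc c1)|exact: (ip _ _ mc c1 ms s1)].
  by apply: eq_Rintegral => w _; rewrite dotpDr sinD.
Qed.

(* Unlike [gaussian], this makes sense for degenerate covariances. *)
Definition gauss_cf n (Z : T -> V n) (C : 'M[K]_n) : Prop := forall u,
  Ecos P Z u = expR (- (dotp u (C *m u)) / 2) /\ Esin P Z u = 0.

Lemma gauss_cf_sum n (Z1 Z2 : T -> V n) C1 C2 :
  measurable_fun setT Z1 -> measurable_fun setT Z2 -> indep P Z1 Z2 ->
  gauss_cf Z1 C1 -> gauss_cf Z2 C2 -> gauss_cf (fun w => Z1 w + Z2 w) (C1 + C2).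
Proof.
move=> m1 m2 hi h1 h2 u; have [-> ->] := indep_Ecos u m1 m2 hi.
have [-> ->] := h1 u; have [-> ->] := h2 u.
rewrite !mulr0 !mul0r subr0 addr0; split=> //.
by rewrite -expRD mulmxDl dotpDr; congr expR; ring.
Qed.

Lemma gauss_cf_lin m n (Z : T -> V m) C (M : 'M[K]_(n, m)) : gauss_cf Z C ->
  gauss_cf (fun w => M *m Z w) (M *m C *m M^T).
Proof.
move=> hZ u; have [-> ->] := Ecos_lin Z M u.
by have [-> ->] := hZ (M^T *m u); rewrite -!mulmxA (dotp_mulmx u M).
Qed.

End cf_sums.

Section gaussian_laws.
Context {K : realType}.
Local Notation V n := 'cV[K]_n.

Lemma probability_prodE d1 d2 (T1 : measurableType d1) (T2 : measurableType d2)
  (P : probability T1 K) (Q : probability T2 K) (A : set T1) (B : set T2) :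
  measurable A -> measurable B ->
  ((P \x Q)%E : probability _ K) (A `*` B) = (P A * Q B)%E.
Proof. by move=> mA mB; exact: product_measure1E. Qed.

Lemma law_fst d1 d2 (T1 : measurableType d1) (T2 : measurableType d2)
  (P : probability T1 K) (Q : probability T2 K) : is_law P (P \x Q)%E fst.
Proof.
move=> A mA; have -> : fst @^-1` A = A `*` [set: T2] by apply/seteqP; split => -[x y] //= [].
by rewrite probability_prodE// probability_setT mule1.
Qed.

Lemma law_snd d1 d2 (T1 : measurableType d1) (T2 : measurableType d2)
  (P : probability T1 K) (Q : probability T2 K) : is_law Q (P \x Q)%E snd.
Proof.
move=> A mA; have -> : snd @^-1` A = [set: T1] `*` A by apply/seteqP; split => -[x y] //= [].
by rewrite probability_prodE// probability_setT mul1e.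
Qed.

Lemma indep_prod d1 d2 (T1 : measurableType d1) (T2 : measurableType d2)
  (P : probability T1 K) (Q : probability T2 K) :
  indep (P \x Q)%E fst snd.
Proof.
move=> A B mA mB.
have -> : fst @^-1` A `&` snd @^-1` B = A `*` B by apply/seteqP; split => -[x y].
by rewrite -(law_fst P Q mA) -(law_snd P Q mB) probability_prodE.
Qed.

Lemma gaussian_gauss_cf n (S : 'M[K]_n) (N : probability (V n) K) :
  posdef S -> gaussian S N -> gauss_cf N id S.
Proof. by move=> hS hN u; exact: gaussian_cf. Qed.

Lemma indep_comp d d1 d2 d3 d4 (T : measurableType d) (T1 : measurableType d1)
   (T2 : measurableType d2) (T3 : measurableType d3) (T4 : measurableType d4)
   (P : probability T K) (X : T -> T1) (Z : T -> T2) (f : T1 -> T3) (g : T2 -> T4) :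
  measurable_fun setT f -> measurable_fun setT g ->
  indep P X Z -> indep P (fun w => f (X w)) (fun w => g (Z w)).
Proof.
move=> mf mg hi A B mA mB.
have := hi (f @^-1` A) (g @^-1` B); apply.
  by rewrite -[X in measurable X]setTI; exact: mf.
by rewrite -[X in measurable X]setTI; exact: mg.
Qed.

(* [ou_law P M N] is the law of [M *m x + z] for independent [x] and [z] of laws
   [P] and [N]. *)
Definition ou_law m n (P : probability (V m) K) (M : 'M[K]_(n, m)) (N L : probability (V n) K) :=
  is_law L (P \x N)%E (fun z => M *m z.1 + z.2).

Lemma measurable_ou m n (M : 'M[K]_(n, m)) :
  measurable_fun setT (fun z : V m * V n => M *m z.1 + z.2).
Proof. by apply: measurable_addmx => //; exact: measurable_mulmx. Qed.

Lemma ou_law_cf m n (P : probability (V m) K) (M : 'M[K]_(n, m)) (N L : probability (V n) K) S u :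
  posdef S -> gaussian S N -> ou_law P M N L ->
  Ecos L id u = Ecos P id (M^T *m u) * expR (- (dotp u (S *m u)) / 2) /\
  Esin L id u = Esin P id (M^T *m u) * expR (- (dotp u (S *m u)) / 2).
Proof.
move=> hS hN hL.
have mM : measurable_fun setT (fun z : V m * V n => M *m z.1) by exact: measurable_mulmx.
have mM1 : measurable_fun setT (fun z : V m => M *m z) by exact: measurable_mulmx.
have mid : measurable_fun setT (id : V n -> V n) by [].
have [-> ->] := law_Ecos u (measurable_ou M) hL.
have [-> ->] := indep_Ecos u mM measurable_snd (indep_comp mM1 mid (@indep_prod _ _ _ _ P N)).
have [-> ->] := Ecos_lin (P \x N)%E fst M u.
have [<- <-] := law_Ecos (M^T *m u) measurable_fst (law_fst P N).
have [<- <-] := law_Ecos u measurable_snd (law_snd P N).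
have [-> ->] := gaussian_gauss_cf hS hN u.
by rewrite !mulr0 subr0 addr0.
Qed.

Lemma ou_law_integral m n (P : probability (V m) K) (M : 'M[K]_(n, m)) (N L : probability (V n) K) g :
  ou_law P M N L -> measurable_fun setT g -> (forall x, 0 <= g x)%E ->
  (\int[L]_x g x = \int[P]_x \int[N]_z g (M *m x + z)%R)%E.
Proof.
move=> hL mg g0; rewrite (ge0_law_integral (measurable_ou M) hL mg g0).
rewrite (fubini_tonelli1 (fun z : V m * V n => g (M *m z.1 + z.2)%R))//.
exact: (measurableT_comp mg (measurable_ou M)).
Qed.

End gaussian_laws.

(** * The matrix exponential *)

Section scalar_euler.
Context {K : realType}.

Lemma cvg_div_nat (x : K) : x / k.+1%:R @[k --> \oo] --> (0 : K).
Proof.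
rewrite -[X in _ --> X](mulr0 x); apply: cvgM; first exact: cvg_cst.
exact: cvg_harmonic.
Qed.

Lemma bernoulli (y : K) k : 0 <= y -> y <= 1 -> 1 - k%:R * y <= (1 - y) ^+ k.
Proof.
move=> y0 y1; elim: k => [|k ih]; first by rewrite mul0r subr0 expr0.
rewrite exprS; apply: (@le_trans _ _ ((1 - y) * (1 - k%:R * y))).
  rewrite -natr1 -subr_ge0 (_ : _ - _ = k%:R * y ^+ 2); last by ring.
  by rewrite mulr_ge0// sqr_ge0.
by rewrite ler_wpM2l// subr_ge0.
Qed.

(** For k beyond |x| one has exp x (1 - x^2 / k) <= (1 + x / k)^k <= exp x. With y = x / k, the
    lower bound combines Bernoulli's inequality for (1 - y^2)^k with exp y (1 - y) <= 1. *)
Lemma cvg_euler (x : K) : (1 + x / k.+1%:R) ^+ k.+1 @[k --> \oo] --> expR x.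
Proof.
have hl : expR x * (1 - x ^+ 2 / k.+1%:R) @[k --> \oo] --> expR x.
  have : expR x * (1 - x ^+ 2 / k.+1%:R) @[k --> \oo] --> expR x * (1 - 0).
    by apply: cvgM; [exact: cvg_cst|apply: cvgB; [exact: cvg_cst|exact: cvg_div_nat]].
  by rewrite subr0 mulr1.
suff sq : \forall k \near \oo, expR x * (1 - x ^+ 2 / k.+1%:R) <= (1 + x / k.+1%:R) ^+ k.+1 <= expR x.
  by apply: (squeeze_cvgr sq hl); exact: cvg_cst.
have [m hm] : exists m : nat, `|x| < m%:R by exists (Num.truncn `|x|).+1; rewrite truncnS_gt.
exists m => // k /= mk.
have k0 : 0 < k.+1%:R :> K by [].
have xk : `|x / k.+1%:R| <= 1.
  rewrite normrM normfV (gtr0_norm k0) ler_pdivrMr// mul1r (le_trans (ltW hm))//.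
  by rewrite ler_nat (leq_trans mk).
set y := x / k.+1%:R in xk *.
have xE : x = k.+1%:R * y by rewrite /y mulrCA mulfV ?mulr1// gt_eqF.
have /andP[y1 y2] : -1 <= y <= 1 by rewrite -ler_norml.
have y10 : 0 <= 1 + y by lra.
apply/andP; split; last first.
  by rewrite xE expRM_natl lerXn2r ?nnegrE ?expR_ge0// expR_ge1Dx.
have -> : x ^+ 2 / k.+1%:R = k.+1%:R * y ^+ 2.
  by rewrite xE; field; rewrite addrC natr1 gt_eqF.
apply: (@le_trans _ _ (expR x * (1 - y ^+ 2) ^+ k.+1)).
  rewrite ler_wpM2l ?expR_ge0// bernoulli ?sqr_ge0//.
  by rewrite -[y ^+ 2]real_normK ?num_real// expr_le1.
rewrite xE expRM_natl -exprMn lerXn2r ?nnegrE//.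
  rewrite mulr_ge0 ?expR_ge0// subr_ge0.
  by rewrite -[y ^+ 2]real_normK ?num_real// expr_le1.
rewrite (_ : 1 - y ^+ 2 = (1 - y) * (1 + y)); last by ring.
rewrite mulrA ler_piMl//.
rewrite -[leRHS](expR0) -(subrr y) expRD ler_wpM2l ?expR_ge0//.
by have := expR_ge1Dx (- y).
Qed.

End scalar_euler.

Section matrix_exponential.
Context {K : realType} {n : nat}.
Implicit Types (a b : 'M[K]_n).

(** The norm taking the largest entry is not submultiplicative; with the factor n one has |a b| <=
    [opn a] |b|. *)
Definition opn a : K := n%:R * `|a|.

Lemma opn_ge0 a : 0 <= opn a. Proof. by rewrite mulr_ge0. Qed.

Lemma mx_norm_mulmx m p q (M : 'M[K]_(m, p)) (N : 'M[K]_(p, q)) :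
  `|M *m N| <= p%:R * `|M| * `|N|.
Proof.
apply: mx_norm_le; first by rewrite !mulr_ge0.
move=> i j; rewrite mxE (le_trans (ler_norm_sum _ _ _))//.
rewrite (_ : p%:R * `|M| * `|N| = \sum_(k < p) `|M| * `|N|); last first.
  by rewrite sumr_const card_ord -mulrA mulr_natl.
apply: ler_sum => k _; rewrite normrM ler_pM//; exact: mx_norm_coord.
Qed.

Lemma mx_norm_exp a k : `|a ^+ k| <= opn a ^+ k.
Proof.
elim: k => [|k ih].
  rewrite !expr0; apply: mx_norm_le => // i j; rewrite mxE.
  by case: (_ == _); rewrite ?normr1 ?normr0.
rewrite !exprS (le_trans (mx_norm_mulmx _ _))//.
by rewrite ler_wpM2l// opn_ge0.
Qed.

Lemma mx_exprZ (c : K) a k : (c *: a) ^+ k = c ^+ k *: a ^+ k.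
Proof.
elim: k => [|k ih]; first by rewrite !expr0 scale1r.
by rewrite !exprS ih -[LHS]/(_ *m _) -scalemxAl -scalemxAr scalerA.
Qed.

Lemma cvg_expmx a :
  series (fun k : nat => (k`!%:R)^-1 *: a ^+ k) m @[m --> \oo] --> expmx a.
Proof.
set s := series _.
have cs i j : cvgn (fun m => s m i j).
  have -> : (fun m => s m i j) = series (fun k => (k`!%:R)^-1 * (a ^+ k) i j).
    apply/funext => m; rewrite /s /series /= summxE.
    by apply: eq_bigr => k _; rewrite mxE.
  apply: normed_cvg; apply: (@series_le_cvg _ _ (exp_coeff (opn a))).
  - by move=> k /=; exact: normr_ge0.
  - by move=> k; exact/exp_coeff_ge0/opn_ge0.
  - move=> k; rewrite /= normrM ger0_norm ?invr_ge0// mulrC /exp_coeff /=.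
    rewrite ler_wpM2r ?invr_ge0//; apply: le_trans (mx_norm_exp a k).
    exact: mx_norm_coord.
  - exact: is_cvg_series_exp_coeff.
suff : cvgn s by [].
apply/cvg_ex; exists (\matrix_(i, j) limn (fun m => s m i j)).
by apply: cvg_mx => i j; rewrite mxE; exact: cs.
Qed.

(** The partial sum of the exponential series minus the binomial expansion of the Euler product has
    nonnegative coefficients. Its norm is therefore at most the same scalar expression at x =
    [opn a], which tends to 0 by [cvg_euler]. *)
Lemma cvg_euler_mx a : (1 + (k.+1%:R)^-1 *: a) ^+ k.+1 @[k --> \oo] --> expmx a.
Proof.
pose s := series (fun k : nat => (k`!%:R)^-1 *: a ^+ k).
(* Cutting the series at k + 2 terms gives the same range of indices as the binomial expansion with
   exponent k + 1. *)
have hs : s k.+2 @[k --> \oo] --> expmx a.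
  have h := @cvg_expmx a.
  by move: h; rewrite -(cvg_shiftn 2); under eq_fun do rewrite addn2.
pose x := opn a.
have hd : s k.+2 - (1 + (k.+1%:R)^-1 *: a) ^+ k.+1 @[k --> \oo] --> (0 : 'M[K]_n).
  apply/cvgr0Pnorm_le => e e0.
  have hx : expR x - (1 + x / k.+1%:R) ^+ k.+1 @[k --> \oo] --> (0 : K).
    rewrite -(subrr (expR x)); apply: cvgB; [exact: cvg_cst|exact: cvg_euler].
  move/cvgr0Pnorm_le : hx => /(_ _ e0); apply: filterS => k hk.
  apply: le_trans (le_trans (ler_norm _) hk).
  (* The binomial coefficient times j! is a falling factorial, at most (k + 1)^j. *)
  have cj (j : 'I_k.+2) : (k.+1%:R : K) ^- j * 'C(k.+1, j)%:R <= (j`!%:R)^-1.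
    rewrite ler_pdivrMl ?exprn_gt0// ler_pdivlMr ?ltr0n ?fact_gt0//.
    rewrite -natrM bin_ffact -natrX ler_nat.
    elim: (nat_of_ord j) => [|l ih]; first by rewrite ffactn0 expn0.
    by rewrite ffactnSr expnSr leq_mul// leq_subr.
  have -> : s k.+2 - (1 + (k.+1%:R)^-1 *: a) ^+ k.+1 =
    \sum_(j < k.+2) ((j`!%:R)^-1 - (k.+1%:R : K) ^- j * 'C(k.+1, j)%:R) *: a ^+ j.
    rewrite /s /series /= big_mkord.
    rewrite exprDn_comm; last exact: commr_sym (commr1 _).
    rewrite -sumrB; apply: eq_bigr => j _.
    by rewrite expr1n mul1r scalerBl mx_exprZ exprVn -[_ *+ 'C(_, _)]scaler_nat scalerA mulrC.
  rewrite (le_trans (ler_norm_sum _ _ _))//.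
  have -> : (1 + x / k.+1%:R) ^+ k.+1 = \sum_(j < k.+2) (k.+1%:R : K) ^- j * 'C(k.+1, j)%:R * x ^+ j.
    rewrite exprDn; apply: eq_bigr => j _.
    by rewrite expr1n mul1r exprMn exprVn -mulr_natl; ring.
  apply: (@le_trans _ _ (\sum_(j < k.+2) ((j`!%:R)^-1 - (k.+1%:R : K) ^- j * 'C(k.+1, j)%:R) * x ^+ j)).
    apply: ler_sum => j _; rewrite normrZ ger0_norm ?subr_ge0//.
    by rewrite ler_wpM2l ?subr_ge0// mx_norm_exp.
  under eq_bigr do rewrite mulrBl.
  rewrite sumrB lerB//.
  have h : nondecreasing_seq (series (exp_coeff x)).
    by apply: nondecreasing_series => j _ _; exact/exp_coeff_ge0/opn_ge0.
  have := nondecreasing_cvgn_le h (is_cvg_series_exp_coeff x) k.+2.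
  move=> hle; apply: (@le_trans _ _ (series (exp_coeff x) k.+2)); last exact: hle.
  rewrite /series /= big_mkord.
  by apply: ler_sum => j _; rewrite /exp_coeff /= mulrC.
have -> : (fun k => (1 + (k.+1%:R)^-1 *: a) ^+ k.+1) =
   (fun k => s k.+2 - (s k.+2 - (1 + (k.+1%:R)^-1 *: a) ^+ k.+1)).
  by apply/funext => k; rewrite subKr.
by rewrite -[X in _ --> X]subr0; apply: cvgB.
Qed.

Lemma expmx_eigen a (v : 'cV[K]_n) mu : a *m v = mu *: v -> expmx a *m v = expR mu *: v.
Proof.
move=> av.
have h1 : (1 + (k.+1%:R)^-1 *: a) ^+ k.+1 *m v @[k --> \oo] --> expmx a *m v.
  by apply: cvg_mulmx; [exact: cvg_euler_mx|exact: cvg_cst].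
have h2 : (1 + mu / k.+1%:R) ^+ k.+1 *: v @[k --> \oo] --> expR mu *: v.
  by apply: cvgZ; [exact: cvg_euler|exact: cvg_cst].
have gen c m : (1 + c *: a) ^+ m *m v = (1 + mu * c) ^+ m *: v.
  elim: m => [|l ih]; first by rewrite !expr0 mul1mx scale1r.
  rewrite exprS -mulmxA ih -scalemxAr mulmxDl mul1mx -scalemxAl av scalerA.
  by rewrite exprSr -[RHS]scalerA [in RHS]scalerDl scale1r (mulrC mu).
have E : (fun k => (1 + (k.+1%:R)^-1 *: a) ^+ k.+1 *m v) = (fun k => (1 + mu / k.+1%:R) ^+ k.+1 *: v).
  by apply/funext => k; rewrite gen.
rewrite E in h1; exact: (cvg_unique _ h1 h2).
Qed.

End matrix_exponential.

(** * The law of a linear stochastic equation *)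

Section euler_scheme.
Context {K : realType} {n : nat}.
Local Notation V := 'cV[K]_n.
Local Notation mu := (@lebesgue_measure K).

Lemma uniform_continuity (X : K -> V) (t e : K) : 0 < e ->
  {within `[0, +oo[, continuous X} ->
  exists2 d : K, 0 < d & forall s u : K, 0 <= s <= t -> 0 <= u -> `|s - u| < d -> `|X s - X u| <= e.
Proof.
move=> e0 cX.
(* Extending X by its value at 0 to negative times turns continuity on the half-line into continuity
   at every real point, as the covering argument needs. *)
pose Y (s : K) := X (Num.max 0 s).
have e2 : 0 < e / 2 by rewrite divr_gt0.
have loc (x : K) : exists2 d : K, 0 < d & forall u : K, `|x - u| < d -> `|Y x - Y u| <= e / 2.
  have Ax (y : K) : `[0, +oo[%classic (Num.max 0 y) by rewrite /= in_itv/= andbT le_max lexx.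
  have /subspace_continuousP /(_ _ (Ax x)) := cX.
  move=> /cvgrPdist_le /(_ _ e2); rewrite /within /= => -[d /= d0 hd].
  exists d => // u xu; apply: hd; last exact: Ax.
  rewrite /ball/=; apply: le_lt_trans xu.
  rewrite /Num.max; case: ltP => x0; case: ltP => u0.
  - by [].
  - by rewrite subr0 !gtr0_norm// ?subr_gt0 ?(le_lt_trans u0)// lerBrDr gerDl.
  - by rewrite sub0r normrN distrC !gtr0_norm// ?subr_gt0 ?(le_lt_trans x0)// lerBrDr gerDl.
  - by rewrite subrr normr0.
have := @segment_compact K 0 t => /compact_near_coveringP.
move=> /(_ K (0^'+) (fun d s => forall u, `|s - u| < d -> `|Y s - Y u| <= e) _) /=.
have H : forall x : K, (x \in `[0, t]) -> \forall x' \near x & d \near 0^'+,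
    forall u, `|x' - u| < d -> `|Y x' - Y u| <= e.
  move=> x _; have [d d0 hd] := loc x.
  have d2 : 0 < d / 2 by rewrite divr_gt0.
  exists ([set y | `|x - y| < d / 2], [set r | r < d / 2]) => /=.
    split; last exact: nbhs_right_lt.
    by exists (d / 2).
  move=> [y r] /= [xy rd] u yu.
  have xu : `|x - u| < d.
    rewrite (le_lt_trans (ler_distD y _ _))// (splitr d) ltrD//.
    exact: lt_trans yu rd.
  have xy' : `|x - y| < d by rewrite (lt_trans xy)// ltr_pdivrMr// ltr_pMr// ltr1n.
  rewrite (le_trans (ler_distD (Y x) _ _))// (splitr e) lerD ?hd//.
  by rewrite distrC hd.
move=> /(_ H) hd.
have [d [d0 {}hd]] : exists d : K, 0 < d /\ `[0, t]%classic `<=` (fun s => forall u, `|s - u| < d -> `|Y s - Y u| <= e).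
  by apply: (@filter_ex _ (0^'+ : set_system K)); apply: filterI => //; exact: nbhs_right_gt.
exists d => // s u /andP[s0 st] u0 su.
have := hd s; rewrite /= in_itv/= s0 st => /(_ isT u su).
by rewrite /Y !max_r.
Qed.

Lemma Rintegral_near_cst (a b g0 eta : K) (g : K -> K) : a <= b ->
  mu.-integrable `]a, b] (EFin \o g) ->
  (forall s, a < s <= b -> `|g s - g0| <= eta) ->
  `|\int[mu]_(s in `]a, b]) g s - (b - a) * g0| <= (b - a) * eta.
Proof.
move=> ab gi hg.
have mab : mu `]a, b]%classic = (b - a)%:E.
  by rewrite lebesgue_measure_itv/= lte_fin; case: ltgtP ab => // ->; rewrite subrr.
have ic (c : K) : mu.-integrable `]a, b] (EFin \o cst c).
  have : mu.-integrable `[a, b] (EFin \o cst c).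
    apply: continuous_compact_integrable; first exact: segment_compact.
    by move=> x; exact: cvg_cst.
  by apply: integrableS => //; apply: subset_itvr; rewrite bnd_simp.
have Ec (c : K) : (\int[mu]_(s in `]a, b]) c = (b - a) * c)%R.
  by rewrite Rintegral_cst//= mab /= mulrC.
rewrite -(Ec g0) -RintegralB//; last exact: ic.
have gB : mu.-integrable `]a, b] (EFin \o (fun s => g s - g0)).
  exact: (integrableB _ gi (ic g0)).
apply: (le_trans (le_normr_Rintegral _ gB)) => //.
rewrite -(Ec eta); apply: le_Rintegral => //; last exact: ic.
exact: integrable_norm.
Qed.

Fixpoint euler (F : 'M[K]_n) (x0 : V) (w : K -> V) (d : K) (k : nat) : V :=
  if k is k'.+1 then
    (1 + d *: F) *m euler F x0 w d k' + (w (k'.+1%:R * d) - w (k'%:R * d))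
  else x0.

Lemma euler_split F x0 w d k :
  euler F x0 w d k = (1 + d *: F) ^+ k *m x0 + euler F 0 w d k.
Proof.
elim: k => [|k ih] /=; first by rewrite expr0 mul1mx addr0.
by rewrite ih mulmxDr mulmxA -addrA exprS.
Qed.

Variables (F : 'M[K]_n) (X w : K -> V) (t : K).
Hypothesis t0 : 0 <= t.
Hypothesis cX : {within `[0, +oo[, continuous X}.
Hypothesis hX : forall s, 0 <= s -> X s = X 0
  + \col_i \int[mu]_(u in `[0, s]) (F *m X u) i 0 + w s.

Let cFX i s : mu.-integrable `[0, s] (EFin \o (fun u => (F *m X u) i 0)).
Proof.
apply: (@continuous_compact_integrable K (fun u => (F *m X u) i 0)).
  exact: segment_compact.
have cX' : {within `[0, s], continuous X}.
  by apply: continuous_subspaceW cX; apply: subset_itvl; rewrite bnd_simp.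
have cF : continuous (fun v : V => (F *m v) i 0).
  move=> v; apply: (@cvg_mx_coord _ _ (nbhs v) _ _ _ (fun v => F *m v)).
  by apply: (@cvg_mulmx _ _ (nbhs v) _ _ _ _ (cst F) id); [exact: cvg_cst|exact: cvg_id].
move=> u; exact: (@continuous_comp (subspace `[0, s]) V K X (fun v => (F *m v) i 0) u (cX' u) (cF _)).
Qed.

(** The increment of w is exact in the scheme, so the local error only comes from freezing X at a in
    the drift. *)
Let step a b eta : 0 <= a -> a <= b -> 0 <= eta ->
  (forall s, a < s <= b -> `|X s - X a| <= eta) ->
  `|X b - X a - (b - a) *: (F *m X a) - (w b - w a)| <= (b - a) * (opn F * eta).
Proof.
move=> a0 ab eta0 hs.
have b0 := le_trans a0 ab.
apply: mx_norm_le; first by rewrite !mulr_ge0 ?subr_ge0 ?opn_ge0.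
move=> i j; rewrite (ord1 j) (hX b0) {1}(hX a0) !mxE.
set W := w b i 0; set Wa := w a i 0.
have -> : (X 0 i 0 + \int[mu]_(u in `[0, b]) (F *m X u) i 0 + W
   - (X 0 i 0 + \int[mu]_(u in `[0, a]) (F *m X u) i 0 + Wa)
   - (b - a) * (\sum_k F i k * X a k 0) - (W - Wa))%R =
   (\int[mu]_(u in `[0, b]) (F *m X u) i 0 - \int[mu]_(u in `[0, a]) (F *m X u) i 0)
    - (b - a) * (F *m X a) i 0 :> K.
  rewrite mxE; ring.
rewrite (Rintegral_itvB (cFX i b)) ?bnd_simp//.
apply: Rintegral_near_cst => //.
  apply: integrableS (cFX i b) => //.
  by apply: subset_itvr; rewrite bnd_simp.
move=> s sab.
have -> : (F *m X s) i 0 - (F *m X a) i 0 = (F *m (X s - X a)) i 0.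
  by rewrite mulmxBr !mxE.
rewrite (le_trans (mx_norm_coord _ _ _))// (le_trans (mx_norm_mulmx _ _))//.
by rewrite ler_wpM2l ?opn_ge0// hs.
Qed.

(** A discrete Gronwall inequality: each step adds a local error and multiplies the previous one by
    at most 1 + d [opn F] <= exp (d [opn F]). *)
Let err d eta k : 0 <= d -> 0 <= eta ->
  (forall l s, (l < k)%N -> l%:R * d < s <= l.+1%:R * d -> `|X s - X (l%:R * d)| <= eta) ->
  `|X (k%:R * d) - euler F (X 0) w d k| <=
    k%:R * (d * (opn F * eta)) * expR (k%:R * (d * opn F)).
Proof.
move=> d0 eta0; elim: k => [|k ih] hk.
  by rewrite !mul0r subrr normr0.
have {}ih := ih (fun l s lk => hk l s (ltnW lk)).
have dk : k.+1%:R * d - k%:R * d = d by rewrite -natr1; ring.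
have := @step (k%:R * d) (k.+1%:R * d) eta.
rewrite dk => /(_ _ _ eta0 (fun s => hk k s (ltnSn k))).
move=> /(_ (mulr_ge0 (ler0n _ _) d0)); rewrite ler_wpM2r// ?ler_nat//.
move=> /(_ isT) h1.
pose e := X (k%:R * d) - euler F (X 0) w d k.
have -> : X (k.+1%:R * d) - euler F (X 0) w d k.+1 =
   (X (k.+1%:R * d) - X (k%:R * d) - d *: (F *m X (k%:R * d)) - (w (k.+1%:R * d) - w (k%:R * d)))
   + (e + d *: (F *m e)).
  rewrite /= /e mulmxDl mul1mx -scalemxAl mulmxBr scalerBr.
  set a := X _; set b := X _; set c := F *m b; set f := euler _ _ _ _ _; set g := F *m f.
  set p := w _; set q := w _.
  by apply/matrixP => i j; rewrite !mxE; ring.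
apply: (le_trans (ler_normD _ _)).
set D := d * (opn F * eta) in h1 ih *.
have he : `|e + d *: (F *m e)| <= (1 + d * opn F) * `|e|.
  rewrite (le_trans (ler_normD _ _))// mulrDl mul1r lerD2l normrZ (ger0_norm d0) -mulrA.
  by rewrite ler_wpM2l// mx_norm_mulmx.
have c0 : 0 <= d * opn F by rewrite mulr_ge0// opn_ge0.
have D0 : 0 <= D by rewrite !mulr_ge0// opn_ge0.
apply: (@le_trans _ _ (D * expR (k.+1%:R * (d * opn F)) + expR (d * opn F) * (k%:R * D * expR (k%:R * (d * opn F))))).
  apply: lerD.
    rewrite (le_trans h1)// ler_peMr// -expR0 ler_expR mulr_ge0//.
  apply: (le_trans he); apply: ler_pM => //; first by rewrite addr_ge0.
  exact: expR_ge1Dx.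
rewrite -[X in D * expR (X * _)]natr1 [X in D * expR X]mulrDl mul1r expRD.
rewrite -natr1 [X in _ <= _ * expR X]mulrDl mul1r expRD.
by rewrite le_eqVlt; apply/orP; left; apply/eqP; ring.
Qed.

Lemma euler_cvg : euler F (X 0) w (t / m.+1%:R) m.+1 @[m --> \oo] --> X t.
Proof.
apply/cvgrPdist_le => e e0.
pose c := t * opn F * expR (t * opn F).
have c0 : 0 <= c by rewrite !mulr_ge0 ?opn_ge0// expR_ge0.
(* By [err] the error at time t is at most c times the modulus of continuity of X; c + 1 covers the
   case c = 0. *)
have eta0 : 0 < e / (c + 1) by rewrite divr_gt0// ltr_wpDl.
have [d d0 hd] := uniform_continuity t eta0 cX.
have [N _ hN] : \forall m \near \oo, t / m.+1%:R < d.
  have := @cvg_div_nat K t => /cvgr0Pnorm_lt /(_ _ d0); apply: filterS => m.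
  by apply: le_lt_trans; exact: ler_norm.
exists N => // m /= Nm.
set del := t / m.+1%:R.
have tE : m.+1%:R * del = t by rewrite /del mulrCA mulfV// mulr1.
have del0 : 0 <= del by rewrite divr_ge0.
have P l s : (l < m.+1)%N -> l%:R * del < s <= l.+1%:R * del ->
    `|X s - X (l%:R * del)| <= e / (c + 1).
  move=> lm /andP[s1 s2]; apply: hd.
  - rewrite (le_trans _ (ltW s1)) ?mulr_ge0//= (le_trans s2)// -tE ler_wpM2r// ler_nat//.
  - by rewrite mulr_ge0.
  - rewrite gtr0_norm ?subr_gt0//; apply: le_lt_trans (hN m Nm).
    rewrite lerBlDr (le_trans s2)// -natr1 mulrDl mul1r addrC//.
have := @err del (e / (c + 1)) m.+1 del0 (ltW eta0) P.
rewrite [X in `|X - _|](congr1 X tE) => h; apply: (le_trans h).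
rewrite (_ : _ * _ * _ = c * (e / (c + 1))); last first.
  by rewrite /c (mulrA m.+1%:R) mulrA tE; ring.
rewrite mulrA ler_pdivrMr ?ltr_wpDl// mulrC ler_wpM2l ?ltW// ltrDl//.
Qed.

End euler_scheme.

Lemma cvg_eqfun (T : topologicalType) (f g : nat -> T) (l : T) :
  (forall k, f k = g k) -> f k @[k --> \oo] --> l -> g k @[k --> \oo] --> l.
Proof. by move=> /funext ->. Qed.

Lemma measurable_mulmxl (K : realType) m n p (M : 'M[K]_(m, n)) :
  measurable_fun setT (fun x : 'M[K]_(n, p) => M *m x).
Proof. by apply: measurable_mulmx; [exact: measurable_cst|exact: measurable_id]. Qed.

(** * Limit of the covariances of the Euler schemes *)

Section matrix_limit.
Context {K : realType} {n : nat}.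
Variables (F S R : 'M[K]_n).
Hypothesis lyap : F *m S + S *m F^T + R = 0.

(** Covariance after k steps of the scheme started at 0 and driven by independent increments of
    covariance d R. *)
Fixpoint euler_cov (d : K) (k : nat) : 'M[K]_n :=
  if k is k'.+1 then
    (1 + d *: F) *m euler_cov d k' *m (1 + d *: F)^T + d *: R
  else 0.

(** The matrices S - G^k S (G^k)' satisfy the recursion of [euler_cov] up to d^2 F S F', because the
    Lyapunov equation cancels the terms of order d. These defects accumulate as in a discrete
    Gronwall inequality, the two exponents coming from multiplication by G on the left and by G' on
    the right. *)
Lemma euler_cov_error d k : 0 <= d ->
  `|euler_cov d k - (S - (1 + d *: F) ^+ k *m S *m ((1 + d *: F) ^+ k)^T)| <=
  k%:R * (d ^+ 2 * `|F *m S *m F^T|) * expR (k%:R * (d * (opn F + opn F^T))).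
Proof.
move=> d0; elim: k => [|k ih].
  by rewrite expr0 mul1mx trmx1 mulmx1 subrr subr0 normr0 !mul0r.
set G := 1 + d *: F in ih *; set a := opn F; set b := opn F^T in ih *.
set D := _ - _ in ih; set c := d ^+ 2 * _ in ih *.
have -> : euler_cov d k.+1 - (S - G ^+ k.+1 *m S *m (G ^+ k.+1)^T) =
   G *m D *m G^T + d ^+ 2 *: (F *m S *m F^T).
  rewrite /= -/G exprS trmx_mul /D mulmxBr mulmxBl mulmxBr mulmxBl !mulmxA.
  set E := G *m euler_cov d k *m G^T; set H := G *m G ^+ k *m S *m _ *m _.
  rewrite (_ : G *m S *m G^T = S + d *: (F *m S + S *m F^T) + d ^+ 2 *: (F *m S *m F^T)); last first.
    rewrite /G mulmxDl mul1mx linearD /= trmx1 mulmxDr mulmx1 linearZ /=.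
    rewrite mulmxDl -!scalemxAl -!scalemxAr scalerDr scalerA -expr2 !addrA.
    by congr (_ + _); rewrite -!addrA; congr (_ + _); rewrite addrC.
  have -> : F *m S + S *m F^T = - R by apply/eqP; rewrite -addr_eq0 lyap.
  rewrite scalerN; set x := d *: R; set y := d ^+ 2 *: _.
  by apply/matrixP => i j; rewrite !mxE; ring.
have hl (M : 'M[K]_n) : `|G *m M| <= expR (d * a) * `|M|.
  rewrite /G mulmxDl mul1mx -scalemxAl (le_trans (ler_normD _ _))//.
  apply: (@le_trans _ _ ((1 + d * a) * `|M|)); last by rewrite ler_wpM2r// expR_ge1Dx.
  rewrite mulrDl mul1r lerD2l normrZ (ger0_norm d0) -mulrA ler_wpM2l//.
  exact: mx_norm_mulmx.
have hr (M : 'M[K]_n) : `|M *m G^T| <= expR (d * b) * `|M|.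
  rewrite /G linearD /= trmx1 linearZ /= mulmxDr mulmx1 -scalemxAr (le_trans (ler_normD _ _))//.
  apply: (@le_trans _ _ ((1 + d * b) * `|M|)); last by rewrite ler_wpM2r// expR_ge1Dx.
  rewrite mulrDl mul1r lerD2l normrZ (ger0_norm d0) -mulrA ler_wpM2l//.
  by rewrite (le_trans (mx_norm_mulmx _ _))// /b /opn mulrAC.
have c0 : 0 <= c by rewrite mulr_ge0// sqr_ge0.
apply: (le_trans (ler_normD _ _)); rewrite [X in _ + X <= _]normrZ ger0_norm ?sqr_ge0// -/c.
apply: (@le_trans _ _ (expR (d * (a + b)) * (k%:R * c * expR (k%:R * (d * (a + b)))) +
   c * expR (k.+1%:R * (d * (a + b))))).
  apply: lerD; last first.
    by rewrite ler_peMr// -expR0 ler_expR !mulr_ge0// addr_ge0// opn_ge0.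
  apply: (le_trans (hr _)).
  apply: (@le_trans _ _ (expR (d * b) * (expR (d * a) * `|D|))).
    by rewrite ler_wpM2l ?expR_ge0// hl.
  by rewrite mulrA -expRD -mulrDr (addrC b) ler_wpM2l ?expR_ge0.
rewrite -natr1 [X in _ + _ * expR X]mulrDl mul1r expRD [X in _ <= _ * expR X]mulrDl mul1r expRD.
by rewrite le_eqVlt; apply/orP; left; apply/eqP; ring.
Qed.

Lemma euler_mx_cvg t : (1 + (t / m.+1%:R) *: F) ^+ m.+1 @[m --> \oo] --> expmx (t *: F).
Proof.
apply: cvg_eqfun (@cvg_euler_mx K n (t *: F)) => m.
by rewrite scalerA mulrC.
Qed.

Lemma euler_cov_cvg t : 0 <= t ->
  euler_cov (t / m.+1%:R) m.+1 @[m --> \oo] -->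
  S - expmx (t *: F) *m S *m (expmx (t *: F))^T.
Proof.
move=> t0.
pose G m := (1 + (t / m.+1%:R) *: F) ^+ m.+1.
have cG : G m @[m --> \oo] --> expmx (t *: F) by exact: euler_mx_cvg.
have cS : S - G m *m S *m (G m)^T @[m --> \oo] --> S - expmx (t *: F) *m S *m (expmx (t *: F))^T.
  apply: cvgB; first exact: cvg_cst.
  apply: cvg_mulmx; last exact: cvg_trmx.
  by apply: cvg_mulmx => //; exact: cvg_cst.
have cE : euler_cov (t / m.+1%:R) m.+1 - (S - G m *m S *m (G m)^T) @[m --> \oo] --> (0 : 'M[K]_n).
  pose c := t * `|F *m S *m F^T| * expR (t * (opn F + opn F^T)).
  have cc : c * (t / m.+1%:R) @[m --> \oo] --> (0 : K).
    by rewrite -(mulr0 c); apply: cvgM; [exact: cvg_cst|exact: cvg_div_nat].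
  apply/norm_cvg0P; apply: (@squeeze_cvgr _ _ _ _ (cst 0) (fun m => c * (t / m.+1%:R))) => //; last exact: cvg_cst.
  apply: nearW => m; rewrite normr_ge0 /=.
  have d0 : 0 <= t / m.+1%:R by rewrite divr_ge0.
  apply: (le_trans (euler_cov_error m.+1 d0)).
  have mE : m.+1%:R * (t / m.+1%:R) = t by rewrite mulrCA mulfV ?mulr1.
  rewrite [X in expR X]mulrA mE.
  rewrite (_ : m.+1%:R * (_ * _) = (m.+1%:R * (t / m.+1%:R)) * (t / m.+1%:R) * `|F *m S *m F^T|); last by rewrite expr2; ring.
  rewrite mE /c; set x := t / _; set y := expR _; set z := `|_ *m _|.
  by rewrite le_eqVlt; apply/orP; left; apply/eqP; ring.
have := cvgD cE cS; rewrite add0r.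
move=> /(_ _) h; apply: (cvg_eqfun _ h) => m /=; by rewrite subrK.
Qed.

End matrix_limit.

(** * The law of the solution at a fixed time *)

Section law.
Context {K : realType} d {Omega : measurableType d} (Pr : probability Omega K).
Local Notation V n := 'cV[K]_n.

Lemma bounded_cvg_ae (f_ : nat -> Omega -> K) (f : Omega -> K) (C : K) :
  (forall n, measurable_fun setT (f_ n)) -> measurable_fun setT f ->
  (forall n x, `|f_ n x| <= C) ->
  {ae Pr, forall x, f_ n x @[n --> \oo] --> f x} ->
  (\int[Pr]_x (f_ n x)%:E)%E @[n --> \oo] --> (\int[Pr]_x (f x)%:E)%E.
Proof.
move=> mf mlim fC fcvg.
have [] := @dominated_convergence _ _ _ Pr setT measurableT
  (fun n => EFin \o f_ n) (EFin \o f) (cst C%:E).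
- by move=> n; exact/measurable_EFinP.
- exact/measurable_EFinP.
- apply: filterS fcvg => x hx _ /=; apply: cvg_EFin; first exact: nearW.
  exact: hx.
- apply: (@bounded_integrable _ _ _ Pr (cst C) `|C|) => //.
- by apply: aeW => x n _; rewrite /= lee_fin.
by move=> _ _.
Qed.

Lemma bounded_Rcvg_ae (f_ : nat -> Omega -> K) (f : Omega -> K) (C : K) :
  (forall n, measurable_fun setT (f_ n)) -> measurable_fun setT f ->
  (forall n x, `|f_ n x| <= C) -> (forall x, `|f x| <= C) ->
  {ae Pr, forall x, f_ n x @[n --> \oo] --> f x} ->
  (\int[Pr]_x f_ n x)%R @[n --> \oo] --> (\int[Pr]_x f x)%R.
Proof.
move=> mf mlim fC fC' fcvg; rewrite /Rintegral.
have h := bounded_cvg_ae mf mlim fC fcvg.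
by apply: fine_cvg; move: h; rewrite (Rintegral_EFin (bounded_integrable Pr mlim fC')).
Qed.

Lemma Ecos_cvg_ae n (X_ : nat -> Omega -> V n) (X : Omega -> V n) u :
  (forall m, measurable_fun setT (X_ m)) -> measurable_fun setT X ->
  {ae Pr, forall w, X_ m w @[m --> \oo] --> X w} ->
  Ecos Pr (X_ m) u @[m --> \oo] --> Ecos Pr X u /\
  Esin Pr (X_ m) u @[m --> \oo] --> Esin Pr X u.
Proof.
move=> mX_ mX cX; split.
  apply: (@bounded_Rcvg_ae (fun m w => cos (dotp u (X_ m w))) _ 1).
  - by move=> m; apply: measurableT_comp; [exact: measurable_cos|exact: measurable_dotp].
  - by apply: measurableT_comp; [exact: measurable_cos|exact: measurable_dotp].
  - by move=> m x; rewrite ler_norml cos_geN1 cos_le1.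
  - by move=> x; rewrite ler_norml cos_geN1 cos_le1.
  apply: filterS cX => w hw.
  apply: (@continuous_cvg _ _ _ _ _ _ (@cos K)); first exact: continuous_cos.
  by apply: cvg_dotp => //; exact: cvg_cst.
apply: (@bounded_Rcvg_ae (fun m w => sin (dotp u (X_ m w))) _ 1).
- by move=> m; apply: measurableT_comp; [exact: measurable_sin|exact: measurable_dotp].
- by apply: measurableT_comp; [exact: measurable_sin|exact: measurable_dotp].
- by move=> m x; rewrite ler_norml sin_geN1 sin_le1.
- by move=> x; rewrite ler_norml sin_geN1 sin_le1.
apply: filterS cX => w hw.
apply: (@continuous_cvg _ _ _ _ _ _ (@sin K)); first exact: continuous_sin.
by apply: cvg_dotp => //; exact: cvg_cst.
Qed.

(** [Omega] is retyped with the sigma-algebra generated by the path on I, so that dependence on the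
    past becomes ordinary measurability. *)
Lemma sigma_proc_measurable n (W : K -> Omega -> V n) (I : set K) s : I s ->
  measurable_fun setT (W s : g_sigma_algebraType (\bigcup_(t in I) sigma_of (W t)) -> V n).
Proof.
move=> Is _ A mA; apply: sub_sigma_algebra; exists s => //.
by exists A.
Qed.

Lemma sigma_of_sub n m (W : K -> Omega -> V n) (I : set K) (Z : Omega -> V m) :
  measurable_fun setT (Z : g_sigma_algebraType (\bigcup_(t in I) sigma_of (W t)) -> V m) ->
  forall A, measurable A -> sigma_proc W I (Z @^-1` A).
Proof. by move=> mZ A mA; have := mZ measurableT A mA; rewrite setTI. Qed.

Section brownian.
Variables (n m : nat) (F : 'M[K]_n) (B : 'M[K]_(n, m)) (W : K -> {RV Pr >-> V m}).
Hypothesis hW : brownian_motion W.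

Lemma increment_gauss_cf s t : 0 <= s -> s < t ->
  gauss_cf Pr (fun w => W t w - W s w) ((t - s)%:M).
Proof.
move=> s0 st.
have ts0 : 0 < t - s by rewrite subr_gt0.
have mD : measurable_fun setT (fun w => W t w - W s w).
  apply: measurable_addmx; first exact: measurable_funPT.
  by apply: measurable_oppmx; exact: measurable_funPT.
have [L hL] := ex_law Pr mD.
have pdts : posdef ((t - s)%:M : 'M[K]_m).
  by rewrite -scalemx1; apply: posdefZ => //; exact: posdef1.
have gL : gaussian (t - s)%:M L.
  by apply: centered_gaussianE => E mE; rewrite hL//; exact: (bm_gauss hW).
move=> u; have [<- <-] := law_Ecos u mD hL.
exact: gaussian_gauss_cf.
Qed.

Let noise del k (w : Omega) : V n := euler F 0 (fun s => B *m W s w) del k.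

(** The map f is meant to be the identity from [Omega] equipped with a smaller sigma-algebra. *)
Lemma measurable_noise d' (T : measurableType d') (del : K) k (f : T -> Omega) :
  (forall j, (j <= k)%N -> measurable_fun setT (fun x => W (j%:R * del) (f x))) ->
  measurable_fun setT (fun x => noise del k (f x)).
Proof.
elim: k => [|k ih] mf; first exact: measurable_cst.
rewrite /noise /=; apply: measurable_addmx.
  apply: measurable_mulmx; first exact: measurable_cst.
  by apply: ih => j jk; apply: mf; exact: leqW.
apply: measurable_addmx; first by apply: measurable_mulmx; [exact: measurable_cst|exact: mf].
by apply: measurable_oppmx; apply: measurable_mulmx; [exact: measurable_cst|exact: mf].
Qed.

(** Up to step k the noise is a function of the path on [0, k del], and the next increment is
    independent of that path; Gaussian characteristic functions multiply and covariances add. *)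
Lemma noise_gauss_cf del k : 0 < del ->
  gauss_cf Pr (noise del k) (euler_cov F (B *m B^T) del k).
Proof.
move=> del0; elim: k => [|k ih].
  move=> u; rewrite /Ecos /Esin /noise /= mul0mx dotp0r oppr0 mul0r expR0.
  rewrite cos0 sin0; split; by rewrite Rintegral_cst//= probability_setT ?mulr1 ?mul0r//= mul1r.
have lt1 : k%:R * del < k.+1%:R * del by rewrite ltr_pM2r// ltr_nat.
have k0 : 0 <= k%:R * del by rewrite mulr_ge0// ltW.
have mD : measurable_fun setT (fun w => W (k.+1%:R * del) w - W (k%:R * del) w).
  apply: measurable_addmx; first exact: measurable_funPT.
  by apply: measurable_oppmx; exact: measurable_funPT.
have mZ : measurable_fun setT (noise del k).
  by apply: (@measurable_noise _ _ del k id) => j _; exact: measurable_funPT.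
have -> : noise del k.+1 = fun w => (1 + del *: F) *m noise del k w
   + B *m (W (k.+1%:R * del) w - W (k%:R * del) w).
  by apply/funext => w; rewrite /noise /= mulmxBr.
apply: gauss_cf_sum.
- exact: measurable_mulmx.
- exact: measurable_mulmx.
- apply: (@indep_comp _ _ _ _ _ _ _ _ _ _ _ Pr (noise del k) _ (mulmx (1 + del *: F)) (mulmx B)).
  + exact: measurable_mulmxl.
  + exact: measurable_mulmxl.
  + move=> A C mA mC; rewrite setIC muleC.
    apply: (bm_indep hW k0 lt1); first by exists C; rewrite ?setTI.
    apply: sigma_of_sub mA.
    apply: (@measurable_noise _ _ del k (id : g_sigma_algebraType _ -> Omega)) => j jk.
    apply: (@sigma_proc_measurable _ (fun s => W s : Omega -> V m)).
    rewrite /= in_itv /= (mulr_ge0 (ler0n _ _) (ltW del0)) /=.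
    by rewrite (ler_pM2r del0) ler_nat.
- exact: gauss_cf_lin.
- have := gauss_cf_lin B (increment_gauss_cf k0 lt1); congr (gauss_cf _ _ _).
  rewrite -mulrBl -natr1 addrAC subrr add0r mul1r -scalemx1 -scalemxAr mulmx1 -scalemxAl.
  by [].
Qed.

Variable (X : K -> {RV Pr >-> V n}) (S : 'M[K]_n).
Hypothesis hX : linear_sde F B W X.
Hypothesis hindep : independent_sigma Pr (sigma_of (X 0)) (sigma_proc W `[0, +oo[).
Hypothesis lyap : F *m S + S *m F^T + B *m B^T = 0.

(** For each step size the scheme is a linear image of [X 0] plus an independent noise with known
    characteristic function. Dominated convergence and the limits of the propagators and covariances
    then identify both sides. *)
Lemma sde_cf t u : 0 < t ->
  let M := expmx (t *: F) in
  let C := S - M *m S *m M^T in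
  Ecos Pr (X t) u = Ecos Pr (X 0) (M^T *m u) * expR (- (dotp u (C *m u)) / 2) /\
  Esin Pr (X t) u = Esin Pr (X 0) (M^T *m u) * expR (- (dotp u (C *m u)) / 2).
Proof.
move=> t0 M C.
pose G m := (1 + (t / m.+1%:R) *: F) ^+ m.+1.
pose Z m := noise (t / m.+1%:R) m.+1.
pose Y m w := G m *m X 0 w + Z m w.
have mX s : measurable_fun setT (X s) by exact: measurable_funPT.
have mZ k : measurable_fun setT (Z k).
  by apply: (@measurable_noise _ _ _ k.+1 id) => j _; exact: measurable_funPT.
have mY k : measurable_fun setT (Y k).
  by apply: measurable_addmx => //; exact: measurable_mulmx.
have cY : {ae Pr, forall w, Y m w @[m --> \oo] --> X t w}.
  apply: filterS hX => w [cX hXw].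
  have := @euler_cvg _ _ F (fun s => X s w) (fun s => B *m W s w) t (ltW t0) cX hXw.
  by apply: cvg_eqfun => k; rewrite euler_split.
have [h1 h2] := Ecos_cvg_ae u mY (mX t) cY.
have iXZ k : indep Pr (fun w => G k *m X 0 w) (Z k).
  apply: (@indep_comp _ _ _ _ _ _ _ _ _ _ _ Pr (X 0) _ (mulmx (G k)) id) => //.
    exact: measurable_mulmxl.
  move=> A D mA mD; apply: hindep; first by exists A; rewrite ?setTI.
  apply: sigma_of_sub mD.
  apply: (@measurable_noise _ _ _ k.+1 (id : g_sigma_algebraType _ -> Omega)) => j jk.
  apply: (@sigma_proc_measurable _ (fun s => W s : Omega -> V m)).
  by rewrite /= in_itv /= andbT mulr_ge0// divr_ge0// ltW.
have del0 k : 0 < t / k.+1%:R by rewrite divr_gt0.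
have YE k : Ecos Pr (Y k) u = Ecos Pr (X 0) ((G k)^T *m u) *
    expR (- (dotp u (euler_cov F (B *m B^T) (t / k.+1%:R) k.+1 *m u)) / 2) /\
  Esin Pr (Y k) u = Esin Pr (X 0) ((G k)^T *m u) *
    expR (- (dotp u (euler_cov F (B *m B^T) (t / k.+1%:R) k.+1 *m u)) / 2).
  have [-> ->] := indep_Ecos u (measurableT_comp (@measurable_mulmxl _ _ _ _ (G k)) (mX 0)) (mZ k) (iXZ k).
  have [-> ->] := Ecos_lin Pr (X 0) (G k) u.
  have [-> ->] := noise_gauss_cf k.+1 (del0 k) u.
  by rewrite !mulr0 subr0 addr0.
have cE : expR (- (dotp u (euler_cov F (B *m B^T) (t / k.+1%:R) k.+1 *m u)) / 2) @[k --> \oo] -->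
    expR (- (dotp u (C *m u)) / 2).
  apply: (@continuous_cvg _ _ _ _ _ _ (@expR K)); first exact: continuous_expR.
  apply: cvgM; last exact: cvg_cst.
  apply: cvgN; apply: cvg_dotp; first exact: cvg_cst.
  by apply: cvg_mulmx; [apply: (euler_cov_cvg lyap); exact: ltW|exact: cvg_cst].
have cG w : (dotp ((G k)^T *m u) (X 0 w)) @[k --> \oo] --> dotp (M^T *m u) (X 0 w).
  apply: cvg_dotp; last exact: cvg_cst.
  by apply: cvg_mulmx; [apply: cvg_trmx; exact: euler_mx_cvg|exact: cvg_cst].
have [h3 h4] : Ecos Pr (X 0) ((G k)^T *m u) @[k --> \oo] --> Ecos Pr (X 0) (M^T *m u) /\
   Esin Pr (X 0) ((G k)^T *m u) @[k --> \oo] --> Esin Pr (X 0) (M^T *m u).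
  have e1 N : Ecos Pr (X 0) (N^T *m u) = Ecos Pr (fun w => N *m X 0 w) u by have [->] := Ecos_lin Pr (X 0) N u.
  have e2 N : Esin Pr (X 0) (N^T *m u) = Esin Pr (fun w => N *m X 0 w) u by have [_ ->] := Ecos_lin Pr (X 0) N u.
  rewrite e1 e2; under eq_fun do rewrite e1.
  under [in X in _ /\ X]eq_fun do rewrite e2.
  apply: Ecos_cvg_ae; [by move=> k; exact: measurable_mulmx|exact: measurable_mulmx|].
  apply: aeW => w; apply: cvg_mulmx; [exact: euler_mx_cvg|exact: cvg_cst].
split.
  have := cvg_unique _ h1; apply; first exact: norm_hausdorff.
  apply: (cvg_eqfun _ (cvgM h3 cE)) => k /=.
  by have [->] := YE k.
have := cvg_unique _ h2; apply; first exact: norm_hausdorff.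
apply: (cvg_eqfun _ (cvgM h4 cE)) => k /=.
by have [_ ->] := YE k.
Qed.

Lemma sde_ou_law t (N : probability (V n) K) : 0 < t ->
  let M := expmx (t *: F) in
  let C := S - M *m S *m M^T in
  posdef C -> gaussian C N ->
  ou_law (distribution Pr (X 0)) M N (distribution Pr (X t)).
Proof.
move=> t0 M C pC gN.
have [L hL] := ex_law ((distribution Pr (X 0)) \x N)%E (measurable_ou M).
have hd s : is_law (distribution Pr (X s)) Pr (X s) by [].
have mX s : measurable_fun setT (X s) by exact: measurable_funPT.
suff LE A : measurable A -> L A = distribution Pr (X t) A.
  by move=> A mA; exact: (etrans (esym (LE A mA)) (hL A mA)).
apply: cf_unique => u.
have [e1 e2] := ou_law_cf u pC gN hL.
have [f1 f2] := sde_cf u t0.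
have [g1 g2] := law_Ecos u (mX t) (hd t).
have [g3 g4] := law_Ecos (M^T *m u) (mX 0) (hd 0).
split.
  by apply: (etrans e1); rewrite g3 -/M -/C -f1 -g1.
by apply: (etrans e2); rewrite g4 -/M -/C -f2 -g2.
Qed.

End brownian.
End law.

(** * Weak gradients along lines *)

Section local.
Context {K : realType} {n : nat}.
Local Notation V := 'cV[K]_n.
Local Notation mu := (lebesgueV K n).

Definition cube (k : nat) : set V := [set x | `|x| <= k%:R].

Lemma closed_cube k : closed (cube k).
Proof.
rewrite (_ : cube k = (fun x : V => `|x|) @^-1` [set y | y <= k%:R])//.
by apply: closed_comp; [move=> x _; exact: norm_continuous|exact: closed_le].
Qed.

Lemma compact_cube k : compact (cube k).
Proof. by apply: (@compact_colV _ _ _ k%:R); [exact: closed_cube|]. Qed.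

Lemma compact_measurableV (C : set V) : compact C -> measurable C.
Proof.
move=> cC; rewrite -(setCK C); apply: measurableC; apply: open_measurableV.
by apply: closed_openC; apply: compact_closed cC; exact: norm_hausdorff.
Qed.

Lemma measurable_cube k : measurable (cube k).
Proof. exact: compact_measurableV (@compact_cube k). Qed.

Lemma bigcup_cube : \bigcup_k cube k = [set: V].
Proof.
apply/seteqP; split => // x _; exists (Num.truncn `|x|).+1 => //=.
by rewrite /cube /= ltW// truncnS_gt.
Qed.

Lemma compact_sub_cube (C : set V) : compact C -> exists k, C `<=` cube k.
Proof.
move=> /compact_bounded [M [Mr hM]].
exists (Num.truncn `|M + 1|).+1 => x Cx; rewrite /cube /=.
have M1 : M < M + 1 by rewrite ltrDl.
by rewrite (le_trans (hM _ M1 x Cx))// (le_trans (ler_norm _))// ltW// truncnS_gt.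
Qed.

Lemma box_sub_cube (a b : 'I_n -> K) : exists k, box a b `<=` cube k.
Proof.
pose M := \sum_i (`|a i| + `|b i|).
exists (Num.truncn M).+1 => x hx; rewrite /cube /=.
apply: mx_norm_le => // i j; rewrite (ord1 j).
apply: (@le_trans _ _ M); last by rewrite ltW// truncnS_gt.
have hi : `|a i| + `|b i| <= M.
  by rewrite /M (bigD1 i)//= lerDl sumr_ge0// => l _; rewrite addr_ge0.
have /andP[h1 h2] := hx i; apply: le_trans hi; rewrite ler_norml.
have := ler_norm (b i); have := ler_norm (- a i); rewrite normrN.
have := normr_ge0 (a i); have := normr_ge0 (b i); lra.
Qed.

Lemma lebesgueV_cube_lty k : (mu (cube k) < +oo)%E.
Proof.
have sub : cube k `<=` [set x | forall i : 'I_n, `[- k%:R, k%:R]%classic (x i 0)].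
  move=> x hx i /=; rewrite in_itv /= -ler_norml.
  exact: le_trans (mx_norm_coord _ _ _) hx.
have mI (i : 'I_n) : measurable `[- k%:R, k%:R : K]%classic by [].
have mB : measurable [set x : V | forall i : 'I_n, `[- k%:R, k%:R : K]%classic (x i 0)].
  rewrite (_ : mkset _ = \bigcap_(i in [set: 'I_n])
      ((fun x : V => x i 0) @^-1` `[- k%:R, k%:R])); last first.
    by apply/seteqP; split=> x xE; [move=> i _|move=> i]; exact: xE.
  apply: fin_bigcap_measurable => [|i _]; first exact: finite_finset.
  by rewrite -[X in measurable X]setTI; apply: measurable_coord.
apply: (@le_lt_trans _ _ (mu [set x | forall i : 'I_n, `[- k%:R, k%:R]%classic (x i 0)])).
  by apply: le_measure => //; rewrite inE//; exact: measurable_cube.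
rewrite (lebesgueV_box mI).
suff /andP[] : (0 <= \prod_(i < n) @lebesgue_measure K `[(- k%:R)%R, k%:R%R] < +oo)%E by [].
apply: (big_ind (fun x : \bar K => is_true (0 <= x < +oo)%E)) => //.
- by rewrite lee01 ltry.
- move=> x y /andP[x0 xo] /andP[y0 yo]; rewrite mule_ge0//=.
  by rewrite lte_mul_pinfty// ge0_fin_numE.
- move=> i _; rewrite measure_ge0 /= lebesgue_measure_itv /=.
  by case: ifP => _; rewrite -?EFinD ltry.
Qed.

Definition loc (h : V -> K) : Prop :=
  forall C, compact C -> mu.-integrable C (EFin \o h).

Lemma loc_measurable h : loc h -> measurable_fun setT h.
Proof.
move=> lh; rewrite -bigcup_cube; apply/measurable_fun_bigcup => [k|k].
  exact: measurable_cube.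
by apply/measurable_EFinP; exact: (measurable_int mu (lh _ (@compact_cube k))).
Qed.

Lemma loc_cube h : measurable_fun setT h ->
  (forall k, mu.-integrable (cube k) (EFin \o h)) -> loc h.
Proof.
move=> mh ih C cC; have [k Ck] := compact_sub_cube cC.
apply: integrableS (ih k) => //; [exact: measurable_cube|exact: compact_measurableV].
Qed.

Lemma loc_continuous h : continuous h -> loc h.
Proof.
move=> ch; have mh := continuous_measurable_mx ch; apply: loc_cube => // k.
apply: measurable_bounded_integrable.
- exact: measurable_cube.
- exact: lebesgueV_cube_lty.
- exact: measurable_funTS.
have : compact (h @` cube k).
  by apply: continuous_compact; [exact: continuous_subspaceT|exact: compact_cube].
move=> /compact_bounded [M [Mr hM]]; exists M; split => // y My x Cx.
by apply: (hM y My); exists x.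
Qed.

Lemma loc_mul_integrable h (phi : V -> K) (C : set V) B : loc h -> compact C ->
  measurable_fun setT phi -> (forall x, `|phi x| <= B) ->
  (forall x, ~ C x -> phi x = 0) ->
  mu.-integrable setT (EFin \o (fun x => h x * phi x)).
Proof.
move=> lh cC mphi phiB phi0.
have mC := compact_measurableV cC.
have mh := loc_measurable lh.
have B0 : 0 <= B by exact: le_trans (phiB 0).
have i1 : mu.-integrable setT ((EFin \o (fun x => B * h x)) \_ C).
  apply/integrable_restrict => //; rewrite setTI.
  exact: (integrableZl mC B (lh _ cC)).
apply: le_integrable i1 => //.
  by apply/measurable_EFinP; exact: measurable_funM.
move=> x _; rewrite patchE; case: ifPn => [xC|/negP]; last first.
  by rewrite inE => /phi0 h0 /=; rewrite h0 mulr0.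
by rewrite /= lee_fin !normrM mulrC ler_wpM2r// (ger0_norm B0).
Qed.

Lemma loc_opp h : loc h -> loc (fun x => - h x).
Proof.
by move=> lh C cC; exact: (integrableN (lh _ cC)).
Qed.

(** Bumps are test functions bounded by 1, supported in the box and converging to its indicator; |h|
    on a cube containing the box dominates. *)
Lemma loc_box_fundamental (h : V -> K) : loc h ->
  (forall phi, test_function phi -> (\int[mu]_x (h x * phi x)%:E = 0)%E) ->
  forall a b, (\int[mu]_(x in box a b) (h x)%:E = 0)%E.
Proof.
move=> lh h0 a b; have mh := loc_measurable lh.
have [l bl] := box_sub_cube a b.
have mb := @measurable_box K n a b.
have k0 (k : nat) : 0 < k.+1%:R^-1 :> K by rewrite invr_gt0.
have [] := @dominated_convergence _ _ _ mu setT measurableT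
  (fun k => EFin \o (fun x => h x * box_bump a b k.+1%:R^-1 x))
  (EFin \o (fun x => h x * \1_(box a b) x))
  ((abse \o (EFin \o h)) \_ (cube l)).
- move=> k; apply/measurable_EFinP; apply: measurable_funM => //.
  apply: continuous_measurable_mx.
  by have [c _] := test_function_box_bump a b (k0 k); exact: (c 0).
- apply/measurable_EFinP; apply: measurable_funM => //.
- apply: aeW => x _ /=; apply: cvg_EFin; first exact: nearW.
  by apply: cvgM; [exact: cvg_cst|exact: box_bump_cvg].
- apply/integrable_restrict => //; first exact: measurable_cube.
  rewrite setTI; apply: integrable_abse; exact: (lh _ (@compact_cube l)).
- apply: aeW => x k _; rewrite patchE; case: ifPn => [xC|/negP].
    rewrite /= lee_fin normrM ler_piMr// ger0_norm ?box_bump_ge0 ?box_bump_le1//.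
  rewrite inE => xC /=; rewrite box_bump_out ?mulr0 ?normr0//.
  by move=> /bl.
move=> _ _ /=.
have -> : (fun k : nat => \int[mu]_x (h x * box_bump a b k.+1%:R^-1 x)%:E)%E = cst 0%E.
  by apply/funext => k; exact: (h0 _ (test_function_box_bump a b (k0 k))).
move=> /(cvg_lim (@ereal_hausdorff K)); rewrite lim_cst; last exact: ereal_hausdorff.
move=> e; rewrite integral_mkcond [RHS]e; apply: eq_integral => x _.
by rewrite patchE indicE; case: ifPn => _ /=; rewrite ?mulr1 ?mulr0.
Qed.

(** The measures of densities h^+ and h^- agree on boxes and are finite there, hence agree
    everywhere; so h integrates to 0 over every measurable part of a cube and vanishes almost
    everywhere. *)
Lemma loc_fundamental (h : V -> K) : loc h ->
  (forall phi, test_function phi -> (\int[mu]_x (h x * phi x)%:E = 0)%E) ->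
  {ae mu, forall x, h x = 0}.
Proof.
move=> lh /(loc_box_fundamental lh) hbox.
have mh := loc_measurable lh.
have mhE : measurable_fun setT (EFin \o h) by exact/measurable_EFinP.
have [m1 hm1] := @ex_density_measure _ _ _ mu _ (funepos_ge0 (EFin \o h)) (measurable_funepos mhE).
have [m2 hm2] := @ex_density_measure _ _ _ mu _ (funeneg_ge0 (EFin \o h)) (measurable_funeneg mhE).
have fin A k : measurable A -> A `<=` cube k ->
   (\int[mu]_(x in A) (EFin \o h)^\+ x)%E \is a fin_num /\
   (\int[mu]_(x in A) (EFin \o h)^\- x)%E \is a fin_num.
  move=> mA Ak; have iA : mu.-integrable A (EFin \o h).
    exact: (integrableS (measurable_cube k) mA Ak (lh _ (@compact_cube k))).
  by split; apply: integrable_fin_num => //; [exact: integrable_funepos|exact: integrable_funeneg].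
have m12 A : measurable A -> m1 A = m2 A.
  apply: measure_unique_boxes => a b; have mb := @measurable_box K n a b.
    rewrite hm1// hm2//; have [k bk] := box_sub_cube a b.
    have [f1 f2] := fin _ _ mb bk.
    have : (\int[mu]_(x in box a b) (EFin \o h)^\+ x - \int[mu]_(x in box a b) (EFin \o h)^\- x)%E = 0%E.
      by rewrite -(hbox a b) [RHS]integralE.
    by move=> /eqP; rewrite sube_eq ?fin_num_adde_defl// add0e => /eqP.
  rewrite hm1//; have [k bk] := box_sub_cube a b.
  by have [f1 f2] := fin _ _ mb bk; rewrite ltey_eq f1.
have ae k : ae_eq mu (cube k) (EFin \o h) (cst 0%E).
  apply: integral_ae_eq => //; first exact: measurable_cube.
    exact: (lh _ (@compact_cube k)).
  move=> A Ak mA; rewrite integral_cst// mul0e integralE -hm1// -hm2// m12//.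
  rewrite subee// hm2//; by have [] := fin _ _ mA Ak.
have : {ae mu, forall x k, cube k x -> (EFin \o h) x = cst 0%E x}.
  by apply/ae_foralln => k; exact: ae.
apply: filterS => x hx.
have [k _ kx] : (\bigcup_k cube k) x by rewrite bigcup_cube.
by have [] := hx k kx.
Qed.

End local.

Section line_calculus.
Context {K : realType} {n : nat}.
Local Notation V := 'cV[K]_n.
Local Notation leb := (@lebesgue_measure K).
Local Notation mu := (lebesgueV K n).

Lemma continuous_shiftV (c : V) : continuous (fun y : V => y + c).
Proof. by move=> x; exact: (@cvgD _ _ _ (nbhs x) _ id (cst c) x c cvg_id (cvg_cst _)). Qed.

Lemma derive_translate (f : V -> K) (c x v : V) :
  'D_v (fun y => f (y + c)) x = 'D_v f (x + c).
Proof.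
rewrite /derive; congr (lim _).
suff -> : (fun h : K => h^-1 *: (((fun y : V => f (y + c)) \o shift x) (h *: v) - f (x + c))) =
  (fun h : K => h^-1 *: ((f \o shift (x + c)) (h *: v) - f (x + c))) by [].
by apply/funext => h /=; rewrite /shift /= addrA.
Qed.

Lemma differentiable_shift (f : V -> K) (c x : V) : differentiable f (x + c) ->
  differentiable (fun y => f (y + c)) x.
Proof.
move=> df; apply: (@differentiable_comp _ _ _ _ (fun y : V => y + c) f) => //.
Qed.

Lemma C_k_shift k (f : V -> K) c : C_k k f -> C_k k (fun x => f (x + c)).
Proof.
elim: k f => [|k ih] f.
  move=> cf x; apply: (@continuous_comp _ _ _ (fun y : V => y + c) f); last exact: cf.
  exact: continuous_shiftV.
rewrite !C_kSP => -[df Df]; split=> [x|i]; first exact: differentiable_shift.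
have -> : (fun x => 'D_(basis_vec i) (fun x0 => f (x0 + c)) x) = fun x => 'D_(basis_vec i) f (x + c).
  by apply/funext => x; exact: derive_translate.
exact: (ih (fun x => 'D_(basis_vec i) f x) (Df i)).
Qed.

Lemma test_function_shift (f : V -> K) c : test_function f ->
  test_function (fun x => f (x + c)).
Proof.
move=> [Cf [C [cC hC]]]; split; first by move=> k; exact: C_k_shift.
exists ((fun x => x - c) @` C); split.
  by apply: continuous_compact => //; apply: continuous_subspaceT; exact: continuous_shiftV.
move=> x hx; apply: hC => Cx; apply: hx; exists (x + c) => //.
by rewrite addrK.
Qed.

Lemma derivable_line (f : V -> K) (b y : V) (s : K) :
  differentiable f (y + s *: b) ->
  is_derive s (1 : K) (fun s => f (y + s *: b)) ('D_b f (y + s *: b)).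
Proof.
move=> df.
have e : (fun h : K => h^-1 *: (((fun s => f (y + s *: b)) \o shift s) (h *: (1 : K)) - f (y + s *: b))) =
  (fun h : K => h^-1 *: ((f \o shift (y + s *: b)) (h *: b) - f (y + s *: b))).
  apply/funext => h /=; congr (_ *: (f _ - _)).
  by rewrite [h%:A]mulr1 scalerDl addrCA.
split; first by rewrite /derivable e; exact: diff_derivable.
by rewrite /derive e.
Qed.

Lemma continuous_line (f : V -> K) (b y : V) : continuous f ->
  continuous (fun s : K => f (y + s *: b)).
Proof.
move=> cf s; apply: (@continuous_comp _ _ _ (fun s : K => y + s *: b) f); last exact: cf.
apply: cvgD; first exact: cvg_cst.
by apply: cvgZr_tmp; exact: cvg_id.
Qed.

Lemma line_FTC (f : V -> K) (b y : V) (h : K) : (forall x, differentiable f x) ->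
  continuous (fun x => 'D_b f x) -> 0 < h ->
  (\int[leb]_(s in `[0%R, h]) ('D_b f (y + s *: b)%R)%:E = (f (y + h *: b)%R - f y)%:E)%E.
Proof.
move=> df cf h0.
have dl s : is_derive s (1 : K) (fun s => f (y + s *: b)) ('D_b f (y + s *: b)).
  exact: derivable_line.
rewrite (@continuous_FTC2 _ (fun s => 'D_b f (y + s *: b)) (fun s => f (y + s *: b)))//.
- by rewrite scale0r addr0.
- by apply: continuous_subspaceT; exact: (@continuous_line (fun x => 'D_b f x)).
- have cl : continuous (fun s : K => f (y + s *: b)).
    by apply: continuous_line => x; apply: differentiable_continuous.
  split.
  + by move=> s _; have [] := dl s.
  + by apply: cvg_at_right_filter; exact: cl.
  + by apply: cvg_at_left_filter; exact: cl.
- by move=> s _; rewrite derive1E; have [_ ->] := dl s.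
Qed.

Lemma cpt_support_bounded (f : V -> K) C : continuous f -> compact C ->
  (forall x, ~ C x -> f x = 0) -> exists2 B, 0 <= B & forall x, `|f x| <= B.
Proof.
move=> cf cC f0.
have : compact (f @` C) by apply: continuous_compact => //; exact: continuous_subspaceT.
move=> /compact_bounded [M [Mr hM]].
exists (`|M| + 1) => [|x]; first by rewrite addr_ge0.
have [Cx|Cx] := pselect (C x); last by rewrite f0// normr0 addr_ge0.
apply: (hM (`|M| + 1)); last by exists x.
by rewrite (le_lt_trans (ler_norm M))// ltrDl.
Qed.

Lemma derive_out (f : V -> K) (C : set V) v : compact C ->
  (forall x, ~ C x -> f x = 0) -> forall x, ~ C x -> 'D_v f x = 0.
Proof.
move=> cC f0 x Cx.
rewrite (@near_eq_derive _ _ _ f (cst 0)) ?derive_cst//.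
have oC : open (~` C).
  by apply: closed_openC; apply: compact_closed cC; exact: norm_hausdorff.
have : nbhs x (~` C) by apply: open_nbhs_nbhs.
by apply: filterS => z /f0.
Qed.

Lemma derive_sum_basis (f : V -> K) (b x : V) : differentiable f x ->
  'D_b f x = \sum_i b i 0 * 'D_(basis_vec i) f x.
Proof.
move=> df; rewrite deriveE//.
have {1}-> : b = \sum_i b i 0 *: basis_vec i.
  by rewrite {1}(matrix_sum_delta b); apply: eq_bigr => i _; rewrite big_ord1.
rewrite linear_sum; apply: eq_bigr => i _.
by rewrite linearZ deriveE.
Qed.

Lemma test_function_derive (f : V -> K) b : test_function f ->
  [/\ forall x, differentiable f x, continuous (fun x => 'D_b f x) &
   forall i, continuous (fun x => 'D_(basis_vec i) f x)].
Proof.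
move=> [Cf _]; have := Cf 1%N; rewrite C_kSP => -[df cDf]; split => //.
have -> : (fun x => 'D_b f x) = fun x => \sum_i b i 0 * 'D_(basis_vec i) f x.
  by apply/funext => x; exact: derive_sum_basis.
move=> x; apply: (@cvg_big _ _ +%R 0 xpredT _ V (nbhs x) _ (fun i x => b i 0 * 'D_(basis_vec i) f x)
   (fun i => b i 0 * 'D_(basis_vec i) f x) (nbhs_filter x)) => [|i _]; first exact: add_continuous.
by apply: cvgM; [exact: cvg_cst|exact: cDf].
Qed.

End line_calculus.

Section parametric_integrals.
Context {K : realType} d1 d2 (T1 : measurableType d1) (T2 : measurableType d2).
Variables (m1 : {sigma_finite_measure set T1 -> \bar K}).
Variables (m2 : {sigma_finite_measure set T2 -> \bar K}).

Lemma measurable_param_Rintegral (f : T1 * T2 -> K) : measurable_fun setT f ->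
  measurable_fun setT (fun x => \int[m2]_y f (x, y))%R.
Proof.
move=> mf; have mfE : measurable_fun setT (EFin \o f) by exact/measurable_EFinP.
have -> : (fun x => \int[m2]_y f (x, y))%R =
  (fun x => fine (\int[m2]_y (EFin \o f)^\+ (x, y) - \int[m2]_y (EFin \o f)^\- (x, y)))%E.
  by apply/funext => x; rewrite /Rintegral integralE; congr (fine (_ - _)%E);
     apply: eq_integral => y _; rewrite !unlock.
apply: (measurableT_comp (fine_measurable _)) => //.
apply: emeasurable_funB.
  apply: (measurable_fun_fubini_tonelli_F (m2 := m2) (EFin \o f)^\+%E) => //.
  exact: measurable_funepos.
apply: (measurable_fun_fubini_tonelli_F (m2 := m2) (EFin \o f)^\-%E) => //.
exact: measurable_funeneg.
Qed.

Lemma ae_integrable_param (f : T1 * T2 -> K) : measurable_fun setT f ->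
  (m1 \x m2)%E.-integrable setT (EFin \o f) ->
  {ae m1, forall x, m2.-integrable setT (fun y => (f (x, y))%:E)}.
Proof.
move=> mf fi; have mfE : measurable_fun setT (EFin \o f) by exact/measurable_EFinP.
have h := (integrable12ltyP m1 m2 mfE).1 fi.
have mF : measurable_fun setT (fun x => \int[m2]_y `|(EFin \o f) (x, y)|)%E.
  apply: (measurable_fun_fubini_tonelli_F (m2 := m2) (abse \o (EFin \o f))) => [|z].
    exact: measurableT_comp.
  exact: abse_ge0.
have iF : m1.-integrable setT (fun x => \int[m2]_y `|(EFin \o f) (x, y)|)%E.
  apply/integrableP; split => //.
  under eq_integral do rewrite gee0_abs ?integral_ge0//.
  exact: h.
have := integrable_ae measurableT iF; apply: filterS => x /(_ I) hx.
apply/integrableP; split.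
  by apply: (measurableT_comp mfE); exact: measurable_pair1.
by rewrite ltey_eq hx.
Qed.

Lemma integrable_prod_mul (f : T1 -> K) (g : T2 -> K) :
  m1.-integrable setT (EFin \o f) -> m2.-integrable setT (EFin \o g) ->
  (m1 \x m2)%E.-integrable setT (EFin \o (fun z => f z.1 * g z.2)).
Proof.
move=> fi gi.
have mf : measurable_fun setT f by apply/measurable_EFinP; exact: (measurable_int m1 fi).
have mg : measurable_fun setT g by apply/measurable_EFinP; exact: (measurable_int m2 gi).
have mfg : measurable_fun setT (fun z : T1 * T2 => f z.1 * g z.2).
  by apply: measurable_funM; exact: measurableT_comp.
apply/integrable12ltyP; first exact/measurable_EFinP.
have [_ fo] := (integrableP _ _ _ fi).
have [_ go] := (integrableP _ _ _ gi).
rewrite [ltLHS](_ : _ = \int[m1]_x (`|(EFin \o f) x| * \int[m2]_y `|(EFin \o g) y|))%E; last first.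
  apply: eq_integral => x _; rewrite -ge0_integralZl//.
  - by apply: eq_integral => y _; rewrite /= normrM EFinM.
  - by apply: measurableT_comp => //; exact/measurable_EFinP.
rewrite ge0_integralZr//.
- by rewrite lte_mul_pinfty// ?integral_ge0// ge0_fin_numE ?integral_ge0.
- by apply: measurableT_comp => //; exact/measurable_EFinP.
- exact: integral_ge0.
Qed.

End parametric_integrals.

(** * Averages over segments and their duality with translations *)

Section shift_integrals.
Context {K : realType} {n : nat}.
Local Notation V := 'cV[K]_n.
Local Notation RT := (measurableTypeR K).
Local Notation leb := (@lebesgue_measure K).
Local Notation mu := (lebesgueV K n).

Lemma integral_itv_indic (h : K) (f : K -> \bar K) :
  (\int[leb]_(s in `[0%R, h]) f s = \int[leb]_s (f s * (\1_(`[0%R, h]%classic) s)%:E))%E.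
Proof.
rewrite integral_mkcond; apply: eq_integral => s _.
by rewrite patchE indicE; case: ifPn => _; rewrite ?mule1 ?mule0.
Qed.

Lemma Rintegral_itv_indic (h : K) (f : K -> K) :
  (\int[leb]_(s in `[0%R, h]) f s = \int[leb]_s (f s * (\1_(`[0%R, h]%classic) s)))%R.
Proof. by rewrite /Rintegral integral_itv_indic. Qed.

Lemma measurable_sndR d (T : measurableType d) :
  measurable_fun setT (fun z : T * RT => z.2 : K).
Proof. exact: (@measurable_snd _ _ T RT). Qed.

Lemma measurable_indicR (h : K) : measurable_fun setT (\1_(`[0, h]%classic) : RT -> K).
Proof. exact: measurable_indic. Qed.

Lemma measurable_indic_sndR d (T : measurableType d) (h : K) :
  measurable_fun setT (fun z : T * RT => \1_(`[0, h]%classic) z.2 : K).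
Proof. exact: (measurableT_comp (measurable_indicR h) (@measurable_snd _ _ T RT)). Qed.

Lemma measurable_shift_line (b : V) (c : K) :
  measurable_fun setT (fun z : V * RT => z.1 + (c * (z.2 : K)) *: b).
Proof.
apply: measurable_addmx => //; apply: measurable_scalemx => //.
by apply: measurable_funM; [exact: measurable_cst|exact: measurable_sndR].
Qed.

Lemma integrable_indic_itv (h : K) : leb.-integrable setT (EFin \o (\1_(`[0, h]%classic) : RT -> K)).
Proof.
apply/integrableP; split; first by apply/measurable_EFinP; exact: measurable_indicR.
under eq_integral => s _ do rewrite /= ger0_norm ?indicE//.
rewrite integral_indic// setIT.
by rewrite /= lebesgue_measure_itv/=; case: ifP => _; rewrite -?EFinD ltry.
Qed.

Section window.
Variables (w psi : V -> K) (b : V) (h B : K) (k : nat).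
Hypotheses (lw : loc w) (mpsi : measurable_fun setT psi).
Hypotheses (psiB : forall x, `|psi x| <= B) (psi0 : forall x, ~ cube k x -> psi x = 0).

Let B0 : 0 <= B. Proof. exact: le_trans (psiB 0). Qed.

Let mw : measurable_fun setT w. Proof. exact: loc_measurable. Qed.

(** For fixed s, [F1] and [F2] are exchanged by the translation by s b. The support of [F1] lies in
    a fixed cube, which makes it integrable on the product; [F2] inherits this from translation
    invariance. *)
Let F1 (z : V * RT) := w z.1 * psi (z.1 + (- 1 * z.2) *: b) * \1_(`[0, h]%classic) z.2.
Let F2 (z : V * RT) := w (z.1 + (1 * z.2) *: b) * psi z.1 * \1_(`[0, h]%classic) z.2.

Let mF1 : measurable_fun setT F1.
Proof.
apply: measurable_funM; last exact: measurable_indic_sndR.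
apply: measurable_funM; first exact: measurableT_comp.
by apply: (measurableT_comp mpsi); exact: measurable_shift_line.
Qed.

Let mF2 : measurable_fun setT F2.
Proof.
apply: measurable_funM; last exact: measurable_indic_sndR.
apply: measurable_funM; last exact: measurableT_comp.
by apply: (measurableT_comp mw); exact: measurable_shift_line.
Qed.

Let iF1 : (mu \x leb)%E.-integrable setT (EFin \o F1).
Proof.
(* Chosen so that [cube l] contains every translate of [cube k] by s b with 0 <= s <= h. *)
pose M := k%:R + `|h| * `|b|.
pose l := (Num.truncn M).+1.
have lM : M <= l%:R by rewrite ltW// truncnS_gt.
have iw : mu.-integrable setT (EFin \o (fun x => w x * (B * \1_(cube l) x))).
  apply: (@loc_mul_integrable _ _ w _ (cube l) B) => //.
  - exact: compact_cube.
  - apply: measurable_funM => //; apply: measurable_indic; exact: measurable_cube.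
  - move=> x; rewrite normrM (ger0_norm B0) ler_piMr// indicE.
    by case: (x \in cube l); rewrite /= ?normr1 ?normr0.
  - by move=> x xl; rewrite indicE memNset// mulr0.
apply: le_integrable (integrable_prod_mul iw (integrable_indic_itv h)) => //.
  exact/measurable_EFinP.
move=> [y s] _ /=; rewrite lee_fin /F1 /= !normrM -!mulrA ler_wpM2l//.
rewrite (ger0_norm B0) indicE [in X in _ <= X]indicE.
have [sh|sh] := boolP (s \in `[0, h]%classic); last by rewrite normr0 !mulr0.
rewrite normr1 !mulr1; have [yl|yl] := boolP (y \in cube l).
  by rewrite normr1 mulr1.
rewrite psi0 ?normr0 ?mulr0// => yk; move/negP: yl; apply; rewrite inE /cube /=.
apply: le_trans lM.
have -> : y = (y + (- 1 * s) *: b) + s *: b by rewrite mulN1r scaleNr subrK.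
apply: (le_trans (ler_normD _ _)); apply: lerD => //.
move: sh; rewrite inE /= in_itv /= => /andP[s0 sh].
by rewrite normrZ ler_wpM2r// ger0_norm// (le_trans sh)// ler_norm.
Qed.

Let slice s : (\int[mu]_y `|(EFin \o F2) (y, s)| = \int[mu]_y `|(EFin \o F1) (y, s)|)%E.
Proof.
rewrite -(@ge0_integral_translateV _ _ ((1 * s) *: b) (fun y => `|(EFin \o F1) (y, s)|%E)).
- apply: eq_integral => y _; rewrite /= /F1 /F2 /=.
  by rewrite mulN1r scaleNr mul1r addrK.
- apply: measurableT_comp => //; apply/measurable_EFinP.
  by apply: (measurableT_comp mF1); exact: measurable_pair2.
- by [].
Qed.

Let sliceR s : (\int[mu]_y (EFin \o F2) (y, s) = \int[mu]_y (EFin \o F1) (y, s))%E.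
Proof.
rewrite -(@integral_translateV _ _ ((1 * s) *: b) (fun y => (EFin \o F1) (y, s))%E).
- apply: eq_integral => y _; rewrite /= /F1 /F2 /=.
  by rewrite mulN1r scaleNr mul1r addrK.
- apply/measurable_EFinP.
  by apply: (measurableT_comp mF1); exact: measurable_pair2.
Qed.

Let iF2 : (mu \x leb)%E.-integrable setT (EFin \o F2).
Proof.
apply/integrable21ltyP; first exact/measurable_EFinP.
under eq_integral do rewrite slice.
by apply: (integrable21ltyP mu leb _).1 => //; exact/measurable_EFinP.
Qed.

Lemma window_fubini1 :
  (\int[mu]_y \int[leb]_(s in `[0%R, h]) (w y * psi (y - s *: b)%R)%:E =
   \int[leb]_(s in `[0%R, h]) \int[mu]_y (w y * psi (y - s *: b)%R)%:E)%E.
Proof.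
rewrite [RHS]integral_itv_indic.
transitivity (\int[mu]_y \int[leb]_s (EFin \o F1) (y, s))%E.
  apply: eq_integral => y _; rewrite integral_itv_indic; apply: eq_integral => s _.
  by rewrite /F1 /= mulN1r scaleNr EFinM.
rewrite (Fubini iF1); apply: eq_integral => s _; rewrite indicE; case: (boolP (s \in _)) => hs.
  by rewrite mule1; apply: eq_integral => y _; rewrite /F1 /= indicE hs mulr1 mulN1r scaleNr.
rewrite mule0; rewrite -[RHS](@integral0 _ _ _ mu setT); apply: eq_integral => y _.
by rewrite /F1 /= indicE (negbTE hs) mulr0.
Qed.

Lemma window_ae : {ae mu, forall y, cube k y -> psi y != 0 ->
  leb.-integrable `[0, h] (fun s => (w (y + s *: b))%:E)}.
Proof.
have := ae_integrable_param (m1 := mu) (m2 := leb) mF2 iF2; apply: filterS => y hy ky py.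
have : leb.-integrable setT ((fun s => (w (y + s *: b))%:E) \_ `[0, h]).
  rewrite (_ : _ \_ _ = fun s => ((psi y)^-1 * F2 (y, s))%:E).
    exact: (integrableZl measurableT (psi y)^-1 hy).
  apply/funext => s; rewrite patchE /F2 /= indicE; case: ifPn => _.
    by rewrite mul1r mulr1 mulrCA mulVf// mulr1.
  by rewrite !mulr0.
by move/integrable_restrict; rewrite setTI; apply.
Qed.

Lemma window_fubini2 :
  (\int[mu]_y \int[leb]_(s in `[0%R, h]) (w (y + s *: b)%R * psi y)%:E =
   \int[leb]_(s in `[0%R, h]) \int[mu]_y (w y * psi (y - s *: b)%R)%:E)%E.
Proof.
rewrite [RHS]integral_itv_indic.
transitivity (\int[mu]_y \int[leb]_s (EFin \o F2) (y, s))%E.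
  apply: eq_integral => y _; rewrite integral_itv_indic; apply: eq_integral => s _.
  by rewrite /F2 /= mul1r EFinM.
rewrite (Fubini iF2); apply: eq_integral => s _; rewrite sliceR indicE; case: (boolP (s \in _)) => hs.
  by rewrite mule1; apply: eq_integral => y _; rewrite /F1 /= indicE hs mulr1 mulN1r scaleNr.
rewrite mule0; rewrite -[RHS](@integral0 _ _ _ mu setT); apply: eq_integral => y _.
by rewrite /F1 /= indicE (negbTE hs) mulr0.
Qed.

Lemma window_abs_lty :
  (\int[mu]_y \int[leb]_(s in `[0%R, h]) `|w (y + s *: b)%R * psi y|%:E < +oo)%E.
Proof.
have mF2E : measurable_fun setT (EFin \o F2) by exact/measurable_EFinP.
apply: le_lt_trans ((integrable12ltyP mu leb mF2E).1 iF2); rewrite le_eqVlt; apply/orP; left; apply/eqP/esym.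
apply: eq_integral => y _; rewrite integral_itv_indic; apply: eq_integral => s _.
by rewrite /F2 /= mul1r -EFinM normrM [`|\1_ _ _|]ger0_norm ?indicE.
Qed.

Lemma measurable_window_inner :
  measurable_fun setT (fun y : V => \int[leb]_(s in `[0%R, h]) (w (y + s *: b)%R * psi y)%:E)%E /\
  measurable_fun setT (fun y : V => \int[leb]_(s in `[0%R, h]) `|w (y + s *: b)%R * psi y|%:E)%E.
Proof.
have mF2E : measurable_fun setT (EFin \o F2) by exact/measurable_EFinP.
split.
  have mf := measurable_fubini_F iF2.
  apply: eq_measurable_fun mf => y _; rewrite /fubini_F integral_itv_indic; apply: eq_integral => s _.
  by rewrite /F2 /= mul1r EFinM.
have mA : measurable_fun setT (abse \o (EFin \o F2)) by exact: measurableT_comp.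
have mf := @measurable_fun_fubini_tonelli_F _ _ _ _ _ leb (abse \o (EFin \o F2)) mA (fun z => abse_ge0 _).
apply: eq_measurable_fun mf => y _; rewrite /fubini_F integral_itv_indic; apply: eq_integral => s _.
by rewrite /F2 /= mul1r -EFinM normrM [`|\1_ _ _|]ger0_norm ?indicE.
Qed.

End window.
Definition window (w : V -> K) (b : V) (h : K) (y : V) : K :=
  (\int[leb]_(s in `[0%R, h]) w (y + s *: b))%R.

Lemma measurable_lineR (w : V -> K) (b y : V) : measurable_fun setT w ->
  measurable_fun setT (fun s : RT => w (y + (s : K) *: b)).
Proof.
move=> mw; apply: (measurableT_comp mw).
have h := measurableT_comp (measurable_shift_line b 1) (@measurable_pair1 _ _ V RT y).
by apply: eq_measurable_fun h => s _ /=; rewrite mul1r.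
Qed.

Lemma measurable_window w b h : measurable_fun setT w -> measurable_fun setT (window w b h).
Proof.
move=> mw; rewrite (_ : window w b h =
  fun y => (\int[leb]_s (w (y + (1 * s) *: b) * \1_(`[0%R, h]%classic) s))%R); last first.
  apply/funext => y; rewrite /window Rintegral_itv_indic.
  by apply: eq_Rintegral => s _; rewrite mul1r.
apply: (@measurable_param_Rintegral _ _ _ V RT leb
   (fun z : V * RT => w (z.1 + (1 * (z.2 : K)) *: b) * \1_(`[0%R, h]%classic) z.2)).
apply: measurable_funM; last exact: measurable_indic_sndR.
by apply: (measurableT_comp mw); exact: measurable_shift_line.
Qed.

Lemma cube_indic_bound k (x : V) : `|\1_(cube k) x| <= 1 :> K.
Proof. by rewrite indicE; case: (_ \in _); rewrite ?normr1 ?normr0. Qed.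

Lemma cube_indic_out k (x : V) : ~ cube k x -> \1_(cube k) x = 0 :> K.
Proof. by move=> h; rewrite indicE memNset. Qed.

Lemma window_integrable_ae w b h : loc w ->
  {ae mu, forall y, leb.-integrable `[0, h] (fun s => (w (y + s *: b))%:E)}.
Proof.
move=> lw.
have : {ae mu, forall y k, cube k y -> (\1_(cube k) y : K) != 0 ->
  leb.-integrable `[0, h] (fun s => (w (y + s *: b))%:E)}.
  apply/ae_foralln => k; apply: (@window_ae w (\1_(cube k)) b h 1 k lw).
  - by apply: measurable_indic; exact: measurable_cube.
  - exact: cube_indic_bound.
  - exact: cube_indic_out.
apply: filterS => y hy.
have [k _ kx] : (\bigcup_k cube k) y by rewrite bigcup_cube.
by apply: (hy k kx); rewrite indicE mem_set// oner_neq0.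
Qed.

Lemma le_window w b h y : measurable_fun setT w ->
  (`|window w b h y|%:E <= \int[leb]_(s in `[0%R, h]) `|w (y + s *: b)|%:E)%E.
Proof.
move=> mw; have mwy := measurable_lineR b y mw.
have mwyE : measurable_fun `[0, h]%classic (fun s : RT => (w (y + (s : K) *: b))%:E).
  by apply: measurable_funTS; exact/measurable_EFinP.
have := @le_abse_integral _ _ _ leb `[0, h]%classic _ (measurable_itv _) mwyE.
apply: le_trans.
by rewrite /window /Rintegral; case: (integral _ _ _) => //= [|]; rewrite normr0 leey.
Qed.

Lemma loc_window w b h : loc w -> loc (window w b h).
Proof.
move=> lw; have mw := loc_measurable lw; have mW := measurable_window b h mw.
apply: loc_cube => // k; apply/integrableP; split.
  by apply: measurable_funTS; exact/measurable_EFinP.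
have m1 : measurable_fun setT (\1_(cube k) : V -> K).
  by apply: measurable_indic; exact: measurable_cube.
have := @window_abs_lty w (\1_(cube k)) b h 1 k lw m1 (cube_indic_bound k) (@cube_indic_out k).
apply: le_lt_trans; rewrite integral_mkcond; apply: ge0_le_integral => //.
- move=> y _; rewrite patchE; case: ifP => // _; exact: abse_ge0.
- apply/(measurable_restrictT _ _).1; first exact: measurable_cube.
  apply: measurable_funTS; apply: measurableT_comp => //; exact/measurable_EFinP.
- by have [] := measurable_window_inner b h lw m1 (cube_indic_bound k) (@cube_indic_out k).
- move=> y _; rewrite patchE; case: ifPn => [yk|_]; last exact: integral_ge0.
  apply: le_trans (le_window b h y mw) _; rewrite le_eqVlt; apply/orP; left; apply/eqP.
  by apply: eq_integral => s _; rewrite indicE yk mulr1.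
Qed.

(** The average over a segment is self-adjoint up to reversing its direction: it can be carried by
    the translated function psi instead of w. *)
Lemma window_pairing w (psi : V -> K) b h B k : loc w -> measurable_fun setT psi ->
  (forall x, `|psi x| <= B) -> (forall x, ~ cube k x -> psi x = 0) ->
  (\int[mu]_y (window w b h y * psi y)%:E =
   \int[leb]_(s in `[0%R, h]) \int[mu]_y (w y * psi (y - s *: b)%R)%:E)%E.
Proof.
move=> lw mpsi psiB psi0; rewrite -(window_fubini2 b h lw mpsi psiB psi0).
have mw := loc_measurable lw; have mW := measurable_window b h mw.
apply: ae_eq_integral => //.
- by apply/measurable_EFinP; exact: measurable_funM.
- by have [] := measurable_window_inner b h lw mpsi psiB psi0.
- apply: filterS (window_integrable_ae b h lw) => y iy _.
  rewrite /window /Rintegral EFinM fineK; last exact: (integrable_fin_num _ iy).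
  by rewrite -integralZr.
Qed.

End shift_integrals.

(** * Weak gradients integrated along lines *)

Section weak_gradients.
Context {K : realType} {n : nat}.
Local Notation V := 'cV[K]_n.
Local Notation RT := (measurableTypeR K).
Local Notation leb := (@lebesgue_measure K).
Local Notation mu := (lebesgueV K n).
Implicit Types (u w : V -> K) (g : V -> V).

Lemma line_integrable (f : V -> K) (b y : V) (h : K) : continuous f ->
  leb.-integrable `[0, h] (EFin \o (fun s : K => f (y + s *: b))).
Proof.
move=> cf.
apply: (@continuous_compact_integrable K (fun s : K => f (y + s *: b))).
  exact: segment_compact.
have cl : continuous (fun s : K => f (y + s *: b)) by exact: continuous_line.
exact: (@continuous_subspaceT K K _ _ cl).
Qed.

Lemma Rintegral_sumr d (T : measurableType d) (m : {measure set T -> \bar K}) (I : Type) (r : seq I)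
   (f : I -> T -> K) : (forall i, m.-integrable setT (EFin \o f i)) ->
  m.-integrable setT (EFin \o (fun x => \sum_(i <- r) f i x)) /\
  (\int[m]_x (\sum_(i <- r) f i x) = \sum_(i <- r) \int[m]_x f i x)%R.
Proof.
move=> hf; elim: r => [|i r [ih1 ih2]].
  split; last first.
    under eq_Rintegral do rewrite big_nil.
    by rewrite big_nil /Rintegral integral0.
  apply: (eq_integrable measurableT (cst 0%E)); last exact: integrable0.
  by move=> x _; rewrite /= big_nil.
have e x : \sum_(j <- i :: r) f j x = f i x + \sum_(j <- r) f j x by rewrite big_cons.
split.
  apply: (eq_integrable measurableT (fun x => (f i x)%:E + (\sum_(j <- r) f j x)%:E)%E).
    by move=> x _; rewrite /= e EFinD.
  exact: (integrableD measurableT (hf i) ih1).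
under eq_Rintegral do rewrite e.
by rewrite RintegralD// ih2 big_cons.
Qed.

Lemma loc_sum (I : Type) (r : seq I) (f : I -> V -> K) : (forall i, loc (f i)) ->
  loc (fun x => \sum_(i <- r) f i x).
Proof.
move=> lf C cC; have mC := compact_measurableV cC; elim: r => [|i r ih].
  apply: (eq_integrable mC (cst 0%E)); last exact: integrable0.
  by move=> x _; rewrite /= big_nil.
apply: (eq_integrable mC (fun x => (f i x)%:E + (\sum_(j <- r) f j x)%:E)%E).
  by move=> x _; rewrite /= big_cons EFinD.
by apply: integrableD => //; exact: lf.
Qed.

Lemma loc_scale c u : loc u -> loc (fun x => c * u x).
Proof. by move=> lu C cC; exact: (integrableZl (compact_measurableV cC) c (lu _ cC)). Qed.

Lemma loc_add u w : loc u -> loc w -> loc (fun x => u x + w x).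
Proof. by move=> lu lw C cC; exact: (integrableD (compact_measurableV cC) (lu _ cC) (lw _ cC)). Qed.

Lemma loc_shift u c : loc u -> loc (fun x => u (x + c)).
Proof.
move=> lu; have mu_ := loc_measurable lu.
have msh : measurable_fun setT (fun x : V => x + c) by exact: measurable_translateV.
apply: loc_cube => [|k]; first exact: measurableT_comp.
have m1 : measurable_fun setT (\1_(cube k) : V -> K).
  by apply: measurable_indic; exact: measurable_cube.
have : mu.-integrable setT (EFin \o (fun x => u x * \1_(cube k) (x - c))).
  apply: (@loc_mul_integrable _ _ u _ ((fun y => y + c) @` cube k) 1 lu).
  - apply: continuous_compact; last exact: compact_cube.
    by apply: continuous_subspaceT; exact: continuous_shiftV.
  - by apply: (measurableT_comp m1); exact: measurable_translateV.
  - by move=> x; exact: cube_indic_bound.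
  - move=> x hx; apply: cube_indic_out => h; apply: hx; exists (x - c) => //.
    by rewrite subrK.
move=> /(integrable_translateV c) /= h.
have : mu.-integrable setT ((EFin \o (fun x => u (x + c))) \_ (cube k)).
  apply: eq_integrable h => // x _; rewrite addrK indicE patchE.
  by case: ifP => _; rewrite ?mulr1 ?mulr0.
by move/integrable_restrict; rewrite setTI; apply => //; exact: measurable_cube.
Qed.

(** The form of [is_weak_gradient] for a real-valued potential u, with its local integrability
    included; [weak_gradient_ae] links the two notions. *)
Definition wgrad u g : Prop := [/\ loc u, forall i, loc (fun x => g x i 0) &
  forall phi, test_function phi -> forall i,
   (\int[mu]_x (u x * 'D_(basis_vec i) phi x) = - \int[mu]_x (g x i 0 * phi x))%R].

Lemma test_support (phi : V -> K) : test_function phi -> exists (k : nat) (B : K),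
  [/\ continuous phi, forall x, `|phi x| <= B & forall x, ~ cube k x -> phi x = 0].
Proof.
move=> [Cphi [C [cC hC]]]; have cphi : continuous phi := Cphi 0.
have [B B0 hB] := cpt_support_bounded cphi cC hC.
have [k Ck] := compact_sub_cube cC.
by exists k, B; split => // x kx; apply: hC => /Ck.
Qed.

Lemma test_derive_support (phi : V -> K) (v : V) : test_function phi -> exists (k : nat) (B : K),
  [/\ continuous (fun x => 'D_v phi x), forall x, `|'D_v phi x| <= B &
   forall x, ~ cube k x -> 'D_v phi x = 0].
Proof.
move=> tphi; have [_ cD _] := test_function_derive v tphi.
move: tphi => [Cphi [C [cC hC]]].
have hD := derive_out v cC hC.
have [B B0 hB] := cpt_support_bounded cD cC hD.
have [k Ck] := compact_sub_cube cC.
by exists k, B; split => // x kx; apply: hD => /Ck.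
Qed.

Lemma test_integrable u phi : loc u -> test_function phi ->
  mu.-integrable setT (EFin \o (fun x => u x * phi x)).
Proof.
move=> lu /test_support [k [B [cphi hB h0]]].
apply: (loc_mul_integrable lu (@compact_cube _ _ k) _ hB h0).
exact: continuous_measurable_mx.
Qed.

Lemma test_derive_integrable u phi v : loc u -> test_function phi ->
  mu.-integrable setT (EFin \o (fun x => u x * 'D_v phi x)).
Proof.
move=> lu /(test_derive_support v) [k [B [cphi hB h0]]].
apply: (loc_mul_integrable lu (@compact_cube _ _ k) _ hB h0).
exact: continuous_measurable_mx.
Qed.

Lemma loc_dotp g b : (forall i, loc (fun x => g x i 0)) -> loc (fun x => dotp (g x) b).
Proof.
move=> lg; rewrite (_ : (fun x => _) = fun x => \sum_i b i 0 * g x i 0).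
  by apply: loc_sum => i; exact: loc_scale.
by apply/funext => x; rewrite dotpE; apply: eq_bigr => i _; rewrite mulrC.
Qed.

Lemma wgrad_dir u g b phi : wgrad u g -> test_function phi ->
  (\int[mu]_x (u x * 'D_b phi x) = - \int[mu]_x (dotp (g x) b * phi x))%R.
Proof.
move=> [lu lg hg] tphi.
have [df _ _] := test_function_derive b tphi.
transitivity (\int[mu]_x (\sum_i b i 0 * (u x * 'D_(basis_vec i) phi x)))%R.
  apply: eq_Rintegral => x _; rewrite derive_sum_basis// mulr_sumr.
  by apply: eq_bigr => i _; rewrite mulrCA.
have [_ ->] := @Rintegral_sumr _ _ mu _ (index_enum 'I_n) (fun i x => b i 0 * (u x * 'D_(basis_vec i) phi x))
  (fun i => integrableZl measurableT (b i 0) (test_derive_integrable (basis_vec i) lu tphi)).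
transitivity (- \int[mu]_x (\sum_i b i 0 * (g x i 0 * phi x)))%R; last first.
  congr (- _); apply: eq_Rintegral => x _; rewrite dotpE mulr_suml.
  by apply: eq_bigr => i _; rewrite mulrCA mulrA.
have [_ ->] := @Rintegral_sumr _ _ mu _ (index_enum 'I_n) (fun i x => b i 0 * (g x i 0 * phi x))
  (fun i => integrableZl measurableT (b i 0) (test_integrable (lg i) tphi)).
rewrite -sumrN; apply: eq_bigr => i _.
rewrite RintegralZl//; last exact: test_derive_integrable.
by rewrite RintegralZl// ?hg ?mulrN//; exact: test_integrable.
Qed.

Lemma EFin_Rintegral d (T : measurableType d) (m : {measure set T -> \bar K}) (f : T -> K) :
  m.-integrable setT (EFin \o f) -> (\int[m]_x f x)%R%:E = (\int[m]_x (f x)%:E)%E.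
Proof. by move=> hf; rewrite /Rintegral fineK//; exact: (integrable_fin_num _ hf). Qed.

(** Against a test function phi, the segment average of v becomes an integral over s of v against
    phi (x - s b). The weak gradient turns it into u against a derivative of the translated phi, and
    integration in s leaves u (phi (x - h b) - phi (x)). The two sides thus have the same pairings,
    and [loc_fundamental] concludes. The null set depends on h. *)
Lemma line_identity u g b (h : K) : wgrad u g -> 0 < h ->
  {ae mu, forall y, u (y + h *: b) = u y + window (fun x => dotp (g x) b) b h y}.
Proof.
move=> wug h0; have [lu lg hg] := wug.
pose v x := dotp (g x) b.
have lv : loc v by exact: loc_dotp.
pose hh y := u (y + h *: b) + (- u y + - window v b h y).
have luh : loc (fun y => u (y + h *: b)) by exact: loc_shift.
have lW : loc (window v b h) by exact: loc_window.
have lhh : loc hh by apply: loc_add => //; apply: loc_add; exact: loc_opp.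
suff : {ae mu, forall x, hh x = 0}.
  apply: filterS => y; rewrite /hh => /eqP; rewrite -opprD subr_eq0 => /eqP ->.
  by [].
apply: loc_fundamental => // phi tphi.
have [k [B [cphi hB h0phi]]] := test_support tphi.
have mphi := continuous_measurable_mx cphi.
have [dphi cD _] := test_function_derive (- b) tphi.
have [k' [B' [_ hB' h0']]] := test_derive_support (- b) tphi.
have mD := continuous_measurable_mx cD.
have tshift s : test_function (fun x => phi (x - s *: b)) by exact: test_function_shift.
have pair : (\int[mu]_y (window v b h y * phi y)%:E =
   \int[mu]_y (u y * (phi (y - h *: b)%R - phi y))%:E)%E.
  rewrite (window_pairing b h lv mphi hB h0phi).
  transitivity (\int[leb]_(s in `[0%R, h]) \int[mu]_y (u y * 'D_(- b) phi (y - s *: b)%R)%:E)%E.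
    apply: eq_integral => s _.
    have e1 : (fun x => 'D_(- b) phi (x - s *: b)) = (fun x => 'D_(- b) (fun x => phi (x - s *: b)) x).
      by apply/funext => x; exact: (esym (derive_translate phi (- (s *: b)) x (- b))).
    have := wgrad_dir (- b) wug (tshift s) => e2.
    rewrite -EFin_Rintegral; last exact: test_integrable.
    rewrite -EFin_Rintegral; last first.
      have e3 x : u x * 'D_(- b) (fun z => phi (z - s *: b)) x = u x * 'D_(- b) phi (x - s *: b).
        by congr (_ * _); exact: (congr1 (fun f => f x) (esym e1)).
      exact: (eq_integrable measurableT _ _ (fun x _ => congr1 EFin (e3 x)) (test_derive_integrable (- b) lu (tshift s))).
    congr (_%:E); rewrite [RHS](_ : _ = \int[mu]_x (u x * 'D_(- b) (fun x => phi (x - s *: b)%R) x))%R; last first.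
      by apply: eq_Rintegral => x _; congr (_ * _); exact: (congr1 (fun f => f x) e1).
    rewrite e2 -[LHS]opprK; congr (- _).
    rewrite -mulN1r -RintegralZl//; last exact: test_integrable.
    by apply: eq_Rintegral => x _; rewrite /v dotpNr mulN1r mulNr.
  rewrite -(window_fubini1 b h lu mD hB' h0'); apply: eq_integral => y _.
  have := line_FTC y dphi cD h0; rewrite scalerN => e.
  have ic := @line_integrable (fun x => 'D_(- b) phi x) (- b) y h cD.
  have mI : measurable (`[0, h]%classic : set RT) by [].
  transitivity (\int[leb]_(s in `[0%R, h]) ((u y)%:E * ('D_(- b) phi (y + s *: - b))%:E))%E.
    by apply: eq_integral => s _; rewrite scalerN EFinM.
  transitivity ((u y)%:E * (phi (y - h *: b) - phi y)%:E)%E; last by rewrite EFinM.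
  by rewrite -e; exact: (integralZl mI ic (u y)).
have iu1 := test_integrable lu tphi.
have iuh := test_integrable luh tphi.
have iW := test_integrable lW tphi.
have ius := test_integrable lu (tshift h).
have e3 : (\int[mu]_y (u (y + h *: b) * phi y) = \int[mu]_y (u y * phi (y - h *: b)))%R.
  rewrite /Rintegral; congr fine.
  rewrite -(@integral_translateV _ _ (h *: b) (fun y => (u y * phi (y - h *: b)%R)%:E)).
    by apply: eq_integral => y _; rewrite addrK.
  exact: (measurable_int mu ius).
have e4 : (\int[mu]_y (window v b h y * phi y) = \int[mu]_y (u y * phi (y - h *: b)) - \int[mu]_y (u y * phi y))%R.
  rewrite -RintegralB// /Rintegral; congr fine; rewrite pair.
  by apply: eq_integral => y _; rewrite mulrBr.
have e5 : (\int[mu]_y (hh y * phi y) = 0)%R.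
  transitivity (\int[mu]_y (u (y + h *: b) * phi y - (u y * phi y + window v b h y * phi y)))%R.
    by apply: eq_Rintegral => y _; rewrite /hh; ring.
  rewrite RintegralB//; last exact: (integrableD measurableT iu1 iW).
  rewrite RintegralD// e3 e4; ring.
by rewrite -(EFin_Rintegral (test_integrable lhh tphi)) e5.
Qed.

End weak_gradients.

(** * The chain rule for the exponential of an absolutely continuous function *)

Section chain_rule.
Context {K : realType}.
Local Notation RT := (measurableTypeR K).
Local Notation leb := (@lebesgue_measure K).

Lemma expR_sub_lower (x y : K) : expR y * (x - y) <= expR x - expR y.
Proof.
have := expR_ge1Dx (x - y); rewrite expRD expRN => h.
have e0 := expR_gt0 y; rewrite lerBrDl -(ler_pM2l (_ : 0 < (expR y)^-1)) ?invr_gt0//.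
rewrite mulrDr mulrA mulVf ?gt_eqF// mul1r; apply: le_trans h _.
by rewrite mulrC.
Qed.

Lemma expR_lip (B x y : K) : `|x| <= B -> `|y| <= B -> `|expR x - expR y| <= expR B * `|x - y|.
Proof.
move=> xB yB; have h z w : z <= w -> `|w| <= B -> `|expR w - expR z| <= expR B * `|w - z|.
  move=> zw wB; rewrite !ger0_norm ?subr_ge0 ?ler_expR//.
  have := expR_sub_lower z w; rewrite -(opprB w z) -(opprB (expR w)) mulrN lerN2 => h.
  apply: (le_trans h); rewrite ler_wpM2r ?subr_ge0// ler_expR.
  exact: le_trans (ler_norm _) wB.
have [xy|/ltW yx] := leP x y; last exact: h.
by rewrite distrC (distrC x); exact: h.
Qed.

Lemma expR_taylor (B x y : K) : `|x| <= B -> `|y| <= B ->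
  `|expR x - expR y - expR y * (x - y)| <= expR B * `|x - y| ^+ 2.
Proof.
move=> xB yB; have h1 := expR_sub_lower x y.
rewrite ger0_norm ?subr_ge0//.
have h2 := expR_sub_lower y x.
apply: (@le_trans _ _ ((expR x - expR y) * (x - y))).
  by move: h2; set a := expR x; set c := expR y; nra.
rewrite (le_trans (ler_norm _))// normrM expr2 mulrA ler_wpM2r//.
exact: expR_lip.
Qed.

Section one_dim.
Variables (v : RT -> K) (H U0 : K).
Hypothesis H0 : 0 <= H.
Hypothesis iv : leb.-integrable `[0, H] (EFin \o v).

Let U s := U0 + (\int[leb]_(r in `[0%R, s]) v r)%R.
(** Controls the variation of U; being continuous and nondecreasing, it replaces the length of
    intervals in the estimates below, v being merely integrable. *)
Let m s := (\int[leb]_(r in `[0%R, s]) `|v r|)%R.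
Let B := `|U0| + m H.

Let inav : leb.-integrable `[0, H] (EFin \o (fun s => `|v s|)).
Proof. exact: (integrable_norm iv). Qed.

Let sub_int (f : RT -> K) a b : leb.-integrable `[0, H] (EFin \o f) -> 0 <= a -> b <= H ->
  leb.-integrable `]a, b] (EFin \o f).
Proof.
move=> fi a0 bH; apply: integrableS fi => //.
by move=> s /=; rewrite !in_itv/= => /andP[h1 h2]; rewrite (le_trans a0 (ltW h1)) (le_trans h2).
Qed.

Let split (f : RT -> K) a b : leb.-integrable `[0, H] (EFin \o f) -> 0 <= a -> a <= b -> b <= H ->
  (\int[leb]_(r in `[0%R, b]) f r - \int[leb]_(r in `[0%R, a]) f r = \int[leb]_(r in `]a, b]) f r)%R.
Proof.
move=> fi a0 ab bH; apply: Rintegral_itvB => //; rewrite ?bnd_simp//.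
by apply: integrableS fi => //; apply: subset_itvl; rewrite bnd_simp.
Qed.

Let mE a b : 0 <= a -> a <= b -> b <= H -> m b - m a = (\int[leb]_(r in `]a, b]) `|v r|)%R.
Proof. exact: split. Qed.

Let m_le a b : 0 <= a -> a <= b -> b <= H -> m a <= m b.
Proof. by move=> a0 ab bH; rewrite -subr_ge0 mE//; exact: Rintegral_ge0. Qed.

Let UE a b : 0 <= a -> a <= b -> b <= H -> U b - U a = (\int[leb]_(r in `]a, b]) v r)%R.
Proof. by move=> a0 ab bH; rewrite /U -(split iv)//; ring. Qed.

Let U_lip a b : 0 <= a -> a <= b -> b <= H -> `|U b - U a| <= m b - m a.
Proof.
move=> a0 ab bH; rewrite UE// mE//; apply: le_normr_Rintegral => //.
exact: sub_int.
Qed.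

Let Uset0 : U 0 = U0.
Proof. by rewrite /U set_itv1 Rintegral_set1 addr0. Qed.

Let mset0 : m 0 = 0.
Proof. by rewrite /m set_itv1 Rintegral_set1. Qed.

Let UB s : 0 <= s -> s <= H -> `|U s| <= B.
Proof.
move=> s0 sH; have -> : U s = U0 + (U s - U 0) by rewrite Uset0 addrC subrK.
rewrite (le_trans (ler_normD _ _))// lerD2l (le_trans (U_lip _ _ _))//.
by rewrite mset0 subr0 m_le.
Qed.

Let cU : {within `[0, H], continuous U}.
Proof.
move: H0; rewrite le_eqVlt => /predU1P[<-|H0'].
  by rewrite set_itv1; exact: continuous_subspace1.
have h := @parameterized_integral_continuous K 0 H v (ltW H0') iv.
by move=> s; apply: cvgD; [exact: cvg_cst|exact: h].
Qed.

Let cm : {within `[0, H], continuous m}.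
Proof. exact: (@parameterized_integral_continuous K 0 H (fun s => `|v s|) H0 inav). Qed.

Let mUv : measurable_fun `[0, H] (fun s : RT => expR (U s) * v s).
Proof.
apply: measurable_funM; last by apply/measurable_EFinP; exact: (measurable_int leb iv).
apply: (@measurableT_comp _ _ _ _ _ _ (@expR K)) => //.
by apply: subspace_continuous_measurable_fun => //.
Qed.

Lemma exp_window_integrable : leb.-integrable `[0, H] (EFin \o (fun s => expR (U s) * v s)).
Proof.
have mI : measurable (`[0, H]%classic : set RT) by [].
have i2 : leb.-integrable `[0, H] (EFin \o (fun s => expR B * v s)).
  exact: (integrableZl mI (expR B) iv).
apply: (le_integrable mI _ _ i2); first exact/measurable_EFinP.
move=> s /=; rewrite in_itv/= => /andP[s0 sH]; rewrite lee_fin !normrM ler_wpM2r//.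
rewrite !ger0_norm ?expR_ge0// ler_expR (le_trans (ler_norm _))//.
exact: UB.
Qed.

Let D s := expR (U s) - (\int[leb]_(r in `[0%R, s]) (expR (U r) * v r))%R.

(** The defect D of the chain rule is of second order in m: one half of the bound is the Taylor
    remainder of the exponential, the other the error of freezing U at a in the integral. *)
Let D_local a b : 0 <= a -> a <= b -> b <= H -> `|D b - D a| <= (2 * expR B) * (m b - m a) ^+ 2.
Proof.
move=> a0 ab bH; have aH := le_trans ab bH; have b0 := le_trans a0 ab.
have i1 := exp_window_integrable.
have iab := sub_int i1 a0 bH; have ivab := sub_int iv a0 bH.
have inab := sub_int inav a0 bH.
have mI : measurable (`]a, b]%classic : set RT) by [].
have iUv := integrableZl mI (expR (U a)) ivab.
have -> : D b - D a = (expR (U b) - expR (U a) - expR (U a) * (U b - U a)) -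
   (\int[leb]_(r in `]a, b]) ((expR (U r) - expR (U a)) * v r))%R.
  have -> : (\int[leb]_(r in `]a, b]) ((expR (U r) - expR (U a)) * v r) =
     \int[leb]_(r in `]a, b]) (expR (U r) * v r) - expR (U a) * \int[leb]_(r in `]a, b]) v r)%R.
    etransitivity; last first.
      etransitivity; first exact: (RintegralB mI iab iUv).
      congr (_ - _); exact: (RintegralZl (expR (U a)) mI ivab).
    by apply: eq_Rintegral => r _; rewrite mulrBl.
  rewrite -(UE a0 ab bH) -(split i1 a0 ab bH).
  have alg (x y p q z : K) : (x - p) - (y - q) = x - y - z - ((p - q) - z) by ring.
  exact: alg.
have mab : 0 <= m b - m a by rewrite subr_ge0 m_le.
rewrite (le_trans (ler_normB _ _))//.
rewrite (_ : 2 * _ * _ = expR B * (m b - m a) ^+ 2 + (expR B * (m b - m a)) * (m b - m a)); last by ring.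
apply: lerD.
  rewrite (le_trans (expR_taylor (UB b0 bH) (UB a0 aH)))// ler_wpM2l ?expR_ge0//.
  by rewrite lerXn2r ?nnegrE// U_lip.
have ic : leb.-integrable `]a, b] (EFin \o (fun r => (expR (U r) - expR (U a)) * v r)).
  apply: eq_integrable (integrableB mI iab iUv) => // r _ /=.
  by rewrite mulrBl EFinB.
rewrite (le_trans (le_normr_Rintegral mI ic))// [X in _ <= _ * X]mE//.
rewrite -(RintegralZl (expR B * (m b - m a)) mI inab).
apply: (le_Rintegral mI (integrable_norm ic) (integrableZl mI (expR B * (m b - m a)) inab)).
move=> r /=; rewrite in_itv/= => /andP[ar rb].
have r0 := le_trans a0 (ltW ar); have rH := le_trans rb bH.
rewrite normrM ler_wpM2r// (le_trans (expR_lip (UB r0 rH) (UB a0 aH)))//.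
rewrite ler_wpM2l ?expR_ge0// (le_trans (U_lip a0 (ltW ar) rH))//.
by rewrite lerD2r m_le.
Qed.

(** Cutting [a, b] where m takes its middle value replaces one square by two squares of the half, so
    the constant is divided by 2. *)
Let D_halve C : (forall a b, 0 <= a -> a <= b -> b <= H -> `|D b - D a| <= C * (m b - m a) ^+ 2) ->
  forall a b, 0 <= a -> a <= b -> b <= H -> `|D b - D a| <= (C / 2) * (m b - m a) ^+ 2.
Proof.
move=> hC a b a0 ab bH.
have cmab : {within `[a, b], continuous m}.
  apply: continuous_subspaceW cm => s /=; rewrite !in_itv/= => /andP[h1 h2].
  by rewrite (le_trans a0 h1) (le_trans h2).
have mm := m_le a0 ab bH.
have [|c] := @IVT K m a b ((m a + m b) / 2) ab cmab.
  rewrite min_l// max_r//; apply/andP; split; lra.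
rewrite in_itv/= => /andP[ac cb] mc.
have h1 := hC a c a0 ac (le_trans cb bH); have h2 := hC c b (le_trans a0 ac) cb bH.
have -> : D b - D a = (D b - D c) + (D c - D a) by ring.
rewrite (le_trans (ler_normD _ _))// (le_trans (lerD h2 h1))// mc.
by rewrite le_eqVlt; apply/orP; left; apply/eqP; field.
Qed.

(** Iterating [D_halve] makes the constant arbitrarily small, so D is constant. No pointwise
    derivative of U is used. *)
Lemma exp_chain_rule :
  expR (U0 + (\int[leb]_(r in `[0%R, H]) v r)%R) - expR U0 =
  (\int[leb]_(s in `[0%R, H]) (expR (U0 + \int[leb]_(r in `[0%R, s]) v r) * v s))%R.
Proof.
have hk k : forall a b, 0 <= a -> a <= b -> b <= H ->
    `|D b - D a| <= (2 * expR B / 2 ^+ k) * (m b - m a) ^+ 2.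
  elim: k => [|k ih]; first by rewrite expr0 divr1; exact: D_local.
  have -> : 2 * expR B / 2 ^+ k.+1 = 2 * expR B / 2 ^+ k / 2 by rewrite exprS; field.
  exact: D_halve.
suff DE : D H - D 0 = 0.
  move: DE; rewrite /D [X in _ - X - _](_ : _ = (\int[leb]_(s in `[0%R, H]) (expR (U s) * v s))%R)//.
  rewrite Uset0 set_itv1 Rintegral_set1 subr0 => /eqP; rewrite addrAC subr_eq0 => /eqP.
  by [].
apply/eqP/negPn/negP; rewrite -normr_gt0 => d0.
pose c := 2 * expR B * (m H - m 0) ^+ 2.
have [k hkc] : exists k : nat, c / `|D H - D 0| < k%:R.
  by exists (Num.truncn (c / `|D H - D 0|)).+1; exact: truncnS_gt.
have := hk k 0 H (lexx 0) H0 (lexx H).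
rewrite (_ : _ * _ = c / 2 ^+ k); last by rewrite /c; ring.
rewrite ler_pdivlMr ?exprn_gt0// leNgt => /negP; apply.
move: hkc; rewrite ltr_pdivrMr// => /lt_le_trans; apply.
rewrite mulrC ler_wpM2l// -natrX ler_nat ltnW// ltn_expl//.
Qed.

End one_dim.
End chain_rule.

Section exp_line.
Context {K : realType} {n : nat}.
Local Notation V := 'cV[K]_n.
Local Notation RT := (measurableTypeR K).
Local Notation leb := (@lebesgue_measure K).
Local Notation mu := (lebesgueV K n).

(** The moving endpoint is written as a condition r <= s inside a fixed integral, so that joint
    measurability follows from that of a parametric integral. *)
Lemma measurable_window2 (v : V -> K) (b : V) : measurable_fun setT v ->
  measurable_fun setT (fun z : V * RT => window v b z.2 z.1).
Proof.
move=> mv.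
rewrite (_ : (fun z => _) = fun z : V * RT => (\int[leb]_r
   (v (z.1 + (1 * r) *: b) * (if (0 <= r) && (r <= z.2) then 1 else 0)))%R); last first.
  apply/funext => z; rewrite /window Rintegral_itv_indic.
  apply: eq_Rintegral => r _; rewrite mul1r indicE; congr (_ * _).
  have -> : (r \in `[0, z.2]%classic) = (0 <= r) && (r <= z.2).
    by apply/idP/idP => [|h]; rewrite ?inE /= ?in_itv//=.
  by case: ifP.
pose f (z : (V * RT) * RT) : K :=
  v (z.1.1 + (1 * (z.2 : K)) *: b) * (if (0 <= (z.2 : K)) && ((z.2 : K) <= (z.1.2 : K)) then 1 else 0).
apply: (@measurable_param_Rintegral _ _ _ (V * RT)%type RT leb f).
have m12 : measurable_fun setT (fun z : (V * RT) * RT => z.1.2 : K).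
  exact: (measurableT_comp (@measurable_sndR K _ V) (@measurable_fst _ _ (V * RT)%type RT)).
apply: measurable_funM.
  apply: (measurableT_comp mv); apply: measurable_addmx.
    exact: (measurableT_comp (@measurable_fst _ _ V RT) (@measurable_fst _ _ (V * RT)%type RT)).
  apply: measurable_scalemx; last exact: measurable_cst.
  by apply: measurable_funM => //; exact: measurable_cst.
apply: measurable_fun_ifT; [|exact: measurable_cst|exact: measurable_cst].
by apply: measurable_and; apply: measurable_fun_ler => //; exact: measurable_cst.
Qed.

(** For each s the identity holds for almost every y; applying Tonelli's theorem to the absolute
    defect exchanges the two quantifiers. *)
Lemma line_identity_ae u g b (H : K) : wgrad u g -> 0 < H ->
  let v x := dotp (g x) b in
  {ae mu, forall y, {ae leb, forall s : RT, `[0, H]%classic s -> u (y + s *: b) = u y + window v b s y}}.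
Proof.
move=> wug H0 v; have [lu lg hg] := wug.
have lv : loc v by exact: loc_dotp.
have mv := loc_measurable lv; have mu_ := loc_measurable lu.
pose e (z : V * RT) := `|u (z.1 + (1 * (z.2 : K)) *: b) - (u z.1 + window v b z.2 z.1)| * \1_(`[0, H]%classic) z.2.
have e0 z : 0 <= e z by rewrite mulr_ge0// indicE.
have me : measurable_fun setT e.
  apply: measurable_funM; last exact: measurable_indic_sndR.
  apply: measurableT_comp => //; apply: measurable_funB.
    by apply: (measurableT_comp mu_); exact: measurable_shift_line.
  apply: measurable_funD; last exact: measurable_window2.
  by apply: measurableT_comp.
have meE : measurable_fun setT (EFin \o e) by exact/measurable_EFinP.
have tot : (\int[mu]_y \int[leb]_s (EFin \o e) (y, s) = 0)%E.
  rewrite (fubini_tonelli (m1 := mu) (m2 := leb) (EFin \o e))//.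
  rewrite -[RHS](@integral0 _ _ _ leb setT); apply: eq_integral => s _.
  have mes : measurable_fun setT (fun y => (EFin \o e) (y, s)).
    by apply: (measurableT_comp meE); exact: measurable_pair2.
  (* [line_identity] needs s > 0; among the other values only s = 0 lies in the segment, and there
     the defect vanishes directly. *)
  have [s0|s0] := ltP 0 s; last first.
    rewrite -[RHS](@integral0 _ _ _ mu setT); apply: eq_integral => y _.
    rewrite /e /= indicE; case: (boolP (s \in _)); last by rewrite mulr0.
    rewrite inE /= in_itv /= => /andP[s1 _].
    have -> : s = 0 by apply/eqP; rewrite eq_le s0 s1.
    by rewrite mulr0 scale0r addr0 /window set_itv1 Rintegral_set1 addr0 subrr normr0 mul0r.
  transitivity (\int[mu]_y `|(EFin \o e) (y, s)|)%E.
    by apply: eq_integral => y _; rewrite gee0_abs// lee_fin.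
  rewrite /cst.
  apply/(ae_eq_integral_abs mu measurableT mes).
  apply: filterS (line_identity b wug s0) => y hy _ /=.
  by rewrite /e /= mul1r hy subrr normr0 mul0r.
have mF : measurable_fun setT (fun y => \int[leb]_s (EFin \o e) (y, s))%E.
  apply: (measurable_fun_fubini_tonelli_F (m2 := leb) (EFin \o e)) => //.
have : ae_eq mu setT (fun y => \int[leb]_s (EFin \o e) (y, s))%E (cst 0%E).
  apply/(ae_eq_integral_abs mu measurableT mF); rewrite -[RHS]tot; apply: eq_integral => y _.
  by rewrite gee0_abs// integral_ge0// => s _; rewrite lee_fin.
apply: filterS => y /(_ I) /= ey.
have mey : measurable_fun setT (fun s : RT => (EFin \o e) (y, s)).
  by apply: (measurableT_comp meE); exact: measurable_pair1.
have : ae_eq leb setT (fun s : RT => (EFin \o e) (y, s)) (cst 0%E).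
  apply/(ae_eq_integral_abs leb measurableT mey); rewrite -[RHS]ey; apply: eq_integral => s _.
  by rewrite gee0_abs// lee_fin.
apply: filterS => s /(_ I) /= -[] es sH.
move: es; rewrite /e /= indicE mem_set// mulr1 mul1r => /eqP.
by rewrite normr_eq0 subr_eq0 => /eqP.
Qed.

(** On almost every line, u coincides for almost every s, and at the endpoint H, with an absolutely
    continuous function to which [exp_chain_rule] applies; changing the integrand on a null set does
    not affect the integral. *)
Lemma exp_line u g b (H : K) : wgrad u g -> 0 < H ->
  let v x := dotp (g x) b in
  {ae mu, forall y,
    leb.-integrable `[0, H] (EFin \o (fun s : RT => expR (u (y + s *: b)) * v (y + s *: b))) /\
    expR (u (y + H *: b)) - expR (u y) = window (fun x => expR (u x) * v x) b H y}.
Proof.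
move=> wug H0 v; have [lu lg hg] := wug.
have lv : loc v by exact: loc_dotp.
have mv := loc_measurable lv; have mu_ := loc_measurable lu.
apply: filterS3 (line_identity b wug H0) (window_integrable_ae b H lv) (line_identity_ae b wug H0).
move=> y e1 iv e2.
pose vy (s : RT) := v (y + s *: b).
have iE := exp_window_integrable (u y) (ltW H0) (v := vy) iv.
pose f1 (s : RT) := expR (u y + \int[leb]_(r in `[0%R, s]) vy r)%R * vy s.
pose f2 (s : RT) := expR (u (y + s *: b)) * v (y + s *: b).
have mf2 : measurable_fun `[0, H]%classic f2.
  apply: measurable_funTS; apply: measurable_funM.
    apply: (measurableT_comp (@measurable_expR K)).
    exact: measurable_lineR.
  exact: measurable_lineR.
have ae12 : ae_eq leb `[0, H]%classic (EFin \o f1) (EFin \o f2).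
  apply: filterS e2 => s hs sH /=; rewrite /f1 /f2 hs//.
have mf1 := measurable_int leb iE.
split.
  apply/integrableP; split; first exact/measurable_EFinP.
  have [_ fo] := integrableP _ _ _ iE.
  apply: le_lt_trans fo; rewrite le_eqVlt; apply/orP; left; apply/eqP.
  apply: ae_eq_integral => //; first by apply: measurableT_comp => //; exact/measurable_EFinP.
    exact: measurableT_comp.
  by apply: filterS ae12 => s hs sH; exact: (congr1 abse (esym (hs sH))).
have := exp_chain_rule (u y) (ltW H0) (v := vy) iv.
rewrite e1 => ->; rewrite /window /Rintegral; congr fine.
by apply: ae_eq_integral => //; exact/measurable_EFinP.
Qed.

End exp_line.

(** * Symmetric Gaussian kernels *)

Section sequential.
Context {K : realType} {n : nat}.
Local Notation V := 'cV[K]_n.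

(** Dominated convergence is available along sequences. They may be taken within distance 1 of the
    limit, which is the neighbourhood in [kernel_bounded]. *)
Lemma continuous_seq (f : V -> K) (x : V) :
  (forall u : nat -> V, (forall k, `|x - u k| <= 1) -> u k @[k --> \oo] --> x ->
     f (u k) @[k --> \oo] --> f x) ->
  f y @[y --> x] --> f x.
Proof.
move=> h; have FF := nbhs_filter x; apply/cvgrPdist_lt => e e0; apply: contrapT => nh.
have /choice[u hu] (k : nat) : exists y : V, `|x - y| < k.+1%:R^-1 /\ ~ (`|f x - f y| < e).
  apply: contrapT => nk; apply: nh.
  suff : nbhs x (fun t => `|f x - f t| < e) by [].
  apply/nbhs_ballP; exists k.+1%:R^-1 => /=.
    by rewrite invr_gt0.
  move=> y; rewrite -ball_normE /= => xy; apply: contrapT => nf; apply: nk.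
  by exists y.
have cu : u k @[k --> \oo] --> x.
  apply/cvgrPdist_lt => d d0.
  have := @near_infty_natSinv_lt K (PosNum d0); apply: filterS => k kd.
  by have [hk _] := hu k; exact: lt_trans hk kd.
have u1 k : `|x - u k| <= 1.
  have [hk _] := hu k; rewrite (le_trans (ltW hk))// invf_le1// ?ler1n//.
have := h u u1 cu => /cvgrPdist_lt /(_ e e0) [k _ /(_ k (leqnn k))].
by have [_ hk] := hu k.
Qed.

End sequential.

Section kernel.
Context {K : realType} {n : nat}.
Local Notation V := 'cV[K]_n.
Local Notation RT := (measurableTypeR K).
Local Notation leb := (@lebesgue_measure K).
Local Notation mu := (lebesgueV K n).

Variables (Sg St M : 'M[K]_n).
Hypotheses (pSg : posdef Sg) (pSt : posdef St).
Hypotheses (StE : St = Sg - M *m Sg *m M^T) (MSg : M *m Sg = Sg *m M^T).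
Variables (gam N : probability V K).
Hypotheses (hgam : gaussian Sg gam) (hN : gaussian St N).

Let U := invmx Sg.
Let J := invmx St.

Let symJ : J^T = J. Proof. by have [] := posdef_inv pSt. Qed.

(** Equivalent to St M' = M St, which follows from M Sg = Sg M'. *)
Lemma kernel_JM : M^T *m J = J *m M.
Proof.
have uS := posdef_unit pSt.
have : St *m M^T = M *m St.
  rewrite StE mulmxBl mulmxBr -MSg; congr (_ - _).
  by rewrite -!mulmxA; congr (_ *m _); rewrite !mulmxA -MSg -!mulmxA.
move=> /(congr1 (fun X => J *m X *m J)).
by rewrite /J -!mulmxA (mulKmx uS) mulmxV// mulmx1.
Qed.

(** Multiplied by St both sides equal M M: one has St J = 1, and St U = 1 - M M since M Sg M' = M M
    Sg. *)
Lemma kernel_JU : M^T *m J *m M = J - U.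
Proof.
have uS := posdef_unit pSt; have uG := posdef_unit pSg.
have e : St *m (J - U) = St *m (M^T *m J *m M).
  have eU : St *m U = 1%:M - M *m M.
    rewrite StE mulmxBl mulmxV// -(mulmxA M) -MSg -!mulmxA mulmxV// mulmx1.
    by [].
  rewrite kernel_JM mulmxBr eU (mulmxA St) (mulmxA St) mulmxV// mul1mx.
  by rewrite opprB addrC subrK.
by have := congr1 (fun X => J *m X) e; rewrite /= !(mulKmx uS) => ->.
Qed.

(** By [kernel_JU], expanding the second form gives y'Jy + x'Jx - x'Ux and a cross term in J M.
    Subtracted from y'Uy it becomes symmetric, J M being symmetric by [kernel_JM]. *)
Lemma kernel_exponent_sym (x y : V) :
  dotp y (U *m y) - dotp (y - M *m x) (J *m (y - M *m x)) =
  dotp x (U *m x) - dotp (x - M *m y) (J *m (x - M *m y)).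
Proof.
have ex (a b : V) : dotp (a - M *m b) (J *m (a - M *m b)) =
    dotp a (J *m a) - 2 * dotp a ((J *m M) *m b) + dotp b (J *m b) - dotp b (U *m b).
  rewrite mulmxBr dotpBl !dotpBr (mulmxA J).
  have -> : dotp (M *m b) (J *m a) = dotp a ((J *m M) *m b).
    by rewrite dotpC dotp_mulmx [RHS]dotp_mulmx trmx_mul symJ mulmxA.
  have -> : dotp (M *m b) ((J *m M) *m b) = dotp b (J *m b) - dotp b (U *m b).
    by rewrite -dotpBr -mulmxBl -kernel_JU dotpC dotp_mulmx dotpC !mulmxA.
  ring.
rewrite !ex; have -> : dotp x ((J *m M) *m y) = dotp y ((J *m M) *m x).
  by rewrite dotp_mulmx trmx_mul symJ kernel_JM dotpC.
ring.
Qed.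

(** The ratio of the density of M x + z to that of gam. Its explicit form is recorded because
    measurability, continuity and the local bound are read off it. *)
Lemma ex_kernel : exists k : V -> V -> K, [/\
  forall y x, 0 < k y x,
  forall y x, k y x = k x y,
  (exists2 c : K, 0 < c & forall y x, k y x = c * expR (2^-1 * (dotp y (U *m y) - dotp (y - M *m x) (J *m (y - M *m x))))) &
  forall (G : V -> \bar K) x, measurable_fun setT G ->
   (\int[N]_z G (M *m x + z)%R = \int[gam]_y (G y * (k y x)%:E))%E].
Proof.
have [c1 c10 h1] := gaussian_integral hgam.
have [c2 c20 h2] := gaussian_integral hN.
pose k y x := c2 / c1 * expR (2^-1 * (dotp y (U *m y) - dotp (y - M *m x) (J *m (y - M *m x)))).
have c0 : 0 < c2 / c1 by rewrite divr_gt0.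
exists k; split.
- by move=> y x; rewrite mulr_gt0// expR_gt0.
- by move=> y x; rewrite /k kernel_exponent_sym.
- by exists (c2 / c1).
move=> G x mG.
have mq : measurable_fun setT (fun y : V => k y x).
  apply: measurable_funM; first exact: measurable_cst.
  apply: (measurableT_comp (@measurable_expR K)); apply: measurable_funM; first exact: measurable_cst.
  apply: measurable_funB; apply: measurable_quad; first exact: measurable_id.
  by apply: measurable_addmx; [exact: measurable_id|exact: measurable_cst].
have mGs : measurable_fun setT (fun z => G (M *m x + z)).
  apply: (measurableT_comp mG); apply: measurable_addmx; [exact: measurable_cst|exact: measurable_id].
rewrite h2// h1; last first.
  by apply: emeasurable_funM => //; exact/measurable_EFinP.
have mGn : measurable_fun setT (fun y => G y * (c2 * expR (- 2^-1 * dotp (y - M *m x) (J *m (y - M *m x))))%:E)%E.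
  apply: emeasurable_funM => //; apply/measurable_EFinP.
  apply: (measurableT_comp (measurable_gauss_density c2 J)).
  by apply: measurable_addmx; [exact: measurable_id|exact: measurable_cst].
rewrite -(@integral_translateV K n (- (M *m x)) (fun z => G (M *m x + z)%R * (c2 * expR (- 2^-1 * dotp z (J *m z)))%:E)%E); last first.
  apply: emeasurable_funM => //; apply/measurable_EFinP; exact: measurable_gauss_density.
apply: eq_integral => y _; rewrite addrC subrK -muleA -EFinM; congr (_ * _%:E)%E.
rewrite /k -/U -/J mulrBr expRD !mulNr.
have := expRN (2^-1 * dotp y (U *m y)) => eN; rewrite eN.
have g0 := expR_gt0 (2^-1 * dotp y (U *m y)).
by field; rewrite !gt_eqF.
Qed.

End kernel.

(** * Averages of a law against a symmetric kernel *)

Section smoothing.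
Context {K : realType} {n : nat}.
Local Notation V := 'cV[K]_n.
Local Notation RT := (measurableTypeR K).
Local Notation leb := (@lebesgue_measure K).
Local Notation mu := (lebesgueV K n).

(** What the Fisher information and entropy arguments use of the Gaussian kernel. The bound is
    uniform in x and local in y: it provides the dominating functions when y varies. *)
Record smoothing_kernel (M : 'M[K]_n) (gam N : probability V K) (k : V -> V -> K) : Prop := {
  kernel_gt0 : forall y x, 0 < k y x;
  kernel_sym : forall y x, k y x = k x y;
  kernel_measurable : measurable_fun setT (fun z : V * V => k z.1 z.2);
  kernel_continuous : forall x, continuous (fun y => k y x);
  kernel_bounded : forall y, exists B, forall y' x, `|y - y'| <= 1 -> k y' x <= B;
  kernel_integral : forall (G : V -> \bar K) x, measurable_fun setT G ->
    (\int[N]_z G (M *m x + z)%R = \int[gam]_y (G y * (k y x)%:E))%E;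
  noise_dominated : forall A, measurable A -> mu A = 0%E -> N A = 0%E }.

Variables (M : 'M[K]_n) (gam N : probability V K) (k : V -> V -> K).
Hypothesis hk : smoothing_kernel M gam N k.
Variable nu : probability V K.

Definition smooth (v : V -> K) (y : V) : K := (\int[nu]_x (k y x * v x))%R.

Let mky y : measurable_fun setT (fun x => k y x).
Proof. exact: (measurableT_comp (kernel_measurable hk) (measurable_pair1 y)). Qed.

Lemma smooth_integrable v y : measurable_fun setT v -> nu.-integrable setT (EFin \o v) ->
  nu.-integrable setT (EFin \o (fun x => k y x * v x)).
Proof.
move=> mv iv; have [B hB] := kernel_bounded hk y.
have iB := integrableZl measurableT B iv.
apply: le_integrable iB => //; first by apply/measurable_EFinP; exact: measurable_funM.
move=> x _ /=; rewrite lee_fin !normrM ler_wpM2r// (ger0_norm (ltW (kernel_gt0 hk _ _))).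
by rewrite (le_trans _ (ler_norm B))// hB// subrr normr0.
Qed.

Lemma continuous_smooth v : measurable_fun setT v -> nu.-integrable setT (EFin \o v) ->
  continuous (smooth v).
Proof.
move=> mv iv y; apply: continuous_seq => w w1 cw.
have [B hB] := kernel_bounded hk y.
have iB := integrable_abse (integrableZl measurableT B iv).
have [] := @dominated_convergence _ _ _ nu setT measurableT
  (fun j => EFin \o (fun x => k (w j) x * v x)) (EFin \o (fun x => k y x * v x))
  (abse \o (fun x => B%:E * (EFin \o v) x)%E).
- by move=> j; apply/measurable_EFinP; exact: measurable_funM.
- by apply/measurable_EFinP; exact: measurable_funM.
- apply: aeW => x _ /=; apply: cvg_EFin; first exact: nearW.
  apply: cvgM; last exact: cvg_cst.
  exact: (continuous_cvg _ (@kernel_continuous _ _ _ _ hk x y) cw).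
- exact: iB.
- apply: aeW => x j _ /=; rewrite lee_fin !normrM ler_wpM2r//.
  rewrite (ger0_norm (ltW (kernel_gt0 hk _ _))) (le_trans _ (ler_norm B))// hB//.
move=> _ _ h; apply: fine_cvg; rewrite fineK; last first.
  exact: (integrable_fin_num _ (smooth_integrable y mv iv)).
exact: h.
Qed.

Variables (u : V -> K).
Hypothesis mu_ : measurable_fun setT u.
Hypothesis nuE : forall A, measurable A -> nu A = (\int[gam]_(x in A) (expR (u x))%:E)%E.

Let mE : measurable_fun setT (fun x => expR (u x)).
Proof. exact: (measurableT_comp (@measurable_expR K) mu_). Qed.

(** The decisive use of symmetry: with [k y x = k x y], an integral over the starting point x
    becomes a mean over the noise at M y + z. The variable y then enters only through a
    translation. *)
Lemma kernel_density (f : V -> K) y : measurable_fun setT f ->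
  (\int[nu]_x (k y x * f x)%:E = \int[N]_z (expR (u (M *m y + z)%R) * f (M *m y + z)%R)%:E)%E.
Proof.
move=> mf.
have mkf : measurable_fun setT (fun x => (k y x * f x)%:E).
  by apply/measurable_EFinP; exact: measurable_funM.
rewrite (density_integral (fun x => expR_ge0 (u x)) mE nuE mkf).
have mef : measurable_fun setT (fun x => (expR (u x) * f x)%:E).
  by apply/measurable_EFinP; exact: measurable_funM.
rewrite (kernel_integral hk y mef); apply: eq_integral => x _.
by rewrite -!EFinM (kernel_sym hk x y); congr (_%:E); ring.
Qed.

Let mshift y : measurable_fun setT (fun z : V => M *m y + z).
Proof. by apply: measurable_addmx; [exact: measurable_cst|exact: measurable_id]. Qed.

Lemma smooth_shift v y : measurable_fun setT v -> nu.-integrable setT (EFin \o v) ->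
  N.-integrable setT (EFin \o (fun z => expR (u (M *m y + z)) * v (M *m y + z))) /\
  smooth v y = (\int[N]_z (expR (u (M *m y + z)) * v (M *m y + z)))%R.
Proof.
move=> mv iv; split; last by rewrite /smooth /Rintegral (kernel_density y mv).
apply/integrableP; split.
  apply/measurable_EFinP.
  exact: (measurableT_comp (measurable_funM mE mv) (mshift y)).
have [_ h] := integrableP _ _ _ (smooth_integrable y mv iv).
apply: le_lt_trans h; rewrite le_eqVlt; apply/orP; left; apply/eqP.
have mav : measurable_fun setT (fun x => `|v x|) by exact: measurableT_comp.
transitivity (\int[nu]_x (k y x * `|v x|)%:E)%E; last first.
  by apply: eq_integral => x _ /=; rewrite normrM (ger0_norm (ltW (kernel_gt0 hk _ _))).
rewrite (kernel_density y mav); apply: eq_integral => z _ /=.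
by rewrite normrM (ger0_norm (expR_ge0 _)).
Qed.

Variables (g : V -> V).
Hypothesis wug : wgrad u g.

Let E v x := expR (u x) * v x.

(** By [smooth_shift] both sides are means over the noise. Moving y along a moves M y + z along b =
    M a, where [exp_line] gives the increment of exp u; Fubini's theorem exchanges noise and
    segment. *)
Lemma smooth_difference (a y : V) (h : K) : 0 < h ->
  let v x := dotp (g x) (M *m a) in
  nu.-integrable setT (EFin \o v) ->
  smooth (cst 1) (y + h *: a) - smooth (cst 1) y =
    (\int[leb]_(s in `[0%R, h]) smooth v (y + s *: a))%R.
Proof.
move=> h0 v iv; have [lu lg hg] := wug.
set b := M *m a in v iv *.
have lv : loc v by exact: loc_dotp.
have mv := loc_measurable lv.
have i1 : nu.-integrable setT (EFin \o (cst 1 : V -> K)).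
  by apply: (@bounded_integrable _ _ _ nu (cst 1) 1) => //; move=> x; rewrite /= normr1.
have m1 : measurable_fun setT (cst 1 : V -> K) by exact: measurable_cst.
have sh s z : M *m (y + s *: a) + z = (M *m y + z) + s *: b.
  by rewrite mulmxDr -scalemxAr addrAC.
have [j1 e1] := smooth_shift (y + h *: a) m1 i1.
have [j0 e0] := smooth_shift y m1 i1.
have mEv : measurable_fun setT (E v) by exact: measurable_funM.
pose F (z : V * RT) : K := E v ((M *m y + z.1) + (1 * (z.2 : K)) *: b) * \1_(`[0, h]%classic) z.2.
have mF : measurable_fun setT F.
  apply: measurable_funM; last exact: measurable_indic_sndR.
  apply: (measurableT_comp mEv); apply: measurable_addmx.
    exact: (measurableT_comp (mshift y) (@measurable_fst _ _ V RT)).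
  apply: measurable_scalemx; last exact: measurable_cst.
  by apply: measurable_funM; [exact: measurable_cst|exact: measurable_sndR].
have mFE : measurable_fun setT (EFin \o F) by exact/measurable_EFinP.
have mav : measurable_fun setT (fun x => `|v x|) by exact: measurableT_comp.
have iav : nu.-integrable setT (EFin \o (fun x => `|v x|)) by exact: (integrable_norm iv).
have segint (f : V -> K) : continuous f -> leb.-integrable setT
    (EFin \o (fun s : RT => f (y + (s : K) *: a) * \1_(`[0, h]%classic) s)).
  move=> cf; have hr : leb.-integrable setT ((EFin \o (fun s : RT => f (y + (s : K) *: a))) \_ `[0, h]).
    by apply/integrable_restrict => //; rewrite setTI; exact: line_integrable.
  apply: eq_integrable hr => // s _ /=; rewrite patchE indicE.
  by case: ifP => _; rewrite ?mulr1 ?mulr0.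
(* Integrating |F| over the noise first gives the average of |v| at a point of the segment; it is
   continuous there, hence integrable. *)
have iF : (N \x leb)%E.-integrable setT (EFin \o F).
  apply/integrable21ltyP => //.
  have [_ ho] := integrableP _ _ _ (segint _ (continuous_smooth mav iav)).
  apply: le_lt_trans ho; rewrite le_eqVlt; apply/orP; left; apply/eqP.
  apply: eq_integral => s _ /=.
  have [js es] := smooth_shift (y + (s : K) *: a) mav iav.
  have p0 : 0 <= smooth (fun x => `|v x|) (y + (s : K) *: a).
    by apply: Rintegral_ge0 => x _; rewrite mulr_ge0// ltW// (kernel_gt0 hk).
  rewrite (ger0_norm (mulr_ge0 p0 _)) ?indicE// EFinM es.
  rewrite (EFin_Rintegral js) -ge0_integralZr//; last exact: (measurable_int N js).
  apply: eq_integral => z _; rewrite /F /E /= sh mul1r !normrM.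
  by rewrite (ger0_norm (expR_ge0 _)) indicE (ger0_norm (ler0n _ _)) EFinM.
(* The exceptional set of [exp_line] is Lebesgue negligible, so is its translate by M y, and the
   noise does not charge it. *)
have aeN : {ae N, forall z, expR (u ((M *m y + z) + h *: b)) - expR (u (M *m y + z)) =
    window (E v) b h (M *m y + z)}.
  have [A [mA A0 hA]] := exp_line b wug h0.
  exists ((fun z => M *m y + z) @^-1` A); split.
  - by rewrite -[X in measurable X]setTI; exact: mshift.
  - apply: (noise_dominated hk).
      by rewrite -[X in measurable X]setTI; exact: mshift.
    have mAi : measurable_fun setT (fun x => (\1_A x)%:E : \bar K).
      by apply/measurable_EFinP; exact: measurable_indic.
    have := integral_translateV (M *m y) mAi.
    have iA (C : set V) : measurable C -> (\int[mu]_x (\1_C x)%:E = mu C)%E.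
      by move=> mC; rewrite integral_indic// setIT.
    rewrite (iA _ mA) A0 => e2.
    rewrite -iA; last by rewrite -[X in measurable X]setTI; exact: mshift.
    rewrite -[RHS]e2; apply: eq_integral => z _; rewrite !indicE; congr ((nat_of_bool _)%:R%:E).
    by apply/idP/idP; rewrite !inE /= addrC.
  - move=> z /= hz; apply: hA => -[_ hz']; apply: hz; exact: hz'.
rewrite e1 e0 -RintegralB//.
transitivity (\int[N]_z window (E v) b h (M *m y + z))%R.
  rewrite /Rintegral; congr fine; apply: ae_eq_integral => //.
  - exact: (measurable_int N (integrableB measurableT j1 j0)).
  - apply/measurable_EFinP; exact: (measurableT_comp (measurable_window b h mEv) (mshift y)).
  - by apply: filterS aeN => z hz _; rewrite /= !mulr1 sh hz.
rewrite Rintegral_itv_indic.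
transitivity (fine (\int[N]_z \int[leb]_s (EFin \o F) (z, s))%E).
  rewrite /Rintegral; congr fine; apply: ae_eq_integral => //.
  - apply/measurable_EFinP; exact: (measurableT_comp (measurable_window b h mEv) (mshift y)).
  - exact: (measurable_fubini_F iF).
  - apply: filterS (ae_integrable_param mF iF) => z hz _.
    rewrite /= -(EFin_Rintegral hz) /window Rintegral_itv_indic; congr (_%:E).
    by apply: eq_Rintegral => s _; rewrite /F /= mul1r.
rewrite (Fubini iF) /Rintegral; congr fine; apply: eq_integral => s _.
have [js es] := smooth_shift (y + (s : K) *: a) mv iv.
rewrite EFinM es (EFin_Rintegral js) -integralZr//; apply: eq_integral => z _.
by rewrite /F /E /= sh mul1r EFinM.
Qed.

End smoothing.

Section euclidean_norm.
Context {K : realType}.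

Lemma enorm_sqr n (x : 'cV[K]_n) : enorm x ^+ 2 = dotp x x.
Proof.
rewrite /enorm sqr_sqrtr; last by apply: sumr_ge0 => i _; exact: sqr_ge0.
by rewrite dotpE; apply: eq_bigr => i _; rewrite expr2.
Qed.

Lemma enorm_ge0 n (x : 'cV[K]_n) : 0 <= enorm x.
Proof. exact: sqrtr_ge0. Qed.

Lemma enorm_cauchy n (x y : 'cV[K]_n) : `|dotp x y| <= enorm x * enorm y.
Proof.
rewrite -ler_sqr ?nnegrE ?mulr_ge0 ?enorm_ge0// exprMn !enorm_sqr.
by rewrite real_normK ?num_real// dotp_cauchy.
Qed.

Lemma measurable_enorm d (T : measurableType d) n (f : T -> 'cV[K]_n) :
  measurable_fun setT f -> measurable_fun setT (fun x => enorm (f x)).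
Proof.
move=> mf; rewrite (_ : (fun x => _) = fun x => Num.sqrt (dotp (f x) (f x))); last first.
  by apply/funext => x; rewrite -enorm_sqr sqrtr_sqr ger0_norm// enorm_ge0.
apply: (measurableT_comp (continuous_measurable_fun (@sqrt_continuous K))); exact: measurable_dotp.
Qed.

End euclidean_norm.

(** * Directional derivatives and integration by parts for the smoothed density *)

Section smoothing_derivative.
Context {K : realType} {n : nat}.
Local Notation V := 'cV[K]_n.
Local Notation RT := (measurableTypeR K).
Local Notation leb := (@lebesgue_measure K).
Local Notation mu := (lebesgueV K n).

Lemma is_derive_line_integral (f w : V -> K) (a y : V) (s : K) : continuous w ->
  (forall y h, 0 < h -> f (y + h *: a) - f y = (\int[leb]_(s in `[0%R, h]) w (y + s *: a))%R) ->
  is_derive s (1 : K) (fun s : K => f (y + s *: a)) (w (y + s *: a)).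
Proof.
move=> cw hf.
(* The base point is moved back by one unit, so that the derivative at s is taken at the interior
   point 1 of [0, 2]. *)
pose y0 := y + (s - 1) *: a.
have i2 := @line_integrable K n w a y0 2 cw.
have [dF F1] := @continuous_FTC1_closed K (fun r : K => w (y0 + r *: a)) 0 1 2
  ltac:(by rewrite ltr1n) i2 ltr01 (@continuous_line K n w a y0 cw 1).
have d1 : is_derive (1 : K) (1 : K) (fun r : K => f (y0 + r *: a)) (w (y0 + 1 *: a)).
  apply: (@near_eq_is_derive _ _ _ (fun r : K => f y0 + (\int[leb]_(t in `[0%R, r]) w (y0 + t *: a))%R)).
    have : \forall r \near (1 : K), 0 < r by apply: lt_nbhsr; exact: ltr01.
    by apply: filterS => r r0; rewrite -(hf y0 r r0) addrC subrK.
  have d0 : is_derive (1 : K) (1 : K) (fun x : K => (\int[leb]_(t in `[0%R, x]) w (y0 + t *: a))%R) (w (y0 + 1 *: a)).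
    by apply: DeriveDef; [exact: dF|rewrite -F1 derive1E].
  have := is_deriveD (is_derive_cst (f y0) (1 : K) (1 : K)) d0.
  by rewrite add0r.
have e : (fun h : K => h^-1 *: (((fun s : K => f (y + s *: a)) \o shift s) (h *: (1 : K)) - f (y + s *: a))) =
  (fun h : K => h^-1 *: (((fun r : K => f (y0 + r *: a)) \o shift (1 : K)) (h *: (1 : K)) - f (y0 + 1 *: a))).
  apply/funext => h /=; rewrite /y0 -!addrA -!scalerDl; congr (_ *: (f (y + _ *: a) - f (y + _ *: a))); ring.
have ew : w (y0 + 1 *: a) = w (y + s *: a).
  by rewrite /y0 -addrA -scalerDl subrK.
rewrite -ew; case: d1 => d1 d1'; split; first by rewrite /derivable e.
by rewrite /derive e.
Qed.

(** The function psi is the derivative of ln f phi along a. Averaging its translates over a unit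
    segment leaves the integral of ln f phi at y + a minus its value at y, which is 0 by translation
    invariance. *)
Lemma line_ibp (f w phi : V -> K) (a : V) : continuous f -> continuous w ->
  (forall x, 0 < f x) ->
  (forall y s, is_derive (s : K) (1 : K) (fun s : K => f (y + s *: a)) (w (y + s *: a))) ->
  test_function phi ->
  (\int[mu]_x (ln (f x) * 'D_a phi x) = - \int[mu]_x (w x / f x * phi x))%R.
Proof.
move=> cf cw f0 df tphi.
have [dphi cD _] := test_function_derive a tphi.
have [k [B [cphi hB h0]]] := test_support tphi.
have [k' [B' [_ hB' h0']]] := test_derive_support a tphi.
have clf : continuous (fun x => ln (f x)).
  by move=> x; apply: (@continuous_comp _ _ _ f (@ln K)); [exact: cf|exact: continuous_ln].
have cwf : continuous (fun x => w x / f x).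
  move=> x; have fi : (f y)^-1 @[y --> x] --> (f x)^-1.
    by apply: (@cvgV _ _ (nbhs x) (nbhs_filter x) f (f x) _ (cf x)); rewrite gt_eqF.
  exact: (@cvgM _ _ (nbhs x) (nbhs_filter x) w (fun y => (f y)^-1) _ _ (cw x) fi).
pose psi x := w x / f x * phi x + ln (f x) * 'D_a phi x.
have i1 := test_integrable (loc_continuous cwf) tphi.
have i2 := test_derive_integrable a (loc_continuous clf) tphi.
have i3 := test_integrable (loc_continuous clf) tphi.
suff psi0 : (\int[mu]_x psi x = 0)%R.
  by move: psi0; rewrite /psi RintegralD// => /eqP; rewrite addrC addr_eq0 => /eqP.
have cpsi : continuous psi.
  move=> x; have FF := nbhs_filter x; apply: (@cvgD _ _ _ (nbhs x) FF (fun x => w x / f x * phi x)).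
    exact: (@cvgM _ _ (nbhs x) FF (fun x => w x / f x) phi _ _ (cwf x) (cphi x)).
  exact: (@cvgM _ _ (nbhs x) FF (fun x => ln (f x)) (fun x => 'D_a phi x) _ _ (clf x) (cD x)).
have ipsi : mu.-integrable setT (EFin \o psi).
  exact: (integrableD measurableT i1 i2).
have mpsi := continuous_measurable_mx cpsi.
pose kk := maxn k k'.
have out x : ~ cube kk x -> psi x = 0.
  move=> hx; rewrite /psi h0 ?h0' ?mulr0 ?addr0// => h; apply: hx; apply: le_trans h _.
    by rewrite ler_nat leq_maxr.
  by rewrite ler_nat leq_maxl.
have [BB BB0 hBB] := cpt_support_bounded cpsi (@compact_cube _ _ kk) out.
have l1 : loc (cst 1 : V -> K) by apply: loc_continuous; exact: cst_continuous.
have := window_fubini1 (- a) 1 l1 mpsi hBB out.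
have shiftE s : (\int[mu]_y (cst 1 y * psi (y - s *: - a)%R)%:E = (\int[mu]_x psi x)%R%:E)%E.
  rewrite (EFin_Rintegral ipsi) -(@integral_translateV _ _ (- (s *: - a)) (EFin \o psi)).
    by apply: eq_integral => y _; rewrite /= mul1r.
  exact/measurable_EFinP.
under [in X in _ = X]eq_integral do rewrite shiftE.
rewrite integral_cst//= lebesgue_measure_itv/= lte_fin ltr01 oppr0 adde0 mule1.
move=> tot; apply: EFin_inj; rewrite -tot.
pose LP x := ln (f x) * phi x.
have inner y : (\int[leb]_(s in `[0%R, 1%R]) (1 * psi (y - s *: - a)%R)%:E =
   (LP (y + a) - LP y)%:E)%E.
  transitivity (\int[leb]_(s in `[0%R, 1%R]) (psi (y + s *: a)%R)%:E)%E.
    by apply: eq_integral => s _; rewrite /= mul1r scalerN opprK.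
  have dl (s : K) : is_derive s (1 : K) (fun s : K => LP (y + s *: a)) (psi (y + s *: a)).
    have d2 := derivable_line (dphi (y + s *: a)).
    have d3 : is_derive s (1 : K) (fun s : K => ln (f (y + s *: a))) (w (y + s *: a) / f (y + s *: a)).
      rewrite mulrC; apply: (@is_derive1_comp K (@ln K) (fun s : K => f (y + s *: a))).
      exact: is_derive1_ln.
    have d4 := is_deriveM d3 d2.
    have -> : psi (y + s *: a) = ln (f (y + s *: a)) *: 'D_a phi (y + s *: a) +
       phi (y + s *: a) *: (w (y + s *: a) / f (y + s *: a)).
      by rewrite /psi addrC [X in _ + X]mulrC.
    exact: d4.
  rewrite (@continuous_FTC2 _ (fun s : K => psi (y + s *: a)) (fun s : K => LP (y + s *: a)))//.
  - by rewrite scale0r addr0 scale1r.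
  - apply: continuous_subspaceT; exact: (@continuous_line _ _ psi).
  - have cLP : continuous LP.
      by move=> x; exact: (@cvgM _ _ (nbhs x) (nbhs_filter x) (fun x => ln (f x)) phi _ _ (clf x) (cphi x)).
    have cl : continuous (fun s : K => LP (y + s *: a)) by exact: continuous_line.
    split.
    + by move=> s _; have [] := dl s.
    + by apply: cvg_at_right_filter; exact: cl.
    + by apply: cvg_at_left_filter; exact: cl.
  - by move=> s _; rewrite derive1E; have [_ ->] := dl s.
under eq_integral do rewrite inner.
have iLP : mu.-integrable setT (EFin \o LP) by exact: i3.
have iLPa : mu.-integrable setT (EFin \o (fun y => LP (y + a))) by exact: (integrable_translateV a iLP).
rewrite -(EFin_Rintegral (integrableB measurableT iLPa iLP)) RintegralB//.
have -> : (\int[mu]_x LP (x + a) = \int[mu]_x LP x)%R.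
  rewrite /Rintegral; congr fine; apply: (@integral_translateV _ _ a (EFin \o LP)).
  exact: (measurable_int mu iLP).
by rewrite subrr.
Qed.

End smoothing_derivative.

(** * Contraction of the Fisher information *)

Section fisher_core.
Context {K : realType} {n : nat}.
Local Notation V := 'cV[K]_n.
Local Notation RT := (measurableTypeR K).
Local Notation leb := (@lebesgue_measure K).
Local Notation mu := (lebesgueV K n).

Variables (M : 'M[K]_n) (gam N : probability V K) (k : V -> V -> K).
Hypothesis hk : smoothing_kernel M gam N k.
Variables nu nu1 : probability V K.
Hypothesis hnu1 : ou_law nu M N nu1.

Let f1 := smooth k nu (cst 1).

Let mky y : measurable_fun setT (fun x => k y x).
Proof. exact: (measurableT_comp (kernel_measurable hk) (measurable_pair1 y)). Qed.

Let i1 : nu.-integrable setT (EFin \o (cst 1 : V -> K)).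
Proof. by apply: (@bounded_integrable _ _ _ nu (cst 1) 1) => //; move=> x; rewrite /= normr1. Qed.

Let m1 : measurable_fun setT (cst 1 : V -> K). Proof. exact: measurable_cst. Qed.

Lemma smooth1_EFin y : (f1 y)%:E = (\int[nu]_x (k y x)%:E)%E.
Proof.
rewrite /f1 /smooth (EFin_Rintegral (smooth_integrable hk y m1 i1)).
by apply: eq_integral => x _; rewrite mulr1.
Qed.

Lemma smooth1_gt0 y : 0 < f1 y.
Proof.
have nT : (0 < nu setT)%E by rewrite (_ : nu setT = 1%E)//; exact: probability_setT.
have := positive_integral_gt0 nT (mky y) (fun x => kernel_gt0 hk y x).
by rewrite -smooth1_EFin lte_fin.
Qed.

Lemma continuous_smooth1 : continuous f1.
Proof. exact: (continuous_smooth hk m1 i1). Qed.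

(** Both sides integrate F against the joint law of (M x + z, x), of density k with respect to the
    product of gam and nu. *)
Lemma ou_tonelli (F : V -> V -> K) : measurable_fun setT (fun z : V * V => F z.1 z.2) ->
  (forall y x, 0 <= F y x) ->
  (\int[gam]_y \int[nu]_x (F y x * k y x)%:E = \int[nu]_x \int[N]_z (F (M *m x + z)%R x)%:E)%E.
Proof.
move=> mF F0.
have mFk : measurable_fun setT (fun z : V * V => (F z.1 z.2 * k z.1 z.2)%:E).
  by apply/measurable_EFinP; apply: measurable_funM => //; exact: (kernel_measurable hk).
rewrite (fubini_tonelli (m1 := gam) (m2 := nu) (fun z : V * V => (F z.1 z.2 * k z.1 z.2)%:E)) //=; last first.
  by move=> z; rewrite lee_fin mulr_ge0// ltW// (kernel_gt0 hk).
apply: eq_integral => x _.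
have mFx : measurable_fun setT (fun y => (F y x)%:E).
  by apply/measurable_EFinP; exact: (measurableT_comp mF (measurable_pair2 x)).
by rewrite (kernel_integral hk x mFx); apply: eq_integral => y _; rewrite EFinM.
Qed.

Lemma ou_density A : measurable A -> nu1 A = (\int[gam]_(y in A) (f1 y)%:E)%E.
Proof.
move=> mA.
have mi : measurable_fun setT (\1_A : V -> K) by exact: measurable_indic.
have mE1 : measurable_fun setT (fun x => (\1_A x : K)%:E) by exact/measurable_EFinP.
transitivity (\int[nu1]_x (\1_A x)%:E)%E; first by rewrite integral_indic// setIT.
rewrite (ou_law_integral hnu1 mE1); last by move=> x; rewrite lee_fin indicE.
rewrite -(@ou_tonelli (fun y _ => \1_A y)); last 2 first.
- exact: (measurableT_comp mi measurable_fst).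
- by move=> y x; rewrite indicE.
rewrite [RHS]integral_mkcond; apply: eq_integral => y _; rewrite patchE indicE.
case: ifP => _; last by rewrite -[RHS](@integral0 _ _ _ nu setT); apply: eq_integral => x _; rewrite mul0r.
by rewrite smooth1_EFin; apply: eq_integral => x _; rewrite mul1r.
Qed.

Variables (u : V -> K) (g : V -> V).
Hypothesis nuE : forall A, measurable A -> nu A = (\int[gam]_(x in A) (expR (u x))%:E)%E.
Hypothesis wug : wgrad u g.
Hypothesis energy : (\int[nu]_x (enorm (g x) ^+ 2)%:E < +oo)%E.

Let mu_ : measurable_fun setT u. Proof. by have [lu _ _] := wug; exact: loc_measurable. Qed.

Lemma wgrad_measurable : measurable_fun setT g.
Proof.
have [_ lg _] := wug; apply: measurable_fun_mx => i j; rewrite (ord1 j).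
exact: loc_measurable.
Qed.

Let mg2 : measurable_fun setT (fun x => enorm (g x) ^+ 2).
Proof. by apply: measurable_funX; apply: measurable_enorm; exact: wgrad_measurable. Qed.

Let ig2 : nu.-integrable setT (EFin \o (fun x => enorm (g x) ^+ 2)).
Proof.
apply/integrableP; split; first exact/measurable_EFinP.
by under eq_integral do rewrite /= ger0_norm ?sqr_ge0//.
Qed.

Let ig1 : nu.-integrable setT (EFin \o (fun x => enorm (g x))).
Proof.
apply: le_integrable (integrableD measurableT i1 ig2) => //.
  by apply/measurable_EFinP; apply: measurable_enorm; exact: wgrad_measurable.
move=> x _ /=; rewrite lee_fin (ger0_norm (enorm_ge0 _)) ger0_norm ?addr_ge0 ?sqr_ge0//.
by have := enorm_ge0 (g x); set e := enorm _; nra.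
Qed.

Let mv b : measurable_fun setT (fun x => dotp (g x) b).
Proof. by apply: measurable_dotp; [exact: wgrad_measurable|exact: measurable_cst]. Qed.

Let iv b : nu.-integrable setT (EFin \o (fun x => dotp (g x) b)).
Proof.
apply: le_integrable (integrableZl measurableT (enorm b) ig1) => //.
  exact/measurable_EFinP.
move=> x _ /=; rewrite lee_fin [X in _ <= X]ger0_norm ?mulr_ge0 ?enorm_ge0//.
by rewrite mulrC enorm_cauchy.
Qed.

Let w (a : V) := smooth k nu (fun x => dotp (g x) (M *m a)).

Let cw a : continuous (w a).
Proof. exact: (continuous_smooth hk (mv _) (iv _)). Qed.

Let Gr (y : V) : V := \col_i w (basis_vec i) y.
Let g1 (y : V) : V := (f1 y)^-1 *: Gr y.

(** The derivative w is linear in the direction, so [Gr] is the gradient of [f1], and testing it in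
    its own direction gives its squared norm. *)
Let smooth_linear (a y : V) : w a y = dotp (Gr y) a.
Proof.
have -> : w a y = (\int[nu]_x (\sum_i a i 0 * (k y x * dotp (g x) (M *m basis_vec i))))%R.
  apply: eq_Rintegral => x _.
  transitivity (\sum_i k y x * (a i 0 * dotp (g x) (M *m basis_vec i))); last first.
    by apply: eq_bigr => i _; rewrite mulrCA.
  rewrite -mulr_sumr; congr (_ * _).
  rewrite dotp_mulmx dotpE; apply: eq_bigr => i _; rewrite mulrC; congr (_ * _).
  rewrite dotp_mulmx dotpE (bigD1 i)//= big1 => [|j ji]; rewrite /basis_vec !mxE ?eqxx ?mulr1 ?addr0//.
  by rewrite (negbTE ji) mulr0.
have ii (i : 'I_n) : nu.-integrable setT (EFin \o (fun x => k y x * dotp (g x) (M *m basis_vec i))).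
  exact: (smooth_integrable hk y (mv _) (iv _)).
have [_ ->] := @Rintegral_sumr _ _ _ nu _ (index_enum 'I_n)
  (fun i x => a i 0 * (k y x * dotp (g x) (M *m basis_vec i)))
  (fun i => integrableZl measurableT (a i 0) (ii i)).
rewrite dotpE; apply: eq_bigr => i _; rewrite (RintegralZl (a i 0) measurableT (ii i)).
by rewrite mulrC /Gr mxE.
Qed.

Lemma smooth_wgrad : wgrad (fun x => ln (f1 x)) g1.
Proof.
have cln : continuous (fun x => ln (f1 x)).
  move=> x; apply: (@continuous_comp _ _ _ f1 (@ln K)); first exact: continuous_smooth1.
  by apply: continuous_ln; exact: smooth1_gt0.
have cg1 i : continuous (fun x => g1 x i 0).
  rewrite (_ : (fun x => _) = fun x => (f1 x)^-1 * w (basis_vec i) x); last first.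
    by apply/funext => x; rewrite /g1 !mxE.
  move=> x; have fi : (f1 y)^-1 @[y --> x] --> (f1 x)^-1.
    apply: (@cvgV _ _ (nbhs x) (nbhs_filter x) f1 (f1 x) _ (@continuous_smooth1 x)).
    by rewrite gt_eqF// smooth1_gt0.
  exact: (@cvgM _ _ (nbhs x) (nbhs_filter x) (fun y => (f1 y)^-1) (w (basis_vec i)) _ _ fi (@cw _ x)).
split; first exact: loc_continuous.
  by move=> i; exact: loc_continuous.
move=> phi tphi i.
rewrite (line_ibp continuous_smooth1 (@cw (basis_vec i)) smooth1_gt0 _ tphi); last first.
  move=> y s; apply: is_derive_line_integral; first exact: cw.
  by move=> y' h h0; exact: (@smooth_difference _ _ _ _ _ _ hk nu u mu_ nuE g wug (basis_vec i) y' h h0 (iv _)).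
by congr (- _); apply: eq_Rintegral => x _; rewrite /g1 !mxE [X in X * _]mulrC.
Qed.

Variable rho : K.
Hypothesis rho0 : 0 <= rho.
Hypothesis hrho : forall x : V, enorm (M *m x) <= rho * enorm x.

Lemma smooth_gradient_bound y :
  enorm (g1 y) ^+ 2 * f1 y <= rho ^+ 2 * smooth k nu (fun x => enorm (g x) ^+ 2) y.
Proof.
have f0 := smooth1_gt0 y.
have k0 x : 0 <= k y x by rewrite ltW// (kernel_gt0 hk).
pose m := smooth k nu (fun x => enorm (g x)) y.
pose q := smooth k nu (fun x => enorm (g x) ^+ 2) y.
have mge : measurable_fun setT (fun x => enorm (g x)) by apply: measurable_enorm; exact: wgrad_measurable.
have jm := smooth_integrable hk y mge ig1.
have jq := smooth_integrable hk y mg2 ig2.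
have j1 := smooth_integrable hk y m1 i1.
have m0 : 0 <= m by apply: Rintegral_ge0 => x _; rewrite mulr_ge0// enorm_ge0.
have CS : m ^+ 2 <= f1 y * q.
  (* Cauchy-Schwarz from the nonnegative weighted mean of (|g| - l)^2, which is least at the
     weighted mean l of |g|. *)
  pose l := m / f1 y.
  have i3 : nu.-integrable setT (EFin \o (fun x => l ^+ 2 * (k y x * cst 1 x))).
    exact: (integrableZl measurableT (l ^+ 2) j1).
  have i4 : nu.-integrable setT (EFin \o (fun x => 2 * l * (k y x * enorm (g x)))).
    exact: (integrableZl measurableT (2 * l) jm).
  have : 0 <= (\int[nu]_x (k y x * enorm (g x) ^+ 2 + (l ^+ 2 * (k y x * cst 1 x) - 2 * l * (k y x * enorm (g x)))))%R.
    apply: Rintegral_ge0 => x _.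
    rewrite (_ : _ + _ = k y x * (enorm (g x) - l) ^+ 2); last by rewrite /cst; ring.
    by rewrite mulr_ge0// sqr_ge0.
  rewrite (RintegralD measurableT jq (integrableB measurableT i3 i4)).
  rewrite (RintegralB measurableT i3 i4) (RintegralZl _ measurableT j1) (RintegralZl _ measurableT jm).
  rewrite -/(smooth k nu (fun x => enorm (g x) ^+ 2) y) -/q -/(smooth k nu (cst 1) y) -/(f1 y).
  rewrite -/(smooth k nu (fun x => enorm (g x)) y) -/m /l => h.
  have : 0 <= f1 y * (q + ((m / f1 y) ^+ 2 * f1 y - 2 * (m / f1 y) * m)) by rewrite mulr_ge0// ltW.
  rewrite (_ : f1 y * _ = f1 y * q - m ^+ 2) ?subr_ge0//.
  by field; rewrite gt_eqF.
(* The gradient is tested in its own direction, whose image by M has norm at most rho |Gr y|. *)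
have GG : enorm (Gr y) ^+ 2 <= rho * enorm (Gr y) * m.
  rewrite enorm_sqr -smooth_linear /w /smooth.
  rewrite /m /smooth -(RintegralZl _ measurableT jm).
  apply: (le_Rintegral measurableT (smooth_integrable hk y (mv _) (iv _)) (integrableZl measurableT _ jm)).
  move=> x _; rewrite mulrCA ler_wpM2l// (le_trans (ler_norm _))// (le_trans (enorm_cauchy _ _))//.
  by rewrite mulrC ler_wpM2r ?enorm_ge0.
have Gm : enorm (Gr y) <= rho * m.
  have [->|G0] := eqVneq (enorm (Gr y)) 0; first by rewrite mulr_ge0.
  have Gp : 0 < enorm (Gr y) by rewrite lt0r G0 enorm_ge0.
  by rewrite -(ler_pM2l Gp); move: GG; rewrite expr2 mulrA (mulrC rho).
have -> : enorm (g1 y) ^+ 2 * f1 y = enorm (Gr y) ^+ 2 / f1 y.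
  by rewrite !enorm_sqr /g1 dotpZl dotpZr; field; rewrite gt_eqF.
rewrite ler_pdivrMr//.
apply: (@le_trans _ _ ((rho * m) ^+ 2)).
  by rewrite lerXn2r ?nnegrE ?mulr_ge0 ?enorm_ge0.
by rewrite exprMn -[X in _ <= X]mulrA; apply: ler_wpM2l; [exact: sqr_ge0|rewrite mulrC].
Qed.

(** The pointwise bound is integrated against gam; [ou_tonelli] removes the kernel, since the bound
    depends on x only and the noise has mass 1. *)
Lemma smooth_energy :
  (\int[nu1]_x (enorm (g1 x) ^+ 2)%:E <= (rho ^+ 2)%:E * \int[nu]_x (enorm (g x) ^+ 2)%:E)%E.
Proof.
have mf1 := continuous_measurable_mx continuous_smooth1.
have mg1 : measurable_fun setT g1.
  have [_ lg _] := smooth_wgrad; apply: measurable_fun_mx => i j; rewrite (ord1 j).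
  exact: loc_measurable.
have mg12 : measurable_fun setT (fun x => enorm (g1 x) ^+ 2).
  by apply: measurable_funX; exact: measurable_enorm.
rewrite (density_integral (fun x => ltW (smooth1_gt0 x)) mf1 ou_density); last exact/measurable_EFinP.
apply: (@le_trans _ _ (\int[gam]_y \int[nu]_x (rho ^+ 2 * enorm (g x) ^+ 2 * k y x)%:E)%E).
  have mF : measurable_fun setT (fun z : V * V => (rho ^+ 2 * enorm (g z.2) ^+ 2 * k z.1 z.2)%:E).
    apply/measurable_EFinP; apply: measurable_funM; last exact: (kernel_measurable hk).
    apply: measurable_funM; first exact: measurable_cst.
    exact: (measurableT_comp mg2 measurable_snd).
  have F0 (z : V * V) : (0 <= (rho ^+ 2 * enorm (g z.2) ^+ 2 * k z.1 z.2)%:E)%E.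
    by rewrite lee_fin (mulr_ge0 (mulr_ge0 (sqr_ge0 _) (sqr_ge0 _)) (ltW (kernel_gt0 hk z.1 z.2))).
  apply: ge0_le_integral => //.
  - by move=> y _; rewrite -EFinM lee_fin mulr_ge0 ?sqr_ge0// ltW// smooth1_gt0.
  - by apply: emeasurable_funM; exact/measurable_EFinP.
  - exact: (measurable_fun_fubini_tonelli_F (m2 := nu) _ mF F0).
  - move=> y _; rewrite -EFinM.
    apply: (@le_trans _ _ (rho ^+ 2 * smooth k nu (fun x => enorm (g x) ^+ 2) y)%:E).
      by rewrite lee_fin smooth_gradient_bound.
    have jq := smooth_integrable hk y mg2 ig2.
    rewrite /smooth -(RintegralZl _ measurableT jq) (EFin_Rintegral (integrableZl measurableT (rho ^+ 2) jq)).
    rewrite le_eqVlt; apply/orP; left; apply/eqP; apply: eq_integral => x _.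
    by congr (_%:E); ring.
rewrite (@ou_tonelli (fun _ x => rho ^+ 2 * enorm (g x) ^+ 2)); last 2 first.
- apply: measurable_funM; first exact: measurable_cst.
  exact: (measurableT_comp mg2 measurable_snd).
- by move=> y x; rewrite mulr_ge0 ?sqr_ge0.
under eq_integral do rewrite probability_integral_cst EFinM.
rewrite ge0_integralZl//.
- exact/measurable_EFinP.
- by move=> x _; rewrite lee_fin sqr_ge0.
- by rewrite lee_fin sqr_ge0.
Qed.

End fisher_core.

(** * Gaussian kernels as smoothing kernels *)

Section gaussian_smoothing.
Context {K : realType} {n : nat}.
Local Notation V := 'cV[K]_n.
Local Notation mu := (lebesgueV K n).

Lemma gaussian_null (S : 'M[K]_n) (gam : probability V K) A : gaussian S gam -> measurable A ->
  (gam A = 0%E <-> mu A = 0%E).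
Proof.
move=> [c c0 hg] mA; have mp := measurable_gauss_density c (invmx S).
have mpE : measurable_fun A (fun x : V => (c * expR (- 2^-1 * dotp x (invmx S *m x)))%:E).
  by apply: measurable_funTS; exact/measurable_EFinP.
split=> h; last first.
  by rewrite (hg _ mA); exact: null_set_integral.
have : (\int[mu]_(x in A) `|(c * expR (- 2^-1 * dotp x (invmx S *m x)))%:E| = 0)%E.
  rewrite -[RHS]h (hg _ mA); apply: eq_integral => x _.
  by rewrite gee0_abs// lee_fin mulr_ge0 ?expR_ge0// ltW.
move=> /(ae_eq_integral_abs mu mA mpE) [B [mB B0 sB]].
apply/eqP; rewrite eq_le measure_ge0 andbT -B0.
apply: le_measure; rewrite ?inE// => x Ax; apply: sB => /= /(_ Ax) /eqP.
by rewrite eqe mulf_eq0 !gt_eqF// expR_gt0.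
Qed.

Lemma gaussian_ae (S : 'M[K]_n) (gam : probability V K) (P : V -> Prop) : gaussian S gam ->
  {ae gam, forall x, P x} <-> {ae mu, forall x, P x}.
Proof.
move=> hg; split=> -[A [mA A0 sA]]; exists A; split => //.
  exact/(gaussian_null hg mA).
exact/(gaussian_null hg mA).
Qed.

Lemma ex_smoothing_kernel (Sg St M : 'M[K]_n) (gam N : probability V K) :
  posdef Sg -> posdef St -> St = Sg - M *m Sg *m M^T -> M *m Sg = Sg *m M^T ->
  gaussian Sg gam -> gaussian St N -> exists k, smoothing_kernel M gam N k.
Proof.
move=> pSg pSt StE MSg hgam hN.
have [k [k0 ks [c c0 kE] ki]] := ex_kernel pSg pSt StE MSg hgam hN.
exists k; split => //.
- rewrite (_ : (fun z => _) = fun z : V * V => c * expR (2^-1 * (dotp z.1 (invmx Sg *m z.1)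
     - dotp (z.1 - M *m z.2) (invmx St *m (z.1 - M *m z.2))))); last by apply/funext => z; rewrite kE.
  apply: measurable_funM; first exact: measurable_cst.
  apply: (measurableT_comp (@measurable_expR K)); apply: measurable_funM; first exact: measurable_cst.
  apply: measurable_funB; apply: measurable_quad; first exact: measurable_fst.
  apply: measurable_addmx; first exact: measurable_fst.
  apply: measurable_oppmx; apply: measurable_mulmx; [exact: measurable_cst|exact: measurable_snd].
- move=> x; rewrite (_ : (fun y => _) = fun y : V => c * expR (2^-1 * (dotp y (invmx Sg *m y)
     - dotp (y + - (M *m x)) (invmx St *m (y + - (M *m x)))))); last by apply/funext => y; rewrite kE.
  move=> y; have FF := nbhs_filter y.
  apply: (@cvgM _ _ (nbhs y) FF (cst c)); first exact: cvg_cst.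
  apply: (@continuous_cvg _ _ _ (nbhs y) FF _ (@expR K)); first exact: continuous_expR.
  apply: (@cvgM _ _ (nbhs y) FF (cst 2^-1)); first exact: cvg_cst.
  apply: (@cvgB _ _ _ (nbhs y) FF (fun y : V => dotp y (invmx Sg *m y))).
    exact: continuous_quad.
  have := @continuous_comp _ _ _ (fun y : V => y + - (M *m x)) (fun y : V => dotp y (invmx St *m y)) y.
  by apply; [exact: continuous_shiftV|exact: continuous_quad].
- move=> y; pose A := [set y' : V | `|y - y'| <= 1].
  have cA : compact A.
    apply: (@compact_colV _ _ _ (`|y| + 1)).
      rewrite (_ : A = (fun y' : V => `|y - y'|) @^-1` [set t | t <= 1])//.
      apply: closed_comp; last exact: closed_le.
      move=> z _; have FF := nbhs_filter z; apply: (@continuous_cvg _ _ _ (nbhs z) FF (fun z => y - z) (fun z : V => `|z|)).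
        exact: norm_continuous.
      by apply: cvgB; [exact: cvg_cst|exact: cvg_id].
    move=> x Ax; have -> : x = y - (y - x) by rewrite opprB addrC subrK.
    by rewrite (le_trans (ler_normB _ _))// lerD2l.
  have : compact ((fun x : V => dotp x (invmx Sg *m x)) @` A).
    by apply: continuous_compact => //; apply: continuous_subspaceT; exact: continuous_quad.
  move=> /compact_bounded [B [Br hB]].
  exists (c * expR (2^-1 * (B + 1))) => y' x yy'.
  have B1 : B < B + 1 by rewrite ltrDl.
  have hq : `|dotp y' (invmx Sg *m y')| <= B + 1 by apply: (hB _ B1); exists y'.
  rewrite kE ler_wpM2l ?(ltW c0)// ler_expR ler_wpM2l ?invr_ge0//.
  rewrite lerBlDr (le_trans (ler_norm _))// (le_trans hq)// lerDl.
  exact: (quad_ge0 _ (posdef_inv pSt)).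
- by move=> A mA A0; apply/(gaussian_null hN mA).
Qed.

End gaussian_smoothing.

(** * The Fisher information through a real-valued potential *)

Section fisher_identification.
Context {K : realType} {n : nat}.
Local Notation V := 'cV[K]_n.
Local Notation mu := (lebesgueV K n).
Variables (S : 'M[K]_n) (gam : probability V K).
Hypothesis hgam : gaussian S gam.

Lemma density_ae (nu : probability V K) (f : V -> K) : measurable_fun setT f ->
  (forall x, 0 <= f x) ->
  (forall A, measurable A -> nu A = \int[gam]_(x in A) (f x)%:E)%E ->
  nu `<< gam /\ {ae gam, forall x, density nu gam x = (f x)%:E}.
Proof.
move=> mf f0 nuE.
have mfE : measurable_fun setT (EFin \o f) by exact/measurable_EFinP.
have dom : nu `<< gam.
  apply/null_content_dominatesP => A mA A0; rewrite nuE//.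
  by apply: null_set_integral => //; exact/measurable_funTS.
split => //.
have : ae_eq gam setT (density nu gam) (EFin \o f).
  apply: integral_ae_eq => //.
    exact: Radon_Nikodym_integrable.
  move=> A _ mA; rewrite -Radon_Nikodym_integral//.
  exact: nuE.
by apply: filterS => x /(_ I).
Qed.

Lemma measurable_lne_density (nu : probability V K) : nu `<< gam ->
  measurable_fun setT (fun x => lne (density nu gam x)).
Proof.
move=> dom; have fn x : density nu gam x \is a fin_num by exact: Radon_Nikodym_fin_num.
have mD : measurable_fun setT (density nu gam).
  have iD : gam.-integrable setT (density nu gam) by exact: Radon_Nikodym_integrable.
  exact: (measurable_int gam iD).
rewrite (_ : (fun x => _) = fun x => if fine (density nu gam x) <= 0 then -oo%E else (ln (fine (density nu gam x)))%:E); last first.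
  by apply/funext => x; rewrite -{1}(fineK (fn x)).
have mf : measurable_fun setT (fun x => fine (density nu gam x)).
  exact: (measurableT_comp (fine_measurable measurableT) mD).
apply: measurable_fun_ifT; [|exact: measurable_cst|].
  by apply: measurable_fun_ler => //; exact: measurable_cst.
by apply/measurable_EFinP; exact: (measurableT_comp (@measurable_ln K) mf).
Qed.

Lemma integrable_ae_eq d (T : measurableType d) (m : {measure set T -> \bar K}) (D : set T)
    (f h : T -> \bar K) : measurable D -> measurable_fun D h -> ae_eq m D f h ->
  m.-integrable D f -> m.-integrable D h.
Proof.
move=> mD mh fh fi; apply/integrableP; split => //.
have [mf fo] := integrableP _ _ _ fi; apply: le_lt_trans fo.
rewrite le_eqVlt; apply/orP; left; apply/eqP; apply: ae_eq_integral => //.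
- exact: measurableT_comp.
- exact: measurableT_comp.
- by apply: filterS fh => x hx Dx; rewrite hx.
Qed.

Section ae_potential.
(** Here ud stands for the extended logarithm of a density and u for a real-valued version of it;
    the lemmas transfer integrability and weak gradients between them. *)
Variables (ud : V -> \bar K) (u : V -> K).
Hypotheses (mud : measurable_fun setT ud) (mu_ : measurable_fun setT u).
Hypothesis udE : {ae mu, forall x, ud x = (u x)%:E}.

Let udA (D : set V) : ae_eq mu D ud (EFin \o u).
Proof. by apply: filterS udE. Qed.

Let muE : measurable_fun setT (EFin \o u). Proof. exact/measurable_EFinP. Qed.

Lemma locally_integrable_ae : locally_integrableV ud <-> loc u.
Proof.
split=> h C cC; have mC := compact_measurableV cC.
  by apply: (integrable_ae_eq mC _ (udA C) (h C cC)); exact: measurable_funTS.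
apply: (integrable_ae_eq mC _ _ (h C cC)); first exact: measurable_funTS.
exact: ae_eq_sym.
Qed.

Lemma weak_gradient_ae (g : V -> V) : loc u -> (is_weak_gradient ud g <-> wgrad u g).
Proof.
move=> lu; have key phi i : test_function phi -> (forall i, loc (fun x => g x i 0)) ->
   (\int[mu]_x (ud x * ('D_(basis_vec i) phi x)%:E) = - \int[mu]_x (g x i 0 * phi x)%:E)%E <->
   (\int[mu]_x (u x * 'D_(basis_vec i) phi x) = - \int[mu]_x (g x i 0 * phi x))%R.
  move=> tphi lg; have [_ cD _] := test_function_derive (basis_vec i) tphi.
  have mD := continuous_measurable_mx cD.
  have -> : (\int[mu]_x (ud x * ('D_(basis_vec i) phi x)%:E) =
      (\int[mu]_x (u x * 'D_(basis_vec i) phi x))%R%:E)%E.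
    rewrite (EFin_Rintegral (test_derive_integrable (basis_vec i) lu tphi)).
    apply: ae_eq_integral => //.
    - by apply: emeasurable_funM => //; exact/measurable_EFinP.
    - by apply/measurable_EFinP; exact: measurable_funM.
    - by apply: filterS udE => x -> _; rewrite EFinM.
  rewrite -(EFin_Rintegral (test_integrable (lg i) tphi)) -EFinN.
  by split=> [[]|->].
split=> [[lg hg]|[_ lg hg]]; split => //.
  by move=> phi tphi i; apply/key => //; exact: hg.
by move=> phi tphi i; apply/key => //; exact: hg.
Qed.

End ae_potential.

Lemma wgrad_unique (u : V -> K) (g g' : V -> V) : wgrad u g -> wgrad u g' ->
  {ae mu, forall x, g x = g' x}.
Proof.
move=> [lu lg hg] [_ lg' hg'].
have hi i : {ae mu, forall x, g x i 0 + - g' x i 0 = 0}.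
  apply: loc_fundamental; first by apply: loc_add => //; exact: loc_opp.
  move=> phi tphi.
  have i1 := test_integrable (lg i) tphi; have i2 := test_integrable (lg' i) tphi.
  rewrite (_ : (fun x => _) = fun x => (g x i 0 * phi x - g' x i 0 * phi x)%:E); last first.
    by apply/funext => x; rewrite -mulrBl.
  rewrite -(EFin_Rintegral (integrableB measurableT i1 i2)) RintegralB//.
  have := hg _ tphi i; rewrite (hg' _ tphi i) => /oppr_inj ->.
  by rewrite subrr.
have : {ae mu, forall x (i : 'I_n), g x i 0 + - g' x i 0 = 0}.
  have h2 (k : nat) : {ae mu, forall x, forall i : 'I_n, val i = k -> g x i 0 + - g' x i 0 = 0}.
    case: (pselect (exists i : 'I_n, val i = k)) => [[i ik]|nk]; last first.
      by apply: aeW => x i ik; exfalso; apply: nk; exists i.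
    apply: filterS (hi i) => x hx j jk.
    by have -> : j = i by apply: val_inj; rewrite jk ik.
  have /ae_foralln := h2; apply: filterS => x hx i; exact: (hx (val i) i).
apply: filterS => x hx; apply/matrixP => i j; rewrite (ord1 j).
by have /eqP := hx i; rewrite subr_eq0 => /eqP.
Qed.

Lemma FisherE (nu : probability V K) (u : V -> K) (g : V -> V) : wgrad u g ->
  (forall A, measurable A -> nu A = \int[gam]_(x in A) (expR (u x))%:E)%E ->
  Fisher nu gam = (\int[nu]_x (enorm (g x) ^+ 2)%:E)%E.
Proof.
move=> wug nuE; have [lu lg hg] := wug.
have mu_ := loc_measurable lu.
have me : measurable_fun setT (fun x => expR (u x)) by exact: (measurableT_comp (@measurable_expR K) mu_).
have [dom aeD] := density_ae me (fun x => expR_ge0 (u x)) nuE.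
pose ud x := lne (density nu gam x).
have mud : measurable_fun setT ud by exact: measurable_lne_density.
have udE : {ae mu, forall x, ud x = (u x)%:E}.
  apply/(gaussian_ae _ hgam); apply: filterS aeD => x hx.
  by rewrite /ud hx lne_EFin ?expR_gt0// expRK.
have lud : locally_integrableV ud by apply/(locally_integrable_ae mud mu_ udE).
have wud : is_weak_gradient ud g by apply/(weak_gradient_ae mud mu_ udE g lu).
have wwg : is_weak_gradient ud (weak_gradient ud).
  exact: (@xgetPex _ (fun=> 0%R) [set g | is_weak_gradient ud g] (ex_intro _ g wud)).
have ww := (weak_gradient_ae mud mu_ udE _ lu).1 wwg.
have gg : {ae nu, forall x, weak_gradient ud x = g x}.
  have /(gaussian_ae _ hgam) [A [mA A0 sA]] := wgrad_unique ww wug.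
  exists A; split => //; have /null_content_dominatesP := dom; exact.
have eE : (\int[nu]_x (enorm (weak_gradient ud x) ^+ 2)%:E = \int[nu]_x (enorm (g x) ^+ 2)%:E)%E.
  apply: ae_eq_integral => //.
  - apply/measurable_EFinP; apply: measurable_funX; apply: measurable_enorm.
    exact: wgrad_measurable ww.
  - apply/measurable_EFinP; apply: measurable_funX; apply: measurable_enorm.
    exact: wgrad_measurable wug.
  - by apply: filterS gg => x -> _.
rewrite /Fisher -/ud; case: asboolP => [_|nh]; first exact: eE.
(* All other conditions in [Fisher] hold, so its default value [+oo] is only taken when the energy
   itself is infinite. *)
apply/eqP; rewrite eq_sym -leye_eq leNgt; apply/negP => fin; apply: nh.
by split => //; [exists g|rewrite eE].
Qed.

(** A locally integrable logarithm is finite almost everywhere, so the density is almost everywhere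
    positive and can be written exp u with u real. *)
Lemma Fisher_fin (nu : probability V K) : (Fisher nu gam < +oo)%E ->
  exists (u : V -> K) (g : V -> V), wgrad u g /\
  (forall A, measurable A -> nu A = \int[gam]_(x in A) (expR (u x))%:E)%E.
Proof.
rewrite /Fisher; set ud := fun x => lne (density nu gam x).
case: asboolP => [[dom lud [g wud] _ _]|//].
have mud : measurable_fun setT ud by exact: measurable_lne_density.
pose u x := fine (ud x).
have mu_ : measurable_fun setT u by exact: (measurableT_comp (fine_measurable measurableT) mud).
have udE : {ae mu, forall x, ud x = (u x)%:E}.
  have : {ae mu, forall x k, cube k x -> ud x \is a fin_num}.
    by apply/ae_foralln => k; exact: (integrable_ae (measurable_cube k) (lud _ (@compact_cube _ _ k))).
  apply: filterS => x hx; have [k _ kx] : (\bigcup_k cube k) x by rewrite bigcup_cube.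
  by rewrite /u fineK// (hx k).
have lu : loc u by apply/(locally_integrable_ae mud mu_ udE).
exists u, g; split; first by apply/(weak_gradient_ae mud mu_ udE g lu).
move=> A mA; rewrite (_ : nu A = \int[gam]_(x in A) density nu gam x)%E; last first.
  by rewrite -Radon_Nikodym_integral.
have me : measurable_fun setT (fun x => expR (u x)) by exact: (measurableT_comp (@measurable_expR K) mu_).
have mD : measurable_fun setT (density nu gam).
  have iD : gam.-integrable setT (density nu gam) by exact: Radon_Nikodym_integrable.
  exact: (measurable_int gam iD).
apply: ae_eq_integral => //.
- exact: measurable_funTS.
- by apply: measurable_funTS; exact/measurable_EFinP.
have /(gaussian_ae _ hgam) := udE; apply: filterS => x; rewrite /ud /u => hx _.
have fn : density nu gam x \is a fin_num by exact: Radon_Nikodym_fin_num.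
move: hx; rewrite -(fineK fn) /ud -(fineK fn) /=; set r := fine _.
by case: ifPn => // r0 _; rewrite lnK// posrE ltNge.
Qed.

End fisher_identification.

Section fisher_contraction.
Context {K : realType} {n : nat}.
Local Notation V := 'cV[K]_n.

Lemma Fisher_contraction (Sg St M : 'M[K]_n) (gam N nu nu1 : probability V K) (rho : K) :
  posdef Sg -> posdef St -> St = Sg - M *m Sg *m M^T -> M *m Sg = Sg *m M^T ->
  gaussian Sg gam -> gaussian St N -> ou_law nu M N nu1 ->
  0 <= rho -> (forall x : V, enorm (M *m x) <= rho * enorm x) ->
  (Fisher nu gam < +oo)%E ->
  (Fisher nu1 gam <= (rho ^+ 2)%:E * Fisher nu gam)%E.
Proof.
move=> pSg pSt StE MSg hgam hN hou rho0 hrho fin.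
have [k hk] := ex_smoothing_kernel pSg pSt StE MSg hgam hN.
have [u [g [wug nuE]]] := Fisher_fin hgam fin.
have FE := FisherE hgam wug nuE; rewrite FE in fin *.
have wg1 := smooth_wgrad hk nuE wug fin.
rewrite (FisherE hgam wg1); last first.
  move=> A mA; rewrite (ou_density hk hou mA); apply: eq_integral => x _.
  by rewrite lnK// posrE (smooth1_gt0 hk).
exact: (smooth_energy hk hou nuE wug fin rho0 hrho).
Qed.

End fisher_contraction.

(** * Contraction of the entropy *)

Section gaussian_convolution.
Context {K : realType} {n : nat}.
Local Notation V := 'cV[K]_n.

Section conv.
Context d1 d2 d3 (T1 : measurableType d1) (T2 : measurableType d2) (T3 : measurableType d3).
Variables (P : probability T1 K) (Q : probability T2 K) (R : probability T3 K).
Variables (X : T1 -> V) (Y : T2 -> V) (Z : T3 -> V) (C1 C2 : 'M[K]_n).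
Hypotheses (mX : measurable_fun setT X) (mY : measurable_fun setT Y) (mZ : measurable_fun setT Z).
Hypotheses (hX : gauss_cf P X C1) (hY : gauss_cf Q Y C2).

Lemma gauss_cf_prod : gauss_cf (P \x Q)%E (fun z => X z.1 + Y z.2) (C1 + C2).
Proof.
have mX1 : measurable_fun setT (fun z : T1 * T2 => X z.1) by exact: measurableT_comp.
have mY2 : measurable_fun setT (fun z : T1 * T2 => Y z.2) by exact: measurableT_comp.
have mc u : measurable_fun setT (fun x : V => cos (dotp u x)).
  apply: (measurableT_comp (@measurable_cos K)).
  by apply: measurable_dotp; [exact: measurable_cst|exact: measurable_id].
have ms u : measurable_fun setT (fun x : V => sin (dotp u x)).
  apply: (measurableT_comp (@measurable_sin K)).
  by apply: measurable_dotp; [exact: measurable_cst|exact: measurable_id].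
have cB (x : K) : `|cos x| <= 1 by rewrite ler_norml cos_geN1 cos_le1.
have sB (x : K) : `|sin x| <= 1 by rewrite ler_norml sin_geN1 sin_le1.
apply: (@gauss_cf_sum _ _ _ (P \x Q)%E _ _ _ _ _ mX1 mY2).
- exact: (indep_comp mX mY (@indep_prod _ _ _ _ _ P Q)).
- move=> u; have [<- <-] := hX u; rewrite /Ecos /Esin; split.
    by rewrite -(law_Rintegral measurable_fst (@law_fst _ _ _ _ _ P Q) (measurableT_comp (mc u) mX) (fun x => cB _)).
  by rewrite -(law_Rintegral measurable_fst (@law_fst _ _ _ _ _ P Q) (measurableT_comp (ms u) mX) (fun x => sB _)).
- move=> u; have [<- <-] := hY u; rewrite /Ecos /Esin; split.
    by rewrite -(law_Rintegral measurable_snd (@law_snd _ _ _ _ _ P Q) (measurableT_comp (mc u) mY) (fun x => cB _)).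
  by rewrite -(law_Rintegral measurable_snd (@law_snd _ _ _ _ _ P Q) (measurableT_comp (ms u) mY) (fun x => sB _)).
Qed.

Lemma gauss_cf_integral (C : 'M[K]_n) (g : V -> K) B : gauss_cf P X C -> gauss_cf R Z C ->
  measurable_fun setT g -> (forall x, `|g x| <= B) ->
  (\int[P]_x g (X x) = \int[R]_z g (Z z))%R.
Proof.
move=> hX' hZ mg gB.
have [L1 hL1] := ex_law P mX; have [L2 hL2] := ex_law R mZ.
rewrite -(law_Rintegral mX hL1 mg gB) -(law_Rintegral mZ hL2 mg gB).
have LE A : measurable A -> L1 A = L2 A.
  apply: cf_unique => u.
  have [e1 e2] := law_Ecos u mX hL1; have [e3 e4] := law_Ecos u mZ hL2.
  have [f1 f2] := hX' u; have [f3 f4] := hZ u.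
  by split; [exact: (etrans e1 (etrans f1 (esym (etrans e3 f3))))|exact: (etrans e2 (etrans f2 (esym (etrans e4 f4))))].
rewrite /Rintegral; congr fine; apply: eq_measure_integral => A mA _.
exact: LE.
Qed.

End conv.

(** Covariances of independent Gaussian vectors add, by uniqueness of characteristic functions. The
    form [gauss_cf] admits degenerate covariances, such as a scaling by 0. *)
Lemma gauss_conv d1 d2 d3 (T1 : measurableType d1) (T2 : measurableType d2) (T3 : measurableType d3)
   (P : probability T1 K) (Q : probability T2 K) (R : probability T3 K)
   (X : T1 -> V) (Y : T2 -> V) (Z : T3 -> V) (C1 C2 : 'M[K]_n) (g : V -> K) B :
  measurable_fun setT X -> measurable_fun setT Y -> measurable_fun setT Z ->
  gauss_cf P X C1 -> gauss_cf Q Y C2 -> gauss_cf R Z (C1 + C2) ->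
  measurable_fun setT g -> (forall x, `|g x| <= B) ->
  (\int[P]_x \int[Q]_y g (X x + Y y) = \int[R]_z g (Z z))%R.
Proof.
move=> mX mY mZ hX hY hZ mg gB.
have mXY : measurable_fun setT (fun z : T1 * T2 => X z.1 + Y z.2).
  by apply: measurable_addmx; exact: measurableT_comp.
rewrite -(gauss_cf_integral mXY mZ (gauss_cf_prod mX mY hX hY) hZ mg gB).
rewrite (@Rintegral_prod _ _ _ _ _ P Q (fun z => g (X z.1 + Y z.2)) B)//.
exact: (measurableT_comp mg mXY).
Qed.

End gaussian_convolution.

(** * Convexity of x ln x and Jensen's inequality *)

Section entropy_function.
Context {K : realType}.

Definition xlnx (x : K) : K := x * ln x.

Lemma measurable_xlnx : measurable_fun setT xlnx.
Proof. by apply: measurable_funM => //; exact: measurable_ln. Qed.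

(** This is 1 + y <= exp y at y = ln m - ln x, multiplied by x. *)
Lemma xlnx_tangent (x m : K) : 0 < x -> 0 < m -> xlnx m + (1 + ln m) * (x - m) <= xlnx x.
Proof.
move=> x0 m0; have := expR_ge1Dx (ln m - ln x).
rewrite expRB !lnK ?posrE// => h.
have : x * (1 + (ln m - ln x)) <= x * (m / x) by rewrite ler_wpM2l// ltW.
rewrite mulrCA mulfV ?gt_eqF// mulr1 /xlnx => h2.
by move: h2; set a := ln m; set b := ln x; nra.
Qed.

Lemma xlnx_geN1 (x : K) : 0 <= x -> - 1 <= xlnx x.
Proof.
rewrite le_eqVlt => /predU1P[<-|x0]; first by rewrite /xlnx mul0r lerN10.
by have := xlnx_tangent x0 ltr01; rewrite /xlnx ln1; nra.
Qed.

Lemma xlnx_bound (a b x : K) : 0 < a -> a <= x -> x <= b -> `|xlnx x| <= b * (`|ln a| + `|ln b|).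
Proof.
move=> a0 ax xb; have x0 := lt_le_trans a0 ax; have b0 := lt_le_trans x0 xb.
rewrite /xlnx normrM ger0_norm ?(ltW x0)//; apply: ler_pM => //; first exact: ltW.
have h1 : ln a <= ln x by rewrite ler_ln.
have h2 : ln x <= ln b by rewrite ler_ln.
rewrite ler_norml; have := ler_norm (ln b); have := ler_norm (- ln a); rewrite normrN.
have := normr_ge0 (ln a); have := normr_ge0 (ln b).
by set p := `|_|; set q := `|_|; move=> *; apply/andP; split; lra.
Qed.

Context d (T : measurableType d) (P : probability T K).

Lemma between_bound (a b x : K) : 0 < a -> a <= x <= b -> `|x| <= b.
Proof. by move=> a0 /andP[ax xb]; rewrite ger0_norm// (le_trans (ltW a0)). Qed.

Lemma Rintegral_between (f : T -> K) (a b : K) : 0 < a -> measurable_fun setT f ->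
  (forall x, a <= f x <= b) -> a <= (\int[P]_x f x)%R <= b.
Proof.
move=> a0 mf fab.
have fi : P.-integrable setT (EFin \o f).
  by apply: (bounded_integrable P mf (C := b)) => x; exact: between_bound (fab x).
have ci (c : K) : P.-integrable setT (EFin \o cst c).
  exact: (@bounded_integrable _ _ _ P (cst c) `|c|).
have Ec (c : K) : (\int[P]_x cst c x)%R = c.
  by rewrite Rintegral_cst//= probability_setT /= mulr1.
apply/andP; split.
  by rewrite -{1}(Ec a); apply: (le_Rintegral measurableT (ci a) fi) => x _; have /andP[] := fab x.
by rewrite -[X in _ <= X](Ec b); apply: (le_Rintegral measurableT fi (ci b)) => x _; have /andP[] := fab x.
Qed.

Lemma xlnx_jensen (f : T -> K) (a b : K) : 0 < a -> measurable_fun setT f ->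
  (forall x, a <= f x <= b) -> xlnx (\int[P]_x f x)%R <= (\int[P]_x xlnx (f x))%R.
Proof.
move=> a0 mf fab; have /andP[ma mb] := Rintegral_between a0 mf fab.
set m := (\int[P]_x f x)%R in ma mb *.
have m0 := lt_le_trans a0 ma.
have fi : P.-integrable setT (EFin \o f).
  by apply: (bounded_integrable P mf (C := b)) => x; exact: between_bound (fab x).
have ci (c : K) : P.-integrable setT (EFin \o cst c).
  exact: (@bounded_integrable _ _ _ P (cst c) `|c|).
have Ec (c : K) : (\int[P]_x cst c x)%R = c.
  by rewrite Rintegral_cst//= probability_setT /= mulr1.
have mx : measurable_fun setT (fun x => xlnx (f x)) by exact: (measurableT_comp measurable_xlnx mf).
have xi : P.-integrable setT (EFin \o (fun x => xlnx (f x))).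
  apply: (bounded_integrable P mx (C := b * (`|ln a| + `|ln b|))) => x.
  by have /andP[h1 h2] := fab x; exact: xlnx_bound.
have f2 := integrableZl measurableT (1 + ln m) fi.
have li := integrableD measurableT (ci (xlnx m - (1 + ln m) * m)) f2.
have -> : xlnx m = (\int[P]_x (cst (xlnx m - (1 + ln m) * m) x + (1 + ln m) * f x))%R.
  rewrite (RintegralD measurableT (ci _) f2) Ec (RintegralZl _ measurableT fi) -/m; ring.
apply: (le_Rintegral measurableT li xi) => x _ /=.
have /andP[h1 h2] := fab x; have := xlnx_tangent (lt_le_trans a0 h1) m0.
by apply: le_trans; rewrite le_eqVlt; apply/orP; left; apply/eqP; ring.
Qed.

End entropy_function.

Lemma tangent_gap (K : realFieldType) (X H y p q r : K) :
  y * (p + q - r) + (1 + (p + q - r)) * (H - y) <= X ->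
  0 <= X + ((r - 1) * H + (- 1 * (H * p) + (- 1 * (H * q) + y))).
Proof. by move=> h; nra. Qed.

Lemma marginal_gap (K : realFieldType) (X Y m l : K) :
  0 <= X + ((l - 1) * m + (- 1 * Y + (- 1 * Y + m))) -> 2 * Y <= X + m * l.
Proof. by move=> h; nra. Qed.

Section tensorization.
Context {K : realType} d (T : measurableType d) (P : probability T K).

Lemma Rintegral_swap d1 d2 (T1 : measurableType d1) (T2 : measurableType d2)
  (P1 : probability T1 K) (P2 : probability T2 K) (f : T1 * T2 -> K) C :
  measurable_fun setT f -> (forall z, `|f z| <= C) ->
  (\int[P1]_x \int[P2]_y f (x, y) = \int[P2]_y \int[P1]_x f (x, y))%R.
Proof.
move=> mf fC; have fi := bounded_integrable2 P1 P2 mf fC.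
have mx x : measurable_fun setT (fun y => f (x, y)).
  by apply: (measurableT_comp mf); exact: measurable_pair1.
have my y : measurable_fun setT (fun x => f (x, y)).
  by apply: (measurableT_comp mf); exact: measurable_pair2.
rewrite /Rintegral; congr fine.
transitivity (\int[P1]_x \int[P2]_y (EFin \o f) (x, y))%E.
  apply: eq_integral => x _; rewrite fineK//.
  exact: (integrable_fin_num _ (bounded_integrable P2 (mx x) (fun y => fC (x, y)))).
rewrite (Fubini fi); apply: eq_integral => y _; rewrite fineK//.
exact: (integrable_fin_num _ (bounded_integrable P1 (my y) (fun x => fC (x, y)))).
Qed.

(* The relative entropy of [H] with respect to the product of its marginals is
   nonnegative. *)
Lemma xlnx_tensorization (H : T * T -> K) (a b : K) : 0 < a -> measurable_fun setT H ->
  (forall z, a <= H z <= b) -> (forall x y, H (x, y) = H (y, x)) ->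
  2 * (\int[P]_x xlnx (\int[P]_y H (x, y)))%R <=
  (\int[P]_x \int[P]_y xlnx (H (x, y)))%R + xlnx (\int[P]_x \int[P]_y H (x, y))%R.
Proof.
move=> a0 mH Hab Hs.
have mHx x : measurable_fun setT (fun y => H (x, y)).
  by apply: (measurableT_comp mH); exact: measurable_pair1.
have HB z : `|H z| <= b by exact: between_bound (Hab z).
pose h x := (\int[P]_y H (x, y))%R.
have mh : measurable_fun setT h by exact: (measurable_Rintegral_fst P mH HB).
have hab x : a <= h x <= b by apply: (Rintegral_between P a0 (mHx x)) => y.
have := Rintegral_between P a0 mh hab; set m := (\int[P]_x h x)%R => /andP[am mb].
have m0 := lt_le_trans a0 am.
have h0 x : 0 < h x by have /andP[+ _] := hab x; exact: lt_le_trans.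
have H0 z : 0 < H z by have /andP[+ _] := Hab z; exact: lt_le_trans.
pose L := `|ln a| + `|ln b|.
have lnB x : a <= x <= b -> `|ln x| <= L.
  move=> /andP[ax xb]; have x0 := lt_le_trans a0 ax; have b0 := lt_le_trans x0 xb.
  have h1 : ln a <= ln x by rewrite ler_ln.
  have h2 : ln x <= ln b by rewrite ler_ln.
  rewrite ler_norml /L; have := ler_norm (ln b); have := ler_norm (- ln a); rewrite normrN.
  have := normr_ge0 (ln a); have := normr_ge0 (ln b).
  by set p := `|_|; set q := `|_|; move=> *; apply/andP; split; lra.
have b0 : 0 <= b by have /andP[] := hab point; move=> /(lt_le_trans a0)/ltW; exact: le_trans.
pose PP := (P \x P)%E : probability _ K.
have mh1 : measurable_fun setT (fun z : T * T => h z.1) by exact: measurableT_comp.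
have mh2 : measurable_fun setT (fun z : T * T => h z.2) by exact: measurableT_comp.
have ml (f : T * T -> K) : measurable_fun setT f -> measurable_fun setT (fun z => ln (f z)).
  by move=> mf; exact: (measurableT_comp (@measurable_ln K) mf).
have bi (f : T * T -> K) C : measurable_fun setT f -> (forall z, `|f z| <= C) ->
   PP.-integrable setT (EFin \o f) by exact: bounded_integrable.
have bp (x y : K) : `|x| <= b -> `|y| <= L -> `|x * y| <= b * L.
  by move=> hx hy; rewrite normrM ler_pM.
pose f1 z := xlnx (H z).
pose f2 z := H z * ln (h z.1).
pose f3 z := H z * ln (h z.2).
have mf1 : measurable_fun setT f1 by exact: (measurableT_comp measurable_xlnx mH).
have mf2 : measurable_fun setT f2 by apply: measurable_funM => //; exact: ml.
have mf3 : measurable_fun setT f3 by apply: measurable_funM => //; exact: ml.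
have B1 z : `|f1 z| <= b * L by apply: bp => //; exact: lnB.
have B2 z : `|f2 z| <= b * L by apply: bp => //; exact: lnB.
have B3 z : `|f3 z| <= b * L by apply: bp => //; exact: lnB.
have i1 := bi f1 _ mf1 B1; have i2 := bi f2 _ mf2 B2; have i3 := bi f3 _ mf3 B3.
have iH := bi H _ mH HB.
pose f4 z := h z.1 * h z.2.
have mf4 : measurable_fun setT f4 by exact: measurable_funM.
have hB x : `|h x| <= b by exact: between_bound (hab x).
have B4 z : `|f4 z| <= b * b by rewrite normrM ler_pM.
have i4 := bi f4 _ mf4 B4.
have E1 : (\int[PP]_z f1 z = \int[P]_x \int[P]_y xlnx (H (x, y)))%R.
  exact: (Rintegral_prod P P mf1 B1).
have EH : (\int[PP]_z H z = m)%R by exact: (Rintegral_prod P P mH HB).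
have hyi (x : T) : P.-integrable setT (EFin \o (fun y => H (x, y))).
  exact: (bounded_integrable P (mHx x) (fun y => HB (x, y))).
have E2 : (\int[PP]_z f2 z = \int[P]_x xlnx (h x))%R.
  rewrite (Rintegral_prod P P mf2 B2); apply: eq_Rintegral => x _.
  by rewrite /f2 /= (RintegralZr _ measurableT (hyi x)).
have E3 : (\int[PP]_z f3 z = \int[P]_x xlnx (h x))%R.
  rewrite (Rintegral_prod P P mf3 B3).
  rewrite (Rintegral_swap P P mf3 B3); apply: eq_Rintegral => y _.
  have hxi : P.-integrable setT (EFin \o (fun x => H (x, y))).
    apply: eq_integrable (hyi y) => // x _ /=; by rewrite Hs.
  rewrite /f3 /= (RintegralZr _ measurableT hxi); congr (_ * _).
  by apply: eq_Rintegral => x _; rewrite Hs.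
have E4 : (\int[PP]_z f4 z = m * m)%R.
  rewrite (Rintegral_prod P P mf4 B4) /f4 /=.
  have hi : P.-integrable setT (EFin \o h) by exact: (bounded_integrable P mh hB).
  rewrite -(RintegralZr m measurableT hi); apply: eq_Rintegral => x _.
  by rewrite (RintegralZl (h x) measurableT hi).
have i2N := integrableZl measurableT (- 1) i2.
have i3N := integrableZl measurableT (- 1) i3.
have iHl := integrableZl measurableT (ln m - 1) iH.
have i4m := integrableZl measurableT m^-1 i4.
have pos : 0 <= (\int[PP]_z (f1 z + ((ln m - 1) * H z + (- 1 * f2 z + (- 1 * f3 z + m^-1 * f4 z)))))%R.
  apply: Rintegral_ge0 => z _.
  (* The tangent is taken at the product of the marginals divided by m, which has the same total
     mass m as H; the linear terms then integrate to m ln m. *)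
  have y0 : 0 < h z.1 * h z.2 / m by rewrite divr_gt0// mulr_gt0.
  have := xlnx_tangent (H0 z) y0.
  rewrite {1}/xlnx ln_div ?posrE ?mulr_gt0// lnM ?posrE// /f2 /f3 /f4 /f1.
  by rewrite (mulrC m^-1); exact: tangent_gap.
move: pos.
have j3 := integrableD measurableT i3N i4m.
have j2 := integrableD measurableT i2N j3.
have j1 := integrableD measurableT iHl j2.
rewrite (RintegralD measurableT i1 j1) (RintegralD measurableT iHl j2).
rewrite (RintegralD measurableT i2N j3) (RintegralD measurableT i3N i4m).
rewrite (RintegralZl _ measurableT iH) (RintegralZl _ measurableT i2).
rewrite (RintegralZl _ measurableT i3) (RintegralZl _ measurableT i4).
rewrite E1 EH E2 E3 E4.
have -> : m^-1 * (m * m) = m by rewrite mulKf// gt_eqF.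
exact: marginal_gap.
Qed.

End tensorization.

Lemma double_midpoint (K : realFieldType) (X Y p q : K) :
  2 * ((1 - 2^-1 * (X + Y)) * p + 2^-1 * (X + Y) * q) =
  ((1 - X) * p + X * q) + ((1 - Y) * p + Y * q).
Proof. by field. Qed.

(** * Interpolation of the entropy for densities between two positive constants *)

Section bounded_entropy.
Context {K : realType} {n : nat}.
Local Notation V := 'cV[K]_n.
Variables (Sg : 'M[K]_n) (gam : probability V K).
Hypotheses (pSg : posdef Sg) (hgam : gaussian Sg gam).

Lemma gauss_cf_scale (c : K) : gauss_cf gam (fun z : V => c *: z) (c ^+ 2 *: Sg).
Proof.
have := gauss_cf_lin (c%:M : 'M[K]_n) (gaussian_gauss_cf pSg hgam).
rewrite tr_scalar_mx mul_scalar_mx mul_mx_scalar scalerA -expr2.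
by rewrite (_ : (fun w => c%:M *m id w) = fun z : V => c *: z)//; apply/funext => z; rewrite mul_scalar_mx.
Qed.

Lemma measurable_scaleV (c : K) : measurable_fun setT (fun z : V => c *: z).
Proof. by apply: measurable_scalemx; [exact: measurable_cst|exact: measurable_id]. Qed.

Definition gavg (c : K) (g : V -> K) (x : V) : K := (\int[gam]_z g (x + c *: z))%R.

Definition bddmeas (g : V -> K) (B : K) : Prop :=
  measurable_fun setT g /\ forall x, `|g x| <= B.

Lemma measurable_gavg2 (c : K) (g : V -> K) : measurable_fun setT g ->
  measurable_fun setT (fun z : V * V => g (z.1 + c *: z.2)).
Proof.
move=> mg; apply: (measurableT_comp mg); apply: measurable_addmx; first exact: measurable_fst.
by apply: measurable_scalemx; [exact: measurable_cst|exact: measurable_snd].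
Qed.

Lemma measurable_shiftscale (c : K) (g : V -> K) x : measurable_fun setT g ->
  measurable_fun setT (fun z : V => g (x + c *: z)).
Proof.
move=> mg; apply: (measurableT_comp mg); apply: measurable_addmx; first exact: measurable_cst.
exact: measurable_scaleV.
Qed.

Lemma bddmeas_gavg c g B : bddmeas g B -> bddmeas (gavg c g) B.
Proof.
move=> [mg gB]; split.
  by apply: (measurable_Rintegral_fst gam (measurable_gavg2 c mg) (C := B)) => z.
by move=> x; apply: Rintegral_bounded => [|z]; [exact: measurable_shiftscale|].
Qed.

Lemma gavg_between (c : K) (g : V -> K) (a b : K) (x : V) :
  0 < a -> measurable_fun setT g -> (forall x, a <= g x <= b) ->
  a <= gavg c g x <= b.
Proof. by move=> a0 mg gab; apply: Rintegral_between => //; exact: measurable_shiftscale. Qed.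

Lemma gavg_comp c d e g B x : bddmeas g B -> c ^+ 2 + d ^+ 2 = e ^+ 2 ->
  gavg c (gavg d g) x = gavg e g x.
Proof.
move=> [mg gB] cde; rewrite /gavg.
have mgx : measurable_fun setT (fun p : V => g (x + p)).
  by apply: (measurableT_comp mg); apply: measurable_addmx; [exact: measurable_cst|exact: measurable_id].
rewrite -(@gauss_conv K n _ _ _ _ _ _ gam gam gam (fun z : V => c *: z) (fun z : V => d *: z)
  (fun z : V => e *: z) (c ^+ 2 *: Sg) (d ^+ 2 *: Sg) (fun p => g (x + p)) B); last 1 first.
- by move=> p; exact: gB.
- by apply: eq_Rintegral => y _; apply: eq_Rintegral => z _; rewrite addrA.
- exact: measurable_scaleV.
- exact: measurable_scaleV.
- exact: measurable_scaleV.
- exact: gauss_cf_scale.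
- exact: gauss_cf_scale.
- by rewrite -scalerDl cde; exact: gauss_cf_scale.
- exact: mgx.
Qed.

Lemma integral_gavg c d e g B : bddmeas g B -> d ^+ 2 + c ^+ 2 = e ^+ 2 ->
  (\int[gam]_y gavg c g (d *: y) = \int[gam]_y g (e *: y))%R.
Proof.
move=> gb cde; have := gavg_comp 0 gb cde; rewrite /gavg => h.
transitivity (\int[gam]_z \int[gam]_z0 g (0 + d *: z + c *: z0))%R.
  by apply: eq_Rintegral => y _; rewrite add0r.
by rewrite h; apply: eq_Rintegral => y _; rewrite add0r.
Qed.

Variables (f : V -> K) (a b : K).
Hypotheses (a0 : 0 < a) (mf : measurable_fun setT f) (fab : forall x, a <= f x <= b).

Let fbdd : bddmeas f b.
Proof. by split => // x; exact: between_bound (fab x). Qed.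

Let C := b * (`|ln a| + `|ln b|).

Let xbdd h : measurable_fun setT h -> (forall x, a <= h x <= b) -> bddmeas (fun x => xlnx (h x)) C.
Proof.
move=> mh hab; split; first exact: (measurableT_comp measurable_xlnx mh).
by move=> x; have /andP[h1 h2] := hab x; exact: xlnx_bound.
Qed.

Let bdd_int g B c : bddmeas g B -> gam.-integrable setT (EFin \o (fun y => g (c *: y))).
Proof.
move=> [mg gB]; apply: (bounded_integrable gam (C := B)) => [|x]; last exact: gB.
exact: (measurableT_comp mg (measurable_scaleV c)).
Qed.

Definition interp_entropy (s : K) : K :=
  (\int[gam]_y xlnx (gavg (Num.sqrt (1 - s)) f (Num.sqrt s *: y)))%R.

(** Given x = sqrt s y, two independent Gaussian vectors of covariance t Sg are added to x. The
    function h of the sum has marginals [h1] and mean [h2], so [xlnx_tensorization] is the claim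
    before averaging over x. *)
Lemma interp_entropy_mid (s t : K) : 0 <= s -> 0 <= t -> s + 2 * t <= 1 ->
  2 * interp_entropy (s + t) <= interp_entropy s + interp_entropy (s + 2 * t).
Proof.
move=> s0 t0 st1.
pose h := gavg (Num.sqrt (1 - (s + 2 * t))) f.
have hb : bddmeas h b by exact: bddmeas_gavg.
have mh : measurable_fun setT h by have [] := hb.
have hab x : a <= h x <= b by exact: gavg_between.
pose q := Num.sqrt t.
pose h1 := gavg q h.
have h1b : bddmeas h1 b by exact: bddmeas_gavg.
have mh1 : measurable_fun setT h1 by have [] := h1b.
have h1ab x : a <= h1 x <= b by exact: gavg_between.
pose h2 := gavg q h1.
have h2b : bddmeas h2 b by exact: bddmeas_gavg.
have mh2 : measurable_fun setT h2 by have [] := h2b.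
have h2ab x : a <= h2 x <= b by exact: gavg_between.
have e1 : gavg (Num.sqrt (1 - (s + t))) f = h1.
  by apply/funext => x; rewrite /h1 /h (gavg_comp x fbdd (e := Num.sqrt (1 - (s + t))))// !sqr_sqrtr//; lra.
have e2 : gavg (Num.sqrt (1 - s)) f = h2.
  by apply/funext => x; rewrite /h2 -e1 (gavg_comp x fbdd (e := Num.sqrt (1 - s)))// !sqr_sqrtr//; lra.
have xh := xbdd mh hab; have xh1 := xbdd mh1 h1ab; have xh2 := xbdd mh2 h2ab.
have E1 : interp_entropy (s + t) = (\int[gam]_y gavg q (fun x => xlnx (h1 x)) (Num.sqrt s *: y))%R.
  rewrite /interp_entropy e1 (integral_gavg xh1 (e := Num.sqrt (s + t)))// !sqr_sqrtr//; lra.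
have E2 : interp_entropy (s + 2 * t) =
   (\int[gam]_y gavg q (gavg q (fun x => xlnx (h x))) (Num.sqrt s *: y))%R.
  rewrite (integral_gavg (bddmeas_gavg q xh) (e := Num.sqrt (s + t))); last by rewrite !sqr_sqrtr//; lra.
  rewrite (integral_gavg xh (e := Num.sqrt (s + 2 * t)))// !sqr_sqrtr//; lra.
rewrite E1 E2 /interp_entropy e2.
have i1 := bdd_int (Num.sqrt s) (bddmeas_gavg q xh1).
have i2 := bdd_int (Num.sqrt s) xh2.
have i3 := bdd_int (Num.sqrt s) (bddmeas_gavg q (bddmeas_gavg q xh)).
rewrite -(RintegralZl 2 measurableT i1) -(RintegralD measurableT i2 i3).
apply: (le_Rintegral measurableT (integrableZl measurableT 2 i1) (integrableD measurableT i2 i3)).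
move=> y _; set x := Num.sqrt s *: y.
(* Symmetric in the two noises because they enter with the same coefficient, so both marginals are
   given by [h1]. *)
pose H (z : V * V) := h (x + q *: z.1 + q *: z.2).
have mH : measurable_fun setT H.
  apply: (measurableT_comp mh); apply: measurable_addmx.
    apply: measurable_addmx; first exact: measurable_cst.
    by apply: measurable_scalemx; [exact: measurable_cst|exact: measurable_fst].
  by apply: measurable_scalemx; [exact: measurable_cst|exact: measurable_snd].
have Hs z w : H (z, w) = H (w, z) by rewrite /H /= addrAC.
have := xlnx_tensorization gam a0 mH (fun z => hab _) Hs.
by rewrite addrC.
Qed.

(** Even numerators reduce to the previous level; an odd one is the midpoint of its neighbours, to
    which [interp_entropy_mid] applies. *)
Lemma interp_entropy_dyadic m k : (k <= 2 ^ m)%N ->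
  interp_entropy (k%:R / 2 ^+ m) <= (1 - k%:R / 2 ^+ m) * interp_entropy 0 +
    k%:R / 2 ^+ m * interp_entropy 1.
Proof.
elim: m k => [|m ih] k.
  rewrite expn0 expr0 divr1; case: k => [|[|//]] _.
    by rewrite subr0 mul1r mul0r addr0.
  by rewrite subrr mul0r add0r mul1r.
rewrite expnS exprS => km.
have [j kj] : exists j, k = j.*2 \/ k = j.*2.+1.
  by exists k./2; rewrite -{1 3}(odd_double_half k); case: (odd k); [right|left].
case: kj km => ->.
  rewrite -muln2 mulnC leq_pmul2l// => /ih.
  suff -> : (2 * j)%:R / (2 * 2 ^+ m) = j%:R / 2 ^+ m :> K by [].
  by rewrite natrM; field; rewrite gt_eqF.
rewrite -muln2 => jm.
have j1 : (j.+1 <= 2 ^ m)%N by move: jm; rewrite mulnC ltn_pmul2l.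
have := @interp_entropy_mid (j%:R / 2 ^+ m) ((2 * 2 ^+ m)^-1).
have -> : j%:R / 2 ^+ m + 2 * (2 * 2 ^+ m)^-1 = j.+1%:R / 2 ^+ m :> K.
  by rewrite -natr1; field; rewrite gt_eqF.
have -> : j%:R / 2 ^+ m + (2 * 2 ^+ m)^-1 = (j * 2).+1%:R / (2 * 2 ^+ m) :> K.
  by rewrite -[(j * 2).+1%:R]natr1 natrM; field; rewrite gt_eqF.
have x0 : 0 <= j%:R / 2 ^+ m :> K by rewrite divr_ge0// ltW.
have y0 : 0 <= (2 * 2 ^+ m)^-1 :> K by rewrite invr_ge0 mulr_ge0// ltW.
have z1 : j.+1%:R / 2 ^+ m <= 1 :> K.
  by rewrite ler_pdivrMr// mul1r -natrX ler_nat.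
move=> /(_ x0 y0 z1); have := ih j (ltnW j1); have := ih j.+1 j1.
have -> : (j * 2).+1%:R / (2 * 2 ^+ m) = 2^-1 * (j%:R / 2 ^+ m + j.+1%:R / 2 ^+ m) :> K.
  by rewrite -[(j * 2).+1%:R]natr1 natrM -[j.+1%:R]natr1; field; rewrite gt_eqF.
set X := j%:R / _; set Y := j.+1%:R / _; set p := interp_entropy 0; set q := interp_entropy 1.
move=> h1 h2 h3; rewrite -(ler_pM2l (ltr0n K 2)); apply: le_trans h3 _.
rewrite double_midpoint.
exact: lerD.
Qed.

Lemma interp_entropy0 : interp_entropy 0 = xlnx (\int[gam]_x f x)%R.
Proof.
rewrite /interp_entropy subr0 sqrtr1 sqrtr0.
transitivity (\int[gam]_y (cst (xlnx (\int[gam]_x f x)%R) y))%R; last first.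
  by rewrite Rintegral_cst//= probability_setT /= mulr1.
apply: eq_Rintegral => y _; congr xlnx; rewrite /gavg scale0r.
by apply: eq_Rintegral => z _; rewrite add0r scale1r.
Qed.

Lemma interp_entropy1 : interp_entropy 1 = (\int[gam]_x xlnx (f x))%R.
Proof.
rewrite /interp_entropy subrr sqrtr1 sqrtr0; apply: eq_Rintegral => y _; congr xlnx.
transitivity (\int[gam]_z (cst (f y) z))%R; last first.
  by rewrite Rintegral_cst//= probability_setT /= mulr1.
by apply: eq_Rintegral => z _; rewrite scale0r addr0 scale1r.
Qed.

Variables (M St : 'M[K]_n) (N : probability V K) (th : K).
Hypotheses (pSt : posdef St) (StE : St = Sg - M *m Sg *m M^T) (hN : gaussian St N).
Hypotheses (th0 : 0 <= th) (th1 : th < 1).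
Hypothesis hth : forall x : V, dotp x (M *m Sg *m M^T *m x) <= th * dotp x (Sg *m x).

Let ou_avg (y : V) : K := (\int[N]_z f (M *m y + z))%R.

Let mMz : measurable_fun setT (fun z : V * V => M *m z.1 + z.2).
Proof. exact: measurable_ou. Qed.

Let mouf : measurable_fun setT (fun z : V * V => f (M *m z.1 + z.2)).
Proof. exact: (measurableT_comp mf mMz). Qed.

Let symSg : Sg^T = Sg. Proof. by have [] := pSg. Qed.

(** As s > th, the matrix S1 = s Sg - M Sg M' is positive definite, and St = S1 + (1 - s) Sg. Thus
    [ou_avg] is a mean of h over the noise of covariance S1. Jensen's inequality moves x ln x inside
    that mean, and M y plus that noise has covariance s Sg. *)
Lemma ou_entropy_interp s : th < s -> s <= 1 ->
  (\int[gam]_y xlnx (ou_avg y))%R <= interp_entropy s.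
Proof.
move=> ths s1; have s0 : 0 < s by exact: le_lt_trans ths.
pose S1 := s *: Sg - M *m Sg *m M^T.
have pS1 : posdef S1.
  apply/posdefP; split.
    by rewrite /S1 linearB /= linearZ /= symSg !trmx_mul trmxK symSg mulmxA.
  move=> x x0; rewrite /S1 mulmxBl dotpBr -scalemxAl dotpZr subr_gt0.
  apply: le_lt_trans (hth x) _; rewrite ltr_pM2r//.
  by have /posdefP[_ h] := pSg; exact: h.
have [N1 hN1] := ex_gaussian pS1.
pose h := gavg (Num.sqrt (1 - s)) f.
have hb : bddmeas h b by exact: bddmeas_gavg.
have mh : measurable_fun setT h by have [] := hb.
have hab x : a <= h x <= b by exact: gavg_between.
have s1' : 0 <= 1 - s by rewrite subr_ge0.
have cfN1 := gaussian_gauss_cf pS1 hN1.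
have mtr (g : V -> K) (p : V) : measurable_fun setT g -> measurable_fun setT (fun q => g (p + q)).
  by move=> mg; apply: (measurableT_comp mg); apply: measurable_addmx; [exact: measurable_cst|exact: measurable_id].
have e1 y : ou_avg y = (\int[N1]_z h (M *m y + z))%R.
  rewrite /ou_avg /h /gavg.
  rewrite -(@gauss_conv K n _ _ _ _ _ _ N1 gam N id (fun z : V => Num.sqrt (1 - s) *: z) id
     S1 ((Num.sqrt (1 - s)) ^+ 2 *: Sg) (fun p => f (M *m y + p)) b).
  - by apply: eq_Rintegral => z _; apply: eq_Rintegral => z' _; rewrite addrA.
  - exact: measurable_id.
  - exact: measurable_scaleV.
  - exact: measurable_id.
  - exact: cfN1.
  - exact: gauss_cf_scale.
  - have -> : S1 + Num.sqrt (1 - s) ^+ 2 *: Sg = St.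
      by rewrite sqr_sqrtr// StE /S1 addrAC -scalerDl (addrC s) subrK scale1r.
    exact: gaussian_gauss_cf.
  - exact: mtr.
  - by move=> p; have [_ +] := fbdd; apply.
have xh := xbdd mh hab.
have mhz : measurable_fun setT (fun z : V * V => xlnx (h (M *m z.1 + z.2))).
  by have [mx _] := xh; exact: (measurableT_comp mx mMz).
have cfM : gauss_cf gam (fun y => M *m y) (M *m Sg *m M^T).
  exact: (gauss_cf_lin M (gaussian_gauss_cf pSg hgam)).
have -> : interp_entropy s = (\int[gam]_y \int[N1]_z xlnx (h (M *m y + z)))%R.
  have [mx xB] := xh.
  rewrite (@gauss_conv K n _ _ _ _ _ _ gam N1 gam (fun y => M *m y) id (fun z : V => Num.sqrt s *: z)
     (M *m Sg *m M^T) S1 (fun p => xlnx (h p)) C)//.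
  - by apply: measurable_mulmx; [exact: measurable_cst|exact: measurable_id].
  - exact: measurable_scaleV.
  - have -> : M *m Sg *m M^T + S1 = Num.sqrt s ^+ 2 *: Sg by rewrite sqr_sqrtr ?(ltW s0)// /S1 addrC subrK.
    exact: gauss_cf_scale.
have mouab y : measurable_fun setT (fun z => f (M *m y + z)) by exact: mtr.
have ouab y : a <= ou_avg y <= b by apply: Rintegral_between.
have mou : measurable_fun setT ou_avg.
  by apply: (measurable_Rintegral_fst N mouf (C := b)) => z; have [_ +] := fbdd; apply.
have [m1 B1] := xbdd mou ouab.
have [_ xB] := xh.
apply: (le_Rintegral measurableT (bounded_integrable gam m1 B1)).
  apply: (bounded_integrable gam (C := C)).
    by apply: (measurable_Rintegral_fst N1 mhz (C := C)) => z; exact: xB.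
  move=> y; apply: Rintegral_bounded => [|z]; last exact: xB.
  by have [mx _] := xh; exact: (mtr _ (M *m y) mx).
move=> y _; rewrite e1; apply: (xlnx_jensen N1 a0) => [|z]; last exact: hab.
exact: mtr.
Qed.

(** Convexity is known at dyadic points only, and th need not be one. A dyadic point within 2^-j
    above th costs at most (E - m) / 2^j, for every j. *)
Lemma ou_entropy_bounded :
  (\int[gam]_y xlnx (ou_avg y))%R <=
  (1 - th) * xlnx (\int[gam]_x f x)%R + th * (\int[gam]_x xlnx (f x))%R.
Proof.
set A := (\int[gam]_y _)%R; set m := xlnx _; set E := (\int[gam]_x _)%R.
have mE : m <= E by exact: (xlnx_jensen gam a0 mf fab).
have key j : A <= (1 - th) * m + th * E + (E - m) / 2 ^+ j.
  have p0 : 0 < 2 ^+ j :> K by rewrite exprn_gt0.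
  (* The least numerator with k / 2^j strictly above th, as [ou_entropy_interp] requires; k <= 2^j
     because th < 1. *)
  pose k := (Num.truncn (th * 2 ^+ j)).+1.
  have thp : 0 <= th * 2 ^+ j by rewrite mulr_ge0// ltW.
  have kth : th * 2 ^+ j < k%:R by exact: truncnS_gt.
  have kth2 : k%:R <= th * 2 ^+ j + 1 :> K.
    have e : k%:R = (Num.truncn (th * 2 ^+ j))%:R + 1 :> K by rewrite natr1.
    by rewrite e lerD2r truncn_le.
  have k2 : (k <= 2 ^ j)%N.
    by rewrite /k truncn_lt_nat// natrX gtr_pMl.
  have h1 := interp_entropy_dyadic k2; rewrite interp_entropy0 interp_entropy1 -/m -/E in h1.
  have h2 : A <= interp_entropy (k%:R / 2 ^+ j).
    apply: ou_entropy_interp; first by rewrite ltr_pdivlMr.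
    by rewrite ler_pdivrMr// mul1r -natrX ler_nat.
  apply: (le_trans h2); apply: (le_trans h1).
  have h3 : k%:R / 2 ^+ j <= th + 1 / 2 ^+ j :> K.
    by rewrite ler_pdivrMr// mulrDl mulfVK ?gt_eqF.
  move: h3; set x := k%:R / _; set e := _^-1; rewrite mul1r; nra.
rewrite leNgt; apply/negP => lt.
set D := A - ((1 - th) * m + th * E).
have D0 : 0 < D by rewrite subr_gt0.
pose j := (Num.truncn ((E - m) / D)).+1.
have h1 : (E - m) / D < j%:R by exact: truncnS_gt.
have h2 : j%:R <= 2 ^+ j :> K by rewrite -natrX ler_nat ltnW// ltn_expl.
have p0 : 0 < 2 ^+ j :> K by rewrite exprn_gt0.
have := key j; rewrite -lerBlDl -/D ler_pdivlMr// leNgt => /negP; apply.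
by rewrite mulrC -ltr_pdivrMr// (lt_le_trans h1).
Qed.

End bounded_entropy.

(** * Relative entropy through densities *)

Section entropy_density.
Context {K : realType} {n : nat}.
Local Notation V := 'cV[K]_n.
Variable gam : probability V K.

Lemma ex_density (nu : probability V K) : nu `<< gam -> exists f : V -> K,
  [/\ measurable_fun setT f, (forall x, 0 <= f x) &
  (forall A, measurable A -> nu A = \int[gam]_(x in A) (f x)%:E)%E].
Proof.
move=> dom; pose F := Radon_Nikodym_SigmaFinite.f nu gam.
have F0 x : (0 <= F x)%E by exact: Radon_Nikodym_SigmaFinite.f_ge0.
have Fn x : F x \is a fin_num by exact: Radon_Nikodym_SigmaFinite.f_fin_num.
exists (fine \o F); split.
- have iF : gam.-integrable setT F by exact: Radon_Nikodym_SigmaFinite.f_integrable.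
  exact: (measurableT_comp (fine_measurable measurableT) (measurable_int gam iF)).
- by move=> x /=; rewrite fine_ge0.
- move=> A mA; rewrite (Radon_Nikodym_SigmaFinite.f_integral dom mA).
  by apply: eq_integral => x _; rewrite /= fineK.
Qed.

Lemma dominates_ae (nu : probability V K) (Q : V -> Prop) : nu `<< gam ->
  {ae gam, forall x, Q x} -> {ae nu, forall x, Q x}.
Proof.
move=> dom [A [mA A0 sA]]; exists A; split => //.
by have /null_content_dominatesP := dom; exact.
Qed.

Section with_density.
Variables (nu : probability V K) (f : V -> K).
Hypotheses (mf : measurable_fun setT f) (f0 : forall x, 0 <= f x).
Hypothesis nuE : forall A, measurable A -> (nu A = \int[gam]_(x in A) (f x)%:E)%E.

Lemma density_pos_ae : {ae nu, forall x, 0 < f x}.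
Proof.
pose A := f @^-1` [set 0].
have mA : measurable A by rewrite -[A]setTI; apply: mf => //; exact: measurable_set1.
exists A; split => //.
  rewrite nuE// -[RHS](@integral0 _ _ _ gam A); apply: eq_integral => x.
  by rewrite inE => ->.
by move=> x /= hx; apply: contrapT => fx; apply: hx; rewrite lt_neqAle f0 andbT eq_sym; apply/eqP.
Qed.

(** The zeros of f, where [lne] is [-oo], are negligible for nu. Infinite values are included, since
    [density_integral] holds for every measurable integrand. *)
Lemma EntE : Ent nu gam = (\int[gam]_x (xlnx (f x))%:E)%E.
Proof.
have [dom aeD] := density_ae mf f0 nuE.
have mln : measurable_fun setT (fun x => (ln (f x))%:E).
  by apply/measurable_EFinP; exact: (measurableT_comp (@measurable_ln K) mf).
rewrite /Ent asboolT//.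
transitivity (\int[nu]_x (ln (f x))%:E)%E.
  apply: ae_eq_integral => //; first exact: measurable_lne_density.
  apply: filterS2 (dominates_ae dom aeD) density_pos_ae => x -> fx _.
  by rewrite lne_EFin.
rewrite (density_integral f0 mf nuE mln); apply: eq_integral => x _.
by rewrite -EFinM mulrC.
Qed.

Lemma density_integral1 : (\int[gam]_x (f x)%:E = 1)%E.
Proof. by rewrite -nuE//; exact: probability_setT. Qed.

Lemma density_integrable : gam.-integrable setT (EFin \o f).
Proof.
apply/integrableP; split; first exact/measurable_EFinP.
rewrite (eq_integral (EFin \o f)); last by move=> x _; rewrite /= ger0_norm.
by rewrite density_integral1 ltry.
Qed.

End with_density.

Lemma xlnx_ge_sub1 (x : K) : 0 <= x -> x - 1 <= xlnx x.
Proof.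
rewrite le_eqVlt => /predU1P[<-|x0]; first by rewrite /xlnx mul0r sub0r lerN10.
by have := xlnx_tangent x0 ltr01; rewrite /xlnx ln1; lra.
Qed.

Lemma xlnx_integrable (g : V -> K) : measurable_fun setT g -> (forall x, 0 <= g x) ->
  (\int[gam]_x (xlnx (g x) + 1)%:E < +oo)%E -> gam.-integrable setT (EFin \o (fun x => xlnx (g x))).
Proof.
move=> mg g0 fin.
have mx : measurable_fun setT (fun x => xlnx (g x)) by exact: (measurableT_comp measurable_xlnx mg).
have i1 : gam.-integrable setT (EFin \o (fun x => xlnx (g x) + 1)).
  apply/integrableP; split; first by apply/measurable_EFinP; exact: measurable_funD.
  rewrite (eq_integral (fun x => (xlnx (g x) + 1)%:E))// => x _ /=.
  by rewrite ger0_norm// -lerBlDr sub0r; exact: xlnx_geN1.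
have i2 : gam.-integrable setT (EFin \o (cst (- 1) : V -> K)).
  exact: (@bounded_integrable _ _ _ gam (cst (- 1)) `|- 1|).
by apply: eq_integrable (integrableD measurableT i1 i2) => // x _ /=; rewrite -EFinD addrK.
Qed.

(** The negative part of x ln x is at most 1, so the positive part must have a finite integral as
    well. *)
Lemma xlnx_integrable_of_finite (g : V -> K) : measurable_fun setT g -> (forall x, 0 <= g x) ->
  (\int[gam]_x (xlnx (g x))%:E < +oo)%E -> gam.-integrable setT (EFin \o (fun x => xlnx (g x))).
Proof.
move=> mg g0 fin.
have mx : measurable_fun setT (fun x => xlnx (g x)) by exact: (measurableT_comp measurable_xlnx mg).
have mxE : measurable_fun setT (fun x => (xlnx (g x))%:E) by exact/measurable_EFinP.
apply: xlnx_integrable => //.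
have neg1 : (\int[gam]_x ((fun x => (xlnx (g x))%:E)^\- x) <= 1)%E.
  rewrite -(probability_integral_cst gam 1); apply: ge0_le_integral => //.
    exact: measurable_funeneg.
  move=> x _; rewrite unlock /= ge_max; apply/andP; split; last by rewrite lee_fin.
  by rewrite lee_fin lerNl; exact: xlnx_geN1.
have neg0 : (0 <= \int[gam]_x ((fun x => (xlnx (g x))%:E)^\- x))%E by exact: integral_ge0.
have posfin : (\int[gam]_x ((fun x => (xlnx (g x))%:E)^\+ x) < +oo)%E.
  move: fin; rewrite integralE; set p := integral _ _ _; set q := integral _ _ _ in neg1 neg0 *.
  by case: q neg1 neg0 => [q| |]//= _ _; case: p => [p| |]//= _; rewrite ltry.
apply: (@le_lt_trans _ _ (\int[gam]_x ((fun x => (xlnx (g x))%:E)^\+ x + 1))%E).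
  apply: ge0_le_integral => //.
  - by move=> x _; rewrite lee_fin -lerBlDr sub0r; exact: xlnx_geN1.
  - by apply/measurable_EFinP; exact: measurable_funD.
  - by apply: emeasurable_funD => //; exact: measurable_funepos.
  - by move=> x _; rewrite EFinD leeD2r// unlock /= le_max lexx.
rewrite ge0_integralD//; last exact: measurable_funepos.
by rewrite (probability_integral_cst gam 1) lte_add_pinfty// ltry.
Qed.

Lemma Ent_ge0 (nu : probability V K) : (0 <= Ent nu gam)%E.
Proof.
case: (pselect (nu `<< gam)) => [dom|nd]; last by rewrite /Ent asboolF// leey.
have [f [mf f0 nuE]] := ex_density dom.
have [fin|] := ltP (Ent nu gam) +oo%E; last by rewrite leye_eq => /eqP ->; rewrite leey.
rewrite (EntE mf f0 nuE) in fin *.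
have fi := density_integrable mf f0 nuE.
have i1 : gam.-integrable setT (EFin \o (fun=> 1 : K)).
  exact: (@bounded_integrable _ _ _ gam (fun=> 1) `|1|).
have xi := xlnx_integrable_of_finite mf f0 fin.
apply: le_trans (le_integral measurableT (integrableB measurableT fi i1) xi _).
  by rewrite (integralB measurableT fi i1) (density_integral1 nuE) (probability_integral_cst gam 1) subee.
by move=> x _; rewrite lee_fin; exact: xlnx_ge_sub1.
Qed.

End entropy_density.

(** * Truncation of densities *)

Section log_truncation.
Context {K : realType}.

Definition ltrunc (j : nat) (x : K) : K :=
  Num.min (Num.max x (expR (- j.+1%:R))) (expR j.+1%:R).

Let exp_le j : expR (- j.+1%:R) <= expR j.+1%:R :> K.
Proof. by rewrite ler_expR ge0_cp. Qed.

Lemma ltrunc_between j x : expR (- j.+1%:R) <= ltrunc j x <= expR j.+1%:R.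
Proof. by rewrite /ltrunc le_min le_max lexx orbT exp_le ge_min lexx orbT. Qed.

Lemma ltrunc_le j x : 0 <= x -> ltrunc j x <= x + expR (- j.+1%:R).
Proof.
by move=> x0; rewrite /ltrunc ge_min ge_max lerDl expR_ge0 lerDr x0.
Qed.

Lemma measurable_ltrunc j : measurable_fun setT (ltrunc j).
Proof.
apply: measurable_minr; last exact: measurable_cst.
by apply: measurable_maxr; [exact: measurable_id|exact: measurable_cst].
Qed.

(** The tangent to x ln x has slope 1 - (j + 1) <= 0 at the lower level and 2 + j >= 0 at the upper
    one. With j in place of j + 1 the lower level would be 1 at j = 0, where the slope is
    positive. *)
Lemma xlnx_ltrunc j x : 0 <= x -> xlnx (ltrunc j x) <= xlnx x.
Proof.
move=> x0; have j1 : 1 <= j.+1%:R :> K by rewrite ler1n.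
rewrite /ltrunc; have [xl|lx] := leP x (expR (- j.+1%:R)).
  rewrite min_l//; move: x0 xl; rewrite le_eqVlt => /predU1P[<- _|x0 xl].
    by rewrite /xlnx expRK mul0r mulrN oppr_le0 mulr_ge0 ?expR_ge0.
  apply: le_trans (xlnx_tangent x0 (expR_gt0 (- j.+1%:R))).
  by rewrite expRK lerDl mulr_le0// ?subr_le0//; lra.
have [xu|ux] := leP x (expR j.+1%:R) => //.
apply: le_trans (xlnx_tangent (lt_trans (expR_gt0 _) ux) (expR_gt0 j.+1%:R)).
by rewrite expRK lerDl mulr_ge0// ?subr_ge0 ?(ltW ux)//; lra.
Qed.

Lemma cvg_expRN : expR (- j.+1%:R) @[j --> \oo] --> (0 : K).
Proof.
apply: (@squeeze_cvgr _ _ _ _ (cst 0) (fun j : nat => j.+1%:R^-1)); [|exact: cvg_cst|exact: cvg_harmonic].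
apply: nearW => j /=; rewrite expR_ge0/= expRN lef_pV2 ?posrE ?expR_gt0//.
by rewrite (le_trans _ (expR_ge1Dx _))// lerDr.
Qed.

Lemma ltrunc_cvg x : 0 <= x -> ltrunc j x @[j --> \oo] --> x.
Proof.
move=> x0; apply: (@squeeze_cvgr _ _ _ _ (fun j => Num.min x (expR j.+1%:R)) (fun j => x + expR (- j.+1%:R))).
- apply: nearW => j; rewrite ltrunc_le// andbT /ltrunc le_min.
  by rewrite !ge_min le_max lexx/= lexx orbT.
- apply: cvg_near_cst; exists (Num.truncn x) => // j /= xj.
  rewrite min_l// (le_trans _ (expR_ge1Dx _))//.
  by rewrite (@le_trans _ _ j.+1%:R) ?lerDr// (le_trans (ltW (truncnS_gt x)))// ler_nat.
- by rewrite -[X in _ --> X]addr0; apply: cvgD; [exact: cvg_cst|exact: cvg_expRN].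
Qed.

(** Truncation may raise the mass of a density slightly above 1, so the term m ln m does not vanish,
    but it stays small. *)
Lemma xlnx_near1 (m e : K) : 0 < m -> 0 <= e -> e <= 1 -> m <= 1 + e -> xlnx m <= 2 * e.
Proof.
move=> m0 e0 e1 me; rewrite /xlnx; have [m1|m1] := leP m 1.
  by apply: (@le_trans _ _ 0); [rewrite mulr_ge0_le0 ?(ltW m0)// ln_le0|rewrite mulr_ge0].
have h : ln m <= m - 1.
  by have := @le_ln1Dx _ (m - 1); rewrite addrCA subrr addr0; apply; lra.
nra.
Qed.

End log_truncation.

(** * Contraction of the entropy for arbitrary densities *)

Section entropy_contraction.
Context {K : realType} {n : nat}.
Local Notation V := 'cV[K]_n.
Variables (Sg St M : 'M[K]_n) (gam N nu nu1 : probability V K) (th : K).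
Hypotheses (pSg : posdef Sg) (pSt : posdef St) (StE : St = Sg - M *m Sg *m M^T).
Hypotheses (MSg : M *m Sg = Sg *m M^T) (hgam : gaussian Sg gam) (hN : gaussian St N).
Hypotheses (hou : ou_law nu M N nu1) (th0 : 0 <= th) (th1 : th < 1).
Hypothesis hth : forall x : V, dotp x (M *m Sg *m M^T *m x) <= th * dotp x (Sg *m x).
Variable f : V -> K.
Hypotheses (mf : measurable_fun setT f) (f0 : forall x, 0 <= f x).
Hypothesis nuE : forall A, measurable A -> (nu A = \int[gam]_(x in A) (f x)%:E)%E.
Hypothesis fin : (\int[gam]_x (xlnx (f x))%:E < +oo)%E.

Let E : K := (\int[gam]_x xlnx (f x))%R.

Let xi : gam.-integrable setT (EFin \o (fun x => xlnx (f x))).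
Proof. exact: xlnx_integrable_of_finite. Qed.

Let fi : gam.-integrable setT (EFin \o f). Proof. exact: (density_integrable mf f0 nuE). Qed.

Let fj j x := ltrunc j (f x).

Let mfj j : measurable_fun setT (fj j).
Proof. exact: (measurableT_comp (measurable_ltrunc j) mf). Qed.

Let Pfj j y : K := (\int[N]_z fj j (M *m y + z))%R.

Let fjab j x : expR (- j.+1%:R) <= fj j x <= expR j.+1%:R. Proof. exact: ltrunc_between. Qed.

Let eps j : K := expR (- j.+1%:R).

Let mass_le j : (\int[gam]_x fj j x)%R <= 1 + eps j.
Proof.
have ei : gam.-integrable setT (EFin \o (fun=> eps j)).
  exact: (@bounded_integrable _ _ _ gam (fun=> eps j) `|eps j|).
have ji : gam.-integrable setT (EFin \o fj j).
  apply: (bounded_integrable gam (mfj j) (C := expR j.+1%:R)) => x.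
  exact: between_bound (expR_gt0 _) (fjab j x).
apply: le_trans (le_Rintegral measurableT ji (integrableD measurableT fi ei) _) _.
  by move=> x _; exact: ltrunc_le.
rewrite (RintegralD measurableT fi ei) /Rintegral (density_integral1 nuE).
by rewrite (probability_integral_cst gam (eps j)).
Qed.

Let entropy_trunc j : (\int[gam]_y xlnx (Pfj j y))%R <= 2 * eps j + th * E.
Proof.
have a0 : 0 < expR (- j.+1%:R) :> K by exact: expR_gt0.
have := ou_entropy_bounded pSg hgam a0 (mfj j) (fjab j) pSt StE hN th0 th1 hth.
move=> /le_trans; apply; apply: lerD.
  have /andP[m1 _] := Rintegral_between gam a0 (mfj j) (fjab j).
  have m0 := lt_le_trans a0 m1.
  have e1 : eps j <= 1 by rewrite /eps -expR0 ler_expR oppr_le0.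
  have c0 : 0 <= 1 - th by rewrite subr_ge0 ltW.
  apply: le_trans (ler_wpM2l c0 (xlnx_near1 m0 (ltW a0) e1 (mass_le j))) _.
  by rewrite ler_piMl ?mulr_ge0 ?(ltW a0)// gerBl.
rewrite ler_wpM2l//; apply: (le_Rintegral measurableT _ xi).
  have mx : measurable_fun setT (fun x => xlnx (fj j x)) by exact: (measurableT_comp measurable_xlnx (mfj j)).
  apply: (bounded_integrable gam mx) => x; have /andP[h1 h2] := fjab j x.
  exact: (xlnx_bound a0 h1 h2).
by move=> x _; exact: xlnx_ltrunc.
Qed.

(** By symmetry of the kernel the density [f1] of nu1 at y is the mean of f (M y + z), hence the
    limit of the means of its truncations. Their entropies are bounded by [entropy_trunc], and
    Fatou's lemma passes to the limit. *)
Lemma Ent_contraction_fin : (Ent nu1 gam <= th%:E * Ent nu gam)%E.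
Proof.
have [k hk] := ex_smoothing_kernel pSg pSt StE MSg hgam hN.
pose f1 := smooth k nu (cst 1).
have f1gt y : 0 < f1 y by exact: (smooth1_gt0 hk).
have f1ge y : 0 <= f1 y by exact: ltW.
have mf1 : measurable_fun setT f1.
  exact: continuous_measurable_mx (continuous_smooth1 hk (nu := nu)).
have nu1E := ou_density hk hou; rewrite -/f1 in nu1E.
have mtr (g : V -> K) y : measurable_fun setT g -> measurable_fun setT (fun z => g (M *m y + z)).
  by move=> mg; apply: (measurableT_comp mg); apply: measurable_addmx; [exact: measurable_cst|exact: measurable_id].
have f1E y : ((f1 y)%:E = \int[N]_z (f (M *m y + z))%:E)%E.
  rewrite (kernel_integral hk y (G := EFin \o f)); last exact/measurable_EFinP.
  rewrite (smooth1_EFin hk) (density_integral f0 mf nuE).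
    by apply: eq_integral => x _; rewrite (kernel_sym hk) muleC.
  by apply/measurable_EFinP; exact: (measurableT_comp (kernel_measurable hk) (measurable_pair1 y)).
have fyi y : N.-integrable setT (EFin \o (fun z => f (M *m y + z))).
  apply/integrableP; split; first by apply/measurable_EFinP; exact: mtr.
  by under eq_integral do rewrite /= ger0_norm//; rewrite -f1E ltry.
have Pcvg y : Pfj j y @[j --> \oo] --> f1 y.
  have i1 : N.-integrable setT (EFin \o (fun=> 1 : K)).
    exact: (@bounded_integrable _ _ _ N (fun=> 1) `|1|).
  have [] := @dominated_convergence _ _ _ N setT measurableT
    (fun j => EFin \o (fun z => fj j (M *m y + z))) (EFin \o (fun z => f (M *m y + z)))
    ((EFin \o (fun z => f (M *m y + z))) \+ (EFin \o (fun=> 1%R : K)))%E.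
  - by move=> j; apply/measurable_EFinP; exact: mtr.
  - by apply/measurable_EFinP; exact: mtr.
  - apply: aeW => z _ /=; apply: cvg_EFin; first exact: nearW.
    exact: ltrunc_cvg.
  - exact: integrableD.
  - apply: aeW => z j _ /=; rewrite lee_fin.
    have a0 : 0 < expR (- j.+1%:R) :> K by exact: expR_gt0.
    have /andP[h1 _] := fjab j (M *m y + z).
    rewrite ger0_norm ?(le_trans (ltW a0))//; apply: le_trans (ltrunc_le _ _) _ => //.
    by rewrite lerD2l -expR0 ler_expR oppr_le0.
  - move=> _ _; rewrite -f1E => h; exact: (fine_cvg h).
have Pgt j y : 0 < Pfj j y.
  have /andP[+ _] := Rintegral_between N (expR_gt0 _) (mtr _ y (mfj j)) (fun z => fjab j (M *m y + z)).
  exact: lt_le_trans (expR_gt0 _).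
have mP j : measurable_fun setT (Pfj j).
  apply: (measurable_Rintegral_fst N (C := expR j.+1%:R) (f := fun z => fj j (M *m z.1 + z.2))).
    exact: (measurableT_comp (mfj j) (measurable_ou M)).
  by move=> z; exact: between_bound (expR_gt0 _) (fjab j _).
have mxP j : measurable_fun setT (fun y => xlnx (Pfj j y)) by exact: (measurableT_comp measurable_xlnx (mP j)).
(* Since x ln x >= -1, adding 1 makes the integrands nonnegative, as Fatou's lemma needs. *)
pose F j y := (xlnx (Pfj j y) + 1)%:E.
have mF j : measurable_fun setT (F j) by apply/measurable_EFinP; exact: measurable_funD.
have F0 j y : (0 <= F j y)%E by rewrite lee_fin -lerBlDr sub0r xlnx_geN1// ltW.
have Fcvg y : F j y @[j --> \oo] --> (xlnx (f1 y) + 1)%:E.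
  apply: cvg_EFin; first exact: nearW.
  apply: cvgD; last exact: cvg_cst.
  apply: cvgM; first exact: Pcvg.
  exact: (continuous_cvg _ (continuous_ln (f1gt y)) (Pcvg y)).
have bnd j : (\int[gam]_y F j y <= (2 * eps j + th * E + 1)%:E)%E.
  have xb := mxP j.
  have ix : gam.-integrable setT (EFin \o (fun y => xlnx (Pfj j y))).
    have a0 : 0 < expR (- j.+1%:R) :> K by exact: expR_gt0.
    apply: (bounded_integrable gam xb) => y.
    have /andP[h1 h2] := Rintegral_between N a0 (mtr _ y (mfj j)) (fun z => fjab j (M *m y + z)).
    exact: (xlnx_bound a0 h1 h2).
  have i1 : gam.-integrable setT (EFin \o (fun=> 1 : K)).
    exact: (@bounded_integrable _ _ _ gam (fun=> 1) `|1|).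
  rewrite (integralD measurableT ix i1) (probability_integral_cst gam 1) EFinD leeD2r//.
  by rewrite -(EFin_Rintegral ix) lee_fin; exact: entropy_trunc.
have lim : (\int[gam]_y (xlnx (f1 y) + 1)%:E <= (th * E + 1)%:E)%E.
  have bc : (2 * eps j + th * E + 1)%:E @[j --> \oo] --> (th * E + 1)%:E.
    apply: cvg_EFin; first exact: nearW.
    rewrite -[X in _ --> X](_ : 2 * 0 + th * E + 1 = _); last by rewrite mulr0 add0r.
    apply: cvgD; last exact: cvg_cst.
    apply: cvgD; last exact: cvg_cst.
    by apply: cvgM; [exact: cvg_cst|exact: cvg_expRN].
  rewrite (eq_integral (fun y => limn_einf (F^~ y))); last first.
    by move=> y _; have [-> _] := cvg_limn_einf_sup (Fcvg y).
  apply: le_trans (fatou gam measurableT mF (fun j y _ => F0 j y)) _.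
  have [<- _] := cvg_limn_einf_sup bc.
  rewrite !limn_einf_lim; apply: lee_lim; [exact: is_cvg_einfs|exact: is_cvg_einfs|].
  apply: nearW => j; apply: le_ereal_inf_tmp => _ [i ji <-].
  by apply: le_trans (bnd i); apply: ereal_inf_lbound; exists i.
have x1 : gam.-integrable setT (EFin \o (fun y => xlnx (f1 y))).
  by apply: xlnx_integrable => //; apply: le_lt_trans lim _; rewrite ltry.
rewrite (EntE mf1 f1ge nu1E) (EntE mf f0 nuE) -(EFin_Rintegral x1) -(EFin_Rintegral xi) -EFinM lee_fin.
have i1 : gam.-integrable setT (EFin \o (fun=> 1 : K)).
  exact: (@bounded_integrable _ _ _ gam (fun=> 1) `|1|).
move: lim; rewrite (integralD measurableT x1 i1) (probability_integral_cst gam 1).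
by rewrite -(EFin_Rintegral x1) -EFinD lee_fin lerD2r.
Qed.

End entropy_contraction.

Lemma Ent_contraction (K : realType) (n : nat) (Sg St M : 'M[K]_n)
    (gam N nu nu1 : probability 'cV[K]_n K) (th : K) :
  posdef Sg -> posdef St -> St = Sg - M *m Sg *m M^T -> M *m Sg = Sg *m M^T ->
  gaussian Sg gam -> gaussian St N -> ou_law nu M N nu1 ->
  0 < th -> th < 1 ->
  (forall x, dotp x (M *m Sg *m M^T *m x) <= th * dotp x (Sg *m x)) ->
  (Ent nu1 gam <= th%:E * Ent nu gam)%E.
Proof.
move=> pSg pSt StE MSg hgam hN hou th0 th1 hth.
have [fin|] := ltP (Ent nu gam) +oo%E; last first.
  (* The factor th is positive, so th times [+oo] is [+oo]. *)
  by rewrite leye_eq => /eqP ->; rewrite gt0_muley ?lte_fin// leey.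
have dom : nu `<< gam by apply: contrapT => nd; move: fin; rewrite /Ent asboolF.
have [f [mf f0 nuE]] := ex_density dom.
rewrite (EntE mf f0 nuE) in fin.
exact: (Ent_contraction_fin pSg pSt StE MSg hgam hN hou (ltW th0) th1 hth mf f0 nuE fin).
Qed.

(** * The rate of convergence *)

Section specnorm.
Context {K : realType} {n : nat}.
Implicit Types (M : 'M[K]_n) (x : 'cV[K]_n).

Lemma enorm_eq0 x : (enorm x == 0) = (x == 0).
Proof. by rewrite -sqrf_eq0 enorm_sqr dotp_eq0. Qed.

Lemma enormZ (c : K) x : enorm (c *: x) = `|c| * enorm x.
Proof.
apply/eqP; rewrite -(@eqrXn2 _ 2) ?mulr_ge0 ?enorm_ge0//.
by rewrite exprMn real_normK ?num_real// !enorm_sqr dotpZr dotpZl mulrA expr2.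
Qed.

Lemma enorm_bounded M : exists C, forall x, enorm x <= 1 -> enorm (M *m x) <= C.
Proof.
pose C := \sum_i dotp (row i M)^T (row i M)^T.
have C0 : 0 <= C by apply: sumr_ge0 => i _; exact: dotp_ge0.
exists (Num.sqrt C) => x x1.
rewrite -ler_sqr ?nnegrE ?enorm_ge0 ?sqrtr_ge0// enorm_sqr sqr_sqrtr// dotpE.
apply: ler_sum => i _; rewrite -expr2.
have -> : (M *m x) i 0 = dotp (row i M)^T x.
  by rewrite dotpE mxE; apply: eq_bigr => j _; rewrite !mxE.
apply: le_trans (dotp_cauchy _ _) _; rewrite ler_piMr ?dotp_ge0//.
by rewrite -enorm_sqr -[X in _ <= X](expr1n _ 2) ler_sqr ?nnegrE ?enorm_ge0.
Qed.

Let specset M := [set enorm (M *m x) | x in [set x : 'cV[K]_n | enorm x <= 1]].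

Let specset_sup M : has_sup (specset M).
Proof.
split; first by exists (enorm (M *m 0)), 0 => //=; rewrite (_ : enorm 0 = 0) ?ler01//; apply/eqP; rewrite enorm_eq0.
by have [C hC] := enorm_bounded M; exists C => _ [x /= x1 <-]; exact: hC.
Qed.

Lemma enorm_specnorm M x : enorm (M *m x) <= specnorm M * enorm x.
Proof.
have [->|x0] := eqVneq x 0.
  have e0 : enorm (0 : 'cV[K]_n) = 0 by apply/eqP; rewrite enorm_eq0.
  by rewrite mulmx0 e0 mulr0.
have n0 : 0 < enorm x by rewrite lt_neqAle enorm_ge0 eq_sym enorm_eq0 x0.
have := sup_upper_bound (specset_sup M) => /(_ (enorm (M *m ((enorm x)^-1 *: x)))) h.
have /h : specset M (enorm (M *m ((enorm x)^-1 *: x))).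
  exists ((enorm x)^-1 *: x) => //=; rewrite enormZ ger0_norm ?invr_ge0 ?enorm_ge0//.
  by rewrite mulVf// gt_eqF.
rewrite -scalemxAr enormZ ger0_norm ?invr_ge0 ?enorm_ge0//.
by rewrite ler_pdivrMl// mulrC.
Qed.

Lemma specnorm_eigen M x (c : K) : x != 0 -> M *m x = c *: x -> `|c| <= specnorm M.
Proof.
move=> x0 Mx; have := enorm_specnorm M x; rewrite Mx enormZ ler_pM2r//.
by rewrite lt_neqAle enorm_ge0 eq_sym enorm_eq0 x0.
Qed.

End specnorm.

Section unmeasured.
Local Open Scope ereal_scope.

(* [specnorm (expmx (s *: F))] is not known to be measurable in [s]. *)
Lemma ge0_le_integral_unmeasured d (T : measurableType d) (K : realType)
    (m : {measure set T -> \bar K}) (f g : T -> \bar K) :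
  (forall x, 0 <= f x) -> (forall x, f x <= g x) -> \int[m]_x f x <= \int[m]_x g x.
Proof.
move=> f0 fg; rewrite !ge0_integralTE//; last by move=> x; exact: le_trans (fg x).
apply: le_ereal_sup => _ [h hf <-]; exists h => // x; exact: le_trans (hf x) (fg x).
Qed.

End unmeasured.

(** * Comparison of exponential rates with iota *)

Section exponential_rate.
Context {K : realType}.
Local Notation leb := (@lebesgue_measure K).

(** The exponential law of rate 2 lam has total mass 1, so exp (- 2 lam s) integrates to 1 / (2 lam)
    over the half-line. *)
Lemma rate_le_integral (lam : K) (f : K -> K) : 0 < lam ->
  (forall s, 0 <= s -> expR (- lam * s) <= f s) ->
  ((2 * lam)^-1%:E <= \int[leb]_(s in `[0%R, +oo[) (f s ^+ 2)%:E)%E.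
Proof.
move=> l0 hf; have l2 : 0 < 2 * lam by rewrite mulr_gt0.
rewrite integral_mkcond.
apply: le_trans (ge0_le_integral_unmeasured leb
  (f := fun s => ((2 * lam)^-1%:E * (exponential_pdf (2 * lam) s)%:E)%E) _ _).
- rewrite ge0_integralZl//.
  + by rewrite integral_exponential_pdf// mule1.
  + by apply/measurable_EFinP; exact: measurable_exponential_pdf.
  + by move=> x _; rewrite lee_fin exponential_pdf_ge0// ltW.
  + by rewrite lee_fin invr_ge0 ltW.
- by move=> x; rewrite -EFinM lee_fin mulr_ge0 ?invr_ge0 ?exponential_pdf_ge0// ltW.
- move=> x; rewrite patchE; case: ifPn => [|xn]; last first.
    by rewrite /exponential_pdf patchE (negbTE xn) mule0.
  rewrite inE /= in_itv /= andbT => x0.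
  rewrite exponential_pdfE// -EFinM mulrA mulVf ?gt_eqF// mul1r lee_fin.
  rewrite (_ : - (2 * lam) * x = (- lam * x) + (- lam * x)); last by ring.
  by rewrite expRD -expr2 ler_sqr ?nnegrE ?hf ?expR_ge0// (le_trans (expR_ge0 _) (hf _ x0)).
Qed.

(* A divergent integral is given the value [0], and then so is [t / iota]. *)
Lemma exp_rate_le (lam t : K) (f : K -> K) : 0 < lam -> 0 <= t ->
  (forall s, 0 <= s -> expR (- lam * s) <= f s) ->
  expR (- (2 * lam) * t) <= expR (- t / (\int[leb]_(s in `[0%R, +oo[) f s ^+ 2)%R).
Proof.
move=> l0 t0 hf; have l2 : 0 < 2 * lam by rewrite mulr_gt0.
rewrite ler_expR /Rintegral.
have := rate_le_integral l0 hf; set I := integral _ _ _; case: I => [i| |]//=.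
- rewrite lee_fin => h; have i0 : 0 < i by apply: lt_le_trans h; rewrite invr_gt0.
  by rewrite mulNr mulNr lerN2 ler_pdivrMr// mulrAC ler_peMl// -ler_pdivrMl// mulr1.
- by move=> _; rewrite invr0 mulr0 mulNr oppr_le0 mulr_ge0// ltW.
Qed.

End exponential_rate.

(** * The stationary covariance and its reversibility *)

Section ou_matrices.
Context {K : realType} {n : nat}.
Local Notation V := 'cV[K]_n.+1.
Variables A R S P Q : 'M[K]_n.+1.
Hypotheses (hP : posdef P) (hQ : posdef Q) (hR : posdef R).
Hypothesis hPeq : A *m P + P *m A^T + R - P *m S *m P = 0.
Hypothesis hQeq : A^T *m Q + Q *m A - Q *m R *m Q + S = 0.
Hypothesis hAR : A *m R = R *m A^T.

Let F := A - R *m Q.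
Let p := invmx P.
Let U := p + Q.
Let Sg := invmx U.

Let pU : posdef U. Proof. exact: posdefD (posdef_inv hP) hQ. Qed.

Lemma posdef_stationary : posdef Sg. Proof. exact: posdef_inv. Qed.

Let uU : U \in unitmx. Proof. exact: posdef_unit. Qed.
Let USg : U *m Sg = 1%:M. Proof. exact: mulmxV. Qed.
Let SgU : Sg *m U = 1%:M. Proof. exact: mulVmx. Qed.
Let sU : U^T = U. Proof. by have [] := pU. Qed.
Let sR : R^T = R. Proof. by have [] := hR. Qed.
Let sQ : Q^T = Q. Proof. by have [] := hQ. Qed.
Let sSg : Sg^T = Sg. Proof. by have [] := posdef_stationary. Qed.

Let FTE : F^T = A^T - Q *m R.
Proof. by rewrite /F linearB /= trmx_mul sQ sR. Qed.

(** Multiplying the equation for P by its inverse p on both sides gives a Riccati equation for p in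
    which S has the opposite sign; adding the equation for Q cancels S and leaves an equation in U =
    p + Q. *)
Let precision_eq : U *m F + F^T *m U + U *m R *m U = 0.
Proof.
have uP := posdef_unit hP.
have pP : p *m P = 1%:M by exact: mulVmx.
have Pp : P *m p = 1%:M by exact: mulmxV.
have e1 : p *m A + A^T *m p + p *m R *m p - S = 0.
  transitivity (p *m (A *m P + P *m A^T + R - P *m S *m P) *m p); last by rewrite hPeq mulmx0 mul0mx.
  rewrite mulmxBr !mulmxDr mulmxBl !mulmxDl; congr (_ + _ + _ - _).
  - by rewrite -!mulmxA Pp mulmx1.
  - by rewrite !mulmxA pP mul1mx.
  - by rewrite !mulmxA pP mul1mx -mulmxA Pp mulmx1.
have : (p *m A + A^T *m p + p *m R *m p - S) + (A^T *m Q + Q *m A - Q *m R *m Q + S) = 0.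
  by rewrite e1 hQeq addr0.
rewrite FTE /F /U => <-.
rewrite !(mulmxDl, mulmxDr, mulmxBl, mulmxBr, mulNmx, mulmxN, mulmxA).
set x1 := p *m A; set x2 := Q *m A; set x3 := A^T *m p; set x4 := A^T *m Q.
set x5 := p *m R *m p; set x6 := p *m R *m Q; set x7 := Q *m R *m p; set x8 := Q *m R *m Q.
apply/matrixP => i j; rewrite !mxE; ring.
Qed.

Lemma stationary_lyapunov : F *m Sg + Sg *m F^T + R = 0.
Proof.
transitivity (Sg *m (U *m F + F^T *m U + U *m R *m U) *m Sg); last by rewrite precision_eq mulmx0 mul0mx.
rewrite (mulmxDr Sg (U *m F + _)) (mulmxDr Sg (U *m F)).
rewrite (mulmxDl (Sg *m (U *m F) + _)) (mulmxDl (Sg *m (U *m F))); congr (_ + _ + _).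
- by rewrite !mulmxA SgU mul1mx.
- by rewrite -!mulmxA USg mulmx1.
- by rewrite !mulmxA SgU mul1mx -mulmxA USg mulmx1.
Qed.

Let FR : F *m R = R *m F^T.
Proof. by rewrite FTE /F mulmxBl mulmxBr hAR !mulmxA. Qed.

(* [D] is antisymmetric and anticommutes with [R *m U], both in the inner product
   given by [U], in which [R *m U] is positive: at the top eigenvector of [- D ^+ 2]
   this forces the eigenvalue to vanish. *)
Lemma stationary_reversible : F *m Sg = Sg *m F^T.
Proof.
pose N := F *m Sg - Sg *m F^T; pose D := N *m U.
have NT : N^T = - N.
  by rewrite /N linearB /= !trmx_mul trmxK sSg opprB.
have F2 : 2 *: (F *m Sg) = N - R.
  have h := stationary_lyapunov.
  have -> : - R = F *m Sg + Sg *m F^T by apply/eqP; rewrite eq_sym -addr_eq0 h.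
  by rewrite /N addrACA addNr addr0 scaler_nat mulr2n.
have F2T : 2 *: (Sg *m F^T) = - N - R.
  have := congr1 trmx F2; rewrite linearZ /= trmx_mul sSg => ->.
  by rewrite linearB /= NT sR.
(* From F R = R F', since 2 F = (N - R) U and 2 F' = U (- N - R). *)
have NUR : N *m U *m R = - (R *m U *m N).
  have e1 : (N - R) *m U *m R = 2 *: (F *m R).
    by rewrite -F2 -scalemxAl -(mulmxA F) SgU mulmx1 -scalemxAl.
  have e2 : R *m U *m (- N - R) = 2 *: (R *m F^T).
    by rewrite -F2T -scalemxAr -mulmxA (mulmxA U) USg mul1mx.
  have : (N - R) *m U *m R = R *m U *m (- N - R) by rewrite e1 e2 FR.
  rewrite !mulmxBl !mulmxBr mulmxN => /eqP; rewrite subr_eq subrK => /eqP ->.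
  by rewrite -mulmxBr.
have UDT x y : dotp x (U *m (D *m y)) = - dotp (D *m x) (U *m y).
  rewrite -dotpNl (dotp_mulmx x U) sU /D.
  rewrite -[N *m U *m y]mulmxA (dotp_mulmx _ N) NT mulNmx dotpNl -dotpNl.
  by rewrite !mulmxA.
pose M' := D^T *m U *m D.
have sM' : M'^T = M' by rewrite /M' (trmx_mul (D^T *m U)) (trmx_mul D^T) trmxK sU mulmxA.
have M'E x : dotp x (M' *m x) = dotp (D *m x) (U *m (D *m x)).
  by rewrite /M' -(mulmxA (D^T *m U) D x) -(mulmxA D^T U) dotp_mulmx trmxK.
have [v [mu [v0 vE hmu]]] := generalized_eigen sM' pU.
have pUv x : x != 0 -> 0 < dotp x (U *m x) by have /posdefP[_ h] := pU; exact: h.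
have pa x : 0 <= dotp x (U *m (R *m U *m x)).
  by rewrite -mulmxA dotp_mulmx sU; exact: quad_ge0.
have mu0 : mu <= 0.
  have DDv : D *m (D *m v) = - mu *: v.
    have DTU : D^T *m U = - (U *m D) by rewrite /D trmx_mul NT sU mulmxN mulNmx mulmxA.
    move: vE; rewrite /M' DTU mulNmx mulNmx -(mulmxA (U *m D) D v) -(mulmxA U D) => vE.
    have {}vE : U *m (D *m (D *m v)) = - mu *: (U *m v) by rewrite scaleNr -vE opprK.
    by rewrite -[LHS]mul1mx -SgU -mulmxA vE -scalemxAr mulmxA SgU mul1mx.
  have h := pa (D *m v).
  (* Set a(x) = x'U R U x. Anticommutation and antisymmetry give a(D v) = - mu a(v), as D D v = - mu
     v. Now a(D v) >= 0 and a(v) > 0, so mu <= 0. *)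
  have e : dotp (D *m v) (U *m (R *m U *m (D *m v))) = - mu * dotp v (U *m (R *m U *m v)).
    have -> : R *m U *m (D *m v) = - (D *m (R *m U *m v)).
      by rewrite /D !mulmxA NUR !mulNmx opprK.
    rewrite mulmxN dotpNr UDT opprK DDv dotpZl; by [].
  have av : 0 < dotp v (U *m (R *m U *m v)).
    have /posdefP[_ hr] := hR.
    rewrite -mulmxA dotp_mulmx sU; apply: hr.
    by apply: contra v0 => /eqP Uv; rewrite -[v]mul1mx -SgU -mulmxA Uv mulmx0.
  by move: h; rewrite e pmulr_lge0// oppr_ge0.
have D0 (x : V) : D *m x = 0.
  apply/eqP; apply: contraT => /pUv; rewrite -M'E ltNge => /negP[].
  by apply: le_trans (hmu x) _; rewrite mulr_le0_ge0// quad_ge0.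
have N0 : N = 0.
  have D00 : D = 0.
    by apply/matrixP => i j; have /matrixP/(_ i 0) := D0 (delta_mx j 0); rewrite -colE !mxE.
  by rewrite -[N]mulmx1 -USg mulmxA -/D D00 mul0mx.
by apply/eqP; rewrite -subr_eq0 -/N N0.
Qed.

Lemma stationary_drift : F *m Sg = - 2^-1 *: R.
Proof.
have := stationary_lyapunov; rewrite -stationary_reversible => /eqP.
rewrite addr_eq0 -mulr2n -scaler_nat => /eqP h.
transitivity (2^-1 *: (2 *: (F *m Sg))); first by rewrite scalerA mulVf// scale1r.
by rewrite h scalerN scaleNr.
Qed.

(* [- lam] is the largest eigenvalue of [F]. *)
Lemma slowest_mode : exists lam, exists w : V, [/\ 0 < lam, w != 0, F *m w = - lam *: w &
  forall x, 2 * lam * dotp x (Sg *m x) <= dotp x (R *m x)].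
Proof.
have sRN : (- R)^T = - R by rewrite linearN /= sR.
have [v [mu [v0 vE hmu]]] := generalized_eigen sRN posdef_stationary.
have Sv0 : Sg *m v != 0.
  by apply: contra v0 => /eqP h; rewrite -[v]mul1mx -USg -mulmxA h mulmx0.
have pSv x : x != 0 -> 0 < dotp x (Sg *m x) by have /posdefP[_ h] := posdef_stationary; exact: h.
have mu0 : mu < 0.
  have /posdefP[_ hr] := hR; have := hr _ v0.
  have -> : dotp v (R *m v) = - mu * dotp v (Sg *m v).
    by rewrite -dotpZr scaleNr -vE mulNmx opprK.
  by rewrite pmulr_lgt0 ?pSv// oppr_gt0.
exists (- mu / 2), (Sg *m v); split => //.
- by rewrite divr_gt0// oppr_gt0.
- rewrite mulmxA stationary_drift -scalemxAl.
  have -> : R *m v = - mu *: (Sg *m v) by rewrite scaleNr -vE mulNmx opprK.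
  by rewrite scalerA; congr (_ *: _); field.
- move=> x; have := hmu x; rewrite mulNmx dotpNr lerNl => h.
  by apply: le_trans h; rewrite le_eqVlt; apply/orP; left; apply/eqP; field.
Qed.

End ou_matrices.

(** * Contraction of the stationary quadratic form under the flow *)

Section reversible_flow.
Context {K : realType} {n : nat}.
Local Notation V := 'cV[K]_n.+1.
Variables (F Sg R : 'M[K]_n.+1) (lam : K).
Hypotheses (pSg : posdef Sg) (rev : F *m Sg = Sg *m F^T).
Hypothesis lyap : F *m Sg + Sg *m F^T + R = 0.
Hypothesis gap : forall x : V, 2 * lam * dotp x (Sg *m x) <= dotp x (R *m x).

Let E d : 'M[K]_n.+1 := 1 + d *: F.

Let powrev d m : E d ^+ m *m Sg = Sg *m (E d ^+ m)^T.
Proof.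
have one : E d *m Sg = Sg *m (E d)^T.
  rewrite /E linearD /= linearZ /= trmx1 mulmxDl mulmxDr mul1mx mulmx1.
  by rewrite -scalemxAl -scalemxAr rev.
elim: m => [|m ih]; first by rewrite expr0 trmx1 mul1mx mulmx1.
rewrite exprS -[in LHS]mulmxA ih mulmxA one -mulmxA -trmx_mul.
have -> // : E d ^+ m *m E d = E d * E d ^+ m by rewrite -exprS exprSr.
Qed.

Let cvgE t : E (t / k.+1%:R) ^+ k.+1 @[k --> \oo] --> expmx (t *: F).
Proof.
have := @cvg_euler_mx K n.+1 (t *: F); apply: cvg_eqfun => k.
by rewrite /E scalerA mulrC.
Qed.

Lemma flow_reversible t : expmx (t *: F) *m Sg = Sg *m (expmx (t *: F))^T.
Proof.
have h1 : E (t / k.+1%:R) ^+ k.+1 *m Sg @[k --> \oo] --> expmx (t *: F) *m Sg.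
  by apply: cvg_mulmx; [exact: cvgE|exact: cvg_cst].
have h2 : E (t / k.+1%:R) ^+ k.+1 *m Sg @[k --> \oo] --> Sg *m (expmx (t *: F))^T.
  under eq_fun do rewrite powrev.
  by apply: cvg_mulmx; [exact: cvg_cst|apply: cvg_trmx; exact: cvgE].
exact: (cvg_unique _ h1 h2).
Qed.

Let H := F *m Sg *m F^T.

(** By the Lyapunov equation one Euler step turns Sg into Sg - d R + d^2 H. The gap bounds R below
    and c bounds H above, so the form is multiplied by at most 1 - 2 lam d + c d^2. *)
Let powbound c d : 0 <= d -> (forall x, dotp x (H *m x) <= c * dotp x (Sg *m x)) -> forall m x,
  dotp x (E d ^+ m *m Sg *m (E d ^+ m)^T *m x) <=
  expR (- (2 * lam) * d + c * d ^+ 2) ^+ m * dotp x (Sg *m x).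
Proof.
move=> d0 hc; set b := expR _.
have one x : dotp x (E d *m Sg *m (E d)^T *m x) <= b * dotp x (Sg *m x).
  have -> : E d *m Sg *m (E d)^T = Sg - d *: R + d ^+ 2 *: H.
    have -> : - (d *: R) = d *: (F *m Sg + Sg *m F^T).
      by rewrite -scalerN; congr (_ *: _); apply/eqP; rewrite eq_sym -addr_eq0 lyap.
    rewrite /E linearD /= linearZ /= trmx1 !mulmxDl !mulmxDr !mul1mx !mulmx1.
    by rewrite -!scalemxAl -!scalemxAr scalerA scalerDr /H expr2 rev !addrA.
  rewrite !mulmxDl !dotpDr mulNmx dotpNr -!scalemxAl !dotpZr.
  apply: (@le_trans _ _ ((1 + (- (2 * lam) * d + c * d ^+ 2)) * dotp x (Sg *m x))).
    have h1 := ler_wpM2l d0 (gap x); have h2 := ler_wpM2l (sqr_ge0 d) (hc x).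
    move: h1 h2; set q := dotp x (Sg *m x); set r := dotp x _; set h := dotp x _.
    move=> h1 h2.
    have -> : (1 + (- (2 * lam) * d + c * d ^+ 2)) * q = q - d * (2 * lam * q) + d ^+ 2 * (c * q) by ring.
    by rewrite lerD// lerD// lerN2.
  by rewrite ler_wpM2r ?expR_ge1Dx// quad_ge0.
elim=> [|m ih] x; first by rewrite !expr0 trmx1 mulmx1 !mul1mx mul1r.
have -> : E d ^+ m.+1 *m Sg *m (E d ^+ m.+1)^T *m x =
    E d *m (E d ^+ m *m Sg *m (E d ^+ m)^T *m ((E d)^T *m x)).
  by rewrite exprS (trmx_mul (E d)) !mulmxA.
rewrite dotp_mulmx; apply: le_trans (ih _) _.
rewrite exprSr -mulrA ler_wpM2l ?exprn_ge0 ?expR_ge0//.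
by have := one x; rewrite -!mulmxA dotp_mulmx.
Qed.

(** The constant c bounding H by Sg comes from [generalized_eigen]. After k steps of size t / k its
    total contribution to the exponent is c t^2 / k, which vanishes in the limit. *)
Lemma flow_contraction t x : 0 <= t ->
  dotp x (expmx (t *: F) *m Sg *m (expmx (t *: F))^T *m x) <=
  expR (- (2 * lam) * t) * dotp x (Sg *m x).
Proof.
move=> t0; have sSg : Sg^T = Sg by have [] := pSg.
have sH : H^T = H by rewrite /H !trmx_mul trmxK sSg mulmxA.
have [v [c [_ _ hc]]] := generalized_eigen sH pSg.
have h1 : dotp x (E (t / k.+1%:R) ^+ k.+1 *m Sg *m (E (t / k.+1%:R) ^+ k.+1)^T *m x) @[k --> \oo] -->
   dotp x (expmx (t *: F) *m Sg *m (expmx (t *: F))^T *m x).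
  apply: cvg_dotp; first exact: cvg_cst.
  apply: cvg_mulmx; last exact: cvg_cst.
  apply: cvg_mulmx; last by apply: cvg_trmx; exact: cvgE.
  by apply: cvg_mulmx; [exact: cvgE|exact: cvg_cst].
have h2 : expR (- (2 * lam) * t + (c * t ^+ 2) / k.+1%:R) * dotp x (Sg *m x) @[k --> \oo] -->
    expR (- (2 * lam) * t) * dotp x (Sg *m x).
  apply: cvgM; last exact: cvg_cst.
  apply: (@continuous_cvg _ _ _ _ _ _ (@expR K)); first exact: continuous_expR.
  rewrite -[X in _ --> X]addr0; apply: cvgD; [exact: cvg_cst|exact: cvg_div_nat].
apply: (ler_cvg_to h1 h2); apply: nearW => k.
have d0 : 0 <= t / k.+1%:R by rewrite divr_ge0.
apply: le_trans (powbound d0 hc k.+1 x) _.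
rewrite -expRM_natl ler_wpM2r ?quad_ge0// ler_expR le_eqVlt; apply/orP; left; apply/eqP.
have : k.+1%:R != 0 :> K by rewrite pnatr_eq0.
by set kk := k.+1%:R => kk0; field.
Qed.

End reversible_flow.

Section fisher_ge0.
Context {K : realType} {n : nat}.

Lemma Fisher_ge0 (nu gam : probability 'cV[K]_n K) : (0 <= Fisher nu gam)%E.
Proof.
rewrite /Fisher; case: ifP => // _; apply: integral_ge0 => x _.
by rewrite lee_fin sqr_ge0.
Qed.

End fisher_ge0.

Theorem theorem2p2 (K : realType) (r : nat) (hr : (1 <= r)%N)
    (A R S P Q : 'M[K]_r)
    (hRpsd : psd R) (hSpsd : psd S)
    (hrankR : \rank (krylov A (sqrtmx R)) = r)
    (hrankS : \rank (krylov A^T (sqrtmx S)) = r)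
    (hP : posdef P)
    (hPeq : A *m P + P *m A^T + R - P *m S *m P = 0)
    (hQ : posdef Q)
    (hQeq : A^T *m Q + Q *m A - Q *m R *m Q + S = 0)
    (alpha beta : K) (halpha : 0 < alpha) (hbeta : 0 < beta)
    (hdecay : forall t : K, 0 <= t ->
       specnorm (expmx (t *: (A - R *m Q))) <= alpha * expR (- beta * t))
    (r1 : nat) (B : 'M[K]_(r, r1)) (hB : B *m B^T = R)
    (d : measure_display) (Omega : measurableType d) (Pr : probability Omega K)
    (W : K -> {RV Pr >-> 'cV[K]_r1}) (hW : brownian_motion W)
    (X : K -> {RV Pr >-> 'cV[K]_r})
    (hX : linear_sde (A - R *m Q) B W X)
    (hindep : independent_sigma Pr (sigma_of (X 0)) (sigma_proc W `[0, +oo[))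
    (eta0 : probability 'cV[K]_r K)
    (hX0 : forall E, measurable E ->
       distribution Pr (X 0) E =
       reweight eta0 (fun x => expR (- (x^T *m Q *m x) 0 0 / 2)) E)
    (eta_inf : probability 'cV[K]_r K)
    (heta_inf : centered_gaussian (invmx (invmx P + Q)) eta_inf)
    (hR : posdef R) (hAR : A *m R = R *m A^T)
    (t : K) (ht : 0 <= t) :
  let eta (s : K) : probability 'cV[K]_r K := distribution Pr (X s) in
  let iota := \int[lebesgue_measure]_(s in `[0, +oo[)
                specnorm (expmx (s *: (A - R *m Q))) ^+ 2 in
  (Fisher (eta t) eta_inf <=
     (alpha ^+ 2 * expR (- 2 * beta * t))%:E * Fisher (eta 0%R) eta_inf)%E /\
  (Ent (eta t) eta_inf <= (expR (- t / iota))%:E * Ent (eta 0%R) eta_inf)%E.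
Proof.
(* The dimension is made a successor, the form required by [generalized_eigen]. *)
case: r hr A R S P Q hRpsd hSpsd hrankR hrankS hP hPeq hQ hQeq hdecay B hB X hX hindep eta0 hX0 eta_inf heta_inf hR hAR
  => [//|n] _ A0 R0 S0 P0 Q0 _ _ _ _ hP0 hPeq0 hQ0 hQeq0 hdecay0 B0 hB0 X0 hX1 hindep0 _ _ gam hgam hR0 hAR0 eta iota.
pose F := A0 - R0 *m Q0; pose Sg := invmx (invmx P0 + Q0).
have pSg : posdef Sg by exact: posdef_stationary.
have sSg : Sg^T = Sg by have [] := pSg.
have lyap : F *m Sg + Sg *m F^T + R0 = 0 by exact: (stationary_lyapunov hP0 hQ0 hR0 hPeq0 hQeq0).
have rev : F *m Sg = Sg *m F^T by exact: (stationary_reversible hP0 hQ0 hR0 hPeq0 hQeq0 hAR0).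
have [lam [w [lam0 w0 Fw gap]]] : exists lam, exists w : 'cV[K]_n.+1,
    [/\ 0 < lam, w != 0, F *m w = - lam *: w &
      forall x, 2 * lam * dotp x (Sg *m x) <= dotp x (R0 *m x)].
  exact: (slowest_mode hP0 hQ0 hR0 hPeq0 hQeq0 hAR0).
have ggam : gaussian Sg gam by exact: centered_gaussianE.
have spec s : expR (- lam * s) <= specnorm (expmx (s *: F)).
  have h : expmx (s *: F) *m w = expR (- lam * s) *: w.
    by apply: expmx_eigen; rewrite -scalemxAl Fw scalerA mulrC.
  by have := specnorm_eigen w0 h; rewrite ger0_norm ?expR_ge0.
have rate : expR (- (2 * lam) * t) <= expR (- t / iota).
  by apply: exp_rate_le => // s _; exact: spec.
have [->|t_neq0] := eqVneq t 0.
  split.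
    (* The spectral norm at time 0 is at least 1 by [spec], so the decay bound at 0 forces alpha >=
       1. *)
    have a1 : 1 <= alpha.
      have := le_trans (spec 0) (hdecay0 0 (lexx _)).
      by rewrite !mulr0 expR0 mulr1.
    rewrite mulr0 expR0 mulr1 -[X in (X <= _)%E]mul1e lee_wpmul2r ?Fisher_ge0// lee_fin.
    by rewrite expr2 (le_trans a1)// ler_peMl// ltW.
  by rewrite oppr0 mul0r expR0 mul1e.
have t_gt0 : 0 < t by rewrite lt_neqAle eq_sym t_neq0.
pose M := expmx (t *: F).
have MSg : M *m Sg = Sg *m M^T by exact: flow_reversible.
pose th := expR (- (2 * lam) * t).
have th1 : th < 1.
  by rewrite /th -expR0 ltr_expR mulNr oppr_lt0 !mulr_gt0.
have hth x : dotp x (M *m Sg *m M^T *m x) <= th * dotp x (Sg *m x).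
  by apply: (flow_contraction pSg rev lyap gap).
pose St := Sg - M *m Sg *m M^T.
have pSt : posdef St.
  apply/posdefP; split; first by rewrite /St linearB /= !trmx_mul trmxK sSg mulmxA.
  move=> x x0; rewrite /St mulmxBl dotpBr subr_gt0; apply: le_lt_trans (hth x) _.
  by rewrite gtr_pMl//; have /posdefP[_ h] := pSg; exact: h.
have [N hN] := ex_gaussian pSt.
have lyapB : F *m Sg + Sg *m F^T + B0 *m B0^T = 0 by rewrite hB0.
have hou : ou_law (eta 0) M N (eta t).
  exact: (sde_ou_law hW hX1 hindep0 lyapB t_gt0 pSt hN).
have e0 := expR_gt0 (- beta * t).
split.
  have -> : alpha ^+ 2 * expR (- 2 * beta * t) = (alpha * expR (- beta * t)) ^+ 2.
    by rewrite exprMn (expr2 (expR _)) -expRD; congr (_ * expR _); ring.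
  (* If the initial information is infinite, so is the right-hand side, its factor being
     positive. *)
  have [fin|] := ltP (Fisher (eta 0) gam) +oo%E; last first.
    rewrite leye_eq => /eqP ->; by rewrite gt0_muley ?leey// lte_fin exprn_gt0// mulr_gt0.
  apply: (Fisher_contraction pSg pSt (erefl St) MSg ggam hN hou) => //.
    by rewrite mulr_ge0// ltW.
  move=> x; apply: le_trans (enorm_specnorm M x) _.
  by rewrite ler_wpM2r ?enorm_ge0// hdecay0.
apply: le_trans (Ent_contraction pSg pSt (erefl St) MSg ggam hN hou (expR_gt0 _) th1 hth) _.
by rewrite lee_wpmul2r ?Ent_ge0// lee_fin.
Qed.
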